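(* Any rational Abhyankar valuation of a noetherian complete equicharacteristic local domain with an algebraically closed residue field is quasi monomial.
   Context: A valuation $\nu$ of a local domain $(R,m)$ has a valuation ring $(R_\nu,m_\nu)$ in the fraction field of $R$ dominating $R$. With $k=R/m$ and $\Phi$ the value group, $\nu$ is rational if $R_\nu/m_\nu=k$ and Abhyankar if $\mathrm{rat.rk.}\,\Phi+\mathrm{tr.deg}_k(R_\nu/m_\nu)=\dim R$. A birational $\nu$-extension of $R$ is a local ring $R'$ containing $R$, essentially of finite type over $R$, with the same fraction field as $R$ and dominated by $R_\nu$. The valuation $\nu$ on $R$ is quasi monomial if there is a birational $\nu$-extension $R\to R'$ where $R'$ is a regular local ring and there is a system of generators of its maximal ideal (a regular system of parameters) with respect to which $\nu$ is a monomial valuation, i.e. the value of an element written as a power series in these generators, with coefficients in a field of representatives of the completion, is the minimum of the values of the monomials occurring in it. *)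

(* Defs.v *)
From HB Require Import structures.
From mathcomp Require Export all_boot all_order all_algebra.
From mathcomp Require Import ring.
From mathcomp Require Export generic_quotient ring_quotient.
From mathcomp Require Export boolp classical_sets functions.
From mathcomp.multinomials Require Export mpoly.

Set Implicit Arguments.
Unset Strict Implicit.
Unset Printing Implicit Defensive.

Import Order.TTheory GRing.Theory Num.Theory.
Local Open Scope classical_set_scope.
Local Open Scope quotient_scope.
Local Open Scope ring_scope.

Section Ideals.
Variable A : comNzRingType.

Definition is_ideal (I : set A) : Prop :=
  [/\ I 0, forall x y, I x -> I y -> I (x + y) & forall a x, I x -> I (a * x)].

Definition prime_ideal (P : set A) : Prop :=
  [/\ is_ideal P, ~ P 1 & forall x y, P (x * y) -> P x \/ P y].

Definition ideal_gen (X : set A) : set A :=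
  [set x | forall I, is_ideal I -> X `<=` I -> I x].

(* The case n = 0 gives the unit ideal. *)
Definition ideal_pow (I : set A) (n : nat) : set A :=
  ideal_gen [set x | exists2 s : 'I_n -> A,
                     (forall i, I (s i)) & x = \prod_(i < n) s i].

Definition noetherian : Prop :=
  forall I : set A, is_ideal I ->
  exists (n : nat) (s : 'I_n -> A), I = ideal_gen (range s).

Definition has_prime_chain (d : nat) : Prop :=
  exists P : nat -> set A,
    (forall i, (i <= d)%N -> prime_ideal (P i)) /\
    (forall i, (i < d)%N -> P i `<` P i.+1).

Definition krull_dim (d : nat) : Prop :=
  has_prime_chain d /\ ~ has_prime_chain d.+1.

(* The set of non-units: A is local iff this is an ideal, which is then the
   unique maximal ideal. *)
Definition max_ideal : set A := [set x | ~ exists y, x * y = 1].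

Definition local_ring : Prop := is_ideal max_ideal.

Definition adic_cauchy (I : set A) (s : nat -> A) : Prop :=
  forall k, exists N, forall m n,
    (N <= m)%N -> (N <= n)%N -> ideal_pow I k (s m - s n).

Definition adic_cvg (I : set A) (s : nat -> A) (l : A) : Prop :=
  forall k, exists N, forall n, (N <= n)%N -> ideal_pow I k (s n - l).

Definition adic_complete (I : set A) : Prop :=
  (forall x, (forall k, ideal_pow I k x) -> x = 0) /\
  (forall s, adic_cauchy I s -> exists l, adic_cvg I s l).

Definition regular_system_of_parameters (d : nat) (u : 'I_d -> A) : Prop :=
  krull_dim d /\ max_ideal = ideal_gen (range u).

Definition regular_local_ring : Prop :=
  [/\ local_ring, noetherian &
      exists (d : nat) (u : 'I_d -> A), regular_system_of_parameters u].

Lemma ideal_gen_ideal X : is_ideal (ideal_gen X).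
Proof.
split=> [I [] //|x y Ix Iy I hI XI|a x Ix I hI XI].
  by case: (hI) => _ + _; apply; [exact: Ix | exact: Iy].
by case: (hI) => _ _; apply; exact: Ix.
Qed.

Lemma ideal_pow_ideal I n : is_ideal (ideal_pow I n).
Proof. exact: ideal_gen_ideal. Qed.

Lemma ideal_oppr I x : is_ideal I -> I x -> I (- x).
Proof. by case=> _ _ h Ix; rewrite -mulN1r; exact: h. Qed.

Lemma ideal_subr I x y : is_ideal I -> I x -> I y -> I (x - y).
Proof. by move=> hI Ix Iy; case: (hI) => _ + _; apply=> //; exact: ideal_oppr. Qed.

Lemma ideal_pow1_sub I : is_ideal I -> ideal_pow I 1 `<=` I.
Proof.
by move=> hI x; apply=> // y [s Is ->]; rewrite big_ord1.
Qed.

Lemma max_ideal1 : ~ max_ideal 1.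
Proof. by apply; exists 1; rewrite mulr1. Qed.

End Ideals.

Arguments noetherian A : clear implicits.
Arguments krull_dim A d : clear implicits.
Arguments max_ideal A : clear implicits.
Arguments local_ring A : clear implicits.
Arguments regular_local_ring A : clear implicits.

Definition subring_of (A : comNzRingType) (S : subringClosed A) : Type :=
  {x : A | x \in S}.

Section SubringOf.
Variables (A : comNzRingType) (S : subringClosed A).
HB.instance Definition _ := SubChoice.copy (subring_of S) {x : A | x \in S}.
HB.instance Definition _ :=
  [SubChoice_isSubComNzRing of subring_of S by <:].

Lemma subring_val0 : val (0 : subring_of S) = 0. Proof. by []. Qed.
Lemma subring_val1 : val (1 : subring_of S) = 1. Proof. by []. Qed.
Lemma subring_valD (x y : subring_of S) : val (x + y) = val x + val y.
Proof. by []. Qed.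
Lemma subring_valM (x y : subring_of S) : val (x * y) = val x * val y.
Proof. by []. Qed.
End SubringOf.

Section ResidueField.
Variables (A : comNzRingType) (hA : local_ring A).

Definition max_ideal_pred of local_ring A : {pred A} :=
  [pred x | `[< max_ideal A x >]].

Lemma max_ideal_idealr : idealr_closed (max_ideal_pred hA).
Proof.
case: (hA) => h0 hD hM; split; first exact/asboolP.
  by apply/asboolP; exact: max_ideal1.
by move=> a x y /asboolP hx /asboolP hy; apply/asboolP; apply: hD => //; exact: hM.
Qed.

HB.instance Definition _ :=
  isIdealr.Build A (max_ideal_pred hA) max_ideal_idealr.

Definition residue_field : Type := {ideal_quot (max_ideal_pred hA)}.

HB.instance Definition _ :=
  GRing.ComNzRing.copy residue_field {ideal_quot (max_ideal_pred hA)}.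

Definition residue (a : A) : residue_field :=
  \pi_{ideal_quot (max_ideal_pred hA)} a.

Lemma residue_mulVf_ex (x : residue_field) :
  exists y, (x != 0 -> y * x = 1) /\ (x = 0 -> y = 0).
Proof.
have [->|x0] := eqVneq x 0; first by exists 0; split.
suff [y yx] : exists y, y * x = 1 by exists y; split=> // x0'; rewrite x0' eqxx in x0.
pose a : A := repr (x : {ideal_quot (max_ideal_pred hA)}).
have ax : residue a = x by rewrite /residue reprK.
have /asboolPn/contrapT[b ab1] : a \notin max_ideal_pred hA.
  apply: contra x0 => ha; rewrite -ax /residue; apply/eqP.
  have := Quotient.idealrBE (max_ideal_pred hA) a 0.
  by rewrite subr0 ha => /esym/eqP ->; rewrite rmorph0.
exists (residue b); rewrite -ax /residue.
by rewrite -(rmorphM \pi_{ideal_quot (max_ideal_pred hA)}) mulrC ab1 rmorph1.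
Qed.

Definition residue_inv (x : residue_field) : residue_field :=
  projT1 (cid (residue_mulVf_ex x)).

Lemma residue_mulVf x : x != 0 -> residue_inv x * x = 1.
Proof. by rewrite /residue_inv; case: cid => y []. Qed.

Lemma residue_inv0 : residue_inv 0 = 0.
Proof. by rewrite /residue_inv; case: cid => y [] /= _; apply. Qed.

HB.instance Definition _ :=
  GRing.ComNzRing_isField.Build residue_field residue_mulVf residue_inv0.
End ResidueField.

(* The ring of Cauchy sequences for the topology defined by the powers of the
   maximal ideal, modulo the sequences converging to 0. *)

Section Completion.
Variables (A : comNzRingType) (hA : local_ring A).
Local Notation m := (max_ideal A).

Definition cauchy_seq_pred of local_ring A : {pred (nat -> A)} :=
  [pred s | `[< adic_cauchy m s >]].

Lemma cauchy_seq_subring : GRing.subring_closed (cauchy_seq_pred hA).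
Proof.
split=> [|s t /asboolP hs /asboolP ht|s t /asboolP hs /asboolP ht];
  apply/asboolP => k; have hI := ideal_pow_ideal m k.
- by exists 0%N => i j _ _; rewrite subrr; case: hI.
- have [[N hN] [M hM]] := (hs k, ht k); exists (maxn N M) => i j.
  rewrite !geq_max => /andP[Ni Mi] /andP[Nj Mj].
  have -> : (s - t) i - (s - t) j = (s i - s j) - (t i - t j).
    by rewrite !fctE; ring.
  by apply: (ideal_subr hI); [exact: hN | exact: hM].
- have [[N hN] [M hM]] := (hs k, ht k); exists (maxn N M) => i j.
  rewrite !geq_max => /andP[Ni Mi] /andP[Nj Mj].
  have -> : (s * t) i - (s * t) j = s i * (t i - t j) + t j * (s i - s j).
    by rewrite !fctE; ring.
  case: hI => _ hD hX; apply: hD; apply: hX; [exact: hM | exact: hN].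
Qed.

HB.instance Definition _ :=
  GRing.isSubringClosed.Build (nat -> A) (cauchy_seq_pred hA) cauchy_seq_subring.

Definition cauchy_seq : comNzRingType := subring_of (cauchy_seq_pred hA).

Definition null_seq_pred : {pred cauchy_seq} :=
  [pred s | `[< adic_cvg m (val s) 0 >]].

Lemma null_seq_idealr : idealr_closed null_seq_pred.
Proof.
split.
- by apply/asboolP => k; exists 0%N => n _; rewrite subrr; case: (ideal_pow_ideal m k).
- apply/asboolP => /(_ 1%N)[N /(_ N (leqnn _))].
  by rewrite subr0 => /(ideal_pow1_sub hA); exact: max_ideal1.
- move=> a x y /asboolP hx /asboolP hy; apply/asboolP => k.
  have [[N hN] [M hM]] := (hx k, hy k); exists (maxn N M) => n.
  rewrite geq_max => /andP[Nn Mn]; rewrite subr0.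
  have := hN _ Nn; have := hM _ Mn; rewrite !subr0 => h1 h2.
  by case: (ideal_pow_ideal m k) => _ hD hX; apply: hD => //; exact: hX.
Qed.

HB.instance Definition _ :=
  isIdealr.Build cauchy_seq null_seq_pred null_seq_idealr.

Definition completion : comNzRingType := {ideal_quot null_seq_pred}.

Lemma const_cauchy (a : A) : (fun=> a) \in cauchy_seq_pred hA.
Proof.
by apply/asboolP => k; exists 0%N => i j _ _; rewrite subrr; case: (ideal_pow_ideal m k).
Qed.

Definition to_completion (a : A) : completion :=
  \pi_{ideal_quot null_seq_pred} (Sub (fun=> a) (const_cauchy a) : cauchy_seq).

(* A subfield of the completion mapped isomorphically onto its residue field. *)
Definition field_of_representatives (C : set completion) : Prop :=
  [/\ C 1, forall c d, C c -> C d -> C (c - d) /\ C (c * d),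
      forall c, C c -> c != 0 -> exists2 c', C c' & c * c' = 1 &
      forall z, exists! c, C c /\ max_ideal completion (z - c)].

(* The n-th partial sum is over the multi-indices a with |a| < n. *)
Definition power_series_expansion (d : nat) (u : 'I_d -> A)
    (c : 'X_{1..d} -> completion) (z : completion) : Prop :=
  adic_cvg (max_ideal completion)
    (fun n => \sum_(a : 'X_{1..d < n})
                c a * \prod_(i < d) to_completion (u i) ^+ (a : 'X_{1..d}) i) z.

End Completion.

HB.mixin Record POrderedZmodule_isOrdered Phi of Num.POrderedZmodule Phi := {
  ordered_le_total : forall x y : Phi, (x <= y) || (y <= x);
  ordered_lerD2l : forall z x y : Phi, x <= y -> z + x <= z + y
}.

#[short(type="orderedZmodType")]
HB.structure Definition OrderedZmodule :=
  {Phi of Num.POrderedZmodule Phi & POrderedZmodule_isOrdered Phi}.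

(* The value at 0, which should be infinity, is left unconstrained; by
   surjectivity Phi is the value group. *)
Record valuation (K : fieldType) (Phi : orderedZmodType) := Valuation {
  valuation_fun :> K -> Phi;
  valuation_surj : forall phi, exists2 x, x != 0 & valuation_fun x = phi;
  valuationM : forall x y, x != 0 -> y != 0 ->
    valuation_fun (x * y) = valuation_fun x + valuation_fun y;
  valuationD : forall x y, x != 0 -> y != 0 -> x + y != 0 ->
    Order.min (valuation_fun x) (valuation_fun y) <= valuation_fun (x + y)
}.

Section ValuationRing.
Variables (K : fieldType) (Phi : orderedZmodType) (v : valuation K Phi).

Definition valuation_ring_pred : {pred K} := [pred x | (x == 0) || (0 <= v x)].

Lemma ordered_addr_ge0 (x y : Phi) : 0 <= x -> 0 <= y -> 0 <= x + y.
Proof.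
move=> x0 y0; apply: (le_trans x0).
by have := ordered_lerD2l x _ _ y0; rewrite addr0.
Qed.

Lemma valuation1 : v 1 = 0.
Proof.
have := valuationM v (oner_neq0 K) (oner_neq0 K); rewrite mulr1 => h.
by apply: (addrI (v 1)); rewrite addr0 -h.
Qed.

Lemma valuationN1 : v (-1) = 0.
Proof.
have n1 : (-1 : K) != 0 by rewrite oppr_eq0 oner_neq0.
have := valuationM v n1 n1; rewrite mulrNN mulr1 valuation1.
set a := v (-1) => aa0; apply/eqP; rewrite eq_le.
case/orP: (ordered_le_total 0 a) => a0; rewrite a0 ?andbT /=.
  by have := ordered_lerD2l a _ _ a0; rewrite addr0 -aa0.
by have := ordered_lerD2l a _ _ a0; rewrite addr0 -aa0.
Qed.

Lemma valuation_ring_subring : GRing.subring_closed valuation_ring_pred.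
Proof.
have hM x y : x \in valuation_ring_pred -> y \in valuation_ring_pred ->
    x * y \in valuation_ring_pred.
  rewrite !inE mulf_eq0; case: eqVneq => //= x0; case: eqVneq => //= y0 hx hy.
  by rewrite valuationM // ordered_addr_ge0.
have hN1 : -1 \in valuation_ring_pred by rewrite inE valuationN1 lexx orbT.
split=> [|x y hx hy|//]; first by rewrite inE valuation1 lexx orbT.
have : - y \in valuation_ring_pred by rewrite -mulN1r hM.
move: (- y) => {hy}z; move: hx; rewrite !inE; move: z => {}y.
have [->|x0] := eqVneq x 0; first by rewrite add0r.
have [->|y0] := eqVneq y 0; first by rewrite addr0 (negbTE x0).
have [//|xy0] := eqVneq (x + y) 0; rewrite /= => hx hy.
apply: le_trans (valuationD v x0 y0 xy0).
by rewrite /Order.min; case: ifP.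
Qed.

HB.instance Definition _ :=
  GRing.isSubringClosed.Build K valuation_ring_pred valuation_ring_subring.

Definition valuation_ring : comNzRingType := subring_of valuation_ring_pred.

Lemma valuation_max_ideal (x : valuation_ring) :
  max_ideal valuation_ring x <-> val x = 0 \/ 0 < v (val x).
Proof.
have [x0|x0] := eqVneq (val x) 0.
  split=> _; first by left.
  case=> y /(congr1 val); rewrite subring_valM subring_val1 x0 mul0r.
  by move/esym/eqP; rewrite oner_eq0.
have vV : v (val x)^-1 = - v (val x).
  apply: (addrI (v (val x))); rewrite subrr -valuationM ?invr_eq0 //.
  by rewrite divff // valuation1.
have vx : 0 <= v (val x) by case: (x) x0 => /= y; rewrite inE => /orP[/eqP->|//]; rewrite eqxx.
split=> [h|[/eqP|h]]; last 1 first.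
- case=> y xy1.
  have /(congr1 val) := xy1; rewrite subring_valM subring_val1 => e.
  have y0 : val y != 0.
    by apply/eqP => y0; move/eqP: e; rewrite y0 mulr0 eq_sym oner_eq0.
  have vy : 0 <= v (val y) by case: (y) y0 => /= z; rewrite inE => /orP[/eqP->|//]; rewrite eqxx.
  have := valuationM v x0 y0; rewrite e valuation1 => e'.
  have := ordered_lerD2l (v (val x)) _ _ vy; rewrite -e' addr0 => h'.
  by have := lt_le_trans h h'; rewrite ltxx.
- right; rewrite lt_neqAle vx andbT eq_sym; apply/eqP => vx0; apply: h.
  have hV : (val x)^-1 \in valuation_ring_pred.
    by rewrite inE vV vx0 oppr0 lexx orbT.
  exists (Sub (val x)^-1 hV : valuation_ring); apply: val_inj.
  by rewrite subring_valM subring_val1 /= divff.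
- by rewrite (negbTE x0).
Qed.

Lemma valuation_ring_local : local_ring valuation_ring.
Proof.
split.
- by apply/valuation_max_ideal; left; rewrite subring_val0.
- move=> x y /valuation_max_ideal hx /valuation_max_ideal hy.
  apply/valuation_max_ideal; rewrite subring_valD.
  case: hx => [->|hx]; first by rewrite add0r.
  case: hy => [->|hy]; first by rewrite addr0; right.
  have [x0|x0] := eqVneq (val x) 0.
    by rewrite x0 add0r; right.
  have [y0|y0] := eqVneq (val y) 0.
    by rewrite y0 addr0; right.
  have [|xy0] := eqVneq (val x + val y) 0; first by left.
  right; apply: lt_le_trans (valuationD v x0 y0 xy0).
  by rewrite /Order.min; case: ifP.
- move=> a x /= hx [b axb]; apply: hx; exists (a * b).
  by rewrite mulrCA mulrA.
Qed.

End ValuationRing.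

(* A and B are identified with subrings of K through the injections f and g. *)
Section Domination.
Variables (K : fieldType) (A B : comNzRingType) (f : A -> K) (g : B -> K).

Definition dominated_by : Prop :=
  (forall a, exists b, g b = f a) /\
  (forall a b, f a = g b -> (max_ideal A a <-> max_ideal B b)).

(* The image of A in the residue field of B, i.e. the residue field of A when
   B dominates A. *)
Definition residue_subfield (hB : local_ring B) : set (residue_field hB) :=
  [set y | exists a b, f a = g b /\ residue hB b = y].
End Domination.

Arguments residue_subfield {K A B} f g hB.

Definition algebraically_independent (L : fieldType) (k : set L) (n : nat)
    (y : 'I_n -> L) : Prop :=
  forall P : {mpoly L[n]}, (forall a, k P@_a) -> P.@[y] = 0 -> P = 0.

Definition tr_deg (L : fieldType) (k : set L) (t : nat) : Prop :=
  (exists y : 'I_t -> L, algebraically_independent k y) /\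
  ~ (exists y : 'I_t.+1 -> L, algebraically_independent k y).

Definition rational_rank (Phi : zmodType) (r : nat) : Prop :=
  let Z_free n (x : 'I_n -> Phi) :=
    forall c : 'I_n -> int, \sum_(i < n) x i *~ c i = 0 -> forall i, c i = 0 in
  (exists x : 'I_r -> Phi, Z_free r x) /\
  ~ (exists x : 'I_r.+1 -> Phi, Z_free r.+1 x).

Section ValuationOfLocalDomain.
Variables (R : idomainType) (Phi : orderedZmodType).
Local Notation K := {fraction R}.
Variable v : valuation K Phi.
Local Notation Rv := (valuation_ring v).
Local Notation hRv := (valuation_ring_local v).

Definition valuation_of_local_domain : Prop :=
  dominated_by (@tofrac R) (val : Rv -> K).

Definition base_residue_field : set (residue_field hRv) :=
  residue_subfield (@tofrac R) (val : Rv -> K) hRv.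

Definition rational_valuation : Prop := base_residue_field = setT.

Definition abhyankar_valuation : Prop :=
  exists r t : nat,
    [/\ rational_rank Phi r, tr_deg base_residue_field t & krull_dim R (r + t)].

Definition adjoin (n : nat) (x : 'I_n -> K) : set K :=
  [set y | exists P : {mpoly R[n]}, y = mmap (@tofrac R) x P].

(* As everything lives in K, an R-algebra essentially of finite type is the
   localization of a subring R[x_1, ..., x_n] of K. *)
Definition essentially_finite_type (S : {pred K}) : Prop :=
  exists (n : nat) (x : 'I_n -> K) (T : set K),
    [/\ T 1, forall s t, T s -> T t -> T (s * t),
        forall t, T t -> adjoin x t /\ t != 0 &
        forall z, z \in S <-> exists a t, [/\ adjoin x a, T t & z = a / t]].

Definition birational_extension (S : subringClosed K) : Prop :=
  [/\ local_ring (subring_of S),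
      forall a : R, tofrac a \in S,
      essentially_finite_type S,
      forall z : K, exists a b, [/\ a \in S, b \in S, b != 0 & z = a / b] &
      dominated_by (val : subring_of S -> K) (val : Rv -> K)].

(* Only nonzero x are considered: the expansion of 0 has no monomials, and its
   value is infinity. *)
Definition monomial_wrt (S : subringClosed K) (hS : local_ring (subring_of S))
    (d : nat) (u : 'I_d -> subring_of S) : Prop :=
  let value (a : 'X_{1..d}) : Phi := v (\prod_(i < d) val (u i) ^+ a i) in
  exists2 C : set (completion hS), field_of_representatives C &
  forall x : subring_of S, x != 0 ->
  exists c : 'X_{1..d} -> completion hS,
    [/\ forall a, C (c a),
        power_series_expansion u c (to_completion hS x),
        exists2 a, c a != 0 & v (val x) = value a &
        forall a, c a != 0 -> v (val x) <= value a].

Definition quasi_monomial : Prop :=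
  exists S : subringClosed K,
    birational_extension S /\
    exists hS : local_ring (subring_of S),
      regular_local_ring (subring_of S) /\
      exists (d : nat) (u : 'I_d -> subring_of S),
        regular_system_of_parameters u /\ monomial_wrt hS u.

End ValuationOfLocalDomain.

(* Main.v *)
(* By Cohen's theorem R contains a coefficient field k, and R is finite over a
   power series ring A = k[[y_1, ..., y_r]]. Call a subfield M of the fraction
   field good if it is the fraction field of a localized A-algebra of finite
   type inside the valuation ring whose maximal ideal is generated by r elements
   with Z-independent values and whose residue field is k. By a toric (Perron)
   argument such a ring absorbs finitely many given elements of the valuation
   ring of M after a monomial modification of its parameters; it is regular with
   the r elements as parameters, and the valuation is monomial in them.
   Goodness lifts along finite extensions. In a normal closure one passes to the
   decomposition field, which is an immediate etale extension, then climbs a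
   chain of prime degree steps (inseparable, Artin-Schreier, Kummer): all of them
   are totally ramified, because the valuation is rational and Abhyankar, so that
   values can be made to leave the lattice of the subfield.
   Finally Frac A itself is good, by induction on r: a linear change of the y_i
   makes A finite over k[[y', g]] for some g whose value is independent modulo
   the values of Frac k[[y']]; adding g to the parameters of Frac k[[y']] gives
   the case of Frac k[[y', g]], and goodness lifts to Frac A. *)

Require Import Defs.
From HB Require Import structures.
From mathcomp Require Import ring zify.
From mathcomp Require Import all_fingroup all_solvable all_field.
Set Implicit Arguments.
Unset Strict Implicit.
Unset Printing Implicit Defensive.
Import Order.TTheory GRing.Theory Num.Theory.
Local Open Scope ring_scope.

(** Rings, fields and the valuation are predicates on one ambient field; values are compared through
    [V (x / y)] and the value group enters only at the end. The recurring device is that terms of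
    pairwise distinct values cannot cancel, so a finite sum has the value of one of its terms;
    noetherianity and Krull's intersection theorem extend this to series. The obstacle is defect in
    characteristic p. F-finiteness excludes it: a model over power series with perfect [k] is
    spanned over its p-th powers by the monomials with exponents below p, whose values differ modulo
    p. Subtracting p-th powers, or Artin-Schreier terms, then leaves an element that is integral or
    has a value not divisible by p. The values of the variables of A may be dependent, so Frac A
    carries no visible monomial parameters; hence the separate induction. A subfield of the normal
    closure need not contain the decomposition field either, so goodness must also be brought down
    from one. Abhyankar's inequality for power series serves twice: it limits ranks, and applied to
    valuations built on chains of primes it bounds the dimension of the final local ring. *)

Section SetRings.
Variable F : fieldType.
Implicit Types (B C K V S : F -> Prop) (x y z : F).

(** Predicates instead of types: the proof keeps comparing, joining and localizing subrings of one
    field, and nothing has to be rebuilt when the tower changes. *)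
Definition subr B :=
 [/\ B 1, forall x y, B x -> B y -> B (x - y) & forall x y, B x -> B y -> B (x * y)].

Definition sfield K := subr K /\ forall x, K x -> K x^-1.

Definition vring V := subr V /\ forall x, V x \/ V x^-1.

(** The maximal ideal of [V]. Zero is listed apart because its inverse is zero by convention, and so
    belongs to [V]. *)
Definition vm V x := x = 0 \/ ~ V x^-1.

(** The units of [V]. The condition [vu V (x / y)] says that [x] and [y] have the same value; it
    replaces the value group throughout. *)
Definition vu V x := [/\ x != 0, V x & V x^-1].

Section Subr.
Variables (B : F -> Prop) (hB : subr B).

Lemma sr1 : B 1. Proof. by case: hB. Qed.
Lemma srB x y : B x -> B y -> B (x - y). Proof. by case: hB => _ h _; exact: h. Qed.
Lemma srM x y : B x -> B y -> B (x * y). Proof. by case: hB => _ _; apply. Qed.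
Lemma sr0 : B 0. Proof. by rewrite -(subrr 1); apply: srB; exact: sr1. Qed.
Lemma srN x : B x -> B (- x). Proof. by rewrite -sub0r; apply: srB; exact: sr0. Qed.
Lemma srD x y : B x -> B y -> B (x + y).
Proof. by move=> hx hy; rewrite -[y]opprK; apply: srB => //; exact: srN. Qed.
Lemma srX x n : B x -> B (x ^+ n).
Proof. by move=> hx; elim: n => [|n ih]; rewrite ?expr0 ?exprS; [exact: sr1|exact: srM]. Qed.
Lemma sr_sum (I : Type) (s : seq I) (P : pred I) (f : I -> F) :
 (forall i, P i -> B (f i)) -> B (\sum_(i <- s | P i) f i).
Proof. by move=> h; elim/big_rec: _ => [|i x Pi]; [exact: sr0|apply: srD; exact: h]. Qed.
Lemma sr_prod (I : Type) (s : seq I) (P : pred I) (f : I -> F) :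
 (forall i, P i -> B (f i)) -> B (\prod_(i <- s | P i) f i).
Proof. by move=> h; elim/big_rec: _ => [|i x Pi]; [exact: sr1|apply: srM; exact: h]. Qed.
Lemma sr_nat n : B n%:R.
Proof. by elim: n => [|n ih]; [exact: sr0|rewrite -natr1; apply: srD => //; exact: sr1]. Qed.
Lemma sr_muln x n : B x -> B (x *+ n).
Proof. by move=> hx; rewrite -mulr_natr; apply: srM => //; exact: sr_nat. Qed.
End Subr.

Lemma sfV K x : sfield K -> K x -> K x^-1. Proof. by case=> _; apply. Qed.
Lemma sf_div K x y : sfield K -> K x -> K y -> K (x / y).
Proof. by move=> hK hx hy; apply: srM => //; [case: hK|exact: sfV]. Qed.

Section Vring.
Variables (V : F -> Prop) (hV : vring V).
Let hs : subr V := proj1 hV.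
Local Notation vm := (vm V).
Local Notation vu := (vu V).

Lemma vm_V x : vm x -> V x.
Proof. by case=> [->|]; [exact: sr0 | case: (proj2 hV x)]. Qed.

Lemma vu_V x : vu x -> V x. Proof. by case. Qed.
Lemma vu_n0 x : vu x -> x != 0. Proof. by case. Qed.

Lemma vu_inv x : vu x -> vu x^-1.
Proof. by case=> x0 h h'; split; rewrite ?invr_eq0 ?invrK. Qed.

Lemma vu1 : vu 1. Proof. by split; rewrite ?oner_eq0 ?invr1 //; exact: sr1. Qed.

Lemma vuM x y : vu x -> vu y -> vu (x * y).
case=> x0 hx hx' [y0 hy hy']; split; first by rewrite mulf_neq0.
- exact: srM.
- by rewrite invfM; exact: srM.
Qed.

Lemma vuX x n : vu x -> vu (x ^+ n).
Proof. by move=> hx; elim: n => [|n ih]; rewrite ?expr0 ?exprS; [exact: vu1|exact: vuM]. Qed.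

Lemma vu_div x y : vu x -> vu y -> vu (x / y).
Proof. by move=> hx hy; apply: vuM => //; exact: vu_inv. Qed.

Lemma vuZ x (n : int) : vu x -> vu (x ^ n).
by case: n => n hx; rewrite ?NegzE -?exprnN; [exact: vuX|apply: vu_inv; exact: vuX].
Qed.

Lemma vu_prod (I : Type) (s : seq I) (P : pred I) (f : I -> F) :
 (forall i, P i -> vu (f i)) -> vu (\prod_(i <- s | P i) f i).
Proof. by move=> h; elim/big_rec: _ => [|i x Pi]; [exact: vu1|apply: vuM; exact: h]. Qed.

Lemma vm_nvu x : vm x -> ~ vu x.
Proof. by case=> [->|h] [x0 _ h']; [rewrite eqxx in x0|exact: h]. Qed.

Lemma vm_or_vu x : V x -> vm x \/ vu x.
move=> hx; have [->|x0] := eqVneq x 0; first by left; left.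
by have [h|h] := pselect (V x^-1); [right|left; right].
Qed.

Lemma nV_vm x : ~ V x -> vm x^-1.
Proof. by move=> h; right; rewrite invrK. Qed.

Lemma vm_nV x : x != 0 -> vm x -> ~ V x^-1.
Proof. by move=> x0 [x0'|//]; rewrite x0' eqxx in x0. Qed.

Lemma v_tri x : x != 0 -> [\/ vm x, vu x | vm x^-1].
move=> x0; have [hx|hx] := pselect (V x).
 by case: (vm_or_vu hx) => h; [constructor 1 | constructor 2].
by constructor 3; exact: nV_vm.
Qed.

Lemma vmM x y : vm x -> V y -> vm (x * y).
move=> hx hy; have [->|x0] := eqVneq x 0; first by rewrite mul0r; left.
have [->|y0] := eqVneq y 0; first by rewrite mulr0; left.
right; move=> h; apply: (vm_nV x0 hx).
have -> : x^-1 = (x * y)^-1 * y by field; rewrite x0 y0.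
exact: srM.
Qed.

Lemma vmMr x y : V x -> vm y -> vm (x * y).
Proof. by move=> hx hy; rewrite mulrC; exact: vmM. Qed.

Lemma vmD x y : vm x -> vm y -> vm (x + y).
move=> hx hy; have [->|x0] := eqVneq x 0; first by rewrite add0r.
have [->|y0] := eqVneq y 0; first by rewrite addr0.
case: (proj2 hV (y / x)) => h.
 have -> : x + y = x * (1 + y / x) by field.
 by apply: vmM => //; apply: srD => //; exact: sr1.
have -> : x + y = y * (1 + (y / x)^-1) by field; rewrite x0 y0.
by apply: vmM => //; apply: srD => //; exact: sr1.
Qed.

Lemma vmN x : vm x -> vm (- x).
Proof. by move=> hx; rewrite -mulrN1; apply: vmM => //; apply: srN => //; exact: sr1. Qed.

Lemma vmB x y : vm x -> vm y -> vm (x - y).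
Proof. by move=> hx hy; apply: vmD => //; exact: vmN. Qed.

Lemma vm_sum (I : Type) (s : seq I) (P : pred I) (f : I -> F) :
 (forall i, P i -> vm (f i)) -> vm (\sum_(i <- s | P i) f i).
Proof. by move=> h; elim/big_rec: _ => [|i x Pi]; [left|apply: vmD; exact: h]. Qed.

Lemma vuDm x y : vu x -> vm y -> vu (x + y).
move=> hx hy; have [h|//] : vm (x + y) \/ vu (x + y).
 by apply: vm_or_vu; apply: srD => //; [exact: vu_V|exact: vm_V].
have e : x = (x + y) - y by ring.
by case: (@vm_nvu x) => //; rewrite e; exact: vmB.
Qed.

Lemma vuN x : vu x -> vu (- x).
Proof. by case=> x0 h h'; split; rewrite ?oppr_eq0 ?invrN //; exact: srN. Qed.

Lemma vm_divu x y : vu y -> vm (x * y) -> vm x.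
move=> [y0 hy hy'] h; have -> : x = x * y * y^-1 by field.
exact: vmM.
Qed.

Lemma vu_cancel x y : vu y -> vu (x * y) -> vu x.
move=> hy h; have -> : x = (x * y) * y^-1 by field; exact: vu_n0 hy.
by apply: vuM => //; exact: vu_inv.
Qed.

Lemma vm_prime x y : V x -> V y -> vm (x * y) -> vm x \/ vm y.
move=> hx hy h; case: (vm_or_vu hy) => hy'; first by right.
by left; exact: vm_divu hy' h.
Qed.

Lemma vmX x n : vm x -> vm (x ^+ n.+1).
Proof. by move=> h; rewrite exprS; apply: vmM => //; apply: srX => //; exact: vm_V. Qed.

Lemma vuX_inv x n : x != 0 -> vu (x ^+ n.+1) -> vu x.
move=> x0 h; case: (v_tri x0) => // hx; first by case: (vm_nvu (vmX n hx)).
by case: (vm_nvu (vmX n hx)); rewrite exprVn; exact: vu_inv.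
Qed.

Lemma v_argmin (I : eqType) (s : seq I) (t : I -> F) :
 s <> [::] -> (forall i, i \in s -> t i != 0) ->
 exists2 i0, i0 \in s & forall i, i \in s -> V (t i / t i0).
elim: s => // j s ih _ t0; case: (eqVneq s [::]) => [->|/eqP s0].
 exists j; rewrite ?mem_head // => i; rewrite inE => /eqP ->.
 by rewrite divff ?t0 ?mem_head //; exact: sr1.
have [|i0 i0s hi0] := ih s0; first by move=> i is_; apply: t0; rewrite inE is_ orbT.
have tj0 : t j != 0 by rewrite t0 ?mem_head.
have ti0 : t i0 != 0 by rewrite t0 // inE i0s orbT.
case: (proj2 hV (t j / t i0)) => h.
 exists i0; first by rewrite inE i0s orbT.
 by move=> i; rewrite inE => /orP[/eqP -> //|]; exact: hi0.
exists j; rewrite ?mem_head // => i; rewrite inE => /orP[/eqP ->|is_].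
 by rewrite divff //; exact: sr1.
have -> : t i / t j = (t i / t i0) * (t j / t i0)^-1 by field; rewrite ti0 tj0.
by apply: srM => //; exact: hi0.
Qed.

(** After division by a term of least value, every other term lies in the maximal ideal, because a
    unit quotient is excluded; adding these to 1 leaves a unit. *)
Lemma v_distinct (I : finType) (P : pred I) (t : I -> F) :
 (exists i, P i) -> (forall i, P i -> t i != 0) ->
 (forall i j, P i -> P j -> i != j -> ~ vu (t i / t j)) ->
 exists i0, [/\ P i0, forall i, P i -> i != i0 -> vm (t i / t i0) &
   vu ((\sum_(i | P i) t i) / t i0)].
move=> [i1 Pi1] t0 td.
have memP i : (i \in enum P) = P i by rewrite mem_enum.
have [|i|i0] := @v_argmin I (enum P) t.
- by move=> h; have := memP i1; rewrite h Pi1.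
- by rewrite memP; exact: t0.
rewrite memP => Pi0 hmin.
have hm i : P i -> i != i0 -> vm (t i / t i0).
 move=> Pi ii0; case: (@vm_or_vu (t i / t i0)) => //; first by apply: hmin; rewrite memP.
 by move=> h; case: (td i i0).
exists i0; split=> //; rewrite (bigD1 i0) //= mulrDl divff ?t0 //.
apply: vuDm; first exact: vu1.
rewrite mulr_suml; apply: vm_sum => i /andP[Pi ii0]; exact: hm.
Qed.

End Vring.

Definition polyB B (p : {poly F}) := forall i, B p`_i.

Section Poly.
Variables (B : F -> Prop) (hB : subr B).
Implicit Types p q : {poly F}.

Lemma polyB0 : polyB B 0. Proof. by move=> i; rewrite coef0; exact: sr0. Qed.
Lemma polyBC c : B c -> polyB B c%:P.
Proof. by move=> hc i; rewrite coefC; case: ifP => // _; exact: sr0. Qed.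
Lemma polyBX : polyB B 'X.
Proof. by move=> i; rewrite coefX; exact: sr_nat. Qed.
Lemma polyBD p q : polyB B p -> polyB B q -> polyB B (p + q).
Proof. by move=> hp hq i; rewrite coefD; apply: srD. Qed.
Lemma polyBB p q : polyB B p -> polyB B q -> polyB B (p - q).
Proof. by move=> hp hq i; rewrite coefB; apply: srB. Qed.
Lemma polyBM p q : polyB B p -> polyB B q -> polyB B (p * q).
Proof. by move=> hp hq i; rewrite coefM; apply: sr_sum => // j _; apply: srM. Qed.
Lemma polyBXn p n : polyB B p -> polyB B (p ^+ n).
by move=> hp; elim: n => [|n ih]; rewrite ?expr0 ?exprS; [apply: polyBC; exact: sr1|exact: polyBM].
Qed.
Lemma polyB_horner p x : polyB B p -> B x -> B p.[x].
by move=> hp hx; rewrite horner_coef; apply: sr_sum => // i _; apply: srM => //; exact: srX.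
Qed.
Lemma polyB_prod (I : Type) (s : seq I) (P : pred I) (f : I -> {poly F}) :
 (forall i, P i -> polyB B (f i)) -> polyB B (\prod_(i <- s | P i) f i).
move=> h; elim/big_rec: _ => [|i x Pi]; first by apply: polyBC; exact: sr1.
by apply: polyBM; exact: h.
Qed.
Lemma polyB_sum (I : Type) (s : seq I) (P : pred I) (f : I -> {poly F}) :
 (forall i, P i -> polyB B (f i)) -> polyB B (\sum_(i <- s | P i) f i).
Proof. by move=> h; elim/big_rec: _ => [|i x Pi]; [exact: polyB0|apply: polyBD; exact: h]. Qed.

Lemma polyB_factor p c : polyB B p -> B c ->
 exists2 q, polyB B q & p = p.[c]%:P + ('X - c%:P) * q.
move=> hp hc; elim/poly_ind: p hp => [|p a ih] hp.
 by exists 0; rewrite ?horner0 ?mulr0 ?addr0 ?rmorph0 //; exact: polyB0.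
have hp' : polyB B p by move=> i; have := hp i.+1; rewrite coefD coefMX coefC addr0.
have [q hq eq] := ih hp'.
exists (p.[c]%:P + 'X * q).
 apply: polyBD; first by apply: polyBC; exact: polyB_horner.
 by apply: polyBM => //; exact: polyBX.
rewrite {1}eq hornerD hornerMX hornerC !rmorphD rmorphM /=; ring.
Qed.
End Poly.

Definition adj1 B x z := exists2 p, polyB B p & z = p.[x].

Definition adjs B (X : seq F) := foldr (fun x C => adj1 C x) B X.

Lemma adj1_subr B x : subr B -> subr (adj1 B x).
move=> hB; split.
- by exists 1; rewrite ?hornerC //; apply: polyBC => //; exact: sr1.
- move=> _ _ [p hp ->] [q hq ->]; exists (p - q); rewrite ?hornerD ?hornerN //.
 exact: polyBB.
- by move=> _ _ [p hp ->] [q hq ->]; exists (p * q); rewrite ?hornerM //; exact: polyBM.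
Qed.

Lemma adj1_base B x z : subr B -> B z -> adj1 B x z.
Proof. by move=> hB hz; exists z%:P; rewrite ?hornerC //; exact: polyBC. Qed.

Lemma adj1_gen B x : subr B -> adj1 B x x.
Proof. by move=> hB; exists 'X; rewrite ?hornerX //; exact: polyBX. Qed.

Lemma adj1_min B C x : subr C -> (forall z, B z -> C z) -> C x ->
 forall z, adj1 B x z -> C z.
by move=> hC BC Cx z [p hp ->]; apply: polyB_horner => // i; apply: BC; exact: hp.
Qed.

Lemma adjs_subr B X : subr B -> subr (adjs B X).
Proof. by move=> hB; elim: X => //= x X ih; exact: adj1_subr. Qed.

Lemma adjs_base B X z : subr B -> B z -> adjs B X z.
Proof. by move=> hB; elim: X => //= x X ih hz; apply: adj1_base; [exact: adjs_subr|exact: ih]. Qed.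

Lemma adjs_gen B X x : subr B -> x \in X -> adjs B X x.
move=> hB; elim: X => //= y X ih; rewrite inE => /orP[/eqP ->|hx].
 by apply: adj1_gen; exact: adjs_subr.
by apply: adj1_base; [exact: adjs_subr|exact: ih].
Qed.

Lemma adjs_min B C X : subr C -> (forall z, B z -> C z) ->
 (forall x, x \in X -> C x) -> forall z, adjs B X z -> C z.
move=> hC BC; elim: X => //= x X ih XC; apply: adj1_min => //.
 by apply: ih => y hy; apply: XC; rewrite inE hy orbT.
by apply: XC; exact: mem_head.
Qed.

(** For [B] inside [V], this is the localization of [B] at the centre of the valuation. *)
Definition loc V B z := exists a b, [/\ B a, B b, vu V b & z = a / b].

Definition frac B z := exists a b, [/\ B a, B b, b != 0 & z = a / b].

Section Loc.
Variables (V B : F -> Prop) (hV : vring V) (hB : subr B).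

Lemma loc_subr : subr (loc V B).
split.
- by exists 1, 1; split; rewrite ?divr1 //; [exact: sr1|exact: sr1|exact: vu1].
- move=> _ _ [a [b [ha hb ub ->]]] [c [d [hc hd ud ->]]].
 exists (a * d - c * b), (b * d); split; [|exact: srM|exact: vuM|].
  by apply: srB => //; exact: srM.
 by field; rewrite (vu_n0 ub) (vu_n0 ud).
- move=> _ _ [a [b [ha hb ub ->]]] [c [d [hc hd ud ->]]].
 exists (a * c), (b * d); split; [exact: srM|exact: srM|exact: vuM|].
 by field; rewrite (vu_n0 ub) (vu_n0 ud).
Qed.

Lemma loc_base z : B z -> loc V B z.
Proof. by exists z, 1; split; rewrite ?divr1 //; [exact: sr1|exact: vu1]. Qed.

Lemma loc_inv z : loc V B z -> vu V z -> loc V B z^-1.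
move=> [a [b [ha hb ub ->]]] hz; exists b, a; split; rewrite ?invf_div //.
have -> : a = (a / b) * b by field; exact: vu_n0 ub.
exact: vuM.
Qed.

Lemma loc_min C : subr C -> (forall z, B z -> C z) ->
 (forall z, B z -> vu V z -> C z^-1) -> forall z, loc V B z -> C z.
Proof. by move=> hC BC BC' _ [a [b [ha hb ub ->]]]; apply: srM => //; [exact: BC|exact: BC']. Qed.

Lemma frac_sfield : sfield (frac B).
split; last first.
 move=> _ [a [b [ha hb b0 ->]]]; have [->|a0] := eqVneq a 0.
  by rewrite mul0r invr0; exists 0, 1; split; rewrite ?mul0r ?oner_eq0 //; [exact: sr0|exact: sr1].
 by exists b, a; split; rewrite ?invf_div.
split.
- by exists 1, 1; split; rewrite ?divr1 ?oner_eq0 //; exact: sr1.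
- move=> _ _ [a [b [ha hb ub ->]]] [c [d [hc hd ud ->]]].
 exists (a * d - c * b), (b * d); split; [|exact: srM|exact: mulf_neq0|].
  by apply: srB => //; exact: srM.
 by field; rewrite ub ud.
- move=> _ _ [a [b [ha hb ub ->]]] [c [d [hc hd ud ->]]].
 exists (a * c), (b * d); split; [exact: srM|exact: srM|exact: mulf_neq0|].
 by field; rewrite ub ud.
Qed.

Lemma frac_base z : B z -> frac B z.
Proof. by exists z, 1; split; rewrite ?divr1 ?oner_eq0 //; exact: sr1. Qed.

Lemma frac_min C : sfield C -> (forall z, B z -> C z) -> forall z, frac B z -> C z.
Proof. by move=> hC BC _ [a [b [ha hb ub ->]]]; apply: sf_div => //; exact: BC. Qed.
End Loc.

Definition igen S (I : finType) (u : I -> F) x :=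
 exists2 b : I -> F, forall i, S (b i) & x = \sum_i b i * u i.

Section Igen.
Variables (S : F -> Prop) (hS : subr S) (I : finType) (u : I -> F).

Lemma igen0 : igen S u 0.
Proof. by exists (fun=> 0) => [i|]; [exact: sr0|rewrite big1 // => i _; rewrite mul0r]. Qed.

Lemma igenD x y : igen S u x -> igen S u y -> igen S u (x + y).
move=> [b hb ->] [c hc ->]; exists (fun i => b i + c i) => [i|]; first exact: srD.
by rewrite -big_split; apply: eq_bigr => i _; rewrite mulrDl.
Qed.

Lemma igenM a x : S a -> igen S u x -> igen S u (a * x).
move=> ha [b hb ->]; exists (fun i => a * b i) => [i|]; first exact: srM.
by rewrite mulr_sumr; apply: eq_bigr => i _; rewrite mulrA.
Qed.

Lemma igenN x : igen S u x -> igen S u (- x).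
Proof. by rewrite -mulN1r; apply: igenM; apply: srN => //; exact: sr1. Qed.

Lemma igenB x y : igen S u x -> igen S u y -> igen S u (x - y).
Proof. by move=> hx hy; apply: igenD => //; exact: igenN. Qed.

Lemma igen_mem i : igen S u (u i).
exists (fun j => (j == i)%:R) => [j|]; first exact: sr_nat.
by rewrite (bigD1 i) //= eqxx mul1r big1 ?addr0 // => j /negbTE ->; rewrite mul0r.
Qed.

Lemma igen_sum (J : Type) (s : seq J) (P : pred J) (f : J -> F) :
 (forall i, P i -> igen S u (f i)) -> igen S u (\sum_(i <- s | P i) f i).
Proof. by move=> h; elim/big_rec: _ => [|i x Pi]; [exact: igen0|apply: igenD; exact: h]. Qed.
End Igen.

Lemma igen_min S (I : finType) (u : I -> F) (J : F -> Prop) :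
 J 0 -> (forall x y, J x -> J y -> J (x + y)) -> (forall a x, S a -> J x -> J (a * x)) ->
 (forall i, J (u i)) -> forall x, igen S u x -> J x.
move=> J0 JD JM Ju x [b hb ->]; elim/big_rec: _ => // i y _ hy; apply: JD => //.
by apply: JM.
Qed.

End SetRings.

Lemma chain_le (P : nat -> Prop) : (forall n, P n -> P n.+1) ->
 forall n m, (n <= m)%N -> P n -> P m.
Proof. by move=> h n m /subnK <-; elim: (m - n)%N => // j ih /ih /h. Qed.

(** * Noetherian rings, Hilbert's basis theorem and Krull's intersection theorem *)

Section Noetherian.
Variable F : fieldType.
Implicit Types (B C V S J Q : F -> Prop) (x y z : F) (s e : seq F).

Fixpoint lin B s x : Prop :=
 if s is y :: s' then exists2 b, B b & lin B s' (x - b * y) else x = 0.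

(** Containment in [B] is left out: these are the [B]-submodules of [F], so that one notion serves
    for ideals and for submodules of finite modules. *)
Definition ideal B J :=
 [/\ J 0, forall x y, J x -> J y -> J (x + y) & forall a x, B a -> J x -> J (a * x)].

Definition noeth B := forall J, ideal B J -> (forall x, J x -> B x) ->
 exists s, (forall x, x \in s -> J x) /\ forall x, J x -> lin B s x.

Lemma idealB B J x y : subr B -> ideal B J -> J x -> J y -> J (x - y).
move=> hB [_ hD hM] hx hy; apply: hD => //; rewrite -mulN1r; apply: hM => //.
by apply: srN => //; exact: sr1.
Qed.

Lemma ideal_sum B J (I : Type) (r : seq I) (P : pred I) (f : I -> F) : ideal B J ->
 (forall i, P i -> J (f i)) -> J (\sum_(i <- r | P i) f i).
Proof. by case=> h0 hD _ h; elim/big_rec: _ => // i x Pi; apply: hD; exact: h. Qed.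

Section Lin.
Variables (B : F -> Prop) (hB : subr B).

Lemma lin0 s : lin B s 0.
Proof. by elim: s => //= y s ih; exists 0; rewrite ?mul0r ?subr0 //; exact: sr0. Qed.

Lemma linD s x y : lin B s x -> lin B s y -> lin B s (x + y).
elim: s x y => [|z s ih] x y /=; first by move=> -> ->; rewrite addr0.
move=> [b hb hx] [c hc hy]; exists (b + c); first exact: srD.
have -> : x + y - (b + c) * z = (x - b * z) + (y - c * z) by ring.
exact: ih.
Qed.

Lemma linM s a x : B a -> lin B s x -> lin B s (a * x).
move=> ha; elim: s x => [|z s ih] x /=; first by move=> ->; rewrite mulr0.
move=> [b hb hx]; exists (a * b); first exact: srM.
have -> : a * x - a * b * z = a * (x - b * z) by ring.
exact: ih.
Qed.

Lemma lin_ideal s : ideal B (lin B s).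
Proof. by split; [exact: lin0|exact: linD|exact: linM]. Qed.

Lemma lin_mem s y : y \in s -> lin B s y.
elim: s => //= z s ih; rewrite inE => /orP[/eqP ->|ys].
 by exists 1; rewrite ?mul1r ?subrr; [exact: sr1|exact: lin0].
by exists 0; rewrite ?mul0r ?subr0; [exact: sr0|exact: ih].
Qed.

Lemma lin_min J s x : ideal B J -> (forall y, y \in s -> J y) -> lin B s x -> J x.
move=> hJ; have [h0 hD hM] := hJ.
elim: s x => [|z s ih] x hs /=; first by move=> ->.
move=> [b hb /ih hx]; rewrite -(subrK (b * z) x); apply: hD.
 by apply: hx => y ys; apply: hs; rewrite inE ys orbT.
by apply: hM => //; apply: hs; exact: mem_head.
Qed.

Lemma lin_sub s (t : seq F) x : (forall y, y \in s -> lin B t y) -> lin B s x -> lin B t x.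
Proof. by apply: lin_min; exact: lin_ideal. Qed.

Lemma lin_subset s (t : seq F) x : {subset s <= t} -> lin B s x -> lin B t x.
Proof. by move=> st; apply: lin_sub => y ys; apply: lin_mem; exact: st. Qed.

Lemma lin_sum s (I : Type) (r : seq I) (P : pred I) (f : I -> F) :
 (forall i, P i -> lin B s (f i)) -> lin B s (\sum_(i <- r | P i) f i).
Proof. by apply: ideal_sum; exact: lin_ideal. Qed.
End Lin.

Lemma lin_mono B C s x : (forall z, B z -> C z) -> lin B s x -> lin C s x.
Proof. by move=> BC; elim: s x => //= y s ih x [b hb h]; exists b; [exact: BC|exact: ih]. Qed.

Section NoethRing.
Variables (B : F -> Prop) (hB : subr B) (hN : noeth B).

(** Without a maximal member, dependent choice would give a strictly increasing chain; its union is
    finitely generated, hence already reached at a finite stage. *)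
Lemma noeth_max (Fm : (F -> Prop) -> Prop) :
 (exists J, Fm J) -> (forall J, Fm J -> ideal B J /\ forall x, J x -> B x) ->
 exists2 J, Fm J & forall J', Fm J' -> (forall x, J x -> J' x) -> forall x, J' x -> J x.
move=> [J0 FJ0] hF; apply: contrapT => hno.
have step (J : {J | Fm J}) : {J' : {J | Fm J} |
  (forall x, sval J x -> sval J' x) /\ exists2 x, sval J' x & ~ sval J x}.
 apply: cid; apply: contrapT => h; apply: hno; exists (sval J); first exact: (svalP J).
 move=> J' FJ' sub x J'x; apply: contrapT => nJx; apply: h; exists (exist Fm J' FJ').
 by split=> //; exists x.
pose T n : {J | Fm J} := iter n (fun J : {J | Fm J} => sval (step J)) (exist Fm J0 FJ0).
have Tsub n x : sval (T n) x -> sval (T n.+1) x by apply: (svalP (step (T n))).1.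
have Tle n m x : (n <= m)%N -> sval (T n) x -> sval (T m) x.
 by apply: (@chain_le (fun n => sval (T n) x)) => j; exact: Tsub.
pose U x := exists n, sval (T n) x.
have idU : ideal B U.
 split.
 - by exists 0%N; case: (hF _ (svalP (T 0%N))) => -[].
 - move=> x y [n hx] [m hy]; exists (maxn n m).
  by case: (hF _ (svalP (T (maxn n m)))) => -[_ hD _] _; apply: hD; [apply: Tle hx|apply: Tle hy]; rewrite ?leq_maxl ?leq_maxr.
 - by move=> a x ha [n hx]; exists n; case: (hF _ (svalP (T n))) => -[_ _ hM] _; exact: hM.
have [|s [sU hs]] := hN idU.
 by move=> x [n hx]; case: (hF _ (svalP (T n))) => _; exact.
have [N hNs] : exists N, forall x, x \in s -> sval (T N) x.
 elim: s sU {hs} => [|y s ih] sU; first by exists 0%N.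
 have [|N hN'] := ih; first by move=> x xs; apply: sU; rewrite inE xs orbT.
 have [M hM] := sU y (mem_head _ _); exists (maxn N M) => x.
 rewrite inE => /orP[/eqP ->|/hN' h]; first by apply: Tle hM; exact: leq_maxr.
 by apply: Tle h; exact: leq_maxl.
have [_ [x hx nx]] := svalP (step (T N)); apply: nx.
have Ux : U x by exists N.+1.
by apply: (lin_min _ hNs (hs _ Ux)); case: (hF _ (svalP (T N))).
Qed.

(** Induction on the generators [e]: the coefficients at the head generator form an ideal of [B],
    and after correcting them only the tail matters. Working modulo [Q] avoids quotient modules. *)
Lemma fg_submodule e (P Q : F -> Prop) :
 ideal B P -> ideal B Q -> (forall x, Q x -> P x) ->
 (forall x, P x -> exists2 y, lin B e y & Q (x - y)) ->
 exists2 s, (forall x, x \in s -> P x) &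
  forall x, P x -> exists2 y, lin B s y & Q (x - y).
elim: e P => [|y e ih] P hP hQ QP hPe.
 by exists [::] => // x /hPe[z /= -> h]; exists 0.
have [Q0 QD QM] := hQ; have [P0 PD PM] := hP.
pose a b := B b /\ exists2 x, P x & exists2 z, lin B e z & Q (x - b * y - z).
have ida : ideal B a.
 split.
 - split; first exact: sr0.
  by exists 0 => //; exists 0; rewrite ?mul0r ?subr0 //; exact: lin0.
 - move=> b c [hb [x Px [z hz Qz]]] [hc [x' Px' [z' hz' Qz']]]; split; first exact: srD.
  exists (x + x'); first exact: PD.
  exists (z + z'); first exact: linD.
  have -> : x + x' - (b + c) * y - (z + z') = (x - b * y - z) + (x' - c * y - z') by ring.
  exact: QD.
 - move=> c b hc [hb [x Px [z hz Qz]]]; split; first exact: srM.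
  exists (c * x); first exact: PM.
  exists (c * z); first exact: linM.
  have -> : c * x - c * b * y - c * z = c * (x - b * y - z) by ring.
exact: QM.
have [|bs [bsa hbs]] := hN ida; first by move=> x [].
pose P' x := P x /\ exists2 z, lin B e z & Q (x - z).
have [|||s sP' hs] := ih P' _ hQ.
- split.
 + by split=> //; exists 0; rewrite ?subr0 //; exact: lin0.
 + move=> x x' [Px [z hz Qz]] [Px' [z' hz' Qz']]; split; first exact: PD.
  exists (z + z'); first exact: linD.
  have -> : x + x' - (z + z') = (x - z) + (x' - z') by ring.
exact: QD.
 + move=> c x hc [Px [z hz Qz]]; split; first exact: PM.
  by exists (c * z); rewrite -?mulrBr; [exact: linM|exact: QM].
- move=> x Qx; split; first exact: QP.
 by exists 0; rewrite ?subr0 //; exact: lin0.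
- by move=> x [_].
have [xs xsP hxs] : exists2 xs, (forall x, x \in xs -> P x) & forall b, lin B bs b ->
  exists w, [/\ lin B xs w, P w & exists2 z, lin B e z & Q (w - b * y - z)].
 elim: bs bsa {hbs} => [|c bs ihb] bsa.
  exists [::] => // b /= ->; exists 0; split=> //.
  by exists 0; rewrite ?mul0r ?subr0 //; exact: lin0.
 have [|xs xsP hxs] := ihb; first by move=> b hb; apply: bsa; rewrite inE hb orbT.
 have [hc [x Px [z hz Qz]]] := bsa c (mem_head _ _).
 exists (x :: xs) => [v|b /=]; first by rewrite inE => /orP[/eqP ->|/xsP].
 move=> [d hd /hxs[w [hw Pw [z' hz' Qz']]]].
 exists (w + d * x); split; last 1 first.
 - exists (z' + d * z); first by apply: linD => //; exact: linM.
  have -> : w + d * x - b * y - (z' + d * z)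
   = (w - (b - d * c) * y - z') + d * (x - c * y - z) by ring.
  by apply: QD => //; exact: QM.
 - by exists d => //; rewrite addrK.
 - by apply: PD => //; exact: PM.
exists (s ++ xs) => [x|x Px].
 by rewrite mem_cat => /orP[/sP'[]|/xsP].
have [w [b hb hw] Qw] := hPe x Px.
have [|v [hv Pv [z hz Qz]]] := hxs b.
 apply: hbs; split=> //; exists x => //; exists (w - b * y) => //.
 by have -> : x - b * y - (w - b * y) = x - w by ring.
have [|w' hw' Qw'] := hs (x - v).
 split; first exact: (idealB hB hP).
 exists ((w - b * y) - z); first by apply: (idealB hB (lin_ideal hB e)).
 have -> : x - v - (w - b * y - z) = (x - w) - (v - b * y - z) by ring.
 exact: (idealB hB hQ).
exists (w' + v).
 by apply: linD => //; [move: hw'|move: hv]; apply: lin_subset => // u hu; rewrite mem_cat hu ?orbT.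
by have -> : x - (w' + v) = x - v - w' by ring.
Qed.

(** Hilbert's basis theorem. The ideal is pulled back to polynomials, since an element of [B[a]] has
    no degree of its own when [a] is algebraic. *)
Lemma noeth_adj1 a : noeth (adj1 B a).
move=> J hJ JC; set C := adj1 B a in hJ JC *.
have hC : subr C by exact: adj1_subr.
have [J0 JD JM] := hJ.
pose JJ p := polyB B p /\ J p.[a].
have JJM p q : polyB B q -> JJ p -> JJ (p * q).
 move=> hq [hp Jp]; split; first exact: polyBM.
 by rewrite hornerM mulrC; apply: JM => //; exists q.
pose l n b := exists p, [/\ JJ p, (size p <= n.+1)%N & b = p`_n].
have lid n : ideal B (l n).
 split.
 - exists 0; split; rewrite ?size_poly0 ?coef0 //.
  by split; rewrite ?horner0 //; exact: polyB0.
 - move=> _ _ [p [[hp Jp] sp ->]] [q [[hq Jq] sq ->]]; exists (p + q).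
  split; rewrite ?coefD //.
   by split; rewrite ?hornerD; [exact: polyBD|exact: JD].
  by apply: leq_trans (size_polyD _ _) _; rewrite geq_max sp.
 - move=> c _ hc [p [hp sp ->]]; exists (p * c%:P); split.
  + by apply: JJM => //; exact: polyBC.
  + by rewrite mulrC mul_polyC; apply: leq_trans (size_scale_leq _ _) _.
  + by rewrite [p * _]mulrC coefCM.
have lB n b : l n b -> B b by case=> p [[hp _] _ ->]; exact: hp.
have lS n b : l n b -> l n.+1 b.
 case=> p [hp sp ->]; exists (p * 'X); split; rewrite ?coefMX //.
  by apply: JJM => //; exact: polyBX.
 have [->|p0] := eqVneq p 0; first by rewrite mul0r size_poly0.
 by rewrite size_mulX.
have lle n m b : (n <= m)%N -> l n b -> l m b.
 by apply: (@chain_le (fun n => l n b)) => j; exact: lS.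
(* The ideals of leading coefficients grow with the degree and are constant from [N] on; in higher
   degrees, generators of degree [N] are multiplied by powers of the variable. *)
have [N hNl] : exists N, forall n b, l n b -> l N b.
 have [||_ [N ->] hmax] := @noeth_max (fun J => exists n, J = l n).
 - by exists (l 0%N), 0%N.
 - by move=> _ [n ->]; split; [exact: lid|exact: lB].
 exists N => n b hb; apply: (hmax (l (maxn N n))); first by exists (maxn N n).
  by move=> x; apply: lle; exact: leq_maxl.
 by apply: lle hb; exact: leq_maxr.
have lfg n : {ps : seq {poly F} | (forall p, p \in ps -> JJ p /\ (size p <= n.+1)%N) /\
  forall b, l n b -> lin B [seq (p : {poly F})`_n | p <- ps] b}.
 apply: cid; have [s [sl hs]] := hN (lid n) (@lB n).
 suff [ps [hps eps]] : exists ps : seq {poly F},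
   (forall p, p \in ps -> JJ p /\ (size p <= n.+1)%N) /\ s = [seq (p : {poly F})`_n | p <- ps].
  by exists ps; rewrite -eps.
 elim: s sl {hs} => [|b s ih] sl; first by exists [::].
 have [|ps [hps ->]] := ih; first by move=> x hx; apply: sl; rewrite inE hx orbT.
 have [p [hp sp ->]] := sl b (mem_head _ _).
 by exists (p :: ps); split=> // q; rewrite inE => /orP[/eqP ->|/hps].
pose G := flatten [seq [seq p.[a] | p <- sval (lfg n)] | n <- iota 0 N.+1].
have GJ x : x \in G -> J x.
 by case/flatten_mapP => n _ /mapP[p /(svalP (lfg n)).1[[_ Jp] _] ->].
have key n b : (n <= N)%N -> l n b ->
  exists w, [/\ JJ w, (size w <= n.+1)%N, w`_n = b & lin C G w.[a]].
 move=> nN /(svalP (lfg n)).2.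
 have : forall p, p \in sval (lfg n) -> [/\ JJ p, (size p <= n.+1)%N & p.[a] \in G].
  move=> p hp; have [h1 h2] := (svalP (lfg n)).1 p hp; split=> //.
  apply/flatten_mapP; exists n; first by rewrite mem_iota add0n ltnS.
  by apply/mapP; exists p.
 elim: (sval (lfg n)) b => [|p ps ih] b hps /=.
  move=> ->; exists 0; rewrite size_poly0 coef0 horner0; split=> //; last exact: lin0.
  by split; rewrite ?horner0 //; exact: polyB0.
 move=> [c hc /ih[|w [[hw Jw] sw ew lw]]]; first by move=> q hq; apply: hps; rewrite inE hq orbT.
 have [[hp Jp] sp pG] := hps p (mem_head _ _).
 exists (w + c%:P * p); split.
 - split; first by apply: polyBD => //; apply: polyBM => //; exact: polyBC.
  rewrite hornerD hornerM hornerC; apply: JD => //; apply: JM => //.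
  exact: adj1_base.
 - apply: leq_trans (size_polyD _ _) _; rewrite geq_max sw mul_polyC.
  exact: leq_trans (size_scale_leq _ _) _.
 - by rewrite coefD coefCM ew subrK.
 - rewrite hornerD hornerM hornerC; apply: linD => //; apply: linM => //.
   exact: adj1_base.
  exact: lin_mem.
exists G; split=> // x Jx; have [p hp ex] := JC x Jx.
have JJp : JJ p by split; rewrite -?ex.
have [m] := ubnP (size p); rewrite {}ex => hm {hp Jx x}.
elim: m p hm JJp => // m ih p; rewrite ltnS => sp JJp.
have [p0|sp0] := posnP (size p).
 by move/eqP: p0; rewrite size_poly_eq0 => /eqP ->; rewrite horner0; exact: lin0.
set n := (size p).-1; have sn : size p = n.+1 by rewrite prednK.
have ln : l (minn n N) p`_n.
 rewrite /minn; case: ltnP => _; first by exists p; split; rewrite ?sn.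
 by apply: (hNl n); exists p; split; rewrite ?sn.
have [w [JJw sw ew lw]] := key _ _ (geq_minr _ _) ln.
set k := (n - minn n N)%N.
have kn : (k + minn n N)%N = n by rewrite subnK // geq_minl.
have polyX i : polyB B ('X^i) by apply: polyBXn => //; exact: polyBX.
have -> : p.[a] = (p - w * 'X^k).[a] + a ^+ k * w.[a].
 by rewrite hornerD hornerN hornerM hornerXn; ring.
apply: linD => //; last first.
 apply: linM => //; apply: srX => //; exact: adj1_gen.
apply: ih; last first.
 have [h1 h2] := JJM w _ (polyX k) JJw; case: JJp => h3 h4.
 by split; [exact: polyBB|rewrite hornerD hornerN; exact: (idealB hC hJ)].
apply: leq_trans sp; rewrite sn ltnS; apply/leq_sizeP => j nj.
rewrite coefB coefMXn; have [jn|jn] := eqVneq j n.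
 have -> : (j < k)%N = false by apply/negbTE; rewrite -leqNgt jn leq_subr.
 have -> : (j - k)%N = minn n N by rewrite jn -{1}kn addKn.
 by rewrite jn ew subrr.
have {jn nj} nj : (n < j)%N by rewrite ltn_neqAle eq_sym jn.
rewrite nth_default ?sn // ltnNge (leq_trans (leq_subr _ _) (ltnW nj)) /=.
rewrite nth_default ?subrr //; apply: leq_trans sw _.
by rewrite -(ltn_add2l k) kn subnKC // (leq_trans (leq_subr _ _) (ltnW nj)).
Qed.

Lemma noeth_loc V : vring V -> noeth (loc V B).
move=> hV J hJ JL; have hL := loc_subr hV hB; have [J0 JD JM] := hJ.
have BL z : B z -> loc V B z by exact: loc_base.
have [||s [sJ hs]] := hN (J := fun x => J x /\ B x).
- split; first by split; [|exact: sr0].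
 + by move=> x y [? ?] [? ?]; split; [exact: JD|exact: srD].
 + by move=> a x ha [? ?]; split; [apply: JM => //; exact: BL|exact: srM].
- by move=> x [].
exists s; split=> [x /sJ[] //|x Jx]; have [a [b [ha hb ub ex]]] := JL x Jx.
have b0 := vu_n0 ub.
have -> : x = b^-1 * a by rewrite ex mulrC.
apply: linM => //; first by apply: loc_inv => //; exact: BL.
apply: (lin_mono BL); apply: hs; split=> //.
have -> : a = b * x by rewrite ex mulrCA divff ?mulr1.
by apply: JM => //; exact: BL.
Qed.
End NoethRing.

Lemma noeth_adjs B X : subr B -> noeth B -> noeth (adjs B X).
move=> hB hN; elim: X => //= x X ih; apply: noeth_adj1 => //; exact: adjs_subr.
Qed.

(** With a subfield [k] in place of [B], the same recursion yields the values at [g] of the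
    homogeneous forms of degree [n] over [k]. Both uses occur. *)
Fixpoint ipow B (I : finType) (g : I -> F) n : F -> Prop :=
 if n is n'.+1 then igen (ipow B g n') g else B.

Section Ipow.
Variables (B : F -> Prop) (hB : subr B) (I : finType) (g : I -> F).
Hypothesis Bg : forall i, B (g i).

Lemma ipow_ideal n : ideal B (ipow B g n).
elim: n => [|n [ih0 ihD ihM]] /=; first by split; [exact: sr0|exact: srD|exact: srM].
split.
- by exists (fun=> 0) => // ; rewrite big1 // => i _; rewrite mul0r.
- move=> _ _ [b hb ->] [c hc ->]; exists (fun i => b i + c i) => [i|]; first exact: ihD.
 by rewrite -big_split; apply: eq_bigr => i _; rewrite mulrDl.
- move=> a _ ha [b hb ->]; exists (fun i => a * b i) => [i|]; first exact: ihM.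
 by rewrite mulr_sumr; apply: eq_bigr => i _; rewrite mulrA.
Qed.

Lemma ipow_base n x : ipow B g n x -> B x.
elim: n x => //= n ih x [b hb ->]; apply: sr_sum => // i _; apply: srM => //; exact: ih.
Qed.

Lemma ipowS n x : ipow B g n.+1 x -> ipow B g n x.
elim: n x => [|n ih] x; first exact: ipow_base.
by move=> [b hb ->]; exists b => // i; apply: ih; exact: hb.
Qed.

Lemma ipow_le n m x : (n <= m)%N -> ipow B g m x -> ipow B g n x.
move=> /subnK <-; elim: (m - n)%N x => // j ih x; rewrite addSn => /ipowS; exact: ih.
Qed.

Lemma ipow_mul n m x y : ipow B g n x -> ipow B g m y -> ipow B g (n + m) (x * y).
elim: n x => [|n ih] x /=; first by case: (ipow_ideal m) => _ _ hM hx hy; exact: hM.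
move=> [b hb ->] hy; exists (fun i => b i * y) => [i|]; first exact: ih.
by rewrite mulr_suml; apply: eq_bigr => i _; ring.
Qed.

Lemma ipow_expr n x : igen B g x -> ipow B g n (x ^+ n).
move=> hx; elim: n => [|n ih]; first exact: sr1.
by rewrite exprS -add1n; apply: ipow_mul.
Qed.

(** Pigeonhole: a product of more than [#|I| * n] generators contains some [g i] at least [n] times.
    The inner statement carries along the monomial already collected. *)
Lemma ipow_absorb Q n : ideal B Q -> (forall i, Q (g i ^+ n)) ->
 forall x, ipow B g (#|I| * n).+1 x -> Q x.
move=> Qid hQ; have [Q0 QD QM] := Qid.
have key N : forall x (e : I -> nat), ipow B g N x ->
  (#|I| * n < \sum_i e i + N)%N -> Q (\prod_i g i ^+ e i * x).
 elim: N => [|N ih] x e.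
  move=> hx; rewrite addn0 => hlt; have [i hi] : exists i, (n <= e i)%N.
   apply: contrapT => hno; move: hlt; rewrite ltnNge; apply/negP/negPn.
   rewrite -sum_nat_const; apply: leq_sum => i _; rewrite leqNgt; apply/negP => h.
   by apply: hno; exists i; exact: ltnW.
  rewrite (bigD1 i) //= -(subnK hi) exprD.
  have -> : g i ^+ (e i - n) * g i ^+ n * (\prod_(j | j != i) g j ^+ e j) * x
   = (g i ^+ (e i - n) * (\prod_(j | j != i) g j ^+ e j) * x) * g i ^+ n by ring.
  apply: QM => //; apply: srM => //; apply: srM => //; first exact: srX.
  by apply: sr_prod => // j _; exact: srX.
 move=> [b hb ->] hlt; rewrite mulr_sumr; apply: (ideal_sum _ Qid) => i _.
 have -> : \prod_j g j ^+ e j * (b i * g i) = \prod_j g j ^+ (e j + (j == i))%N * b i.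
  under [in RHS]eq_bigr do rewrite exprD.
  rewrite big_split /=; have -> : \prod_j g j ^+ (j == i) = g i.
   by rewrite (bigD1 i) //= eqxx expr1 big1 ?mulr1 // => j /negbTE ->.
  by ring.
 apply: ih; first exact: hb.
 rewrite big_split /=.
 have -> : (\sum_j (j == i) = 1)%N.
  by rewrite (bigD1 i) //= eqxx big1 // => j /negbTE ->.
 by rewrite addn1 addSnnS.
move=> x hx; have := key _ x (fun=> 0%N) hx; rewrite big1 // add0n ltnSn => /(_ isT).
by rewrite big1 ?mul1r // => i _; rewrite expr0.
Qed.

(** The Artin-Rees lemma is avoided: among the ideals that contain [E = J + (g) x] and meet
    [D = J + B x] only in [E], a maximal one contains a power of each [g i], hence a power of [(g)],
    hence [x]; and [x] in [E] is the claim. *)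
Lemma krull_intersection J x : noeth B -> ideal B J -> (forall z, J z -> B z) -> B x ->
 (forall n, exists2 y, J y & ipow B g n (x - y)) ->
 exists2 t : F, igen B g t & J ((1 - t) * x).
move=> hN hJ JB Bx hx; have [J0 JD JM] := hJ.
have gid := ipow_ideal 1; have [g0 gD gM] := gid.
pose D z := exists i b, [/\ J i, B b & z = i + b * x].
pose E z := exists i (t : F), [/\ J i, igen B g t & z = i + t * x].
pose Fm (Q : F -> Prop) := [/\ ideal B Q, forall z, Q z -> B z, forall z, E z -> Q z &
        forall z, Q z -> D z -> E z].
have igB t : igen B g t -> B t by exact: (@ipow_base 1).
have Dsub z w : D z -> D w -> D (z - w).
 move=> [i [b [hi hb ->]]] [j [c [hj hc ->]]]; exists (i - j), (b - c).
 by split; [exact: (idealB hB hJ)|exact: srB | ring].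
have [||Q [Qid QB EQ QE] hmax] := @noeth_max _ hN Fm.
- exists E; split=> //.
 + split.
  * by exists 0, 0; split; rewrite ?mul0r ?addr0.
  * move=> _ _ [i [t [hi ht ->]]] [j [t' [hj ht' ->]]]; exists (i + j), (t + t').
   by split; [exact: JD|exact: gD | ring].
  * move=> a _ ha [i [t [hi ht ->]]]; exists (a * i), (a * t).
   by split; [exact: JM|exact: gM | ring].
 + move=> _ [i [t [hi ht ->]]]; apply: srD => //; first exact: JB.
  by apply: srM => //; exact: igB.
- by move=> Q [].
have [Q0 QD QM] := Qid.
have pw i : exists n, Q (g i ^+ n).
 pose q n b := B b /\ Q (g i ^+ n * b).
 have qid n : ideal B (q n).
  split.
  - by split; rewrite ?mulr0 //; exact: sr0.
  - by move=> b c [hb Qb] [hc Qc]; split; rewrite ?mulrDr; [exact: srD|exact: QD].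
  - move=> a b ha [hb Qb]; split; first exact: srM.
   by rewrite mulrCA; exact: QM.
 have qle n m b : (n <= m)%N -> q n b -> q m b.
  move=> nm [hb Qb]; split=> //; rewrite -(subnK nm) exprD -mulrA.
  by apply: QM => //; exact: srX.
 have [||_ [n ->] qmax] := @noeth_max _ hN (fun J => exists n, J = q n).
 - by exists (q 0%N), 0%N.
 - by move=> _ [n ->]; split=> // z [].
 (* Here [n] is a stage where the colon ideals of [Q] by the powers of [g i] stop growing. As [g i]
    maps [D] into [E], adding [g i ^+ n] to [Q] brings no new element of [D], so maximality
    applies. *)
 exists n; pose Q' z := exists a b, [/\ Q a, B b & z = a + b * g i ^+ n].
 have Bgn : B (g i ^+ n) by exact: srX.
 apply: (hmax Q') => [|z Qz|]; last 1 first.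
 - by exists 0, 1; split; rewrite ?add0r ?mul1r //; exact: sr1.
 - split.
  + split.
   * by exists 0, 0; split; rewrite ?mul0r ?addr0 //; exact: sr0.
   * move=> _ _ [a [b [ha hb ->]]] [a' [b' [ha' hb' ->]]]; exists (a + a'), (b + b').
    by split; [exact: QD|exact: srD | ring].
   * move=> c _ hc [a [b [ha hb ->]]]; exists (c * a), (c * b).
    by split; [exact: QM|exact: srM | ring].
  + by move=> _ [a [b [ha hb ->]]]; apply: srD => //; [exact: QB|exact: srM].
  + by move=> z Ez; exists z, 0; split; rewrite ?mul0r ?addr0 //; [exact: EQ|exact: sr0].
  + move=> z [a [b [ha hb ez]]] Dz; apply: QE => //.
   have Ez : Q (g i * z).
    apply: EQ; case: Dz => i' [c [hi' hc ->]]; exists (g i * i'), (c * g i).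
    by split; [exact: JM|apply: gM => //; exact: igen_mem | ring].
   have : q n.+1 b.
    split=> //; have -> : g i ^+ n.+1 * b = g i * z - g i * a by rewrite ez exprS; ring.
    by apply: (idealB hB Qid) => //; exact: QM.
   move/(qmax _ _ (fun b h => qle n n.+1 b (leqnSn n) h)); case; first by exists n.+1.
   by move=> _ Qb; rewrite ez; apply: QD => //; rewrite mulrC.
 - by exists z, 0; split; rewrite ?mul0r ?addr0 //; exact: sr0.
have [n hn] : exists n, forall i, Q (g i ^+ n).
 pose f i := sval (cid (pw i)); exists (\max_i f i) => i.
 rewrite -(subnK (leq_bigmax i : f i <= _)%N) exprD; apply: QM; first exact: srX.
 exact: (svalP (cid (pw i))).
have [y Jy hy] := hx (#|I| * n).+1.
have Qx : Q x.
 rewrite -(subrK y x); apply: QD; first exact: (ipow_absorb Qid hn).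
 by apply: EQ; exists y, 0; split; rewrite ?mul0r ?addr0.
have [|i [t [hi ht ex]]] := QE x Qx.
 by exists 0, 1; split; rewrite ?add0r ?mul1r //; exact: sr1.
exists t => //; have -> : (1 - t) * x = i by rewrite mulrBl mul1r {1}ex addrK.
by [].
Qed.
End Ipow.
End Noetherian.

(** * Existence of valuation rings (Chevalley) *)

Section Chevalley.
Variable F : fieldType.
Variables (T J : F -> Prop) (hT : subr T) (hJ : ideal T J) (J1 : ~ J 1).
Hypothesis JT : forall x, J x -> T x.

(** The extended ideal [J V], given as an intersection so that it makes sense for any predicate
    [V]. *)
Let jv (V : F -> Prop) z := forall K, ideal V K -> (forall x, J x -> K x) -> K z.

Let jv_ideal V : ideal V (jv V).
split.
- by move=> K [h0 _ _] _.
- by move=> x y hx hy K hK JK; have [_ hD _] := hK; apply: hD; [apply: hx|apply: hy].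
- by move=> a x ha hx K hK JK; have [_ _ hM] := hK; apply: hM => //; apply: hx.
Qed.

Let jv_mem V x : J x -> jv V x. Proof. by move=> Jx K _; apply. Qed.

Let jv_adj1 V x z : subr V -> jv (adj1 V x) z -> exists2 p, polyB (jv V) p & z = p.[x].
move=> hV hz; apply: (hz (fun z => exists2 p, polyB (jv V) p & z = p.[x])); last first.
 by move=> y Jy; exists y%:P; rewrite ?hornerC // => i; rewrite coefC; case: ifP => _; [exact: jv_mem | case: (jv_ideal V)].
have [h0 hD hM] := jv_ideal V.
split.
- by exists 0; rewrite ?horner0 // => i; rewrite coef0.
- move=> _ _ [p hp ->] [q hq ->]; exists (p + q); rewrite ?hornerD // => i.
 by rewrite coefD; apply: hD.
- move=> _ _ [a ha ->] [p hp ->]; exists (a * p); rewrite ?hornerM // => i.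
 by rewrite coefM; apply: (ideal_sum _ (jv_ideal V)) => j _; apply: hM.
Qed.

(** Descent on the total degree. The second relation expresses [1 - b], with [b] the constant term
    of [q], by negative powers of [x]; multiplying the first relation by [1 - b] and substituting
    removes the leading term of the longer polynomial [p]. *)
Let jv_elim V x p q : subr V -> (forall z, jv V z -> V z) -> ~ jv V 1 -> x != 0 ->
 polyB (jv V) p -> polyB (jv V) q -> p.[x] = 1 -> q.[x^-1] = 1 -> False.
move=> hV jvV nj; have [n] := ubnP (size p + size q).
elim: n x p q => // n ih x p q; rewrite ltnS => hn x0 hp hq px qx.
wlog le_qp : x p q hn x0 hp hq px qx / (size q <= size p)%N.
 move=> H; case: (leqP (size q) (size p)) => [|/ltnW] h; first exact: (H x p q).
 by apply: (H x^-1 q p); rewrite ?invr_eq0 ?invrK // addnC.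
have [h0 hD hM] := jv_ideal V.
have sq : (1 < size q)%N.
 rewrite ltnNge; apply/negP => /size1_polyC eq; apply: nj.
 by rewrite -qx eq hornerC; exact: hq.
have sp : size p = (size p).-1.+1 by rewrite prednK //; lia.
set N := (size p).-1 in sp; have N0 : (0 < N)%N by rewrite -ltnS -sp (leq_trans sq).
set a := p`_N; set b := q`_0.
have ja : jv V a by exact: hp.
have jb : jv V b by exact: hq.
have V1b : V (1 - b) by apply: srB => //; [exact: sr1|exact: jvV].
pose q' := \sum_(1 <= j < size q) (a * q`_j) *: 'X^(N - j).
have sq' : (size q' <= N)%N.
 rewrite /q' big_nat; elim/big_ind: _ => [|u v hu hv|j /andP[j1 _]].
 - by rewrite size_poly0.
 - by apply: leq_trans (size_polyD _ _) _; rewrite geq_max hu.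
 - apply: leq_trans (size_scale_leq _ _) _; rewrite size_polyXn.
  by move: N0; case: (N) => // N1 _; rewrite ltnS; lia.
pose p' := b%:P + (1 - b) *: (p - a *: 'X^N) + q'.
have sp' : (size p' <= N)%N.
 apply: leq_trans (size_polyD _ _) _; rewrite geq_max sq' andbT.
 apply: leq_trans (size_polyD _ _) _; rewrite geq_max; apply/andP; split.
  exact: leq_trans (size_polyC_leq1 _) N0.
 apply: leq_trans (size_scale_leq _ _) _.
 apply/leq_sizeP => j; rewrite leq_eqVlt => /orP[/eqP <-|Nj].
  by rewrite coefB coefZ coefXn eqxx mulr1 subrr.
 by rewrite coefB coefZ coefXn gtn_eqF // mulr0 subr0 nth_default // sp.
apply: (ih x p' q) => //.
- by apply: leq_trans hn; rewrite sp addSn ltnS leq_add2r.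
- move=> i; rewrite !coefD; apply: (hD); first apply: (hD).
 + by rewrite coefC; case: ifP.
 + rewrite coefZ; apply: hM => //; rewrite coefB coefZ coefXn.
  case: eqP => [->|_]; first by rewrite mulr1 subrr.
  by rewrite mulr0 subr0.
 + rewrite /q' coef_sum; apply: (ideal_sum _ (jv_ideal V)) => j _.
  rewrite coefZ mulrC; apply: (hM); first by rewrite coefXn; exact: sr_nat.
  by apply: hM => //; exact: jvV.
- rewrite /p' !hornerD hornerC hornerZ hornerD hornerN px hornerZ hornerXn.
 have -> : q'.[x] = a * x ^+ N * (1 - b).
  have -> : 1 - b = \sum_(1 <= j < size q) q`_j * x^-1 ^+ j.
   rewrite -qx horner_coef -(big_mkord xpredT (fun i => q`_i * x^-1 ^+ i)).
   by rewrite big_ltn 1?ltnW // expr0 mulr1 addrC addKr.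
  rewrite /q' horner_sum mulr_sumr !big_nat; apply: eq_bigr => j /andP[j1 jq].
  rewrite hornerZ hornerXn exprVn.
  have jN : (j <= N)%N by rewrite -ltnS -sp (leq_trans jq).
  by rewrite -{2}(subnK jN) exprD; field; rewrite expf_neq0.
 by ring.
Qed.

(** Zorn's lemma for the subrings above [T] in which [J] still generates a proper ideal. If a
    maximal one missed both [x] and its inverse, adjoining either would make [J] generate 1, which
    the degree descent excludes. *)
Lemma chevalley : exists V, [/\ vring V, forall x, T x -> V x & forall x, J x -> vm V x].
have [J0 JD JM] := hJ.
pose good (V : set F) := [/\ subr V, forall x, T x -> V x & ~ jv V 1].
pose P (V : set F) := (forall x, ~ V x) \/ good V.
have [|V [PV Vmax]] := @Zorn_bigcup F P.
 move=> C CP Ctot; have [[W [CW [w Ww]]]|hno] := pselect (exists W, C W /\ exists w, W w); last first.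
  left=> x [W CW Wx]; apply: hno; exists W; split=> //; by exists x.
 have Cgood X x : C X -> X x -> good X by move=> CX Xx; case: (CP _ CX) => // /(_ x).
 have top X Y : C X -> C Y -> good X -> good Y ->
   exists Z, [/\ C Z, good Z, (forall x, X x -> Z x) & (forall x, Y x -> Z x)].
  by move=> CX CY gX gY; case: (Ctot X Y CX CY) => h; [exists Y | exists X].
 have gW := Cgood _ _ CW Ww.
 right; split.
 - split.
  + by exists W => //; case: gW => h _ _; exact: sr1.
  + move=> x y [X CX Xx] [Y CY Yy].
   have [Z [CZ [gZ _ _] hX hY]] := top X Y CX CY (Cgood _ _ CX Xx) (Cgood _ _ CY Yy).
   by exists Z => //; apply: srB => //; [exact: hX|exact: hY].
  + move=> x y [X CX Xx] [Y CY Yy].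
   have [Z [CZ [gZ _ _] hX hY]] := top X Y CX CY (Cgood _ _ CX Xx) (Cgood _ _ CY Yy).
   by exists Z => //; apply: srM => //; [exact: hX|exact: hY].
 - by move=> x Tx; exists W => //; case: gW => _ h _; exact: h.
 - move=> /(_ (fun z => exists X, [/\ C X, good X & jv X z])); case.
  + split.
   * by exists W; split=> //; case: (jv_ideal W).
   * move=> x y [X [CX gX hx]] [Y [CY gY hy]].
    have [Z [CZ gZ hX hY]] := top X Y CX CY gX gY.
    exists Z; split=> //; case: (jv_ideal Z) => _ hD _; apply: hD.
     by move=> K [k0 kD kM] JK; apply: hx => //; split=> // a b /hX; exact: kM.
    by move=> K [k0 kD kM] JK; apply: hy => //; split=> // a b /hY; exact: kM.
   * move=> a x [X CX Xa] [Y [CY gY hy]].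
    have [Z [CZ gZ hX hY]] := top X Y CX CY (Cgood _ _ CX Xa) gY.
    exists Z; split=> //; case: (jv_ideal Z) => _ _ hM; apply: hM; first exact: hX.
    by move=> K [k0 kD kM] JK; apply: hy => //; split=> // b c /hY; exact: kM.
  + by move=> x Jx; exists W; split=> //; exact: jv_mem.
  + by move=> X [_ [_ _ h] h']; exact: h.
have gT : good T.
 by split=> // h; apply: J1; exact: h.
have gV : good V.
 case: PV => // Ve; case: (Vmax T); last by right.
 split; last by move=> TV; apply: (Ve 1); apply: TV; exact: sr1.
 by move=> x /Ve.
have [hV TV nj] := gV.
have jvV z : jv V z -> V z.
 apply; first by split; [exact: sr0|exact: srD|exact: srM].
 by move=> x Jx; apply: TV; exact: JT.
have ext x : ~ V x -> jv (adj1 V x) 1.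
 move=> nVx; apply: contrapT => h; apply: (Vmax (adj1 V x)).
  split; last by move=> sub; apply: nVx; apply: sub; exact: adj1_gen.
  by move=> y; exact: adj1_base.
 right; split=> //; first exact: adj1_subr.
 by move=> y Ty; apply: adj1_base => //; exact: TV.
exists V; split=> //.
- split=> // x; apply: contrapT => /not_orP[nx nx'].
 have x0 : x != 0 by apply/eqP => x0; apply: nx; rewrite x0; exact: sr0.
 have [p hp ep] := jv_adj1 hV (ext _ nx); have [q hq eq] := jv_adj1 hV (ext _ nx').
 by apply: (jv_elim hV jvV nj x0 hp hq).
- move=> x Jx; have [->|x0] := eqVneq x 0; first by left.
 right=> Vx; apply: nj; case: (jv_ideal V) => _ _ hM.
 by rewrite -(mulVf x0); apply: hM => //; exact: jv_mem.
Qed.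
End Chevalley.

(** * Power series in prescribed elements of a complete ring *)

Section Series.
Variable F : fieldType.
Implicit Types (A B k : F -> Prop) (x y z : F).

(** A complete separated ring filtration. It need not consist of the powers of the ideal of the
    chosen elements, so that series in some of the variables, or in new elements, can be summed
    inside [A]. *)
Definition filt B (Fl : nat -> F -> Prop) :=
 [/\ subr B, (forall x, Fl 0%N x <-> B x) /\ (forall n, ideal B (Fl n)),
   forall n x, Fl n.+1 x -> Fl n x,
   forall n m x y, Fl n x -> Fl m y -> Fl (n + m)%N (x * y) &
   (forall x, (forall n, Fl n x) -> x = 0) /\
   forall t : nat -> F, (forall n, Fl n (t n)) ->
    exists s, forall n, Fl n (s - \sum_(i < n) t i)].

(* [A] is complete and separated for the topology defined by the powers of the
  ideal generated by [y], with residue field [k]. *)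
Definition base k A (I : finType) (y : I -> F) :=
 [/\ subr A, sfield k /\ (forall c, k c -> A c), forall i, A (y i),
   forall a, A a -> exists2 c, k c & igen A y (a - c) &
   (forall x, (forall n, ipow A y n x) -> x = 0) /\
   forall t : nat -> F, (forall n, ipow A y n (t n)) ->
    exists s, forall n, ipow A y n (s - \sum_(i < n) t i)].

Lemma base_filt k A (I : finType) (y : I -> F) : base k A y -> filt A (ipow A y).
case=> hA _ Ay _ hc; split=> //.
- by split=> // n; exact: ipow_ideal.
- by move=> n x; exact: ipowS.
- by move=> n m x z; exact: ipow_mul.
Qed.

Section Pser.
Variables (k B : F -> Prop) (Fl : nat -> F -> Prop).
Hypotheses (hF : filt B Fl) (hk : sfield k) (kB : forall c, k c -> B c).
Let hB : subr B. Proof. by case: hF. Qed.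
Let Fl0 x : Fl 0%N x <-> B x. Proof. by case: hF => _ [h _]. Qed.
Let Flid n : ideal B (Fl n). Proof. by case: hF => _ [_ h]. Qed.
Let FlM n m x y : Fl n x -> Fl m y -> Fl (n + m)%N (x * y). Proof. by case: hF => _ _ _ h _; exact: h. Qed.
Let Flle n m x : (n <= m)%N -> Fl m x -> Fl n x.
case: hF => _ _ h _ _ /subnK <-.
by elim: (m - n)%N => // j ih; rewrite addSn => /h.
Qed.
Let FlD n x y : Fl n x -> Fl n y -> Fl n (x + y). Proof. by case: (Flid n) => _ h _; exact: h. Qed.
Let FlB n x y : Fl n x -> Fl n y -> Fl n (x - y). Proof. exact: (idealB hB (Flid n)). Qed.
Let Flsum n (J : Type) (r : seq J) (P : pred J) (f : J -> F) :
 (forall i, P i -> Fl n (f i)) -> Fl n (\sum_(i <- r | P i) f i).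
Proof. exact: (ideal_sum _ (Flid n)). Qed.
Let FlBase n x : Fl n x -> B x. Proof. by move=> /(Flle (leq0n n)) /Fl0. Qed.
Let sep x : (forall n, Fl n x) -> x = 0. Proof. by case: hF => _ _ _ _ [h _]; exact: h. Qed.
Let ks : subr k := proj1 hk.

Section Params.
Variables (I : finType) (y : I -> F).
Hypothesis y1 : forall i, Fl 1%N (y i).

(** The part of degree [n] is [h n]. Uniqueness of [h] is not claimed, since nothing is assumed
    about relations between the [y i]. *)
Definition pserh (h : nat -> F) x :=
 (forall n, ipow k y n (h n)) /\ forall n, Fl n (x - \sum_(i < n) h i).

Definition pser x := exists h, pserh h x.

Lemma ipowB_Fl n x : ipow B y n x -> Fl n x.
elim: n x => [|n ih] x /=; first by move/Fl0.
by move=> [b hb ->]; apply: Flsum => i _; rewrite -addn1; apply: FlM => //; apply: ih; exact: hb.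
Qed.

Lemma ipowk_Fl n x : ipow k y n x -> Fl n x.
elim: n x => [|n ih] x /=; first by move=> /kB /Fl0.
by move=> [b hb ->]; apply: Flsum => i _; rewrite -addn1; apply: FlM => //; apply: ih; exact: hb.
Qed.

Lemma pser_lift h : (forall n, ipow k y n (h n)) -> exists x, pserh h x.
move=> hh; case: hF => _ _ _ _ [_ hc]; have [|s hs] := hc h.
 by move=> n; apply: ipowk_Fl.
by exists s.
Qed.

Lemma pserB h g x z : pserh h x -> pserh g z -> pserh (fun n => h n - g n) (x - z).
move=> [hh hx] [hg hz]; split=> n; first exact: (idealB ks (ipow_ideal ks y n)).
have -> : x - z - \sum_(i < n) (h i - g i) = (x - \sum_(i < n) h i) - (z - \sum_(i < n) g i).
 by rewrite sumrB; ring.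
exact: FlB.
Qed.

Lemma pser0 : pserh (fun=> 0) 0.
split=> n; first by case: (ipow_ideal ks y n).
by rewrite big1 ?subr0 //; case: (Flid n).
Qed.

Lemma pserD h g x z : pserh h x -> pserh g z -> pserh (fun n => h n + g n) (x + z).
move=> hx hz; have := pserB hx (pserB pser0 hz).
have -> : x - (0 - z) = x + z by ring.
by congr pserh; apply/funext => n; ring.
Qed.

Lemma pser_sum (J : Type) (r : seq J) (P : pred J) (f : J -> F) (h : J -> nat -> F) :
 (forall j, P j -> pserh (h j) (f j)) ->
 pserh (fun n => \sum_(j <- r | P j) h j n) (\sum_(j <- r | P j) f j).
move=> hf; elim: r => [|j r ih].
 have -> : (fun n => \sum_(j <- [::] | P j) h j n) = (fun=> 0) by apply/funext => n; rewrite big_nil.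
 by rewrite big_nil; exact: pser0.
rewrite big_cons; case: ifP => Pj.
 have := pserD (hf j Pj) ih; congr pserh; apply/funext => n.
 by rewrite big_cons Pj.
by have := ih; congr pserh; apply/funext => n; rewrite big_cons Pj.
Qed.

Lemma pserC c : k c -> pser c.
move=> hc; exists (fun n => if n is 0%N then c else 0); split=> [[|n]|[|n]] //.
- by case: (ipow_ideal ks y n.+1).
- by rewrite big_ord0 subr0; apply/Fl0; exact: kB.
- by rewrite big_ord_recl big1 // addr0 subrr; case: (Flid n.+1).
Qed.

Lemma pserX h x i : pserh h x -> pserh (fun n => if n is n'.+1 then h n' * y i else 0) (x * y i).
move=> [hh hx]; split=> [[|n]|[|n]].
- by case: (ipow_ideal ks y 0).
- exists (fun j => if j == i then h n else 0) => [j|].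
  by case: ifP => // _; case: (ipow_ideal ks y n).
 by rewrite (bigD1 i) //= eqxx big1 ?addr0 // => j /negbTE ->; rewrite mul0r.
- rewrite big_ord0 subr0; have := FlM (hx 0%N) (y1 i); rewrite big_ord0 subr0.
 exact: Flle.
- rewrite big_ord_recl add0r; have := FlM (hx n) (y1 i); rewrite addn1.
 by congr Fl; rewrite mulrBl mulr_suml.
Qed.

Lemma pserM h g x z : pserh h x -> pserh g z ->
 pserh (fun n => \sum_(i < n.+1) h i * g (n - i)%N) (x * z).
move=> [hh hx] [hg hz]; split=> n.
 apply: (ideal_sum _ (ipow_ideal ks y n)) => i _.
 have {1}-> : n = (i + (n - i))%N by rewrite subnKC // -ltnS.
 exact: ipow_mul.
have hxB m : B (x - \sum_(i < m) h i) by apply: FlBase; exact: hx.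
have hB' : B (\sum_(i < n) h i).
 apply: sr_sum => // i _; apply: (@FlBase i); exact: ipowk_Fl.
have zB : B z by have := hz 0%N; rewrite big_ord0 subr0 => /Fl0.
have -> : x * z - \sum_(i < n) \sum_(j < i.+1) h j * g (i - j)%N
 = (x - \sum_(i < n) h i) * z + \sum_(i < n) h i * (z - \sum_(j < n - i) g j).
 have -> : \sum_(i < n) h i * (z - \sum_(j < n - i) g j)
  = (\sum_(i < n) h i) * z - \sum_(i < n) \sum_(j < n - i) h i * g j.
  rewrite mulr_suml -sumrB; apply: eq_bigr => i _.
  by rewrite mulrBr mulr_sumr.
 suff -> : \sum_(i < n) \sum_(j < i.+1) h j * g (i - j)%N
  = \sum_(i < n) \sum_(j < n - i) h i * g j by ring.
 clear; elim: n => [|n ih]; first by rewrite !big_ord0.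
 rewrite big_ord_recr ih /= [RHS]big_ord_recr /= subSnn big_ord1.
 rewrite [X in _ + X = _]big_ord_recr /= subnn addrA; congr (_ + _).
 rewrite -big_split; apply: eq_bigr => i _ /=.
 by rewrite subSn ?big_ord_recr //= ltnW.
apply: FlD.
 by have := FlM (hx n) (proj2 (Fl0 z) zB); rewrite addn0.
apply: Flsum => i _; rewrite -{1}(subnKC (ltnW (ltn_ord i))); apply: FlM => //.
exact: ipowk_Fl.
Qed.

Lemma pser_subr : subr pser.
split.
- by apply: pserC; exact: sr1.
- by move=> x z [h hx] [g hz]; eexists; exact: pserB hx hz.
- by move=> x z [h hx] [g hz]; eexists; exact: pserM hx hz.
Qed.

Lemma pserB_sub x : pser x -> B x.
Proof. by move=> [h [_ /(_ 0%N)]]; rewrite big_ord0 subr0 => /Fl0. Qed.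

Lemma pser_gen i : pser (y i).
have [h1 h11] := pserC (sr1 ks); rewrite -[y i]mul1r.
by eexists; exact: pserX h11.
Qed.

Lemma pserh_uniq h x z : pserh h x -> pserh h z -> x = z.
move=> [_ hx] [_ hz]; apply/eqP; rewrite -subr_eq0; apply/eqP; apply: sep => n.
have -> : x - z = (x - \sum_(i < n) h i) - (z - \sum_(i < n) h i) by ring.
exact: FlB.
Qed.

(** Each part of positive degree is split along the [y i] and the pieces are summed again. The
    record of vanishing parts is what turns an order of vanishing into membership in a power of the
    ideal. *)
Lemma pser_dec h x : pserh h x -> exists b : I -> F, exists hb : I -> nat -> F,
 [/\ forall i, pserh (hb i) (b i), x = h 0%N + \sum_i b i * y i &
   forall n, h n.+1 = 0 -> forall i, hb i n = 0].
move=> hx; have [hh _] := hx.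
have step n : {b : I -> F | [/\ forall i, ipow k y n (b i), h n.+1 = \sum_i b i * y i &
  h n.+1 = 0 -> forall i, b i = 0]}.
 apply: cid; have [h0|h0] := pselect (h n.+1 = 0).
  exists (fun=> 0); split=> // [i|]; first by case: (ipow_ideal ks y n).
  by rewrite h0 big1 // => i _; rewrite mul0r.
 by have [b hb e] := hh n.+1; exists b; split.
pose hb i n := sval (step n) i.
have lift i : {b | pserh (hb i) b}.
 by apply: cid; apply: pser_lift => n; case: (svalP (step n)) => b1 _ _; exact: b1.
exists (fun i => sval (lift i)), hb; split=> [i||n h0 i].
- exact: (svalP (lift i)).
- apply: (pserh_uniq hx).
 have hc : k (h 0%N) by exact: (hh 0%N).
 have [g [hg hgx]] : exists g, pserh g (h 0%N) /\ forall n, g n = if n is 0%N then h 0%N else 0.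
  exists (fun n => if n is 0%N then h 0%N else 0); split=> //.
  split=> [[|n]|[|n]] //.
  + by case: (ipow_ideal ks y n.+1).
  + by rewrite big_ord0 subr0; apply/Fl0; exact: kB.
  + by rewrite big_ord_recl big1 // addr0 subrr; case: (Flid n.+1).
 have := pserD hg (@pser_sum I (index_enum I) xpredT _ _ (fun i _ => pserX i (svalP (lift i)))).
 congr pserh; apply/funext => -[|n]; rewrite hgx.
  by rewrite big1 ?addr0.
 by rewrite add0r /hb; have [_ e _] := svalP (step n); rewrite [RHS]e.
- by case: (svalP (step n)) => _ _ b1; exact: b1.
Qed.

Lemma pser_ipow n h x : pserh h x -> (forall i, (i < n)%N -> h i = 0) -> ipow pser y n x.
elim: n h x => [|n ih] h x hx h0; first by exists h.
have [b [hb [hbb -> hz]]] := pser_dec hx; rewrite h0 // add0r.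
exists b => // i; apply: (ih _ _ (hbb i)) => j jn.
by apply: hz; rewrite h0.
Qed.

Lemma ipow_pser n x : ipow pser y n x -> exists2 h, pserh h x & forall i, (i < n)%N -> h i = 0.
elim: n x => [|n ih] x /=; first by move=> [h hx]; exists h.
move=> [b hb ->].
have hb' i : {h | pserh h (b i) /\ forall j, (j < n)%N -> h j = 0}.
 by apply: cid; have [h h1 h2] := ih _ (hb i); exists h.
exists (fun m => \sum_i (if m is m'.+1 then sval (hb' i) m' * y i else 0)).
 apply: (@pser_sum I (index_enum I) xpredT (fun i => b i * y i)
      (fun i m => if m is m'.+1 then sval (hb' i) m' * y i else 0)) => i _.
 by apply: pserX; case: (svalP (hb' i)).
move=> [|m] hm; rewrite big1 // => i _.
by case: (svalP (hb' i)) => _ ->; rewrite ?mul0r.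
Qed.

(** The point is completeness for the powers of the ideal [(y)] of the series ring itself, which are
    finer than the ambient filtration. *)
Lemma pser_base : base k pser y.
split.
- exact: pser_subr.
- by split=> // c; exact: pserC.
- exact: pser_gen.
- move=> a [h ha]; have [b [hb [hbb -> _]]] := pser_dec ha.
 exists (h 0%N); first by case: ha => hh _; exact: (hh 0%N).
 by exists b => [i|]; [exists (hb i)|rewrite addrC addKr].
split.
 move=> x hx; apply: sep => n; apply: ipowB_Fl.
 elim: n x {hx} (hx n) => [|n ih] x /=; first exact: pserB_sub.
 by move=> [b hb ->]; exists b => // i; apply: ih; exact: hb.
move=> t ht.
have hh n : {h | pserh h (t n) /\ forall i, (i < n)%N -> h i = 0}.
 by apply: cid; have [h h1 h2] := ipow_pser (ht n); exists h.
(* The term [t n] is represented by parts that vanish below degree [n], so only the terms up to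
   index [m] contribute to degree [m]. *)
pose H m := \sum_(n < m.+1) sval (hh n) m.
have [s hs] : exists s, pserh H s.
 apply: pser_lift => m; apply: (ideal_sum _ (ipow_ideal ks y m)) => n _.
 have [[h1 _] _] := svalP (hh n); exact: h1.
exists s => n.
have hsum : pserh (fun m => \sum_(i < n) sval (hh i) m) (\sum_(i < n) t i).
 by apply: pser_sum => i _; case: (svalP (hh i)).
apply: (pser_ipow (pserB hs hsum)) => m mn.
rewrite /H -(big_mkord xpredT (fun i => sval (hh i) m)) -(big_mkord xpredT (fun i => sval (hh i) m)).
rewrite [X in _ - X](@big_cat_nat _ _ _ m.+1) //=.
have -> : \sum_(m.+1 <= i < n) sval (hh i) m = 0; last by rewrite addr0 subrr.
by rewrite big_nat big1 // => i /andP[mi _]; case: (svalP (hh i)) => _ ->.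
Qed.

(** Successive approximation: each step gains one factor in [(y)], and the coefficients found at
    step [n] are forms of degree [n], so they sum to power series. Finiteness of [B] over the series
    ring is thus obtained rather than assumed. *)
Lemma complete_nakayama (J : finType) (e : J -> F) : (forall j, B (e j)) ->
 (forall b, B b -> exists2 c : J -> F, forall j, k (c j) & igen B y (b - \sum_j c j * e j)) ->
 forall b, B b -> exists2 a : J -> F, forall j, pser (a j) & b = \sum_j a j * e j.
move=> Be he.
have step n b : ipow B y n b -> exists2 h : J -> F, forall j, ipow k y n (h j) &
  ipow B y n.+1 (b - \sum_j h j * e j).
 elim: n b => [|n ih] b /=; first exact: he.
 move=> [c hc ->].
 have hh i : {h : J -> F | (forall j, ipow k y n (h j)) /\ ipow B y n.+1 (c i - \sum_j h j * e j)}.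
  by apply: cid; have [h h1 h2] := ih _ (hc i); exists h.
 exists (fun j => \sum_i sval (hh i) j * y i) => [j|].
  by exists (fun i => sval (hh i) j) => // i; case: (svalP (hh i)) => h1 _; exact: h1.
 exists (fun i => c i - \sum_j sval (hh i) j * e j) => [i|]; first by case: (svalP (hh i)).
 under [in RHS]eq_bigr do rewrite mulrBl.
 rewrite sumrB; congr (_ - _); under eq_bigr do rewrite mulr_suml.
 rewrite exchange_big; apply: eq_bigr => i _; rewrite mulr_suml; apply: eq_bigr => j _.
 by rewrite mulrAC.
have step' n b : {h : J -> F | ipow B y n b -> (forall j, ipow k y n (h j)) /\
  ipow B y n.+1 (b - \sum_j h j * e j)}.
 apply: cid; have [hb|hb] := pselect (ipow B y n b); last by exists (fun=> 0).
 by have [h h1 h2] := step n b hb; exists h.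
move=> b Bb.
pose rem := fix rem n := if n is n'.+1 then rem n' - \sum_j sval (step' n' (rem n')) j * e j else b.
have hrem n : ipow B y n (rem n).
 by elim: n => // n ih; case: (svalP (step' n (rem n)) ih).
pose h j n := sval (step' n (rem n)) j.
have hh j n : ipow k y n (h j n) by case: (svalP (step' n (rem n)) (hrem n)) => h1 _; exact: h1.
have lift j : {a | pserh (h j) a} by apply: cid; apply: pser_lift.
exists (fun j => sval (lift j)) => [j|]; first by exists (h j); exact: (svalP (lift j)).
apply/eqP; rewrite -subr_eq0; apply/eqP; apply: sep => n.
have er : rem n = b - \sum_j (\sum_(i < n) h j i) * e j.
 elim: n => [|n ih]; first by rewrite big1 ?subr0 // => j _; rewrite big_ord0 mul0r.
 have -> : rem n.+1 = rem n - \sum_j h j n * e j by [].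
 rewrite {1}ih -addrA; congr (_ + _); rewrite -opprD -big_split; congr (- _).
 by apply: eq_bigr => j _; rewrite big_ord_recr mulrDl.
have -> : b - \sum_j sval (lift j) * e j
 = rem n - \sum_j (sval (lift j) - \sum_(i < n) h j i) * e j.
 under [X in _ = _ - X]eq_bigr do rewrite mulrBl.
 by rewrite sumrB er; ring.
apply: FlB; first exact: ipowB_Fl.
apply: Flsum => j _; have [_ /(_ n) hl] := svalP (lift j).
by have := FlM hl (proj2 (Fl0 _) (Be j)); rewrite addn0.
Qed.
End Params.

Definition fcons (T : Type) r (g : T) (y : 'I_r -> T) (i : 'I_r.+1) : T :=
 if unlift ord0 i is Some j then y j else g.

Lemma fcons0 (T : Type) r (g : T) (y : 'I_r -> T) : fcons g y ord0 = g.
Proof. by rewrite /fcons unlift_none. Qed.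
Lemma fconsS (T : Type) r (g : T) (y : 'I_r -> T) i : fcons g y (lift ord0 i) = y i.
Proof. by rewrite /fcons liftK. Qed.

Lemma fcons_case (T : Type) r (g : T) (y : 'I_r -> T) (P : T -> Prop) :
 P g -> (forall i, P (y i)) -> forall i, P (fcons g y i).
Proof. by move=> hg hy i; rewrite /fcons; case: unlift. Qed.

Lemma igen_fcons (S : F -> Prop) r g (y : 'I_r -> F) x :
 igen S (fcons g y) x <-> exists a z, [/\ S a, igen S y z & x = a * g + z].
split=> [[b hb ->]|[a [_ [ha [b hb ->] ->]]]].
 exists (b ord0), (\sum_i b (lift ord0 i) * y i); split=> //.
  by exists (fun i => b (lift ord0 i)).
 by rewrite big_ord_recl fcons0; congr (_ + _); apply: eq_bigr => i _; rewrite fconsS.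
exists (fcons a b); first exact: fcons_case.
rewrite big_ord_recl !fcons0; congr (_ + _); apply: eq_bigr => i _.
by rewrite !fconsS.
Qed.

Lemma pser_split r (g : F) (y : 'I_r -> F) : Fl 1%N g -> (forall i, Fl 1%N (y i)) ->
 forall x, pser (fcons g y) x ->
 exists a b, [/\ pser y a, pser (fcons g y) b & x = a + g * b].
move=> g1 y1 x [h [hh hx]].
have z1 : forall i, Fl 1%N (fcons g y i) by exact: fcons_case.
have split n u : ipow k (fcons g y) n.+1 u ->
  exists a b, [/\ ipow k y n.+1 a, ipow k (fcons g y) n b & u = a + g * b].
 elim: n u => [|n ih] u /igen_fcons [c [z [hc hz ->]]].
  by exists z, c; split=> //; ring.
 case: hz => d hd ez.
 have dec i : {ab : F * F | [/\ ipow k y n.+1 ab.1, ipow k (fcons g y) n ab.2 & d i = ab.1 + g * ab.2]}.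
  by apply: cid; have [a [b [ha hb e]]] := ih _ (hd i); exists (a, b).
 exists (\sum_i (sval (dec i)).1 * y i), (c + \sum_i (sval (dec i)).2 * y i); split.
 - by exists (fun i => (sval (dec i)).1) => // i; case: (svalP (dec i)).
 - case: (ipow_ideal ks (fcons g y) n.+1) => _ hD _; apply: hD => //.
  apply/igen_fcons; exists 0, (\sum_i (sval (dec i)).2 * y i); split.
  + by case: (ipow_ideal ks (fcons g y) n).
  + by exists (fun i => (sval (dec i)).2) => // i; case: (svalP (dec i)).
  + by rewrite mul0r add0r.
 - rewrite ez mulrDr addrCA mulrC; congr (_ + _); rewrite mulr_sumr -big_split.
  by apply: eq_bigr => i _; case: (svalP (dec i)) => _ _ {1}->; rewrite mulrDl mulrA.
have dec n : {ab : F * F | [/\ ipow k y n.+1 ab.1, ipow k (fcons g y) n ab.2 & h n.+1 = ab.1 + g * ab.2]}.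
 by apply: cid; have [a [b [ha hb e]]] := split _ _ (hh n.+1); exists (a, b).
pose ha n := if n is n'.+1 then (sval (dec n')).1 else h 0%N.
pose hb n := (sval (dec n)).2.
have [|a aP] := pser_lift y1 (h := ha).
 by move=> [|n]; [exact: (hh 0%N) | case: (svalP (dec n))].
have [|b bP] := pser_lift z1 (h := hb); first by move=> n; case: (svalP (dec n)).
exists a, b; split; [by exists ha|by exists hb|].
apply/eqP; rewrite -subr_eq0; apply/eqP; apply: sep => n.
apply: (Flle (leqnSn n)).
have -> : x - (a + g * b) = (x - \sum_(i < n.+1) h i) - (a - \sum_(i < n.+1) ha i)
  - g * (b - \sum_(i < n) hb i).
 suff -> : \sum_(i < n.+1) h i = \sum_(i < n.+1) ha i + g * \sum_(i < n) hb i by ring.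
 rewrite big_ord_recl [in RHS]big_ord_recl /= -addrA; congr (_ + _).
 rewrite mulr_sumr -big_split; apply: eq_bigr => i _ /=.
 by rewrite /bump leq0n add1n; have [_ _ e] := svalP (dec i); rewrite [LHS]e.
apply: FlB; first by apply: FlB => //; case: aP.
by rewrite -add1n; apply: FlM => //; case: bP.
Qed.
End Pser.
End Series.

(** * Power series rings: changes of coordinates, noetherianity, F-finiteness *)

Section Coordinates.
Variable F : fieldType.
Implicit Types (A B k : F -> Prop) (x z : F).

Definition mev r (y : 'I_r -> F) (m : 'X_{1..r}) := \prod_i y i ^+ m i.

Lemma mevD r (y : 'I_r -> F) m m' : mev y (m + m')%MM = mev y m * mev y m'.
Proof. by rewrite /mev -big_split; apply: eq_bigr => i _; rewrite mnmDE exprD. Qed.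

Lemma mevU r (y : 'I_r -> F) i : mev y U_(i)%MM = y i.
rewrite /mev (bigD1 i) //= mnm1E eqxx expr1 big1 ?mulr1 // => j ji.
by rewrite mnm1E eq_sym (negbTE ji).
Qed.

Lemma mev0 r (y : 'I_r -> F) : mev y 0%MM = 1.
Proof. by rewrite /mev big1 // => i _; rewrite mnm0E. Qed.

Lemma mev_sr B r (y : 'I_r -> F) m : subr B -> (forall i, B (y i)) -> B (mev y m).
Proof. by move=> hB By; apply: sr_prod => // i _; exact: srX. Qed.

Definition mform k r n (P : {mpoly F[r]}) :=
 forall m, k P@_m /\ (P@_m != 0 -> mdeg m = n).

Lemma ipow_mform k r (y : 'I_r -> F) n x : subr k -> ipow k y n x ->
 exists2 P, mform k n P & x = P.@[y].
move=> hk hx.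
suff [s hs ->] : exists2 s : seq ('X_{1..r} * F),
  forall mc, mc \in s -> k mc.2 /\ mdeg mc.1 = n & x = \sum_(mc <- s) mc.2 * mev y mc.1.
 exists (\sum_(mc <- s) mc.2 *: 'X_[mc.1]) => [m|]; last first.
  by rewrite raddf_sum /=; apply: eq_bigr => mc _; rewrite mevalZ mevalX.
 rewrite raddf_sum /=; split.
  rewrite big_seq; apply: sr_sum => // mc /hs[h _]; rewrite mcoeffZ mcoeffX.
  by apply: srM => //; exact: sr_nat.
 move=> h; have [mc mcs em] : exists2 mc, mc \in s & mc.1 = m.
  apply: contrapT => hno; move/eqP: h; apply; rewrite big_seq big1 // => mc mcs.
  rewrite mcoeffZ mcoeffX; case: eqP => [e|]; last by rewrite mulr0.
  by case: hno; exists mc.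
 by case: (hs _ mcs) => _ <-; rewrite em.
elim: n x hx => [|n ih] x /=.
 move=> hx; exists [:: (0%MM, x)] => [mc|]; first by rewrite inE => /eqP -> /=; rewrite mdeg0.
 by rewrite big_seq1 mev0 mulr1.
move=> [b hb ->].
have step i : {s : seq ('X_{1..r} * F) | (forall mc, mc \in s -> k mc.2 /\ mdeg mc.1 = n) /\
  b i = \sum_(mc <- s) mc.2 * mev y mc.1}.
 by apply: cid; have [s h1 h2] := ih _ (hb i); exists s.
exists (flatten [seq [seq ((mc.1 + U_(i))%MM, mc.2) | mc <- sval (step i)] | i <- enum 'I_r]).
 move=> _ /flatten_mapP[i _ /mapP[mc hmc ->]] /=.
 by case: (svalP (step i)) => h _; have [h1 h2] := h _ hmc; rewrite mdegD mdeg1 h2 addn1.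
rewrite big_flatten big_map big_enum /=; apply: eq_bigr => i _.
have [_ e] := svalP (step i); rewrite [in LHS]e mulr_suml big_map; apply: eq_bigr => mc _ /=.
by rewrite mevD mevU mulrA.
Qed.

(** Algebraic closedness of a subfield, in the shape of [GRing.closed_field_axiom]. *)
Definition kclosed k := forall n (P : nat -> F), (0 < n)%N -> (forall i, k (P i)) ->
 exists2 x, k x & x ^+ n = \sum_(i < n) P i * x ^+ i.

Section Field.
Variables (k : F -> Prop) (hk : sfield k) (kc : kclosed k).
Let ks : subr k := proj1 hk.

Lemma kroot p : polyB k p -> (1 < size p)%N -> exists2 c, k c & p.[c] = 0.
move=> hp sp; set n := (size p).-1; have sn : size p = n.+1 by rewrite prednK // ltnW.
have l0 : p`_n != 0 by rewrite -[n]/(size p).-1 -lead_coefE lead_coef_eq0 -size_poly_gt0 ltnW.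
have [||c hc ec] := kc (n := n) (P := fun i => - (p`_i / p`_n)).
- by rewrite -ltnS -sn.
- by move=> i; apply: srN => //; apply: sf_div.
exists c => //; rewrite horner_coef sn big_ord_recr /= ec mulr_sumr -big_split big1 //= => i _.
by field.
Qed.

Lemma kinfinite n : exists s : seq F, [/\ uniq s, size s = n & forall x, x \in s -> k x].
elim: n => [|n [s [us ss sk]]]; first by exists [::].
suff [c hc cs] : exists2 c, k c & c \notin s.
 exists (c :: s); split; rewrite /= ?cs ?ss // => x; rewrite inE => /orP[/eqP ->//|]; exact: sk.
case: (posnP n) => [n0|n0].
 by exists 0; [exact: sr0|move: ss; rewrite n0; case: (s)].
pose q : {poly F} := \prod_(x <- s) ('X - x%:P) + 1.
have sq : size q = n.+1.
 rewrite /q size_polyDl ?size_prod_XsubC ?ss // size_poly1; lia.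
have [||c hc /eqP] := @kroot q.
- apply: polyBD => //; last by apply: polyBC => //; exact: sr1.
 rewrite big_seq; apply: polyB_prod => // x /sk hx.
 by apply: polyBB => //; [exact: polyBX|exact: polyBC].
- by rewrite sq ltnS.
rewrite hornerD hornerC => h; exists c => //; apply/negP => cs; move: h.
by rewrite (_ : _.[c] = 0) ?add0r ?oner_eq0 //; apply/rootP; rewrite root_prod_XsubC.
Qed.

Lemma poly_nonroot (p : {poly F}) : p != 0 -> exists2 t, k t & p.[t] != 0.
move=> p0; have [s [us ss sk]] := kinfinite (size p).
apply: contrapT => hno.
have : all (root p) s.
 apply/allP => x /sk kx; apply/negPn/negP => h; apply: hno; exists x => //.
by move/(max_poly_roots p0)/(_ us); rewrite ss ltnn.
Qed.

Lemma digits_inj r N (f g : 'I_r -> nat) : (forall i, f i < N)%N -> (forall i, g i < N)%N ->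
 (\sum_i f i * N ^ i = \sum_i g i * N ^ i)%N -> f =1 g.
elim: r f g => [|r ih] f g hf hg; first by move=> _ [].
rewrite !big_ord_recl /= !expn0 !muln1.
have H (h : 'I_r.+1 -> nat) : (\sum_(i < r) h (lift ord0 i) * N ^ bump 0 i
  = (\sum_(i < r) h (lift ord0 i) * N ^ i) * N)%N.
 by rewrite big_distrl; apply: eq_bigr => i _ /=; rewrite /bump leq0n add1n expnSr mulnA.
rewrite !H => e.
have e0 : f ord0 = g ord0.
 by have := congr1 (modn^~ N) e; rewrite /= !(addnC (_ ord0)) !modnMDl !modn_small.
have N0 : (0 < N)%N by apply: leq_ltn_trans (hf ord0).
have e1 : (\sum_(i < r) f (lift ord0 i) * N ^ i = \sum_(i < r) g (lift ord0 i) * N ^ i)%N.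
 by move: e; rewrite e0 => /addnI /eqP; rewrite eqn_pmul2r // => /eqP.
move=> i; case: (unliftP ord0 i) => [j ->|-> //].
exact: (ih (fun j => f (lift ord0 j)) (fun j => g (lift ord0 j))).
Qed.

(** Kronecker substitution: with [N] above all exponents, sending the variable of index [i] to
    [t ^+ (N ^ i)] keeps distinct monomials distinct, so a nonroot in one variable suffices. *)
Lemma mpoly_nonroot r (P : {mpoly F[r]}) : P != 0 ->
 exists2 l : 'I_r -> F, forall i, k (l i) & P.@[l] != 0.
move=> P0; set N := msize P.
pose e (m : 'X_{1..r}) := (\sum_(i < r) m i * N ^ i)%N.
have hN m i : m \in msupp P -> (m i < N)%N.
 move=> /msize_mdeg_lt; apply: leq_ltn_trans; rewrite mdegE (bigD1 i) //=; exact: leq_addr.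
pose p : {poly F} := \sum_(m <- msupp P) P@_m *: 'X^(e m).
have p0 : p != 0.
 have mP := mlead_supp P0; apply/eqP => /(congr1 (fun q : {poly F} => q`_(e (mlead P)))).
 rewrite coef0 coef_sum (bigD1_seq (mlead P)) //= coefZ coefXn eqxx mulr1 big_seq_cond big1.
  by rewrite addr0 => /eqP; rewrite mcoeff_eq0 mP.
 move=> m /andP[hm ne]; rewrite coefZ coefXn; case: eqP => [ee|]; last by rewrite mulr0.
 move/eqP: ne; case; apply/mnmP => i; apply/esym; move: i.
 apply: (@digits_inj r N (mlead P) m) => // [i|i]; exact: hN.
have [t kt ht] := poly_nonroot p0.
exists (fun i : 'I_r => t ^+ (N ^ i)) => [i|]; first exact: srX.
suff -> : P.@[fun i : 'I_r => t ^+ (N ^ i)] = p.[t] by [].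
rewrite mevalE horner_sum; apply: eq_bigr => m _; rewrite hornerZ hornerXn; congr (_ * _).
rewrite /e (@big_morph _ _ (fun n => t ^+ n) 1 *%R 0%N addn) ?expr0 //; last exact: exprD.
by apply: eq_bigr => i _; rewrite -exprM mulnC.
Qed.

Section Base.
Variables (A : F -> Prop) (I : finType) (y : I -> F).
Hypothesis hb : base k A y.
Let hA : subr A. Proof. by case: hb. Qed.
Let kA c : k c -> A c. Proof. by case: hb => _ [_ h] _ _ _; exact: h. Qed.
Let Ay i : A (y i). Proof. by case: hb. Qed.
Let sep x : (forall n, ipow A y n x) -> x = 0. Proof. by case: hb => _ _ _ _ [h _]; exact: h. Qed.

Lemma base_dec a : A a -> exists2 c, k c & igen A y (a - c). Proof. by case: hb => _ _ _ h _; exact: h. Qed.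

(** The geometric series in [- (t / c)], summed by completeness. *)
Lemma base_unit c t : k c -> c != 0 -> igen A y t -> exists2 v, A v & v * (c + t) = 1.
move=> hc c0 ht; set w := - (t / c).
have hw : igen A y w.
 rewrite /w mulrC; apply: igenN => //; apply: igenM => //; apply: kA; exact: sfV.
have [s hs] : exists s, forall n, ipow A y n (s - \sum_(i < n) w ^+ i).
 case: hb => _ _ _ _ [_ h]; apply: h => n; exact: ipow_expr.
have As : A s by have := hs 0%N; rewrite big_ord0 subr0.
have e : s * (1 - w) = 1.
 apply/eqP; rewrite -subr_eq0; apply/eqP; apply: sep => n.
 have -> : s * (1 - w) - 1 = (1 - w) * (s - \sum_(i < n) w ^+ i) - w ^+ n.
  have := subrXX 1 w n; rewrite expr1n.
  under eq_bigr do rewrite expr1n mul1r.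
  by move=> h; rewrite [(1 - w) * (s - _)]mulrBr -h; ring.
 apply: (idealB hA (ipow_ideal hA y n)); last exact: ipow_expr.
 case: (ipow_ideal hA y n) => _ _ hM; apply: hM => //; apply: srB => //; first exact: sr1.
 have [b hbb ->] := hw; apply: sr_sum => // i _; apply: srM => //.
exists (s / c); first by apply: srM => //; apply: kA; exact: sfV.
by rewrite -e /w; field.
Qed.

Lemma base_lead n x : ipow A y n x -> exists2 h, ipow k y n h & ipow A y n.+1 (x - h).
elim: n x => [|n ih] x; first exact: base_dec.
move=> [b hbb ->].
have step i : {h | ipow k y n h /\ ipow A y n.+1 (b i - h)}.
 by apply: cid; have [h h1 h2] := ih _ (hbb i); exists h.
exists (\sum_i sval (step i) * y i).
 by exists (fun i => sval (step i)) => // i; case: (svalP (step i)).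
exists (fun i => b i - sval (step i)) => [i|]; first by case: (svalP (step i)).
by rewrite -sumrB; apply: eq_bigr => i _; rewrite mulrBl.
Qed.
End Base.

(* After a generic linear change of coordinates, [f] is regular in [y'']. *)
Lemma base_coord A r (y : 'I_r.+1 -> F) f : base k A y -> A f -> f != 0 ->
 exists (y' : 'I_r -> F) (y'' : F) (d : nat) (v : F),
 [/\ (forall i, igen k y (fcons y'' y' i)), (forall i, igen k (fcons y'' y') (y i)),
   A v & igen A y' (y'' ^+ d - v * f)].
move=> hb Af f0; have [hA [_ kA] Ay _ [sep _]] := hb.
have [d [hd nd]] : exists d, ipow A y d f /\ ~ ipow A y d.+1 f.
 apply: contrapT => hno; move/eqP: f0; apply; apply: sep; elim=> [//|n ih].
 by apply: contrapT => h; apply: hno; exists n.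
have [h hh hfh] := base_lead hb hd.
have [P hP eP] := ipow_mform ks hh.
have P0 : P != 0.
 by apply/eqP => P0; apply: nd; move: hfh; rewrite eP P0 meval0 subr0.
(* The leading form is multiplied by the variable of index 0, so that the nonroot also has a nonzero
   coordinate there; dividing by it makes the linear change invertible. *)
have X0 : ('X_ord0 : {mpoly F[r.+1]}) != 0.
 by apply/eqP => /(congr1 (meval (fun=> 1))); rewrite mevalXU meval0 => /eqP; rewrite oner_eq0.
have [l kl] := mpoly_nonroot (mulf_neq0 P0 X0).
rewrite mevalM mevalXU mulf_eq0 negb_or => /andP[Pl l0].
pose y'' := y ord0 / l ord0; pose y' i := y (lift ord0 i) - l (lift ord0 i) * y''.
have kl0 : k (l ord0)^-1 by exact: sfV.
have g0 : igen k y y'' by rewrite /y'' mulrC; apply: igenM => //; exact: igen_mem.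
have gi i : igen k y (y' i).
 by apply: igenB => //; [exact: igen_mem|apply: igenM].
have igA (I : finType) (z : I -> F) x : igen k z x -> igen A z x.
 by case=> b hbk ->; exists b => // i; exact: kA.
have AI x : igen k y x -> A x.
 by case=> b hbk ->; apply: sr_sum => // i _; apply: srM => //; exact: kA.
have hz i : igen k y' (y i - l i * y'').
 case: (unliftP ord0 i) => [j ->|->].
  have -> : y (lift ord0 j) - l (lift ord0 j) * y'' = y' j by [].
  exact: igen_mem.
 by rewrite /y'' mulrC divfK // subrr; exact: igen0.
have A'' : A y'' by exact: AI.
have A' i : A (y' i) by exact: AI.
have cM a b a' b' : A a -> A b' -> igen A y' (a - a') -> igen A y' (b - b') -> igen A y' (a * b - a' * b').
 move=> ha hb' h1 h2; have -> : a * b - a' * b' = a * (b - b') + b' * (a - a') by ring.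
 by apply: igenD => //; apply: igenM.
have cev m : igen A y' (mev y m - mev (fun i => l i * y'') m).
 rewrite /mev; elim: (index_enum _) => [|i s ih].
  by rewrite !big_nil subrr; exact: igen0.
 rewrite !big_cons; apply: (cM) => //; first exact: srX.
  by apply: sr_prod => // j _; apply: srX => //; apply: srM => //; exact: kA.
 elim: (m i) => [|n ih']; first by rewrite !expr0 subrr; exact: igen0.
 rewrite !exprS; apply: cM => //; last by apply: igA.
 by apply: srX => //; apply: srM => //; exact: kA.
have eval_homog : P.@[fun i => l i * y''] = P.@[l] * y'' ^+ d.
 rewrite !mevalE mulr_suml; apply: eq_big_seq => m; rewrite mcoeff_msupp => hm.
 have [_ /(_ hm) <-] := hP m; rewrite mdegE -mulrA; congr (_ * _).
 rewrite -prodrXr -big_split; apply: eq_bigr => i _; rewrite exprMn //.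
have ch : igen A y' (h - P.@[l] * y'' ^+ d).
 rewrite eP -eval_homog !mevalE -sumrB; apply: igen_sum => // m _; rewrite -mulrBr.
 by apply: igenM => //; [apply: kA; case: (hP m)|exact: cev].
have cp n x : ipow A y n x -> exists2 a, A a & igen A y' (x - a * y'' ^+ n).
 elim: n x => [|n ih] x /=; first by exists x; rewrite ?expr0 ?mulr1 ?subrr //; exact: igen0.
 move=> [b hbb ->].
 have step i : {a | A a /\ igen A y' (b i - a * y'' ^+ n)}.
  by apply: cid; have [a h1 h2] := ih _ (hbb i); exists a.
 exists (\sum_i sval (step i) * l i).
  by apply: sr_sum => // i _; apply: srM; [|case: (svalP (step i))|exact: kA].
 rewrite mulr_suml -sumrB; apply: igen_sum => // i _.
 have [h1 h2] := svalP (step i).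
 have -> : sval (step i) * l i * y'' ^+ n.+1 = (sval (step i) * y'' ^+ n) * (l i * y'').
  by rewrite exprSr; ring.
 apply: (cM _ _ _ _ _ _ h2 (igA _ _ _ (hz i))); last by apply: srM => //; exact: kA.
 exact: ipow_base (hbb i).
have [a Aa ha] := cp _ _ hfh.
have kP : k P.@[l].
 rewrite mevalE; apply: sr_sum => // m _; apply: srM => //; first by case: (hP m).
 by apply: sr_prod => // i _; exact: srX.
have [v Av ev] := base_unit hb kP Pl (igenM hA Aa (igA _ _ _ g0)).
exists y', y'', d, v; split=> //.
- by move=> i; apply: fcons_case.
- move=> i; apply/igen_fcons; exists (l i), (y i - l i * y''); split=> //; ring.
- have -> : y'' ^+ d - v * f = - (v * (h - P.@[l] * y'' ^+ d) + v * (f - h - a * y'' ^+ d.+1)).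
  transitivity (v * (P.@[l] + a * y'') * y'' ^+ d - v * f); first by rewrite ev mul1r.
  by rewrite exprSr; ring.
 by apply: igenN => //; apply: igenD => //; apply: igenM.
Qed.

(** Weierstrass preparation in module form: modulo [f] and [y'] the power [y'' ^+ d] vanishes, so
    the lower powers of [y''] span over [k], and the complete Nakayama lemma lifts this to series in
    [f] and [y']. *)
Lemma coord_finite A r (y : 'I_r.+1 -> F) (y' : 'I_r -> F) y'' d v f :
 base k A y -> (forall i, igen k y (fcons y'' y' i)) ->
 (forall i, igen k (fcons y'' y') (y i)) -> A v -> igen A y' (y'' ^+ d - v * f) ->
 igen A y f ->
 forall a, A a -> exists2 c : 'I_d -> F,
  forall j, pser k (ipow A y) (fcons f y') (c j) & a = \sum_j c j * y'' ^+ j.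
move=> hb g1 g2 Av hd f1; have [hA [_ kA] Ay _ [sep _]] := hb.
have Az i : igen A y (fcons y'' y' i).
 by case: (g1 i) => b hbk ->; exists b => // j; exact: kA.
have AI x : igen A y x -> A x.
 by case=> b hbk ->; apply: sr_sum => // i _; exact: srM.
have A'' : A y'' by have := AI _ (Az ord0); rewrite fcons0.
have y'1 i : igen A y (y' i) by have := Az (lift ord0 i); rewrite fconsS.
have red n a : A a -> exists (c : nat -> F) b, [/\ forall j, k (c j), A b &
  igen A y' (a - \sum_(j < n) c j * y'' ^+ j - b * y'' ^+ n)].
 elim: n a => [|n ih] a Aa.
  exists (fun=> 0), a; split=> // [j|]; first exact: sr0.
  by rewrite big_ord0 expr0 mulr1 subr0 subrr; exact: igen0.
 have [c [b [hc hbb h]]] := ih a Aa.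
 have [e ke [w Aw ew]] := base_dec hb hbb.
 have [b' Ab' hb'] : exists2 b', A b' & igen A y' (b - e - b' * y'').
  have dec i : {t | A t /\ igen A y' (y i - t * y'')}.
   apply: cid; have /igen_fcons[t [z [kt [zb hzb ->] ->]]] := g2 i.
   exists t; split; first exact: kA.
   by rewrite addrC addKr; exists zb => // j; exact: kA.
  exists (\sum_i w i * sval (dec i)).
   by apply: sr_sum => // i _; apply: srM => //; case: (svalP (dec i)).
  rewrite ew mulr_suml -sumrB; apply: igen_sum => // i _; rewrite -mulrA -mulrBr.
  by apply: igenM => //; case: (svalP (dec i)).
 exists (fun j => if j == n then e else c j), b'; split=> // [j|]; first by case: ifP.
 rewrite big_ord_recr /= eqxx (eq_bigr (fun j : 'I_n => c j * y'' ^+ j)); last first.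
  by move=> j _; rewrite ltn_eqF.
 have -> : a - (\sum_(j < n) c j * y'' ^+ j + e * y'' ^+ n) - b' * y'' ^+ n.+1
  = (a - \sum_(j < n) c j * y'' ^+ j - b * y'' ^+ n) + y'' ^+ n * (b - e - b' * y'').
  by rewrite exprS; ring.
 by apply: igenD => //; apply: igenM => //; exact: srX.
have f1' : ipow A y 1 f by [].
have fz1 : forall i, ipow A y 1 (fcons f y' i) by exact: fcons_case.
apply: (complete_nakayama (base_filt hb) kA fz1 (e := fun j : 'I_d => y'' ^+ j)).
 by move=> j; exact: srX.
move=> {}a Aa; have [c [b [hc Ab h]]] := red d a Aa.
exists (fun j : 'I_d => c j) => //; apply/igen_fcons; exists (b * v), (a - \sum_(j < d) c j * y'' ^+ j - b * v * f).
split; [exact: srM| |ring].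
have -> : a - \sum_(j < d) c j * y'' ^+ j - b * v * f
 = (a - \sum_(j < d) c j * y'' ^+ j - b * y'' ^+ d) + b * (y'' ^+ d - v * f) by ring.
by apply: igenD => //; apply: igenM.
Qed.

(** For a nonzero nonunit [f] of the ideal, [A / f A] is finite over a series ring with one variable
    less, which is noetherian by induction; the quotient enters through the submodule [Q] of
    multiples of [f]. *)
Lemma base_noeth r A (y : 'I_r -> F) : base k A y -> noeth A.
elim: r A y => [|r ih] A y hb J hJ JA; have [hA [_ kA] Ay _ [sep _]] := hb; have [J0 JD JM] := hJ.
 have [[x [Jx x0]]|hno] := pselect (exists x, J x /\ x != 0); last first.
  exists [::]; split=> // x Jx /=; apply/eqP/negPn/negP => x0; apply: hno; by exists x.
 exists [:: x]; split=> [z|z Jz /=]; first by rewrite inE => /eqP ->.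
 have Ak a : A a -> k a.
  move=> /(base_dec hb)[c kc' [b _]]; rewrite big_ord0 => /eqP; rewrite subr_eq0 => /eqP -> //.
 exists (z / x); last by rewrite divfK ?subrr.
 by apply: kA; apply: sf_div => //; apply: Ak; exact: JA.
have [[f [Jf f0]]|hno] := pselect (exists x, J x /\ x != 0); last first.
 exists [::]; split=> // x Jx /=; apply/eqP/negPn/negP => x0; apply: hno; by exists x.
have [c kc' hfc] := base_dec hb (JA _ Jf).
have [c0|c0] := eqVneq c 0; last first.
 have [v Av ev] := base_unit hb kc' c0 hfc.
 exists [:: f]; split=> [z|z Jz /=]; first by rewrite inE => /eqP ->.
 exists (z * v); first by apply: srM => //; exact: JA.
 by rewrite -mulrA (_ : v * f = 1) ?mulr1 ?subrr // -ev addrC subrK.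
rewrite c0 subr0 in hfc.
have [y' [y'' [d [v [g1 g2 Av hd]]]]] := base_coord hb (JA _ Jf) f0.
have fin := coord_finite hb g1 g2 Av hd hfc.
have hF := base_filt hb.
have Az i : igen A y (fcons y'' y' i).
 by case: (g1 i) => b hbk ->; exists b => // j; exact: kA.
have y'1 i : ipow A y 1 (y' i) by have := Az (lift ord0 i); rewrite fconsS.
set A0 := pser k (ipow A y) y'.
have hb0 : base k A0 y' by exact: (pser_base hF hk kA y'1).
have A0s := pser_subr hF hk kA y'1; have A0A x : A0 x -> A x by exact: (pserB_sub hF).
pose Q x := exists2 a, A a & x = a * f.
have idA0 (K : F -> Prop) : ideal A K -> ideal A0 K.
 by case=> h0 hD hM; split=> // a x /A0A; exact: hM.
have hQ : ideal A Q.
 split.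
 - by exists 0; rewrite ?mul0r //; exact: sr0.
 - by move=> _ _ [a ha ->] [b hb' ->]; exists (a + b); rewrite ?mulrDl //; exact: srD.
 - by move=> a _ ha [b hb' ->]; exists (a * b); rewrite ?mulrA //; exact: srM.
have [||s sJ hs] := @fg_submodule _ _ A0s (ih _ _ hb0) [seq y'' ^+ j | j <- iota 0 d] J Q (idA0 _ hJ) (idA0 _ hQ).
- by move=> _ [a ha ->]; exact: JM.
- move=> x /JA /fin[e he ->].
 have dec j : {ab : F * F | [/\ A0 ab.1, A ab.2 & e j = ab.1 + f * ab.2]}.
  apply: cid; have [a [b [h1 h2 h3]]] := pser_split hF hk kA hfc y'1 (he j).
  by exists (a, b); split=> //; exact: (pserB_sub hF h2).
 exists (\sum_(j < d) (sval (dec j)).1 * y'' ^+ j).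
  apply: lin_sum => // j _; apply: linM => //; first by case: (svalP (dec j)).
  by apply: lin_mem => //; apply: map_f; rewrite mem_iota /=.
 exists (\sum_(j < d) (sval (dec j)).2 * y'' ^+ j).
  apply: sr_sum => // j _; apply: srM => //; first by case: (svalP (dec j)).
  by apply: srX => //; have := Az ord0; rewrite fcons0 => -[b hbb ->]; apply: sr_sum => // i _; exact: srM.
 rewrite -sumrB mulr_suml; apply: eq_bigr => j _; have [_ _ {1}->] := svalP (dec j); ring.
exists (f :: s); split=> [x|x Jx /=]; first by rewrite inE => /orP[/eqP ->|/sJ].
have [z hz [a Aa e]] := hs x Jx; exists a => //.
rewrite (_ : x - a * f = z); first exact: lin_mono hz.
by rewrite -e; ring.
Qed.
End Field.

Definition frobp p A x := exists2 b, A b & x = b ^+ p.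

Lemma frobp_subr p A : p \in [pchar F] -> subr A -> subr (frobp p A).
move=> cp hA; split.
- by exists 1; rewrite ?expr1n //; exact: sr1.
- move=> _ _ [a ha ->] [b hb ->]; exists (a - b); first exact: srB.
 by rewrite -!(pFrobenius_autE cp) rmorphB.
- by move=> _ _ [a ha ->] [b hb ->]; exists (a * b); rewrite ?exprMn //; exact: srM.
Qed.

(** F-finiteness in characteristic [p]. This is the property that rules out defect in the extensions
    of degree [p]. *)
Definition ffin p A := exists2 e : seq F, forall x, x \in e -> A x & forall a, A a -> lin (frobp p A) e a.

(** Monomials with exponents below [p] span [A] over the series in the [y i ^+ p]; such a series is
    a p-th power, because every element of [k] is one. *)
Lemma base_ffin p k r A (y : 'I_r -> F) : p \in [pchar F] -> sfield k -> kclosed k ->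
 base k A y -> ffin p A.
move=> cp hk kc hb; have [hA [_ kA] Ay _ [sep cpl]] := hb; have ks := proj1 hk.
have p0 : (0 < p)%N by apply: prime_gt0; exact: (pcharf_prime cp).
pose z i := y i ^+ p.
have y1 i : ipow A y 1 (y i) by exact: igen_mem.
have z1 i : ipow A y 1 (z i).
 rewrite /z; case: (p) p0 => // p' _; rewrite exprSr; apply: (igenM hA) => //; [exact: srX|exact: igen_mem].
have hF := base_filt hb.
have Az i : A (z i) by exact: srX.
pose e (b : {ffun 'I_r -> 'I_p}) := \prod_i y i ^+ b i.
have Ae b : A (e b) by apply: sr_prod => // i _; exact: srX.
have kroot_p c : k c -> exists2 c', k c' & c = c' ^+ p.
 move=> kc'; have [||c' h1 h2] := kc p (fun i => if i == 0%N then c else 0) => //.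
  by move=> i; case: ifP => // _; exact: sr0.
 exists c' => //; rewrite h2; case: (p) p0 => // p' _.
 by rewrite big_ord_recl expr0 mulr1 big1 ?addr0 // => i _; rewrite mul0r.
have fr := frobp_subr cp hA.
have key a : A a -> exists2 c, forall b, pser k (ipow A y) z (c b) & a = \sum_b c b * e b.
 apply: (complete_nakayama hF kA z1 Ae) => {}a Aa.
 pose good x := exists2 c : {ffun 'I_r -> 'I_p} -> F, forall j, k (c j) & igen A z (x - \sum_j c j * e j).
 have g0 : good 0.
  exists (fun=> 0) => [j|]; first exact: sr0.
  by rewrite big1 ?subr0; [exact: igen0|move=> j _; rewrite mul0r].
 have gD x w : good x -> good w -> good (x + w).
  move=> [c hc h1] [c' hc' h2]; exists (fun j => c j + c' j) => [j|]; first exact: srD.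
  under eq_bigr do rewrite mulrDl.
  by rewrite big_split /= opprD addrACA; exact: igenD.
 have gig x : igen A z x -> good x.
  move=> hx; exists (fun=> 0) => [j|]; first exact: sr0.
  by rewrite big1 ?subr0 // => j _; rewrite mul0r.
 have gm c (m : 'X_{1..r}) : k c -> good (c * mev y m).
  move=> hc; have [hm|hm] := pselect (forall i, (m i < p)%N).
   exists (fun b : {ffun 'I_r -> 'I_p} => if [forall i, b i == m i :> nat] then c else 0) => [b|].
    by case: ifP => // _; exact: sr0.
   rewrite (bigD1 [ffun i => Ordinal (hm i)]) //= ifT; last by apply/forallP => i; rewrite ffunE.
   rewrite big1 => [|b nb].
    rewrite addr0 /e (_ : \prod_i _ = mev y m) ?subrr; first exact: igen0.
    by apply: eq_bigr => i _; rewrite ffunE.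
   rewrite ifF ?mul0r //; apply/negbTE; apply: contra nb => /forallP h; apply/eqP/ffunP => i.
   by rewrite ffunE; apply: val_inj => /=; exact/eqP.
  apply: gig; have [i hi] : exists i, (p <= m i)%N.
   by apply: contrapT => h; apply: hm => i; rewrite ltnNge; apply/negP => h'; apply: h; exists i.
  rewrite /mev (bigD1 i) //= -(subnK hi) exprD -!/(z i) -mulrA [z i * _]mulrC !mulrA.
  apply: igenM; [exact: hA| |exact: igen_mem].
  apply: srM => //; last by apply: sr_prod => // j _; exact: srX.
  by apply: srM => //; [exact: kA|exact: srX].
 have gh n x : ipow k y n x -> good x.
  move=> /(ipow_mform ks)[P hP ->]; rewrite mevalE.
  elim: (msupp P) => [|m s ih]; rewrite ?big_nil // big_cons; apply: gD => //.
  by apply: gm; case: (hP m).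
 have gN n : (exists h, good h /\ ipow A y n (a - h)).
  elim: n => [|n [h [gh' hh]]]; first by exists 0; rewrite subr0.
  have [h' hk' hh'] := base_lead hb hh; exists (h + h'); split; first by apply: gD => //; exact: gh hk'.
  by rewrite opprD addrA.
 have [h [gh' hh]] := gN (#|'I_r| * p).+1.
 rewrite -(subrK h a); apply: gD => //; apply: gig; apply: (@ipow_absorb _ A hA _ y Ay (igen A z) p) hh => //.
  by split; [exact: igen0|move=> ? ?; exact: igenD|move=> ? ?; exact: igenM].
 by move=> i; exact: igen_mem.
exists [seq e b | b <- enum {: {ffun 'I_r -> 'I_p}}] => [x /mapP[b _ -> //]|a /key[c hc ->]].
apply: lin_sum => // b _; apply: linM => //; last first.
 by apply: lin_mem => //; apply: map_f; rewrite mem_enum.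
have [h [hh hx]] := hc b.
have hg n : {g | ipow k y n g /\ h n = g ^+ p}.
 apply: cid; elim: n (h n) (hh n) => [|n ih] x /=; first by move/kroot_p => [c' ? ?]; exists c'.
 move=> [d hd ->]; have st i : {g | ipow k y n g /\ d i = g ^+ p}.
  by apply: cid; exact: ih (hd i).
 exists (\sum_i sval (st i) * y i); split.
  by exists (fun i => sval (st i)) => // i; case: (svalP (st i)).
 rewrite -(pFrobenius_autE cp) rmorph_sum /=; apply: eq_bigr => i _.
 by rewrite rmorphM /= !pFrobenius_autE; have [_ <-] := svalP (st i).
have [s hs] := pser_lift hF kA y1 (fun n => proj1 (svalP (hg n))).
exists s; first by apply: (pserB_sub hF); exists (fun n => sval (hg n)); exact: hs.
apply/eqP; rewrite -subr_eq0; apply/eqP; apply: sep => n.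
have -> : c b - s ^+ p = (c b - \sum_(i < n) h i) - (s - \sum_(i < n) sval (hg i)) ^+ p.
 rewrite -[in RHS](pFrobenius_autE cp) rmorphB rmorph_sum /= !pFrobenius_autE.
 have -> : \sum_(i < n) pFrobenius_aut cp (sval (hg i)) = \sum_(i < n) h i.
  apply: eq_bigr => i _; have [_ ei] := svalP (hg i).
  by symmetry; rewrite pFrobenius_autE; exact: ei.
 by ring.
apply: (idealB hA (ipow_ideal hA y n)); first exact: hx.
have [_ /(_ n)] := hs; move: (s - _) => w hn; rewrite -(prednK p0) exprSr.
case: (ipow_ideal hA y n) => _ _ hM; apply: hM => //; apply: srX => //; exact: ipow_base hn.
Qed.
End Coordinates.

Section SubfieldType.
Variables (F : fieldType) (K : F -> Prop) (hK : sfield K).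

Definition sfield_pred of sfield K : {pred F} := [pred x | `[< K x >]].

Lemma sfield_divring : GRing.divring_closed (sfield_pred hK).
split=> [|x y /asboolP hx /asboolP hy|x y /asboolP hx /asboolP hy]; apply/asboolP.
- exact: sr1 (proj1 hK).
- exact: (srB (proj1 hK)).
- exact: sf_div.
Qed.

HB.instance Definition _ := GRing.isDivringClosed.Build F (sfield_pred hK) sfield_divring.

(** A subfield repackaged as a field type, for the sake of matrices and polynomial divisibility over
    it. *)
Definition sfieldT : Type := {x : F | x \in sfield_pred hK}.
HB.instance Definition _ := SubChoice.copy sfieldT {x : F | x \in sfield_pred hK}.
HB.instance Definition _ := [SubChoice_isSubComUnitRing of sfieldT by <:].
HB.instance Definition _ := [SubComUnitRing_isSubIntegralDomain of sfieldT by <:].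
HB.instance Definition _ := [SubIntegralDomain_isSubField of sfieldT by <:].

Lemma sfieldT_val (x : sfieldT) : K (val x).
Proof. by case: x => x /= /asboolP. Qed.

Lemma sfieldT_sub x : K x -> {y : sfieldT | val y = x}.
Proof. by move=> /asboolP hx; exists (Sub x hx : sfieldT). Qed.

End SubfieldType.

(** * Rational rank and divisible hulls of value groups *)

Section Hull.
Variable F : fieldType.
Implicit Types (A B K M V : F -> Prop) (x y z : F).

Lemma noeth_subset B (P : F -> Prop) : subr B -> noeth B -> (forall x, P x -> B x) ->
 exists2 s : seq F, forall x, x \in s -> P x & forall x, P x -> lin B s x.
move=> hB hN PB.
pose J z := exists2 s : seq F, forall x, x \in s -> P x & lin B s z.
have lsub s t z : {subset s <= t} -> lin B s z -> lin B t z.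
 by move=> st; apply: lin_min; [exact: lin_ideal|move=> y /st; exact: lin_mem].
have [|z [s sP]|t [tJ ht]] := hN J.
- split.
 + by exists [::].
 + move=> x y [s sP hs] [t tP ht]; exists (s ++ t).
   by move=> z; rewrite mem_cat => /orP[/sP|/tP].
  by apply: linD => //; [apply: lsub hs|apply: lsub ht] => z h; rewrite mem_cat h ?orbT.
 + by move=> a x Ba [s sP hs]; exists s => //; exact: linM.
- by apply: lin_min => [|x /sP /PB //]; split; [exact: sr0|move=> ? ?; exact: srD|move=> ? ?; exact: srM].
suff [s sP hs] : exists2 s : seq F, forall x, x \in s -> P x & forall x, x \in t -> lin B s x.
 exists s => // x Px; apply: lin_min (ht x _) => //; first exact: lin_ideal.
 by exists [:: x] => [y|]; [rewrite inE => /eqP ->|apply: lin_mem => //; exact: mem_head].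
elim: t tJ {ht} => [|x t ih] tJ; first by exists [::].
have [|s sP hs] := ih; first by move=> y yt; apply: tJ; rewrite inE yt orbT.
have [s' s'P hs'] := tJ x (mem_head _ _).
exists (s' ++ s) => [z|z]; first by rewrite mem_cat => /orP[/s'P|/sP].
rewrite inE => /orP[/eqP ->|/hs h].
 by apply: lsub hs' => y h; rewrite mem_cat h.
by apply: lsub h => y h; rewrite mem_cat h orbT.
Qed.

Lemma sfield_dep K n d (C : 'I_n -> 'I_d -> F) : sfield K -> (d < n)%N ->
 (forall i j, K (C i j)) ->
 exists v : 'I_n -> F, [/\ forall i, K (v i), exists i, v i != 0 &
  forall j, \sum_i v i * C i j = 0].
move=> hK dn hC.
pose D : 'M[sfieldT hK]_(n, d) := \matrix_(i, j) sval (sfieldT_sub hK (hC i j)).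
have : kermx D != 0 by rewrite -mxrank_eq0 mxrank_ker subn_eq0 -ltnNge (leq_ltn_trans (rank_leq_col D)).
move=> /rowV0Pn[w /sub_kermxP wD w0].
exists (fun i => val (w ord0 i)); split=> [i||j].
- exact: sfieldT_val.
- have /rV0Pn[i hi] := w0; exists i; apply: contraNneq hi => h; apply/eqP; exact: val_inj.
- have /matrixP/(_ ord0 j) := wD; rewrite !mxE => /(congr1 val); rewrite rmorph_sum => e; rewrite -[RHS]e.
 apply: eq_bigr => i _; rewrite mxE rmorphM /=; congr (_ * _).
 by rewrite -[LHS](svalP (sfieldT_sub hK (hC i j))).
Qed.

(** The first [n + 1] powers of [x] lie in a space spanned by [n] vectors. *)
Lemma finite_algebraic K n (e : 'I_n -> F) (Q : F -> Prop) : sfield K ->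
 subr Q -> (forall x, Q x -> exists2 c : 'I_n -> F, forall i, K (c i) & x = \sum_i c i * e i) ->
 forall x, Q x -> exists2 p : {poly F}, polyB K p & p != 0 /\ p.[x] = 0.
move=> hK hQ he x Qx.
have h (i : 'I_n.+1) : {c : 'I_n -> F | (forall j, K (c j)) /\ x ^+ i = \sum_j c j * e j}.
 by apply: cid; have [c h1 h2] := he _ (srX hQ i Qx); exists c.
have [|v [Kv [i vi0] hv]] := sfield_dep (C := fun i => sval (h i)) hK (ltnSn n).
 by move=> i j; case: (svalP (h i)) => h1 _; exact: h1.
pose w m := if insub m is Some i then v i else 0.
have wE (j : 'I_n.+1) : w j = v j by rewrite /w valK.
exists (\poly_(m < n.+1) w m).
 move=> j; rewrite coef_poly; case: ifP => [jn|_]; last exact: sr0 (proj1 hK).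
 by rewrite -[j]/(nat_of_ord (Ordinal jn)) wE.
split.
 apply/eqP => /(congr1 (fun q : {poly F} => q`_i)); rewrite coef_poly ltn_ord wE coef0.
 by move/eqP: vi0.
rewrite horner_poly (eq_bigr (fun i => \sum_j v i * sval (h i) j * e j)); last first.
 move=> j _; rewrite wE; have [_ ej] := svalP (h j); rewrite [in LHS]ej mulr_sumr.
 by apply: eq_bigr => l _; rewrite mulrA.
by rewrite exchange_big big1 // => j _; rewrite -mulr_suml hv mul0r.
Qed.

(** The value of [x] lies in the divisible hull of the value group of [K]. *)
Definition hull V K x := exists n, exists2 h, K h & vu V (x ^+ n.+1 / h).

Section Val.
Variables (V : F -> Prop) (hV : vring V).

Lemma hull_div K x y : sfield K -> hull V K x -> hull V K y -> hull V K (x / y).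
move=> hK [n [h Kh hx]] [m [h' Kh' hy]].
exists (n.+1 * m.+1).-1, (h ^+ m.+1 / h' ^+ n.+1).
 by apply: sf_div => //; apply: (srX (proj1 hK)).
rewrite prednK // expr_div_n {2}mulnC !exprM.
have -> : (x ^+ n.+1) ^+ m.+1 / (y ^+ m.+1) ^+ n.+1 / (h ^+ m.+1 / h' ^+ n.+1)
 = (x ^+ n.+1 / h) ^+ m.+1 / (y ^+ m.+1 / h') ^+ n.+1.
 by rewrite !expr_div_n !invf_div; rewrite mulrACA [RHS]mulrACA; congr (_ * _); exact: mulrC.
by apply: vu_div => //; exact: vuX.
Qed.

Lemma hull_unit K x : sfield K -> vu V x -> hull V K x.
Proof. by move=> hK hx; exists 0%N, 1; rewrite ?expr1 ?divr1 //; exact: sr1 (proj1 hK). Qed.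

(** In a vanishing sum two nonzero terms must have the same value; their quotient compares a power
    of [x] with an element of [K]. *)
Lemma alg_hull K x p : sfield K -> polyB K p -> p != 0 -> p.[x] = 0 -> x != 0 -> hull V K x.
move=> hK hp p0 px x0; apply: contrapT => hno.
pose t (i : 'I_(size p)) := p`_i * x ^+ i.
have [||i j /= pi pj ij hu|i0 [_ _ hu]] := @v_distinct _ V hV _ (fun i : 'I_(size p) => p`_i != 0) t.
- have sp : ((size p).-1 < size p)%N by rewrite prednK // size_poly_gt0.
 by exists (Ordinal sp); rewrite /= -lead_coefE lead_coef_eq0.
- by move=> i /= pi; rewrite mulf_neq0 // expf_neq0.
- apply: hno; wlog ltij : i j pi pj ij hu / (j < i)%N.
  move=> hw; case: (ltngtP j i) => [|h|/esym/val_inj h]; first exact: hw.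
   by apply: (hw j i) => //; rewrite 1?eq_sym // -invf_div; exact: vu_inv.
  by rewrite h eqxx in ij.
 exists (i - j).-1, (p`_j / p`_i); first by apply: sf_div.
 rewrite prednK ?subn_gt0 //.
 have ei : x ^+ i = x ^+ (i - j) * x ^+ j by rewrite -exprD subnK // ltnW.
 rewrite (_ : _ / _ = t i / t j) //; rewrite /t ei.
 by field; rewrite pi pj expf_neq0.
have e : \sum_(i < size p | p`_i != 0) t i = 0.
 rewrite -[RHS]px horner_coef [RHS](bigID (fun i : 'I_(size p) => p`_i != 0)) /= [X in _ + X]big1 ?addr0 //.
 by move=> i; rewrite negbK => /eqP ->; rewrite mul0r.
by have := vu_n0 hu; rewrite e mul0r eqxx.
Qed.

Definition vind r (u : 'I_r -> F) := (forall i, u i != 0) /\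
 forall a : 'I_r -> int, vu V (\prod_i u i ^ a i) -> forall i, a i = 0.

Definition rkle M r := forall u : 'I_r.+1 -> F, (forall i, M (u i)) -> ~ vind u.

Lemma rkleP M r : rkle M r -> forall u : 'I_r.+1 -> F, (forall i, M (u i)) -> (forall i, u i != 0) ->
 exists a : 'I_r.+1 -> int, vu V (\prod_i u i ^ a i) /\ exists i, a i != 0.
move=> hM u uM u0; apply: contrapT => hno; apply: (hM u) => //; split=> // a ha i.
by apply/eqP/negPn/negP => ai; apply: hno; exists a; split=> //; exists i.
Qed.

Lemma rkle_hull K M r : rkle K r -> (forall x, M x -> x != 0 -> hull V K x) -> rkle M r.
move=> hK hM u uM [u0 ui].
have hx i : {nh : nat * F | K nh.2 /\ vu V (u i ^+ nh.1.+1 / nh.2)}.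
 by apply: cid; have [n [h Kh hu]] := hM _ (uM i) (u0 i); exists (n, h).
pose n i := (sval (hx i)).1; pose h i := (sval (hx i)).2.
have hK' i : K (h i) by case: (svalP (hx i)).
have hu i : vu V (u i ^+ (n i).+1 / h i) by case: (svalP (hx i)).
have h0 i : h i != 0.
 by apply/eqP => h0; have := vu_n0 (hu i); rewrite h0 invr0 mulr0 eqxx.
have [a [ha [i ai]]] := rkleP hK hK' h0.
suff /ui/(_ i)/eqP : vu V (\prod_i u i ^ ((n i).+1%:Z * a i)).
 by rewrite mulf_eq0 (negbTE ai) orbF.
have -> : \prod_i u i ^ ((n i).+1%:Z * a i)
 = \prod_i h i ^ a i * \prod_i (u i ^+ (n i).+1 / h i) ^ a i.
 rewrite -big_split; apply: eq_bigr => j _ /=; rewrite -exprz_exp -expfzMl; congr (_ ^ _).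
 by rewrite mulrC divfK.
by apply: vuM => //; apply: vu_prod => // j _; exact: vuZ.
Qed.

(** Eliminating [g] from [r + 2] elements leaves [r + 1] combinations whose values come from [K],
    and these are dependent. *)
Lemma rkle_gen K M g r : sfield K -> g != 0 -> rkle K r ->
 (forall x, M x -> x != 0 -> exists2 h, K h & exists m : int, vu V (x / (h * g ^ m))) ->
 rkle M r.+1.
move=> hK g0 hKr hM u uM [u0 ui].
have hx i : {mh : int * F | K mh.2 /\ vu V (u i / (mh.2 * g ^ mh.1))}.
 by apply: cid; have [h Kh [m hu]] := hM _ (uM i) (u0 i); exists (m, h).
pose m i := (sval (hx i)).1; pose h i := (sval (hx i)).2.
have hK' i : K (h i) by case: (svalP (hx i)).
have hu i : vu V (u i / (h i * g ^ m i)) by case: (svalP (hx i)).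
have h0 i : h i != 0.
 by apply/eqP => h0; have := vu_n0 (hu i); rewrite h0 mul0r invr0 mulr0 eqxx.
pose eps i := u i / (h i * g ^ m i).
have ue i : u i = eps i * h i * g ^ m i by rewrite -mulrA divfK // mulf_neq0 // expfz_neq0.
have eu i : vu V (eps i) by exact: hu.
clearbody eps.
(* An index with a nonzero exponent of [g] serves as pivot, with [e] equal to that exponent. If all
   exponents of [g] vanish, any index and [e = 1] will do. *)
have [i0 [e [e0 me]]] : exists i0, exists e : int, e != 0 /\ forall j, m j * (e - m i0) = 0.
 have [[i mi]|hno] := pselect (exists i, m i != 0).
  by exists i, (m i); split=> // j; rewrite subrr mulr0.
 exists ord0, 1; split=> // j; suff -> : m j = 0 by rewrite mul0r.
 by apply/eqP/negPn/negP => mj; apply: hno; exists j.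
have Kz x (b : int) : K x -> K (x ^ b).
 by move=> Kx; case: b => b; rewrite ?NegzE -?exprnN; [|apply: sfV => //]; exact: (srX (proj1 hK)).
pose f j := h (lift i0 j) ^ e * h i0 ^ (- m (lift i0 j)).
have [|j|a [ha [j aj]]] := rkleP hKr (u := f).
- by move=> j; apply: (srM (proj1 hK)); exact: Kz.
- by rewrite mulf_neq0 // expfz_neq0.
pose b i := if unlift i0 i is Some j then e * a j else - \sum_j m (lift i0 j) * a j.
suff /ui/(_ (lift i0 j))/eqP : vu V (\prod_i u i ^ b i).
 by rewrite /b liftK mulf_eq0 (negbTE aj) (negbTE e0).
have -> : \prod_i u i ^ b i = \prod_j f j ^ a j *
  \prod_j (eps (lift i0 j) ^ (e * a j) * eps i0 ^ (- (m (lift i0 j) * a j))).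
 rewrite (bigD1_ord i0) //= {1}/b unlift_none -sumrN.
 rewrite (big_morph (fun n : int => u i0 ^ n) (fun n n' => expfzDr n n' (u0 i0)) (expr0z _)).
 rewrite -!big_split; apply: eq_bigr => l _ /=; rewrite /b liftK.
 rewrite [in LHS](ue i0) [in LHS](ue (lift i0 l)) !expfzMl /f.
 have eg : (g ^ m (lift i0 l)) ^ (e * a l) * (g ^ m i0) ^ (- (m (lift i0 l) * a l)) = 1.
  rewrite !exprz_exp -expfzDr // (_ : _ + _ = m (lift i0 l) * (e - m i0) * a l).
   by rewrite me mul0r expr0z.
  by ring.
 transitivity (h (lift i0 l) ^ (e * a l) * h i0 ^ (- (m (lift i0 l) * a l)) *
  (eps (lift i0 l) ^ (e * a l) * eps i0 ^ (- (m (lift i0 l) * a l))) *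
  ((g ^ m (lift i0 l)) ^ (e * a l) * (g ^ m i0) ^ (- (m (lift i0 l) * a l)))).
  by ring.
 by rewrite eg mulr1 !exprz_exp mulNr.
apply: vuM => //; apply: vu_prod => // l _; apply: vuM => //; exact: vuZ.
Qed.

End Val.
End Hull.

(** * Abhyankar's inequality for power series rings *)

Section Abhyankar.
Variables (F : fieldType) (V k : F -> Prop).
Hypotheses (hV : vring V) (hk : sfield k) (kc : kclosed k).
Implicit Types (A B K M S : F -> Prop) (x z : F).

Lemma igen_vm S (I : finType) (u : I -> F) x :
 (forall z, S z -> V z) -> (forall i, vm V (u i)) -> igen S u x -> vm V x.
Proof. by move=> SV um [b hb ->]; apply: vm_sum => // i _; apply: vmMr => //; exact: SV. Qed.

Lemma vm_one x : vm V x -> vu V (1 - x).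
Proof. by move=> h; apply: vuDm => //; [exact: vu1|exact: vmN]. Qed.

Lemma regular_param A r (y : 'I_r.+1 -> F) (y' : 'I_r -> F) g :
 base k A y -> (forall z, A z -> V z) -> (forall i, vm V (y i)) ->
 (forall i, igen A y (y' i)) -> igen A y g ->
 g != 0 -> ~ hull V (frac (pser k (ipow A y) y')) g ->
 forall x, pser k (ipow A y) (fcons g y') x -> x != 0 ->
 exists2 h, pser k (ipow A y) y' h & exists n, vu V (x / (h * g ^+ n)).
move=> hb AV ym y'1 g1 g0 gh x A1x x0.
have [hA [_ kA] Ay _ [sep _]] := hb; have hF := base_filt hb.
set A0 := pser _ _ y' in gh *; set A1 := pser _ _ (fcons g y') in A1x.
have y'F i : ipow A y 1 (y' i) by exact: y'1.
have gF : ipow A y 1 g by exact: g1.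
have A0s : subr A0 by exact: (pser_subr hF hk kA y'F).
have A0A z : A0 z -> A z by exact: (pserB_sub hF).
have A1A z : A1 z -> A z by exact: (pserB_sub hF).
have A0N : noeth A0 by apply: (base_noeth hk kc (y := y')); exact: (pser_base hF hk kA y'F).
have vg : vm V g by exact: igen_vm g1.
have Ag : A g by have [b hbb ->] := g1; apply: sr_sum => // i _; exact: srM.
have sp z : {ab : F * F | A1 z -> [/\ A0 ab.1, A1 ab.2 & z = ab.1 + g * ab.2]}.
 apply: cid; have [h|h] := pselect (A1 z); last by exists (0, 0).
 by have [a [b [h1 h2 h3]]] := pser_split hF hk kA gF y'F h; exists (a, b).
pose b n := iter n (fun z => (sval (sp z)).2) x.
pose a n := (sval (sp (b n))).1.
have hbn n : A1 (b n) by elim: n => //= n ih; case: (svalP (sp (b n)) ih).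
have ha n : A0 (a n) by case: (svalP (sp (b n)) (hbn n)).
have eb n : b n = a n + g * b n.+1 by case: (svalP (sp (b n)) (hbn n)).
have ex n : x = \sum_(i < n) a i * g ^+ i + b n * g ^+ n.
 elim: n => [|n ih]; first by rewrite big_ord0 add0r expr0 mulr1.
 rewrite big_ord_recr {1}ih -addrA; congr (_ + _).
 rewrite (congr1 ( *%R^~ (g ^+ n)) (eb n)) exprS /=; ring.
have [z [i _ ->]|s sP hs] := @noeth_subset _ A0 (fun z => exists2 i, true & z = a i) A0s A0N.
 exact: ha.
have [N hN] : exists N, forall z, z \in s -> exists2 i, (i < N)%N & z = a i.
 elim: (s) sP => [|z t ih] tP; first by exists 0%N.
 have [|N hN] := ih; first by move=> w wt; apply: tP; rewrite inE wt orbT.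
 have [i _ ei] := tP z (mem_head _ _); exists (maxn N i.+1) => w; rewrite inE => /orP[/eqP ->|/hN[j jN ej]].
  by exists i; rewrite // leq_max leqnn orbT.
 by exists j; rewrite // leq_max jN.
have [[i ai]|hno] := pselect (exists i : 'I_N, a i != 0); last first.
 have az j : a j = 0.
  have : lin A0 s (a j) by apply: hs; exists j.
  apply: (@lin_min _ A0 (fun z => z = 0)) => [|z /hN[i iN ->]].
   by split=> // [? ? -> ->|? ? _ ->]; rewrite ?addr0 ?mulr0.
  by apply/eqP/negPn/negP => h; apply: hno; exists (Ordinal iN).
 move/eqP: x0; case; apply: sep => n; rewrite (ex n) big1 ?add0r => [|i _]; last by rewrite az mul0r.
 case: (ipow_ideal hA y n) => _ _; apply; first exact: A1A.
 exact: ipow_expr.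
pose t (i : 'I_N) := a i * g ^+ i.
have [||i1 j /= ai1 aj ij hu|i0 [/= ai0 tm hu]] := v_distinct hV (P := fun i : 'I_N => a i != 0) (t := t).
- by exists i.
- by move=> j /= aj; rewrite mulf_neq0 // expf_neq0.
- apply: gh; wlog ltij : i1 j ai1 aj ij hu / (j < i1)%N.
  move=> hw; case: (ltngtP j i1) => [|h|/esym/val_inj h]; first exact: hw.
   by apply: (hw j i1) => //; rewrite 1?eq_sym // -invf_div; exact: vu_inv.
  by rewrite h eqxx in ij.
 exists (i1 - j).-1, (a j / a i1).
  by exists (a j), (a i1); split.
 rewrite prednK ?subn_gt0 //.
 have ei : g ^+ i1 = g ^+ (i1 - j) * g ^+ j by rewrite -exprD subnK // ltnW.
 rewrite (_ : _ / _ = t i1 / t j) //; rewrite /t ei.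
 by field; rewrite ai1 aj expf_neq0.
set th := t i0 in tm hu; exists (a i0); first exact: ha.
exists i0; have th0 : th != 0 by rewrite /th mulf_neq0 // expf_neq0.
have tV j : V (t j / th).
 have [aj|aj] := eqVneq (a j) 0; first by rewrite /t aj !mul0r; exact: sr0 (proj1 hV).
 have [->|ji] := eqVneq j i0; first by rewrite divff //; exact: sr1 (proj1 hV).
 by apply: vm_V => //; exact: tm.
(* Elements of value above that of the dominating term [th]. Truncations of the tail lie here, and
   Krull's theorem puts the whole tail here up to the unit [1 - u]. *)
pose J z := A z /\ vm V (z / th).
have hJ : ideal A J.
 split; first by split; [exact: sr0|rewrite mul0r; left].
  by move=> u v [h1 h2] [h3 h4]; split; [exact: srD|rewrite mulrDl; exact: vmD].
 by move=> u v h1 [h2 h3]; split; [exact: srM|rewrite -mulrA; apply: vmMr => //; exact: AV].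
have Jt j : (N <= j)%N -> J (a j * g ^+ j).
 move=> Nj; split; first by apply: srM => //; [exact: A0A|exact: srX].
 have : lin A0 s (a j) by apply: hs; exists j.
 apply: (@lin_min _ A0 (fun z => vm V (z * g ^+ j / th))) => [|z /hN[l lN ->]].
  split; first by rewrite !mul0r; left.
   by move=> u v h1 h2; rewrite !mulrDl; exact: vmD.
  by move=> u v h1 h2; rewrite -!mulrA; apply: vmMr => //; [apply: AV; exact: A0A|rewrite mulrA].
 have lj : (l < j)%N by exact: leq_trans Nj.
 have -> : a l * g ^+ j / th = (t (Ordinal lN) / th) * g ^+ (j - l.+1).+1.
  by rewrite /t /= subnSK // -{1}(subnK (ltnW lj)) exprD; ring.
 by apply: vmMr => //; exact: vmX.
pose w := x - \sum_(i < N) t i.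
have Aw : A w.
 apply: srB => //; first exact: A1A.
 by apply: sr_sum => // j _; apply: srM => //; [exact: A0A|exact: srX].
have AN : noeth A by exact: base_noeth hb.
have [n|u hu1 [_ hu2]] := krull_intersection hA Ay AN hJ (fun z h => proj1 h) Aw.
 exists (\sum_(N <= i < N + n) a i * g ^+ i).
  by rewrite big_nat_cond; apply: (ideal_sum _ hJ) => j /andP[/andP[/Jt]].
 have -> : w - \sum_(N <= i < N + n) a i * g ^+ i = b (N + n)%N * g ^+ N * g ^+ n.
  rewrite /w {1}(ex (N + n)%N) -(big_mkord xpredT (fun i => a i * g ^+ i)).
  rewrite (@big_cat_nat _ _ _ N) //= ?leq_addr // big_mkord exprD; rewrite /t; ring.
 case: (ipow_ideal hA y n) => _ _; apply; last exact: ipow_expr.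
 by apply: srM => //; [exact: A1A|exact: srX].
have u1 : vu V (1 - u) by apply: vm_one; exact: igen_vm hu1.
have wm : vm V (w / th).
 by apply: (@vm_divu _ _ hV _ _ u1); rewrite mulrC mulrA.
have -> : x / th = (\sum_(i < N) t i) / th + w / th by rewrite -mulrDl /w; congr (_ / _); ring.
apply: vuDm => //; move: hu; rewrite [in X in vu V X -> _](_ : \sum_(i < N | a i != 0) t i = \sum_(i < N) t i) //.
rewrite [RHS](bigID (fun i : 'I_N => a i != 0)) /= [X in _ + X]big1 ?addr0 // => l.
by rewrite negbK /t => /eqP ->; rewrite mul0r.
Qed.

(** The change of coordinates is made for the product of the list; a multiple of the product is a
    multiple of each factor, so one change serves all. *)
Lemma coord_list A r (y : 'I_r.+1 -> F) (s : seq F) : base k A y ->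
 (forall g, g \in s -> A g /\ g != 0) ->
 exists (y' : 'I_r -> F) (y'' : F),
 [/\ (forall i, igen k y (fcons y'' y' i)), (forall i, igen k (fcons y'' y') (y i)) &
   forall g, g \in s -> exists d v, A v /\ igen A y' (y'' ^+ d - v * g)].
move=> hb hs; have [hA [_ kA] _ _ _] := hb.
have AP : A (\prod_(g <- s) g) by rewrite big_seq; apply: sr_prod => // g /hs[].
have P0 : \prod_(g <- s) g != 0.
 by rewrite prodf_seq_neq0; apply/allP => g /hs[_ g0].
have [y' [y'' [d [v [g1 g2 Av hd]]]]] := base_coord hk kc hb AP P0.
exists y', y''; split=> // g gs; exists d, (v * \prod_(h <- rem g s) h); split.
 apply: srM => //; rewrite big_seq; apply: sr_prod => // h /mem_rem/hs[] //.
by move: hd; rewrite (perm_big _ (perm_to_rem gs)) big_cons /= -mulrA [g * _]mulrC.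
Qed.

Section Coord.
Variables (A : F -> Prop) (r : nat) (y : 'I_r.+1 -> F) (y' : 'I_r -> F) (y'' g v : F) (d : nat).
Hypotheses (hb : base k A y) (AV : forall z, A z -> V z) (ym : forall i, vm V (y i)).
Hypotheses (g1 : forall i, igen k y (fcons y'' y' i)) (g2 : forall i, igen k (fcons y'' y') (y i)).
Hypotheses (Ag : A g) (g0 : g != 0) (Av : A v) (hd : igen A y' (y'' ^+ d - v * g)).
Local Notation A0 := (pser k (ipow A y) y').
Local Notation A1 := (pser k (ipow A y) (fcons g y')).
Hypothesis gh : ~ hull V (frac A0) g.

Lemma coord_y'1 i : igen A y (y' i).
have [hA [_ kA] _ _ _] := hb.
by have := g1 (lift ord0 i); rewrite fconsS => -[b hbb ->]; exists b => // j; exact: kA.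
Qed.

Lemma base0_subr : subr A0.
Proof. by have [hA [_ kA] _ _ _] := hb; exact: (pser_subr (base_filt hb) hk kA coord_y'1). Qed.

Lemma coord_nonunit : igen A y g.
have [hA [_ kA] _ _ _] := hb; have [c kc' hc] := base_dec hb Ag.
have [c0|c0] := eqVneq c 0; first by rewrite c0 subr0 in hc.
case: gh; apply: hull_unit; first exact: frac_sfield base0_subr.
have [v' Av' ev] := base_unit hk hb kc' c0 hc.
rewrite addrC subrK in ev; split=> //; first exact: AV.
by rewrite -[g^-1]mul1r -ev mulfK //; exact: AV.
Qed.

Lemma base1_base : base k A1 (fcons g y').
have [hA [_ kA] _ _ _] := hb.
by apply: (pser_base (base_filt hb) hk kA) => i; apply: fcons_case; [exact: coord_nonunit|exact: coord_y'1].
Qed.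

Lemma base0_base : base k A0 y'.
Proof. by have [hA [_ kA] _ _ _] := hb; exact: (pser_base (base_filt hb) hk kA coord_y'1). Qed.

Lemma coord_fin x : A x -> exists2 c : 'I_d -> F, forall j, A1 (c j) & x = \sum_j c j * y'' ^+ j.
Proof. by move=> Ax; exact: (coord_finite hk hb g1 g2 Av hd coord_nonunit Ax). Qed.

Lemma coord_hull1 x : frac A x -> x != 0 -> hull V (frac A1) x.
have [hA _ _ _ _] := hb; have [hA1 _ _ _ _] := base1_base.
have hK := frac_sfield hA1.
have key z : A z -> z != 0 -> hull V (frac A1) z.
 move=> Az z0; have [x1|p hp [p0 pz]] := @finite_algebraic _ (frac A1) d (fun j => y'' ^+ j) A hK hA _ z Az.
  by move=> /coord_fin[c' h1 ->]; exists c' => // i; exact: frac_base.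
 exact: alg_hull pz z0.
move=> [a [b [Aa Ab b0 ->]]]; rewrite mulf_eq0 invr_eq0 negb_or => /andP[a0 _].
by apply: hull_div => //; exact: key.
Qed.

Lemma coord_param x : frac A1 x -> x != 0 ->
 exists2 h, frac A0 h & exists m : int, vu V (x / (h * g ^ m)).
move=> [a [b [ha hb' b0 ->]]]; rewrite mulf_eq0 invr_eq0 negb_or => /andP[a0 _].
have RJ := regular_param hb AV ym coord_y'1 coord_nonunit g0 gh.
have [c hc [n hn]] := RJ _ ha a0; have [e he [m hm]] := RJ _ hb' b0.
exists (c / e).
 have e0 : e != 0 by apply/eqP => e0; have := vu_n0 hm; rewrite e0 mul0r invr0 mulr0 eqxx.
 by exists c, e.
exists (n%:Z - m%:Z); rewrite expfzDr // -exprnN -exprnP.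
have -> : a / b / (c / e * (g ^+ n / g ^+ m)) = (a / (c * g ^+ n)) / (b / (e * g ^+ m)).
 by rewrite !invfM !invrK; ring.
exact: vu_div.
Qed.

Lemma coord_rk : rkle V (frac A0) r -> rkle V (frac A) r.+1.
move=> h; apply: (rkle_hull hV (K := frac A1)); last by move=> x; exact: coord_hull1.
apply: (rkle_gen hV (g := g) _ _ h) => //; first exact: frac_sfield base0_subr.
exact: coord_param.
Qed.
End Coord.

Lemma rkle_S M r : rkle V M r -> rkle V M r.+1.
move=> h u uM [u0 ui]; apply: (h (fun i => u (lift ord0 i))) => //; split=> // a ha i.
have := ui (fcons 0 a); rewrite big_ord_recl fcons0 expr0z mul1r => /(_ _ (lift ord0 i)).
by rewrite fconsS; apply; rewrite (eq_bigr (fun i => u (lift ord0 i) ^ a i)) // => j _; rewrite fconsS.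
Qed.

(** If all numerators and denominators had values in the divisible hull, so would the quotients
    [f i], which are too many to be independent there. *)
Lemma coord_not_hull A r m (y : 'I_r.+1 -> F) (y' : 'I_r -> F) (f a b : 'I_m.+1 -> F) :
 base k A y -> (forall i, igen A y (y' i)) -> rkle V (frac (pser k (ipow A y) y')) m ->
 vind V f -> (forall i, f i = a i / b i) ->
 exists2 g, (exists i, g = a i \/ g = b i) & ~ hull V (frac (pser k (ipow A y) y')) g.
move=> hb y'1 h fi fab; have [hA [_ kA] _ _ _] := hb; apply: contrapT => hno.
have h' i g : g = a i \/ g = b i -> hull V (frac (pser k (ipow A y) y')) g.
 by move=> hg; apply: contrapT => hg'; apply: hno; exists g => //; exists i.
have hK := frac_sfield (pser_subr (base_filt hb) hk kA y'1).
pose M x := hull V (frac (pser k (ipow A y) y')) x.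
apply: (rkle_hull hV h (M := M) _ (u := f)) => // i.
by rewrite fab; apply: (hull_div hV hK); apply: (h' i); [left|right].
Qed.

(** Too many independent values force some numerator or denominator [g] out of the hull of the ring
    in one variable less. Adding [g] to that ring raises the rank by at most one, and [A] is finite
    over the result. *)
Lemma abhyankar A r (y : 'I_r -> F) : base k A y -> (forall z, A z -> V z) ->
 (forall i, vm V (y i)) -> rkle V (frac A) r.
elim: r A y => [|r ih] A y hb AV ym f fA [f0 fi]; have [hA [_ kA] _ _ [sep _]] := hb.
 have Ak a : A a -> k a.
  move=> /(base_dec hb)[c kc' [b _]]; rewrite big_ord0 => /eqP; rewrite subr_eq0 => /eqP -> //.
 have [a [b [Aa Ab b0 e]]] := fA ord0.
 have kf : k (f ord0) by rewrite e; apply: sf_div => //; exact: Ak.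
 suff /fi/(_ ord0)/eqP : vu V (\prod_i f i ^ (fun=> 1) i) by [].
 rewrite big_ord1 expr1z; split=> //; apply: AV; apply: kA => //; exact: sfV.
have hab i : {ab : F * F | [/\ A ab.1, A ab.2, ab.2 != 0 & f i = ab.1 / ab.2]}.
 by apply: cid; have [a [b [h1 h2 h3 h4]]] := fA i; exists (a, b).
pose a i := (sval (hab i)).1; pose b i := (sval (hab i)).2.
have fab i : f i = a i / b i by case: (svalP (hab i)).
have Aa i : A (a i) by case: (svalP (hab i)).
have Ab i : A (b i) by case: (svalP (hab i)).
have b0 i : b i != 0 by case: (svalP (hab i)).
have a0 i : a i != 0 by have := f0 i; rewrite fab mulf_eq0 negb_or => /andP[].
have [g|y' [y'' [g1 g2 hs]]] := coord_list (s := [seq a i | i : 'I_r.+2] ++ [seq b i | i : 'I_r.+2]) hb.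
 by rewrite mem_cat => /orP[]/mapP[i _ ->].
have y'1 := coord_y'1 hb g1; have hb0 := base0_base hb g1.
have A0A z : pser k (ipow A y) y' z -> A z by exact: (pserB_sub (base_filt hb)).
have rk0 : rkle V (frac (pser k (ipow A y) y')) r.
 apply: ih hb0 _ _ => [z /A0A|i]; first exact: AV.
 exact: igen_vm (y'1 i).
have [g [i gi] gh] := coord_not_hull (a := a) (b := b) hb y'1 (rkle_S rk0) (conj f0 fi) fab.
have gs : g \in [seq a i | i : 'I_r.+2] ++ [seq b i | i : 'I_r.+2].
 by rewrite mem_cat; case: gi => ->; rewrite map_f ?orbT // mem_enum.
have [d [v [Av hd]]] := hs g gs.
have [Ag g0] : A g /\ g != 0 by case: gi => ->.
exact: (coord_rk hb AV ym g1 g2 Ag g0 Av hd gh rk0 fA).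
Qed.
End Abhyankar.

Lemma card_pred_le (T : finType) (P Q : pred T) : (forall y, P y -> Q y) -> (#|P| <= #|Q|)%N.
Proof. by move=> PQ; apply: subset_leq_card; apply/fintype.subsetP => y; exact: PQ. Qed.

Lemma card_pred_lt (T : finType) (P Q : pred T) x :
 (forall y, P y -> Q y) -> Q x -> ~~ P x -> (#|P| < #|Q|)%N.
move=> PQ Qx Px; apply: proper_card; apply/properP; split; last by exists x.
by apply/fintype.subsetP => y; exact: PQ.
Qed.

(** * Models with monomial parameters and Perron's algorithm *)

Section Models.
Variables (F : fieldType) (V k A : F -> Prop).
Hypotheses (hV : vring V) (hk : sfield k) (kV : forall c, k c -> V c).
Hypothesis kres : forall x, V x -> exists2 c, k c & vm V (x - c).
Hypotheses (hA : subr A) (kA : forall c, k c -> A c) (AV : forall x, A x -> V x) (AN : noeth A).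
Implicit Types (S M : F -> Prop) (x z : F) (X : seq F).
Let ks : subr k := proj1 hk.
Let Vs : subr V := proj1 hV.

Lemma k_unit c : k c -> c != 0 -> vu V c.
Proof. by move=> kc c0; split=> //; apply: kV => //; exact: sfV. Qed.

Lemma k_vm c : k c -> vm V c -> c = 0.
Proof. by move=> kc h; apply/eqP/negPn/negP => c0; exact: vm_nvu h (k_unit kc c0). Qed.

Definition zev r (u : 'I_r -> F) (a : 'I_r -> int) := \prod_i u i ^ a i.

Lemma zev_nat r (u : 'I_r -> F) (m : 'X_{1..r}) : zev u (fun i => (m i)%:Z) = mev u m.
Proof. by apply: eq_bigr. Qed.

Lemma zevU r (u : 'I_r -> F) i : zev u (fun j => (j == i)%:Z) = u i.
rewrite /zev (bigD1 i) //= eqxx expr1z big1 ?mulr1 // => j /negbTE ->.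
by rewrite expr0z.
Qed.

Lemma zev_div r (u : 'I_r -> F) a b : (forall i, u i != 0) ->
 zev u (fun i => a i - b i) = zev u a / zev u b.
move=> u0; rewrite /zev -prodfV -big_split; apply: eq_bigr => i _ /=.
by rewrite expfzDr // invr_expz.
Qed.

Lemma zev_n0 r (u : 'I_r -> F) a : (forall i, u i != 0) -> zev u a != 0.
Proof. by move=> u0; apply/prodf_neq0 => i _; rewrite expfz_neq0. Qed.

Lemma mev_n0 r (u : 'I_r -> F) m : (forall i, u i != 0) -> mev u m != 0.
Proof. by move=> u0; rewrite -zev_nat zev_n0. Qed.

Lemma mev_igen S r (u : 'I_r -> F) m : subr S -> (forall i, S (u i)) -> m != 0%MM -> igen S u (mev u m).
move=> hS Su m0; have [i hi] : exists i, m i != 0%N.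
 apply: contrapT => h; move/eqP: m0; apply; apply/mnmP => i; rewrite mnm0E.
 by apply/eqP/negPn/negP => hi; apply: h; exists i.
have -> : mev u m = (\prod_(j | j != i) u j ^+ m j * u i ^+ (m i).-1) * u i.
 by rewrite /mev (bigD1 i) //= -mulrA -exprSr prednK ?lt0n // mulrC.
apply: igenM => //; last exact: igen_mem.
by apply: srM => //; [apply: sr_prod => // j _; exact: srX|exact: srX].
Qed.

Lemma mev_vm r (u : 'I_r -> F) m : (forall i, vm V (u i)) -> m != 0%MM -> vm V (mev u m).
by move=> um m0; apply: (igen_vm hV (S := V) (u := u)) => //; apply: mev_igen => // i; exact: vm_V.
Qed.

Lemma vind_neq r (u : 'I_r -> F) (m m' : 'X_{1..r}) : vind V u -> vu V (mev u m / mev u m') -> m = m'.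
move=> [u0 ui] h; apply/mnmP => i; apply/eqP; rewrite -eqz_nat -subr_eq0; apply/eqP.
by apply: (ui (fun i => (m i)%:Z - (m' i)%:Z)); rewrite -/(zev u _) zev_div // !zev_nat.
Qed.

(** For [S] inside [V] and [u] in the maximal ideal of [V], this says that [u] generates the maximal
    ideal of [S] and that the residue field is [k]. *)
Definition clos S r (u : 'I_r -> F) := forall s, S s -> exists2 c, k c & igen S u (s - c).

Section Local.
Variables (S : F -> Prop) (r : nat) (u : 'I_r -> F).
Hypotheses (hS : subr S) (SN : noeth S) (SV : forall x, S x -> V x) (kS : forall c, k c -> S c).
Hypotheses (Sinv : forall x, S x -> vu V x -> S x^-1).
Hypotheses (Su : forall i, S (u i)) (um : forall i, vm V (u i)) (Sc : clos S u).

Lemma clos_vm x : S x -> vm V x -> igen S u x.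
move=> Sx xm; have [c kc hc] := Sc Sx; suff c0 : c = 0 by rewrite c0 subr0 in hc.
apply: k_vm => //; rewrite -[c](subKr x); apply: vmB => //.
exact: igen_vm hc.
Qed.

Lemma clos_lead n x : ipow S u n x -> exists2 h, ipow k u n h & ipow S u n.+1 (x - h).
elim: n x => [|n ih] x; first exact: Sc.
move=> [b hbb ->].
have step i : {h | ipow k u n h /\ ipow S u n.+1 (b i - h)}.
 by apply: cid; have [h h1 h2] := ih _ (hbb i); exists h.
exists (\sum_i sval (step i) * u i).
 by exists (fun i => sval (step i)) => // i; case: (svalP (step i)).
exists (fun i => b i - sval (step i)) => [i|]; first by case: (svalP (step i)).
by rewrite -sumrB; apply: eq_bigr => i _; rewrite mulrBl.
Qed.

Definition expansion x (c : 'X_{1..r} -> F) :=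
 (forall m, k (c m)) /\
 forall n, ipow S u n (x - \sum_(m : 'X_{1..r < n}) c m * mev u m).

Lemma expansionP x : S x -> exists c, expansion x c.
move=> Sx.
have step n z : {P : {mpoly F[r]} | ipow S u n z -> mform k n P /\ ipow S u n.+1 (z - P.@[u])}.
 apply: cid; have [h|h] := pselect (ipow S u n z); last by exists 0.
 have [w hw hz] := clos_lead h; have [P hP eP] := ipow_mform ks hw.
 by exists P => _; rewrite -eP.
pose rem := fix rem n := if n is n'.+1 then rem n' - (sval (step n' (rem n'))).@[u] else x.
have hrem n : ipow S u n (rem n).
 by elim: n => // n ih; case: (svalP (step n (rem n)) ih).
pose P n := sval (step n (rem n)).
have hP n : mform k n (P n) by case: (svalP (step n (rem n)) (hrem n)).
exists (fun m => (P (mdeg m))@_m); split=> [m|n]; first by case: (hP (mdeg m) m).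
suff <- : rem n = x - \sum_(m : 'X_{1..r < n}) (P (mdeg m))@_m * mev u m by [].
have {hrem} e : rem n = x - \sum_(i < n) (P i).@[u].
 elim: n => [|n ih]; first by rewrite big_ord0 subr0.
 by rewrite big_ord_recr opprD addrA -ih.
rewrite e; congr (_ - _).
transitivity (\sum_(i < n) \sum_(m : 'X_{1..r < n} | mdeg m == i) (P i)@_m * mev u m).
 apply: eq_bigr => i _.
 have sz : (msize (P i) <= n)%N.
  rewrite msizeE; apply/bigmax_leqP_seq => m; rewrite mcoeff_msupp => hm _.
  by have [_ /(_ hm) ->] := hP i m; exact: ltn_ord i.
 rewrite {1}(mpolywE sz) raddf_sum /= [RHS]big_mkcond /=; apply: eq_bigr => m _.
 rewrite mevalZ mevalX; case: ifP => [//|/negbT h].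
 suff -> : (P i)@_m = 0 by rewrite mul0r.
 by apply/eqP; apply: contraNT h => nz; have [_ /(_ nz) ->] := hP i (bmnm m).
rewrite (exchange_big_dep xpredT) //=; apply: eq_bigr => m _.
by rewrite (big_pred1 (Ordinal (bmdeg m))) //.
Qed.

(** Ideals are closed for the topology of the powers of [(u)]: the factor [1 - t] in Krull's theorem
    is invertible in [S]. *)
Lemma clos_krull J x : ideal S J -> (forall z, J z -> S z) -> S x ->
 (forall n, exists2 z, J z & ipow S u n (x - z)) -> J x.
move=> hJ JS Sx hx; have [t ht hJt] := krull_intersection hS Su SN hJ JS Sx hx.
have tm : vm V t by exact: igen_vm ht.
have St : S t by case: ht => b hbb ->; apply: sr_sum => // i _; exact: srM.
have t1 := vm_one hV tm; have S1t : S (1 - t) by apply: srB => //; exact: sr1.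
case: hJ => _ _ hM; rewrite -[x](mulKf (vu_n0 t1)); apply: hM => //; exact: Sinv.
Qed.

Lemma ipow_mev m n : (n <= mdeg m)%N -> ipow S u n (mev u m).
move=> nm; apply: (ipow_le hS Su nm); rewrite mdegE /mev.
apply: (big_ind2 (fun a b => ipow S u a b)); first exact: sr1.
 by move=> n1 x1 n2 x2 h1 h2; exact: ipow_mul.
by move=> i _; apply: ipow_expr => //; exact: igen_mem.
Qed.

(** The monomials of the expansion generate an ideal; finitely many of them suffice, and [x] lies in
    it because ideals are closed. Distinct monomials have distinct values, so after the least one is
    subtracted, what remains lies in the closed ideal of strictly larger values. *)
Lemma expansion_min x c : vind V u -> S x -> x != 0 -> expansion x c ->
 exists s : seq 'X_{1..r}, exists2 m0, [/\ c m0 != 0, vu V (x / mev u m0) &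
   forall m, c m != 0 -> V (mev u m / mev u m0)] &
  [/\ m0 \in s, forall m, m \in s -> V (mev u m / mev u m0) & lin S [seq mev u m | m <- s] x].
move=> hu Sx x0 [kc hx]; have [u0 _] := hu.
have Sm m : S (mev u m) by exact: mev_sr.
have Scm m : S (c m * mev u m) by apply: srM => //; exact: kS.
have [z [m _ ->] //|t tP ht] := @noeth_subset _ S (fun z => exists2 m, c m != 0 & z = mev u m) hS SN.
have [s sP es] : exists2 s : seq 'X_{1..r}, (forall m, m \in s -> c m != 0) & t = [seq mev u m | m <- s].
 elim: t tP {ht} => [|z t ih] tP; first by exists [::].
 have [|s sP ->] := ih; first by move=> y yt; apply: tP; rewrite inE yt orbT.
 have [m cm ->] := tP z (mem_head _ _); exists (m :: s) => // m'.
 by rewrite inE => /orP[/eqP ->|/sP].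
subst t.
have part n (P : pred 'X_{1..r}) (J : F -> Prop) : ideal S J ->
  (forall m, c m != 0 -> P m -> J (mev u m)) -> J (\sum_(m : 'X_{1..r < n} | P m) c m * mev u m).
 move=> hJ h; apply: (ideal_sum _ hJ) => m Pm; have [cm|cm] := eqVneq (c m) 0.
  by rewrite cm mul0r; case: hJ.
 by case: (hJ) => _ _; apply; [exact: kS|exact: h].
have ls : lin S [seq mev u m | m <- s] x.
 have hL := @lin_ideal _ S hS [seq mev u m | m <- s].
 apply: (clos_krull hL) => // [z|n].
  apply: lin_min => [|y /mapP[m _ -> //]].
  by split; [exact: sr0|move=> ? ?; exact: srD|move=> ? ?; exact: srM].
 exists (\sum_(m : 'X_{1..r < n}) c m * mev u m) => //.
 by apply: (part n xpredT) => // m cm _; apply: ht; exists m.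
have s0 : s <> [::].
 by move=> s0; move: ls; rewrite s0 /= => /eqP; rewrite (negbTE x0).
have [i _|m0 m0s hmin] := v_argmin hV s0 (t := mev u); first exact: mev_n0.
have th0 : mev u m0 != 0 by exact: mev_n0.
have hV0 m : c m != 0 -> V (mev u m / mev u m0).
 move=> cm; have : lin S [seq mev u m | m <- s] (mev u m) by apply: ht; exists m.
 apply: (@lin_min _ S (fun z => V (z / mev u m0))) => [|_ /mapP[m' m's ->]]; last exact: hmin.
 split; first by rewrite mul0r; exact: sr0.
  by move=> ? ? ? ?; rewrite mulrDl; exact: srD.
 by move=> ? ? ? ?; rewrite -mulrA; apply: srM => //; exact: SV.
exists s, m0; split=> //; first exact: sP.

pose J z := S z /\ vm V (z / mev u m0).
have hJ : ideal S J.
 split; first by split; [exact: sr0|rewrite mul0r; left].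
  by move=> ? ? [h1 h2] [h3 h4]; split; [exact: srD|rewrite mulrDl; exact: vmD].
 by move=> ? ? h1 [h2 h3]; split; [exact: srM|rewrite -mulrA; apply: vmMr => //; exact: SV].
pose w := x - c m0 * mev u m0.
have [|n|_ hw] := clos_krull hJ (fun z h => proj1 h) (x := w).
- by apply: srB.
(* The extra [mdeg m0 + 1] guarantees that [m0] itself occurs in the truncated sum. *)
- set N := (n + (mdeg m0).+1)%N.
 exists (\sum_(m : 'X_{1..r < N} | bmnm m != m0) c m * mev u m).
  apply: (part N (fun m => m != m0)) => // m cm mm0; split=> //.
  case: (vm_or_vu (hV0 _ cm)) => //.
  by move=> /(vind_neq hu) e; rewrite e eqxx in mm0.
 have m0N : (mdeg m0 < N)%N by rewrite /N addnS ltnS leq_addl.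
 have := hx N; rewrite (bigD1 (BMultinom m0N)) //= opprD addrA; apply: ipow_le => //.
 exact: leq_addr.
have -> : x / mev u m0 = c m0 + w / mev u m0 by rewrite /w mulrBl mulfK // addrC subrK.
by apply: vuDm => //; apply: k_unit => //; exact: sP.
Qed.

Lemma value_monomial x : vind V u -> S x -> x != 0 ->
 exists s : seq 'X_{1..r}, exists m0, [/\ vu V (x / mev u m0), m0 \in s,
  forall m, m \in s -> V (mev u m / mev u m0) & lin S [seq mev u m | m <- s] x].
move=> hu Sx x0; have [c hc] := expansionP Sx.
by have [s [m0 [? ? ?] [? ? ?]]] := expansion_min hu Sx x0 hc; exists s, m0.
Qed.
End Local.

(** Generators [X] and parameters [u] are kept apart: extensions enlarge [X], whereas the parameters
    are only exchanged and always remain [r] in number. *)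
Definition mring X r (u : 'I_r -> F) := loc V (adjs A (X ++ [seq u i | i : 'I_r])).

Lemma mring_subr X r (u : 'I_r -> F) : subr (mring X u).
Proof. by apply: loc_subr => //; exact: adjs_subr. Qed.

Lemma mring_A X r (u : 'I_r -> F) x : A x -> mring X u x.
Proof. by move=> Ax; apply: loc_base; [|apply: adjs_subr|apply: adjs_base]. Qed.

Lemma mring_X X r (u : 'I_r -> F) x : x \in X -> mring X u x.
move=> Xx; apply: loc_base => //; first exact: adjs_subr.
by apply: adjs_gen => //; rewrite mem_cat Xx.
Qed.

Lemma mring_u X r (u : 'I_r -> F) i : mring X u (u i).
apply: loc_base => //; first exact: adjs_subr.
by apply: adjs_gen => //; rewrite mem_cat map_f ?orbT // mem_enum.
Qed.

Lemma mring_noeth X r (u : 'I_r -> F) : noeth (mring X u).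
Proof. by apply: noeth_loc => //; [exact: adjs_subr|exact: noeth_adjs]. Qed.

Lemma mring_inv X r (u : 'I_r -> F) x : mring X u x -> vu V x -> mring X u x^-1.
Proof. by apply: loc_inv. Qed.

Lemma mring_min X r (u : 'I_r -> F) S : subr S -> (forall x, A x -> S x) ->
 (forall x, x \in X -> S x) -> (forall i, S (u i)) -> (forall x, S x -> vu V x -> S x^-1) ->
 forall x, mring X u x -> S x.
move=> hS AS XS uS Si; have h : forall x, adjs A (X ++ [seq u i | i : 'I_r]) x -> S x.
 by apply: adjs_min => // x; rewrite mem_cat => /orP[/XS //|/mapP[i _ ->]].
by apply: loc_min => // x /h; exact: Si.
Qed.

Lemma mring_V X r (u : 'I_r -> F) x : (forall z, z \in X -> V z) -> (forall i, vm V (u i)) ->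
 mring X u x -> V x.
move=> XV um; apply: mring_min => // [i|z _ [] //]; exact: vm_V.
Qed.

(** Elements congruent to a constant modulo [(u)] form a ring that is stable under inverting units,
    so checking the generators is enough. *)
Lemma clos_gen X r (u : 'I_r -> F) : (forall z, z \in X -> V z) -> (forall i, vm V (u i)) ->
 (forall a, A a -> exists2 c, k c & igen (mring X u) u (a - c)) ->
 (forall x, x \in X -> exists2 c, k c & igen (mring X u) u (x - c)) ->
 clos (mring X u) u.
move=> XV um hAc hXc; set S := mring X u in hAc hXc *.
have hS : subr S := mring_subr X u.
have Su : forall i, S (u i) := mring_u X u.
have SV : forall z, S z -> V z by move=> z; exact: mring_V.
pose T x := S x /\ exists2 c, k c & igen S u (x - c).
have hT : subr T.
 split.
 - by split; [exact: sr1 | exists 1; rewrite ?subrr; [exact: sr1|exact: igen0]].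
 - move=> x y [Sx [c kc hc]] [Sy [d kd hd]]; split; first exact: srB.
  exists (c - d); first exact: srB.
  have -> : x - y - (c - d) = (x - c) - (y - d) by ring.
  exact: igenB.
 - move=> x y [Sx [c kc hc]] [Sy [d kd hd]]; split; first exact: srM.
  exists (c * d); first exact: srM.
  have -> : x * y - c * d = y * (x - c) + c * (y - d) by ring.
  by apply: igenD => //; apply: igenM => //; apply: mring_A; exact: kA.
move=> s Ss; suff [] : T s by [].
apply: (mring_min hT) Ss => [x Ax|x Xx|i|x [Sx [c kc hc]] hx].
- by split; [exact: mring_A|exact: hAc].
- by split; [exact: mring_X|exact: hXc].
- by split=> //; exists 0; [exact: sr0|rewrite subr0; exact: igen_mem].
- have c0 : c != 0.
  apply/eqP => c0; rewrite c0 subr0 in hc; apply: vm_nvu hx; exact: igen_vm hc.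
 have Si := mring_inv Sx hx; split=> //; exists c^-1; first exact: sfV.
 have -> : x^-1 - c^-1 = - (x^-1 * c^-1) * (x - c) by field; rewrite c0 (vu_n0 hx).
 apply: igenM => //; apply: srN => //; apply: srM => //; apply: mring_A.
 by apply: kA; exact: sfV.
Qed.

Definition model X r (u : 'I_r -> F) :=
 [/\ vind V u, forall i, vm V (u i), forall x, x \in X -> V x & clos (mring X u) u].

(** Only the field is recorded, because the ring and its parameters are modified at every step. *)
Definition good r M := exists X, exists2 u : 'I_r -> F, model X u &
 forall x, M x <-> frac (mring X u) x.

Lemma model_value X r (u : 'I_r -> F) x : model X u -> mring X u x -> x != 0 ->
 exists s : seq 'X_{1..r}, exists m0, [/\ vu V (x / mev u m0), m0 \in s,
  forall m, m \in s -> V (mev u m / mev u m0) & lin (mring X u) [seq mev u m | m <- s] x].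
move=> [hu um XV hc]; apply: value_monomial => //; first exact: mring_subr.
- exact: mring_noeth.
- by move=> z; exact: mring_V.
- by move=> c /kA; exact: mring_A.
- by move=> z; exact: mring_inv.
- by move=> i; exact: mring_u.
Qed.

(** A toric modification. Each family is expressed by the other, so the exponent matrix is
    unimodular when the values of [u] are independent; only the exponents of [u] in [w] must be
    nonnegative, which is why the ring grows. *)
Definition tor r (u w : 'I_r -> F) := [/\ vind V w, forall i, vm V (w i),
 forall i, exists m : 'X_{1..r}, u i = mev w m &
 forall i, exists a : 'I_r -> int, w i = zev u a].

Lemma tor_mev r (u w : 'I_r -> F) m : tor u w -> exists m', mev u m = mev w m'.
move=> [_ _ hm _]; rewrite /mev; apply: (big_ind (fun x => exists m', x = mev w m')).
- by exists 0%MM; rewrite mev0.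
- by move=> _ _ [m1 ->] [m2 ->]; exists (m1 + m2)%MM; rewrite mevD.
- move=> i _; have [m' ->] := hm i; elim: (m i) => [|n [m1 e]].
  by exists 0%MM; rewrite mev0 expr0.
 by exists (m' + m1)%MM; rewrite mevD exprS e.
Qed.

Lemma zevD r (u : 'I_r -> F) a b : (forall i, u i != 0) ->
 zev u a * zev u b = zev u (fun i => a i + b i).
Proof. by move=> u0; rewrite -big_split; apply: eq_bigr => i _; rewrite /= expfzDr. Qed.

Lemma zevZ r (u : 'I_r -> F) a (n : int) : zev u a ^ n = zev u (fun i => a i * n).
rewrite /zev (big_morph (fun x : F => x ^ n) (fun x y => expfzMl x y n) (exp1rz _ n)).
by apply: eq_bigr => i _; rewrite exprz_exp.
Qed.

Lemma tor_zev r (u w : 'I_r -> F) a : (forall i, u i != 0) -> tor u w ->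
 exists b, zev w a = zev u b.
move=> u0 [_ _ _ hz]; rewrite {1}/zev; apply: (big_ind (fun x => exists b, x = zev u b)).
- by exists (fun=> 0); rewrite /zev big1 // => i _; rewrite expr0z.
- by move=> _ _ [m1 ->] [m2 ->]; eexists; exact: zevD.
- by move=> i _; have [b ->] := hz i; eexists; exact: zevZ.
Qed.

Lemma tor_refl r (u : 'I_r -> F) : vind V u -> (forall i, vm V (u i)) -> tor u u.
move=> hu um; split=> // i; first by exists U_(i)%MM; rewrite mevU.
by exists (fun j => (j == i)%:Z); rewrite zevU.
Qed.

Lemma tor_trans r (u w z : 'I_r -> F) : vind V u -> tor u w -> tor w z -> tor u z.
move=> [u0 _] h1 h2; have [hz zm _ h4] := h2; split=> // i.
 by case: h1 => _ _ h _; have [m ->] := h i; exact: tor_mev h2.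
by have [a ->] := h4 i; exact: tor_zev.
Qed.

(** A monomial blow-up, with [u i] replaced by [u i / u j]. The quotient cannot be a unit because
    the values are independent, so it is again a parameter. *)
Lemma tor_move r (u : 'I_r -> F) i j : vind V u -> (forall l, vm V (u l)) -> i != j ->
 V (u i / u j) -> exists2 w, tor u w & forall a, zev u a =
  zev w (fun l => if l == j then a i + a j else a l).
move=> [u0 ui] um ij hij.
pose w l := if l == i then u i / u j else u l.
have w0 l : w l != 0 by rewrite /w; case: ifP => // _; rewrite mulf_neq0 ?invr_eq0.
have ji : (j == i) = false by rewrite eq_sym (negbTE ij).
have key a : zev u a = zev w (fun l => if l == j then a i + a j else a l).
 rewrite /zev (bigD1 j) // (bigD1 i) //= [RHS](bigD1 j) // [in RHS](bigD1 i) //=.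
 rewrite /w eqxx ji eqxx (negbTE ij) expfzDr // !mulrA; congr (_ * _); last first.
  by apply: eq_bigr => l /andP[/negbTE -> /negbTE ->].
 rewrite expfzMl exprz_inv -!mulrA [RHS]mulrCA; congr (_ * _).
 by rewrite mulrCA -expfzDr // subrr expr0z mulr1.
have key' a : zev w a = zev u (fun l => if l == j then a j - a i else a l).
 rewrite key; apply: eq_bigr => l _; rewrite eqxx (negbTE ij); case: eqP => [->|//].
 by congr (_ ^ _); ring.
have wij : vm V (u i / u j).
 case: (vm_or_vu hij) => // h; exfalso.
 have := ui (fun l => (l == i)%:Z - (l == j)%:Z); rewrite -/(zev u _) zev_div //.
 by rewrite !zevU => /(_ h i); rewrite eqxx (negbTE ij).
exists w => //; split.
- split=> // a; rewrite -/(zev w a) key' => /ui h l; have := h l; case: eqP => [->|//].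
 by have := h i; rewrite (negbTE ij) => ->; rewrite subr0.
- by move=> l; rewrite /w; case: ifP.
- move=> l; have [->|li] := eqVneq l i.
  exists (U_(i) + U_(j))%MM; rewrite mevD !mevU /w eqxx ji divfK //.
 by exists U_(l)%MM; rewrite mevU /w (negbTE li).
- move=> l; rewrite /w; case: ifP => _.
  by exists (fun o : 'I_r => (o == i)%:Z - (o == j)%:Z); rewrite zev_div // !zevU.
 by exists (fun o : 'I_r => (o == l)%:Z); rewrite zevU.
Qed.

(* Each move either lowers an exponent of maximal absolute value, or brings an
  exponent of the opposite sign closer to the sign of a maximal one. *)
Lemma perron1 r N n (u : 'I_r -> F) (a : 'I_r -> int) :
 vind V u -> (forall l, vm V (u l)) -> V (zev u a) ->
 (forall l, `|a l| <= N)%N -> (#|[pred l | `|a l| == N]| <= n)%N ->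
 exists2 w, tor u w & exists m, zev u a = mev w m.
elim: N n u a => [|N ihN] n u a hu um hV' aN cN.
 exists u; first exact: tor_refl.
 exists 0%MM; rewrite mev0 /zev big1 // => i _.
 by have := aN i; rewrite leqn0 absz_eq0 => /eqP ->; rewrite expr0z.
elim: n u a hu um hV' aN cN => [|n ihn] u a hu um hV' aN cN.
 apply: (ihN r) => // [l|]; last by rewrite -[X in (_ <= X)%N]card_ord max_card.
 have := aN l; rewrite leq_eqVlt => /orP[h|//]; exfalso.
 by move: cN; rewrite leqn0 => /eqP/card0_eq/(_ l); rewrite inE h.
have [[i ai]|hno] := pselect (exists i, `|a i|%N = N.+1); last first.
 apply: ihn => //; rewrite (eq_card0 _) // => l; rewrite inE.
 by apply/negP => /eqP h; apply: hno; exists l.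
have [o] := ubnP #|[pred l | a l * a i < 0]|.
elim: o u a hu um hV' aN cN ai => // o iho u a hu um hV' aN cN ai; rewrite ltnS => co.
have [[j aj]|hno] := pselect (exists j, a j * a i < 0); last first.
 have h j : 0 <= a j * a i by rewrite leNgt; apply/negP => h; apply: hno; exists j.
 exists u; first exact: tor_refl.
 have [pi|ni] : 0 < a i \/ a i < 0 by have : a i != 0; [rewrite -absz_eq0 ai | lia].
  exists [multinom `|a l|%N | l < r]; rewrite -zev_nat; apply: eq_bigr => l _.
  rewrite mnmE; congr (_ ^ _); have := h l; nia.
 exfalso; have [u0 _] := hu.
 have e : zev u a * mev u [multinom `|a l|%N | l < r] = 1.
  rewrite -zev_nat zevD // /zev big1 // => l _; rewrite mnmE.
  have -> : a l + `|a l|%N%:Z = 0 by have := h l; nia.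
  exact: expr0z.
 have m0 : [multinom `|a l|%N | l < r] != 0%MM.
  by apply/eqP => /mnmP/(_ i); rewrite mnmE ai mnm0E.
 have := vmMr hV hV' (mev_vm um m0); rewrite e => h1; apply: (vm_nvu h1); exact: vu1.
have ij : i != j by apply/eqP => e; move: aj; rewrite e; nia.
have aji : (`|(a i + a j)%R| < N.+1)%N by have := aN j; nia.
have [u0 _] := hu.
have [hij|hji] := proj2 hV (u i / u j); last first.
 rewrite invf_div in hji.
 have [|w tw ew] := tor_move hu um _ hji; first by rewrite eq_sym.
 have [hw wm _ _] := tw.
 rewrite ew; set b := (X in zev w X); have [|||w' tw' ?] := ihn w b hw wm.
 - by rewrite -ew.
 - by move=> l; rewrite /b; case: ifP => // _; rewrite addrC ltnW.
 - have : (#|[pred l | `|b l|%N == N.+1]| < #|[pred l | `|a l|%N == N.+1]|)%N.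
   apply: (@card_pred_lt _ _ _ i) => [l||] /=; rewrite ?ai // /b; last first.
    by rewrite eqxx addrC neq_ltn aji.
   by case: ifP => // _; rewrite addrC => /eqP h; rewrite h ltnn in aji.
  by move=> h; rewrite -ltnS; exact: leq_trans h cN.
 by exists w' => //; exact: tor_trans tw tw'.
have [w tw ew] := tor_move hu um ij hij; have [hw wm _ _] := tw.
rewrite ew; set b := (X in zev w X).
have bi : b i = a i by rewrite /b (negbTE ij).
have [|||||w' tw' ?] := iho w b hw wm.
- by rewrite -ew.
- by move=> l; rewrite /b; case: ifP => // _; exact: ltnW.
- apply: leq_trans cN; apply: card_pred_le => l /=; rewrite /b.
 by case: ifP => // _ /eqP h; rewrite h ltnn in aji.
- by rewrite bi.
- rewrite bi; apply: leq_trans co; apply: (@card_pred_lt _ _ _ j) => [l||] //=; rewrite /b.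
  by case: eqP => // ->.
 by rewrite eqxx; have := aN j; nia.
by exists w' => //; exact: tor_trans tw tw'.
Qed.

Lemma perron r (u : 'I_r -> F) (s : seq ('I_r -> int)) : vind V u -> (forall l, vm V (u l)) ->
 (forall i, (i < size s)%N -> V (zev u (nth (fun=> 0) s i))) ->
 exists2 w, tor u w & forall i, (i < size s)%N -> exists m, zev u (nth (fun=> 0) s i) = mev w m.
move=> hu um; elim: s => [|a s ih] hs; first by exists u => //; exact: tor_refl.
have [i hi|w tw hw] := ih; first exact: (hs i.+1).
have [hww wm _ hz] := tw; have [u0 _] := hu; have [w0 _] := hww.
have [b eb] : exists b, zev u a = zev w b.
 rewrite {1}/zev; apply: (big_ind (fun x => exists b, x = zev w b)).
 - by exists (fun=> 0); rewrite /zev big1 // => i _; rewrite expr0z.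
 - by move=> _ _ [m1 ->] [m2 ->]; eexists; exact: zevD.
 - move=> i _; case: tw => _ _ hm _; have [m ->] := hm i; rewrite -zev_nat.
  by eexists; exact: zevZ.
have [N hN] : exists N, forall l, (`|b l| <= N)%N.
 by exists (\max_l `|b l|)%N => l; exact: leq_bigmax.
have [|w' tw' [m em]] := @perron1 r N _ w b hww wm _ hN (leqnn _).
 by rewrite -eb; exact: (hs 0%N).
exists w'; first exact: tor_trans tw tw'.
move=> [|i] /= hi; first by exists m; rewrite eb.
by have [m' ->] := hw i hi; exact: tor_mev tw'.
Qed.

Lemma tor_sub X r (u w : 'I_r -> F) x : tor u w -> mring X u x -> mring X w x.
move=> [_ _ hm _]; apply: mring_min; first exact: mring_subr.
- by move=> z; exact: mring_A.
- by move=> z; exact: mring_X.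
- by move=> i; have [m ->] := hm i; apply: mev_sr; [exact: mring_subr|exact: mring_u].
- by move=> z; exact: mring_inv.
Qed.

Lemma igen_trans S S' (I J : finType) (u : I -> F) (w : J -> F) x : subr S' ->
 (forall z, S z -> S' z) -> (forall i, igen S' w (u i)) -> igen S u x -> igen S' w x.
Proof. by move=> hS' SS' h [b hb ->]; apply: igen_sum => // i _; apply: igenM => //; exact: SS'. Qed.

Lemma tor_model X r (u w : 'I_r -> F) : model X u -> tor u w -> model X w.
move=> [hu um XV hc] tw; have [hw wm hm _] := tw; split=> //.
have key x : igen (mring X u) u x -> igen (mring X w) w x.
 apply: igen_trans; [exact: mring_subr|by move=> z; exact: tor_sub |].
 move=> i; have [m em] := hm i; rewrite em; apply: mev_igen; [exact: mring_subr|exact: mring_u|].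
 apply/eqP => m0; have := um i; rewrite em m0 mev0 => h; apply: (vm_nvu h); exact: vu1.
apply: clos_gen => // x hx.
 by have [c kc' /key h] := hc _ (mring_A X u hx); exists c.
by have [c kc' /key h] := hc _ (mring_X u hx); exists c.
Qed.

Lemma tor_frac X r (u w : 'I_r -> F) x : (forall i, u i != 0) -> tor u w ->
 frac (mring X w) x <-> frac (mring X u) x.
move=> u0 tw; have [_ _ _ hz] := tw; split.
 apply: frac_min; first exact: frac_sfield (mring_subr X u).
 have hK := frac_sfield (mring_subr X u).
 have b z : mring X u z -> frac (mring X u) z by apply: frac_base; exact: mring_subr.
 apply: mring_min; first by case: hK.
 - by move=> z Az; apply: b; exact: mring_A.
 - by move=> z Az; apply: b; exact: mring_X.
 - move=> i; have [a ->] := hz i; apply: sr_prod => [|j _]; first by case: hK.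
  have hj : frac (mring X u) (u j) by apply: b; exact: mring_u.
  case: (a j) => n; rewrite ?NegzE -?exprnN; [|apply: sfV => //]; apply: srX => //; by case: hK.
 - by move=> z hz' _; exact: sfV.
apply: frac_min; first exact: frac_sfield (mring_subr X w).
by move=> z hz'; apply: frac_base; [exact: mring_subr|exact: tor_sub tw hz'].
Qed.

(** Numerator and denominator are each a dominating monomial times a unit, the unit being a
    combination of Laurent monomials that lie in [V]. These, and the quotient of the two dominating
    monomials, become true monomials by one run of Perron's algorithm. *)
Lemma monomialize1 X r (u : 'I_r -> F) z : model X u -> V z -> frac (mring X u) z ->
 exists2 w, tor u w & mring X w z.
move=> hm Vz [a [b [Sa Sb b0 ez]]]; have [hu um XV hc] := hm; have [u0 _] := hu.
have [a0|a0] := eqVneq a 0.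
 by exists u; [exact: tor_refl|rewrite ez a0 mul0r; apply: sr0; exact: mring_subr].
have [sa [ma [va mas ha la]]] := model_value hm Sa a0.
have [sb [mb [vb mbs hb lb]]] := model_value hm Sb b0.
pose d (m m' : 'X_{1..r}) (i : 'I_r) : int := (m i)%:Z - (m' i)%:Z.
pose s := d ma mb :: [seq d m ma | m <- sa] ++ [seq d m mb | m <- sb].
have ed m m' : zev u (d m m') = mev u m / mev u m' by rewrite zev_div // !zev_nat.
have hs i : (i < size s)%N -> V (zev u (nth (fun=> 0) s i)).
 pose P (f : 'I_r -> int) := V (zev u f).
 have h1 : P (d ma mb).
  rewrite /P ed; have -> : mev u ma / mev u mb = z * ((b / mev u mb) / (a / mev u ma)).
   by rewrite ez; field; rewrite a0 b0 !mev_n0.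
  by apply: srM => //; apply: vu_V; exact: vu_div.
 case: i => //= i; rewrite size_cat !size_map nth_cat !size_map => hi; case: ifP => h.
  by rewrite (nth_map 0%MM) // ed; apply: ha; exact: mem_nth.
 rewrite (nth_map 0%MM) ?ed; last by rewrite ltn_subLR // leqNgt h.
 by apply: hb; apply: mem_nth; rewrite ltn_subLR // leqNgt h.
have [w tw hw] := perron hu um hs.
exists w => //; have hS := mring_subr X w.
have sub x : mring X u x -> mring X w x by exact: tor_sub.
have mS m : mring X w (mev w m) by apply: mev_sr => //; exact: mring_u.
have h1 : mring X w (mev u ma / mev u mb).
 by have [m e] := hw 0%N isT; rewrite -ed e.
have key x m0 t : (forall m, m \in t -> exists m', zev u (d m m0) = mev w m') ->
  lin (mring X u) [seq mev u m | m <- t] x -> mring X w (x / mev u m0).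
 move=> ht; apply: (@lin_min _ (mring X u) (fun x => mring X w (x / mev u m0))).
  split; first by rewrite mul0r; exact: sr0.
   by move=> p q h3 h4; rewrite mulrDl; exact: srD.
  by move=> p q h3 h4; rewrite -mulrA; apply: srM => //; exact: sub.
 by move=> _ /mapP[m mt ->]; have [m' e] := ht m mt; rewrite -ed e.
have ha' : mring X w (a / mev u ma).
 apply: key la => m mt; have := hw (index m sa).+1.
 rewrite /s /= nth_cat size_cat !size_map index_mem mt (nth_map 0%MM) ?index_mem // nth_index //.
 by apply; rewrite ltnS ltn_addr // index_mem.
have hb' : mring X w (b / mev u mb).
 apply: key lb => m mt; have := hw (size sa + index m sb).+1.
 have e : (size sa + index m sb < size sa)%N = false by rewrite ltnNge leq_addr.
 rewrite /s /= nth_cat size_cat !size_map e addKn (nth_map 0%MM) ?index_mem // nth_index //.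
 by apply; rewrite ltnS ltn_add2l index_mem.
have -> : z = (mev u ma / mev u mb) * ((a / mev u ma) * (b / mev u mb)^-1).
 by rewrite ez; field; rewrite b0 !mev_n0.
by apply: srM => //; apply: srM => //; exact: mring_inv.
Qed.

Lemma monomialize X r (u : 'I_r -> F) (Z : seq F) : model X u ->
 (forall z, z \in Z -> V z /\ frac (mring X u) z) ->
 exists2 w, tor u w & forall z, z \in Z -> mring X w z.
move=> hm; have [hu um _ _] := hm; have [u0 _] := hu.
elim: Z => [|z Z ih] hZ; first by exists u => //; exact: tor_refl.
have [|w tw hw] := ih; first by move=> x xZ; apply: hZ; rewrite inE xZ orbT.
have [Vz fz] := hZ z (mem_head _ _).
have [|w' tw' hz] := monomialize1 (tor_model hm tw) Vz; first by apply/(tor_frac _ _ u0 tw).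
exists w'; first exact: tor_trans tw tw'.
move=> x; rewrite inE => /orP[/eqP -> //|/hw h]; exact: tor_sub tw' h.
Qed.
End Models.

(** * Goodness along etale, ramified and descending extensions *)

Section Extensions.
Variables (F : fieldType) (V k A : F -> Prop).
Hypotheses (hV : vring V) (hk : sfield k) (kV : forall c, k c -> V c).
Hypothesis kres : forall x, V x -> exists2 c, k c & vm V (x - c).
Hypotheses (hA : subr A) (kA : forall c, k c -> A c) (AV : forall x, A x -> V x) (AN : noeth A).
Implicit Types (S M : F -> Prop) (x z : F) (X : seq F).
Let ks : subr k := proj1 hk.
Let Vs : subr V := proj1 hV.

Lemma zev_sf K r (u : 'I_r -> F) a : sfield K -> (forall i, K (u i)) -> K (zev u a).
move=> hK Ku; apply: sr_prod => [|i _]; first by case: hK.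
case: (a i) => n; rewrite ?NegzE -?exprnN; [|apply: sfV => //]; by apply: srX; first by case: hK.
Qed.

Lemma zev_inv S r (u : 'I_r -> F) a : subr S -> (forall i, S (u i)) -> (forall i, S (u i)^-1) -> S (zev u a).
move=> hS Su Sui; apply: sr_prod => // i _.
by case: (a i) => n; rewrite ?NegzE -?exprnN -?exprVn; exact: srX.
Qed.

Section Lattice.
Variables (r : nat) (u : 'I_r -> F) (e : nat).
Hypotheses (hu : vind V u) (e0 : (0 < e)%N).
Let u0 : forall i, u i != 0 := proj1 hu.

(** The value of [x] is [v / e] in the coordinates given by the values of [u]; the common
    denominator [e] keeps the vectors integral. *)
Definition lgr x (v : 'rV[int]_r) := vu V (x ^+ e / zev u (fun i => v ord0 i)).

Lemma lgr_n0 x v : lgr x v -> x != 0.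
move=> h; apply/eqP => x0; have := vu_n0 h.
by rewrite x0 expr0n eqn0Ngt e0 mul0r eqxx.
Qed.

Lemma lgr1 : lgr 1 0.
rewrite /lgr expr1n /zev big1 ?divr1; first exact: vu1.
by move=> i _; rewrite mxE expr0z.
Qed.

Lemma lgrM x y v w : lgr x v -> lgr y w -> lgr (x * y) (v + w).
move=> hx hy; have := vuM hV hx hy; rewrite /lgr; congr vu.
have -> : zev u (fun i => (v + w) ord0 i) = zev u (fun i => v ord0 i) * zev u (fun i => w ord0 i).
 by rewrite zevD //; apply: eq_bigr => i _; rewrite mxE.
by rewrite exprMn invfM mulrACA.
Qed.

Lemma lgrV x v : lgr x v -> lgr x^-1 (- v).
move=> hx; have := vu_inv hx; rewrite /lgr; congr vu.
have -> : zev u (fun i => (- v) ord0 i) = (zev u (fun i => v ord0 i))^-1.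
 rewrite /zev -prodfV; apply: eq_bigr => i _; rewrite mxE invr_expz //.
by rewrite invfM !invrK exprVn mulrC.
Qed.

Lemma lgrZ x v (n : int) : lgr x v -> lgr (x ^ n) (n *: v).
move=> hx; have hn m : lgr (x ^+ m) (m%:Z *: v).
 elim: m => [|m ih]; first by rewrite expr0 scale0r; exact: lgr1.
 by rewrite exprS intS scalerDl scale1r; exact: lgrM.
case: n => m; first exact: hn.
by rewrite NegzE -exprnN scaleNr; apply: lgrV; exact: hn.
Qed.

Lemma lgr_zev N (g : 'I_N -> F) (C : 'M[int]_(N, r)) b :
 (forall j, lgr (g j) (row j C)) -> lgr (zev g b) (\sum_j b j *: row j C).
move=> h; rewrite /zev; apply: (big_ind2 lgr) => [|x v y w|j _]; [exact: lgr1|exact: lgrM|exact: lgrZ].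
Qed.

Lemma lgr_unit x : lgr x 0 -> vu V x.
rewrite /lgr /zev big1 ?divr1 => [h|i _]; last by rewrite mxE expr0z.
case: (e) e0 h => // m _ h; apply: (vuX_inv hV _ h).
by apply/eqP => x0; have := vu_n0 h; rewrite x0 expr0n eqxx.
Qed.

Lemma lgr_uniq x v : lgr x v -> vu V x -> v = 0.
move=> h hx; apply/rowP => i; rewrite mxE; apply: (proj2 hu (fun i => v ord0 i)).
have := vu_div hV (vuX hV e hx) h; congr vu.
by rewrite invf_div mulrC divfK // expf_neq0 // (vu_n0 hx).
Qed.
End Lattice.

(** The values of the [g j] span a lattice that contains the one of the [u i] with finite index.
    Smith normal form provides a basis of it, and inverting some members makes all values
    positive. *)
Lemma overlattice r (u : 'I_r -> F) N (g : 'I_N -> F) : vind V u ->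
 (forall i, exists j, u i = g j) ->
 (forall j, exists n, exists a, vu V (g j ^+ n.+1 / zev u a)) ->
 exists w : 'I_r -> F, [/\ vind V w, forall i, vm V (w i),
  forall i, exists b, w i = zev g b & forall j, exists a, vu V (g j / zev w a)].
move=> hu ug hg; have [u0 _] := hu.
suff [w [hw wg gw]] : exists w : 'I_r -> F, [/\ vind V w,
  forall i, exists b, w i = zev g b & forall j, exists a, vu V (g j / zev w a)].
 have [w0 wi] := hw.
 have sg i : {s : int | s * s = 1 /\ vm V (w i ^ s)}.
  apply: cid; case: (v_tri V (w0 i)) => h; first by exists 1; rewrite expr1z.
   have := wi (fun j => (j == i)%:Z); rewrite -/(zev w _) zevU => /(_ h i).
   by rewrite eqxx.
  by exists (-1); rewrite exprN1.
 pose s i := sval (sg i).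
 have ss i : s i * s i = 1 by case: (svalP (sg i)).
 have zs a : zev (fun i => w i ^ s i) a = zev w (fun i => s i * a i).
  by apply: eq_bigr => i _; rewrite exprz_exp.
 exists (fun i => w i ^ s i); split.
 - split=> [i|a]; first by rewrite expfz_neq0.
  rewrite -/(zev _ a) zs => /wi h i; have := h i => /(congr1 (fun n => s i * n)).
  by rewrite mulrA ss mul1r mulr0.
 - by move=> i; case: (svalP (sg i)).
 - by move=> i; have [b ->] := wg i; eexists; exact: zevZ.
 - move=> j; have [a ha] := gw j; exists (fun i => s i * a i); rewrite zs.
  rewrite (_ : zev w _ = zev w a) //; apply: eq_bigr => i _.
  by rewrite mulrA ss mul1r.
have hn j : {na : nat * ('I_r -> int) | vu V (g j ^+ na.1.+1 / zev u na.2)}.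
 by apply: cid; have [n [a h]] := hg j; exists (n, a).
pose n j := (sval (hn j)).1.+1; pose e := (\prod_j n j)%N.
have e0 : (0 < e)%N by apply: prodn_gt0.
pose C : 'M[int]_(N, r) := \matrix_(j, i) ((sval (hn j)).2 i * (\prod_(l | l != j) n l)%N%:Z).
have hC j : lgr u e (g j) (row j C).
 have hj := svalP (hn j); rewrite /lgr /e (bigD1 j) //= exprM.
 have := vuX hV (\prod_(l | l != j) n l) hj; rewrite expr_div_n; congr vu; congr (_ / _).
 by rewrite exprnP zevZ; apply: eq_bigr => i _; rewrite !mxE.
have [L uL [R uR [d _ eC]]] := int_Smith_normal_form C.
set D := \matrix_(i, j) _ in eC.
(* A vanishing elementary divisor would give a nonzero vector killed by [C]; but each [u i] is among
   the [g j], so [C] has [e] times every unit vector among its rows. *)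
have col0 (i : 'I_r) : exists l : 'I_N, (l : nat) = i /\ d`_i != 0.
 apply: contrapT => hno.
 have Di : D *m delta_mx i ord0 = 0 :> 'cV[int]_N.
  apply/colP => l; rewrite !mxE big1 // => j _; rewrite !mxE eqxx andbT.
  have [->|_] := eqVneq j i; last by rewrite mulr0.
  rewrite mulr1; have [li|_] := eqVneq (l : nat) i; last by rewrite mulr0n.
  by rewrite mulr1n li; apply/eqP/negPn/negP => h; apply: hno; exists l.
 pose v : 'cV[int]_r := invmx R *m delta_mx i ord0.
 have Cv : C *m v = 0 by rewrite eC /v -!mulmxA (mulmxA R) mulmxV // mul1mx Di mulmx0.
 have v0 : v = 0.
  apply/colP => i'; rewrite mxE; have [j ej] := ug i'.
  have hj := hC j; rewrite -ej in hj.
  have hj' : lgr u e (u i') (e%:Z *: delta_mx ord0 i').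
   have h : vu V (u i' ^+ e / u i' ^+ e) by rewrite divff ?expf_neq0 //; exact: vu1.
   rewrite /lgr; move: h; congr vu; congr (_ / _).
   rewrite -[u i' in LHS](zevU u) exprnP zevZ; apply: eq_bigr => l _.
   by rewrite !mxE eqxx /= mulrC; case: eqP.
  have er : row j C = e%:Z *: delta_mx ord0 i'.
   have h1 := lgrM hu hj (lgrV hj'); rewrite divff // in h1.
   by apply/eqP; rewrite -subr_eq0; apply/eqP; apply: (lgr_uniq hu h1); exact: vu1.
  have := congr1 (fun m : 'cV[int]_N => m j ord0) Cv.
  have -> : (C *m v) j ord0 = (row j C *m v) ord0 ord0 by rewrite -row_mul [in RHS]mxE.
  rewrite er -scalemxAl -rowE mxE [row _ _ _ _]mxE [RHS]mxE => /eqP.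
  rewrite mulf_eq0 => /orP[/eqP h|/eqP h].
   by have := e0; rewrite -ltz_nat h ltxx.
  by rewrite [RHS]mxE -[RHS]h mxE.
 have : R *m v = 0 by rewrite v0 mulmx0.
 rewrite /v mulmxA mulmxV // mul1mx => /colP/(_ i).
 by rewrite !mxE !eqxx.
pose l i := sval (cid (col0 i)).
have li i : (l i : nat) = i by case: (svalP (cid (col0 i))).
have di (i : 'I_r) : d`_i != 0 by case: (svalP (cid (col0 i))).
pose w i := zev g (fun j => invmx L (l i) j).
have hw i : lgr u e (w i) (d`_i *: row i R).
 have := lgr_zev hu (fun j => invmx L (l i) j) hC; congr lgr.
 transitivity (row (l i) (invmx L *m C)).
  by apply/rowP => j; rewrite !mxE summxE; apply: eq_bigr => o _; rewrite !mxE.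
 rewrite eC -!mulmxA [invmx L *m _]mulmxA mulVmx // mul1mx.
 apply/rowP => j; rewrite !mxE (bigD1 i) //= !mxE li eqxx mulr1n big1 ?addr0 // => o oi.
 by rewrite !mxE li eq_sym -(inj_eq val_inj) /= in oi *; rewrite (negbTE oi) mulr0n mul0r.
have hwa a : lgr u e (zev w a) (\sum_i a i *: (d`_i *: row i R)).
 have := lgr_zev hu (e := e) (g := w) (C := \matrix_(i, j) (d`_i * R i j)) a; rewrite (eq_bigr (fun i => a i *: (d`_i *: row i R))).
  by apply=> // i; have := hw i; congr lgr; apply/rowP => j; rewrite !mxE.
 by move=> i _; congr (_ *: _); apply/rowP => j; rewrite !mxE.
exists w; split.
- split=> [i|a ha i]; first exact: lgr_n0 (hw i).
 have := lgr_uniq hu (hwa a) ha.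
 have -> : \sum_i a i *: (d`_i *: row i R) = (\row_i (a i * d`_i)) *m R.
  apply/rowP => j; rewrite !mxE summxE; apply: eq_bigr => o _; rewrite !mxE mulrA //.
 move=> /(congr1 (mulmx^~ (invmx R))); rewrite -mulmxA mulmxV // mulmx1 mul0mx => /rowP/(_ i).
 by rewrite !mxE => /eqP; rewrite mulf_eq0 (negbTE (di i)) orbF => /eqP.
- by move=> i; exists (fun j => invmx L (l i) j).
- move=> j; exists (fun i => L j (l i)).
 apply: (lgr_unit e0 (u := u)).
 have := lgrM hu (hC j) (lgrV (hwa (fun i => L j (l i)))); congr lgr.
 apply/eqP; rewrite subr_eq0; apply/eqP/rowP => o; rewrite [in LHS]eC mxE -mulmxA mxE summxE.
 have -> : \sum_i ((L j (l i) *: (d`_i *: row i R)) ord0 o) = \sum_i L j (l i) * (D *m R) (l i) o.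
  apply: eq_bigr => i _; rewrite !mxE (bigD1 i) //= !mxE li eqxx mulr1n big1 ?addr0 // => q qi.
  by rewrite !mxE li eq_sym -(inj_eq val_inj) /= in qi *; rewrite (negbTE qi) mulr0n mul0r.
 rewrite (bigID (fun q : 'I_N => (q < r)%N)) /= [X in _ + X]big1 ?addr0 => [|q qr]; last first.
  rewrite !mxE big1 ?mulr0 // => i _; rewrite !mxE gtn_eqF ?mulr0n ?mul0r //.
  by apply: leq_trans (ltn_ord i) _; rewrite leqNgt.
 rewrite (reindex_omap l (fun q : 'I_N => insub (q : nat))) /= => [|q qr]; last first.
  by rewrite insubT /=; congr Some; apply: val_inj; rewrite /= li.
 apply: eq_big => [i|i _]; first by rewrite li ltn_ord valK eqxx.
 by [].
Qed.

Local Notation mring := (mring V A).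
Local Notation model := (model V k A).
Local Notation good := (good V k A).

Lemma model_zev X r (u : 'I_r -> F) x : model X u -> frac (mring X u) x -> x != 0 ->
 exists a, vu V (x / zev u a).
move=> hm [a [b [Sa Sb b0 ->]]]; rewrite mulf_eq0 negb_or => /andP[a0 _].
have [[u0 _] _ _ _] := hm.
have [_ [ma [va _ _ _]]] := model_value hV hk kV hA kA AV AN hm Sa a0.
have [_ [mb [vb _ _ _]]] := model_value hV hk kV hA kA AV AN hm Sb b0.
exists (fun i => (ma i)%:Z - (mb i)%:Z); rewrite zev_div // !zev_nat.
have -> : a / b / (mev u ma / mev u mb) = (a / mev u ma) / (b / mev u mb).
 by field; rewrite b0 !mev_n0.
exact: vu_div.
Qed.

Lemma model_monomialize X r (u : 'I_r -> F) (Z : seq F) : model X u ->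
 (forall z, z \in Z -> V z /\ frac (mring X u) z) ->
 exists w : 'I_r -> F, [/\ tor V u w, model X w, forall z, z \in Z -> mring X w z,
  forall x, mring X u x -> mring X w x & forall x, frac (mring X w) x <-> frac (mring X u) x].
move=> hm hZ; have [w tw hw] := monomialize hV hk kV hA kA AV AN hm hZ.
have [[u0 _] _ _ _] := hm.
exists w; split=> //.
- exact: tor_model tw.
- by move=> x; exact: tor_sub.
- by move=> x; exact: tor_frac.
Qed.

Lemma mring_step X X' r r' (u : 'I_r -> F) (w : 'I_r' -> F) x : {subset X <= X'} ->
 (forall i, mring X' w (u i)) -> mring X u x -> mring X' w x.
move=> XX' uw; apply: mring_min => // [|z|z|z].
- exact: mring_subr.
- exact: mring_A.
- by move=> /XX'; exact: mring_X.
- exact: mring_inv.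
Qed.

Lemma clos_step X X' r (u w : 'I_r -> F) : model X u -> {subset X <= X'} ->
 (forall z, z \in X' -> V z) -> (forall i, vm V (w i)) -> (forall i, igen (mring X' w) w (u i)) ->
 (forall x, x \in X' -> x \notin X -> exists2 c, k c & igen (mring X' w) w (x - c)) ->
 clos k (mring X' w) w.
move=> [hu um XV hc] XX' X'V wm uw hX'.
have hS' := mring_subr hV hA X' w.
have sub x : mring X u x -> mring X' w x.
 apply: mring_step => // i.
 by have [b hb ->] := uw i; apply: sr_sum => // j _; apply: srM => //; exact: mring_u.
have key x : igen (mring X u) u x -> igen (mring X' w) w x by exact: igen_trans.
apply: clos_gen => // x hx.
 by have [c kc' /key h] := hc _ (mring_A hV hA X u hx); exists c.
have [h|h] := boolP (x \in X); last exact: hX'.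
by have [c kc' /key h'] := hc _ (mring_X hV hA u h); exists c.
Qed.

(** A simple root needs no new parameters. Write [P] as [P.[c]] plus ['X - c] times [q], with [c]
    the residue of [th]: then [q.[th]] is a unit, and [th - c] is a unit times [P.[c]], hence in the
    ideal of the old parameters. *)
Lemma good_etale r M M' th (P : {poly F}) : good r M -> sfield M' -> (forall x, M x -> M' x) ->
 M' th -> V th -> (forall x, M' x -> exists2 q, polyB M q & x = q.[th]) ->
 polyB M P -> polyB V P -> P.[th] = 0 -> vu V P^`().[th] -> good r M'.
move=> [X [u hm eM]] hM' MM' M'th Vth hgen PM PV Pth P'th.
have [z /(nthP 0)[i _ <-]|w [tw hw Zw sub fr]] := model_monomialize (Z := P) hm.
 by split; [exact: PV|apply/eM; exact: PM].
have hS := mring_subr hV hA X w.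
have PS : polyB (mring X w) P.
 move=> i; have [ip|ip] := ltnP i (size P); first by apply: Zw; exact: mem_nth.
 by rewrite nth_default //; exact: sr0.
have [c kc hc] := kres Vth; have [hww wm XV hcl] := hw.
have cS : mring X w c by apply: mring_A => //; exact: kA.
have [q qS eP] := polyB_factor hS PS cS.
have SS' x : mring X w x -> mring (th :: X) w x.
 apply: mring_min => [|z|z|i|z]; [exact: mring_subr|exact: mring_A| |exact: mring_u|exact: mring_inv].
 by move=> h; apply: mring_X => //; rewrite inE h orbT.
have S'th : mring (th :: X) w th by apply: mring_X => //; exact: mem_head.
have hS' := mring_subr hV hA (th :: X) w.
have S'q : mring (th :: X) w q.[th] by apply: polyB_horner => // i; apply: SS'; exact: qS.
have Vq : polyB V q by move=> i; apply: (mring_V hV AV XV wm); exact: qS.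
have vq : vu V q.[th].
 have : vu V (P^`().[th] - (th - c) * q^`().[th]).
  apply: vuDm => //; apply: vmN => //; apply: vmM => //; apply: polyB_horner => // i.
  by rewrite coef_deriv; apply: sr_muln => //; exact: Vq.
 congr vu; rewrite {1}eP derivD derivC derivM derivXsubC mul1r add0r.
 by rewrite hornerD hornerM hornerXsubC addrK.
have eq : th - c = - (q.[th])^-1 * P.[c].
 have := congr1 (fun p : {poly F} => p.[th]) eP; rewrite hornerD hornerC hornerM hornerXsubC Pth.
 move=> /esym/eqP; rewrite addrC addr_eq0 => /eqP h; rewrite mulNr -mulrN -h mulrC mulfK //.
 exact: vu_n0 vq.
exists (th :: X), w.
 split=> // [x|]; first by rewrite inE => /orP[/eqP ->|/XV].
 apply: (clos_step hw) => //.
 - by move=> x h; rewrite inE h orbT.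
 - by move=> x; rewrite inE => /orP[/eqP ->|/XV].
 - by move=> i; apply: igen_mem.
 - move=> x; rewrite inE => /orP[/eqP -> _|-> //]; exists c => //; rewrite eq.
  have SPc : mring X w P.[c] by exact: polyB_horner.
  apply: igenM => //; first by apply: srN => //; apply: mring_inv.
  apply: (igen_trans hS' SS' (w := w)) (clos_vm hV hk kV _ wm hcl SPc _) => //.
  + by move=> i; apply: igen_mem.
  + by move=> x'; apply: mring_V.
  + have -> : P.[c] = - (th - c) * q.[th].
    by rewrite eq; field; exact: vu_n0 vq.
   by apply: vmM => //; [apply: vmN | case: vq].
have hK := frac_sfield hS'.
have MK x : M x -> frac (mring (th :: X) w) x.
 move=> /eM/fr; apply: frac_min => // z hz; apply: frac_base => //; exact: SS'.
move=> x; split=> [/hgen[p pM ->]|].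
 by apply: polyB_horner; [case: hK|move=> i; exact: MK|apply: frac_base].
apply: frac_min => //; have MS z : mring X w z -> M' z.
 by move=> h; apply: MM'; apply/eM/fr; exact: frac_base.
apply: mring_min; first by case: hM'.
- by move=> z h; apply: MS; exact: mring_A.
- by move=> z; rewrite inE => /orP[/eqP -> //|h]; apply: MS; exact: mring_X.
- by move=> i; apply: MS; exact: mring_u.
- by move=> z h _; exact: sfV.
Qed.

Lemma frac_mring_sf X r (u : 'I_r -> F) : sfield (frac (mring X u)).
Proof. by apply: frac_sfield; exact: mring_subr. Qed.

Lemma good_sfield r M : good r M -> sfield M.
move=> [X [u _ eM]]; have [[h1 hB hM] hV'] := frac_mring_sf X u; split; last by move=> x /eM/hV'/eM.
by split; [apply/eM|move=> x y /eM hx /eM hy; apply/eM; exact: hB|move=> x y /eM hx /eM hy; apply/eM; exact: hM].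
Qed.

(* The new generators are the units comparing the old parameters and the basis
  elements with monomials in a basis of the larger value group. *)
Lemma good_ramified r M M' n (z : 'I_n -> F) q00 : good r M -> sfield M' -> (forall x, M x -> M' x) ->
 z q00 = 1 -> (forall q, M' (z q)) -> (forall q, z q != 0) ->
 (forall x, M' x -> exists2 m : 'I_n -> F, forall q, M (m q) & x = \sum_q m q * z q) ->
 (forall q q' m, q != q' -> M m -> ~ vu V (z q / (m * z q'))) -> good r M'.
move=> hg hM' MM' z0 zM' zn0 zgen zd; have hM := good_sfield hg.
have [X [u hm eM]] := hg; have [[u0 ui] um XV hc] := hm; have hu : vind V u by [].
have uM i : M (u i) by apply/eM; apply: frac_base; [exact: mring_subr|exact: mring_u].
have hullz q : hull V M (z q).
 have [x /zgen[m hm' ->]|p hp [p0 pz]] := finite_algebraic hM (proj1 hM') (e := z) _ (zM' q).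
  by exists m.
 exact: (alg_hull hV hM hp p0 pz (zn0 q)).
pose g (j : 'I_(r + n)) := match fintype.split j with inl i => u i | inr q => z q end.
have gu i : g (lshift _ i) = u i by rewrite /g (unsplitK (inl i)).
have gz q : g (rshift _ q) = z q by rewrite /g (unsplitK (inr q)).
have gP (Q : F -> Prop) : (forall i, Q (u i)) -> (forall q, Q (z q)) -> forall j, Q (g j).
 by move=> h1 h2 j; rewrite /g; case: fintype.split.
have gM' j : M' (g j) by apply: (gP M') => // i; exact: MM'.
have g0 j : g j != 0 by apply: (gP (fun x => x != 0)).
have [|j|w [hw wm wg gw]] := @overlattice r u _ g hu.
- by move=> i; exists (lshift _ i); rewrite gu.
- apply: (gP (fun x => exists n, exists a, vu V (x ^+ n.+1 / zev u a))) => [i|q].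
  exists 0%N, (fun l => (l == i)%:Z); rewrite zevU expr1 divff //; exact: vu1.
 have [m [h Mh vh]] := hullz q.
 have h0 : h != 0 by apply/eqP => h0; have := vu_n0 vh; rewrite h0 invr0 mulr0 eqxx.
 have [a ha] := model_zev hm (proj1 (eM h) Mh) h0; exists m, a.
 have := vuM hV vh ha; congr vu; by field; rewrite h0 zev_n0.
have w0 : forall i, w i != 0 := proj1 hw.
have aj j : {a | vu V (g j / zev w a)} by apply: cid; exact: gw.
pose al j := sval (aj j); pose om j := g j / zev w (al j).
have omu j : vu V (om j) by exact: (svalP (aj j)).
have eg j : g j = om j * zev w (al j) by rewrite divfK // zev_n0.
have wM' i : M' (w i) by have [b ->] := wg i; exact: zev_sf.
have omM' j : M' (om j) by apply: sf_div => //; exact: zev_sf.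
have ez q (b : 'I_r -> int) : exists be, exists ga, zev u b * z q = zev om be * zev w ga.
 exists (fun j => \sum_(i < r) b i * (j == lshift _ i)%:Z + (j == rshift _ q)%:Z).
 exists (fun i => \sum_(l < r) al (lshift _ l) i * b l + al (rshift _ q) i).
 have om0 j : om j != 0 by exact: vu_n0 (omu j).
 rewrite -!zevD // zevU mulrACA -eg gz; congr (_ * _).
 rewrite /zev (eq_bigr (fun i => om (lshift _ i) ^ b i * zev w (al (lshift _ i)) ^ b i)); last first.
  by move=> i _; rewrite -expfzMl -eg gu.
 rewrite big_split; congr (_ * _).
  rewrite (eq_bigr (fun i => zev om (fun j => (j == lshift _ i)%:Z * b i))) => [|i _].
   rewrite /zev exchange_big; apply: eq_bigr => j _ /=.
   rewrite -(big_morph (fun n : int => om j ^ n) (fun n n' => expfzDr n n' (om0 j)) (expr0z _)).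
   by congr (_ ^ _); apply: eq_bigr => i _; rewrite mulrC.
  by rewrite -zevZ zevU.
 rewrite (eq_bigr (fun i => zev w (fun j => al (lshift _ i) j * b i))) => [|i _]; last by rewrite zevZ.
 rewrite /zev exchange_big; apply: eq_bigr => j _ /=.
 by rewrite -(big_morph (fun n : int => w j ^ n) (fun n n' => expfzDr n n' (w0 j)) (expr0z _)).
have dec j : {m : 'I_n -> F | (forall q, M (m q)) /\ om j = \sum_q m q * z q}.
 by apply: cid; have [m h1 h2] := zgen _ (omM' j); exists m.
pose m j := sval (dec j).
have mM j q : M (m j q) by case: (svalP (dec j)) => h _; exact: h.
have em j : om j = \sum_q m j q * z q by have [_ e] := svalP (dec j); exact: e.
have dd j q q' : m j q != 0 -> m j q' != 0 -> q != q' -> ~ vu V (m j q * z q / (m j q' * z q')).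
 move=> h1 h2 qq' h; apply: (zd q q' (m j q' / m j q)) => //; first exact: sf_div.
 by move: h; congr vu; field; rewrite h1 h2 zn0.
(* The value of the unit [om j] is zero, so its dominating term belongs to the trivial class modulo
   the values of [M], and that class is represented by [z q00 = 1] alone. *)
have hmin j : vu V (m j q00) /\ forall q, q != q00 -> vm V (m j q * z q).
 have sumE : \sum_(q | m j q != 0) m j q * z q = om j.
  rewrite em [RHS](bigID (fun q => m j q != 0)) /= [X in _ + X]big1 ?addr0 //.
  by move=> q; rewrite negbK => /eqP ->; rewrite mul0r.
 have [||q q' /= h1 h2|q0 [/= mq0 hmm hs]] := v_distinct hV (P := fun q => m j q != 0) (t := fun q => m j q * z q).
 - apply: contrapT => hno; have := vu_n0 (omu j); rewrite em big1 ?eqxx // => q _.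
  have [->|h] := eqVneq (m j q) 0; first by rewrite mul0r.
  by case: hno; exists q.
 - by move=> q /= h; rewrite mulf_neq0.
 - exact: dd.
 rewrite sumE in hs.
 have vt : vu V (m j q0 * z q0) by have := vu_div hV (omu j) hs; rewrite invf_div mulrC divfK // (vu_n0 (omu j)).
 have eq00 : q0 = q00.
  apply/eqP/negPn/negP => h; apply: (zd q0 q00 (m j q0)^-1 h (sfV hM (mM j q0))).
  by move: vt; rewrite z0 mulr1 invrK mulrC.
 subst q0; rewrite z0 mulr1 in vt; split=> // q qn0.
 have [->|mq] := eqVneq (m j q) 0; first by rewrite mul0r; left.
 have := hmm q mq qn0; rewrite z0 mulr1 => h.
 by rewrite -[_ * _](divfK mq0); apply: vmM => //; exact: vu_V.
have be j q : {b | m j q != 0 -> vu V (m j q / zev u b)}.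
 apply: cid; have [h|h] := eqVneq (m j q) 0; first by exists (fun=> 0).
 by have [b hb] := model_zev hm (proj1 (eM _) (mM j q)) h; exists b.
pose eta j q := m j q / zev u (sval (be j q)).
(* The dominating coefficients and the unit parts [eta] of all nonzero coefficients lie in [M]; the
   old model is modified to contain them before anything new is adjoined. *)
pose Z1 := [seq (if m jq.1 jq.2 == 0 then 0 else eta jq.1 jq.2) | jq : 'I_(r + n) * 'I_n]
  ++ [seq m j q00 | j : 'I_(r + n)].
have [x|u2 [tu2 hm2 Zu2 sub2 fr2]] := model_monomialize (Z := Z1) hm.
 rewrite mem_cat => /orP[]/mapP[j _ ->].
  case: eqP => [_|/eqP h]; first by split; [exact: sr0|apply: sr0; case: (frac_mring_sf X u)].
  split; first by apply: vu_V; exact: (svalP (be j.1 j.2)).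
  apply/eM; apply: sf_div => //; apply: zev_sf => //.
 by split; [apply: vu_V; case: (hmin j)|apply/eM].
have eta2 j q : m j q != 0 -> mring X u2 (eta j q).
 move=> h; apply: Zu2; rewrite mem_cat; apply/orP; left; apply/mapP; exists (j, q); first by rewrite mem_enum.
 by rewrite /= (negbTE h).
have m02 j : mring X u2 (m j q00).
 by apply: Zu2; rewrite mem_cat; apply/orP; right; apply/mapP; exists j; rewrite ?mem_enum.
have [hu2 um2 _ hc2] := hm2; have [u20 _] := hu2.
have eu2 i : exists be, exists ga, u2 i = zev om be * zev w ga.
 have [_ _ _ hb] := tu2; have [b ->] := hb i; have [b1 [b2 e]] := ez q00 b.
 by exists b1, b2; rewrite -e z0 mulr1.
have om0 j : om j != 0 by exact: vu_n0 (omu j).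
have zou b : vu V (zev om b) by apply: vu_prod => // j _; exact: vuZ.
have e1' i : {ga | exists b, u2 i = zev om b * zev w ga}.
 by apply: cid; have [b1 [b2 e]] := eu2 i; exists b2, b1.
have e2' j q : {ga | exists b, zev u (sval (be j q)) * z q = zev om b * zev w ga}.
 by apply: cid; have [b1 [b2 e]] := ez q (sval (be j q)); exists b2, b1.
pose f1 i := sval (e1' i); pose f2 j q := sval (e2' j q).
have e1 i : exists b, u2 i = zev om b * zev w (f1 i) := svalP (e1' i).
have e2 j q : exists b, zev u (sval (be j q)) * z q = zev om b * zev w (f2 j q) := svalP (e2' j q).
clearbody f1 f2.
(* Exponents in [w] of the nondominating terms of the [om j]. The zero vector fills the places of
   absent or dominating terms. *)
pose E2 (jq : 'I_(r + n) * 'I_n) : 'I_r -> int :=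
 if (m jq.1 jq.2 == 0) || (jq.2 == q00) then fun=> 0 else f2 jq.1 jq.2.
pose s := [seq f1 i | i : 'I_r] ++ [seq E2 jq | jq : 'I_(r + n) * 'I_n].
have w1 i : vm V (zev w (f1 i)).
 have [b eb] := e1 i; have := um2 i; rewrite eb => h.
 by apply: (vm_divu hV (zou b)); rewrite mulrC.
have w2 j q : m j q != 0 -> q != q00 -> vm V (zev w (f2 j q)).
 move=> mq qn; have [b eb] := e2 j q; have [_ /(_ q qn) h] := hmin j.
 apply: (vm_divu hV (zou b)); rewrite mulrC -eb.
 apply: (vm_divu hV (svalP (be j q) mq)); move: h; congr vm.
 by field; exact: zev_n0.
have sP i : (i < size s)%N -> V (zev w (nth (fun=> 0) s i)).
 move=> hi; have : nth (fun=> 0) s i \in s by exact: mem_nth.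
 rewrite mem_cat => /orP[]/mapP[j _ ->]; first exact: vm_V.
 rewrite /E2; case: ifP => [_|/norP[h1 h2]]; last by apply: vm_V => //; exact: w2.
 by rewrite /zev big1 => [|l _]; [exact: sr1|rewrite expr0z].
have [v tv hv] := perron hV hw wm sP.
have [hv' vmv vw _] := tv.
have mon a : a \in s -> exists mo, zev w a = mev v mo.
 by move=> h; have := hv (index a s); rewrite index_mem nth_index //; exact.
pose X' := X ++ [seq om j | j : 'I_(r + n)].
have XX' : {subset X <= X'} by move=> x h; rewrite mem_cat h.
have hS' := mring_subr hV hA X' v.
have Sv i : mring X' v (v i) by exact: mring_u.
have Som j : mring X' v (om j).
 by apply: mring_X => //; rewrite mem_cat map_f ?orbT // mem_enum.
have Szo b : mring X' v (zev om b) by apply: zev_inv => // j; exact: mring_inv.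
have igen_mon a : a \in s -> vm V (zev w a) -> igen (mring X' v) v (zev w a).
 move=> /mon[mo ->] h; apply: mev_igen => //; apply/eqP => mo0.
 by move: h; rewrite mo0 mev0 => /vm_nvu; apply; exact: vu1.
have u2S i : igen (mring X' v) v (u2 i).
 have [b eb] := e1 i; rewrite eb; apply: igenM => //; apply: igen_mon => //.
 by rewrite mem_cat map_f // mem_enum.
have sub' x : mring X u2 x -> mring X' v x.
 apply: mring_step => // i; have [b hb ->] := u2S i.
 by apply: sr_sum => // j _; apply: srM.
have X'V x : x \in X' -> V x.
 by rewrite mem_cat => /orP[/XV //|/mapP[j _ ->]]; apply: vu_V; exact: omu.
exists X', v.
 split=> //; apply: (clos_step hm2) => // x; rewrite mem_cat => /orP[-> //|/mapP[j _ ->] _].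
 have [c kc hcc] := hc2 _ (m02 j); exists c => //.
 rewrite em (bigD1 q00) //= z0 mulr1 addrAC; apply: igenD => //; first exact: igen_trans hcc.
 apply: igen_sum => // q qn; have [->|mq] := eqVneq (m j q) 0; first by rewrite mul0r; exact: igen0.
 have [b eb] := e2 j q.
 have -> : m j q * z q = (eta j q * zev om b) * zev w (f2 j q).
  by rewrite -mulrA -eb mulrA divfK // zev_n0.
 apply: igenM => //; first by apply: srM => //; apply: sub'; exact: eta2.
 apply: igen_mon; last exact: w2.
 rewrite mem_cat; apply/orP; right; apply/mapP; exists (j, q); first by rewrite mem_enum.
 by rewrite /E2 /= (negbTE mq) (negbTE qn).
have hK := frac_mring_sf X' v.
have fS x : mring X' v x -> frac (mring X' v) x by exact: frac_base.
have fM x : M x -> frac (mring X' v) x.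
 by move=> /eM/fr2; apply: frac_min => // y hy; apply: fS; exact: sub'.
have fw i : frac (mring X' v) (w i).
 have [mo ->] := vw i; apply: mev_sr; [by case: hK|by move=> l; exact: fS].
have fz q : frac (mring X' v) (z q).
 rewrite -gz eg; apply: srM; [by case: hK|exact: fS|exact: zev_sf].
move=> x; split=> [/zgen[mo hmo ->]|].
 by apply: sr_sum => [|q _]; [case: hK|apply: srM; [case: hK|exact: fM|exact: fz]].
apply: frac_min => //; have hM's := proj1 hM'.
apply: mring_min => // [y Ay|y|i|y hy _]; last exact: sfV.
- by apply/MM'/eM; apply: frac_base; [exact: mring_subr|exact: mring_A].
- rewrite mem_cat => /orP[h|/mapP[j _ ->] //].
 by apply/MM'/eM; apply: frac_base; [exact: mring_subr|exact: mring_X].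
- by have [_ _ _ hb] := tv; have [b ->] := hb i; exact: zev_sf.
Qed.

Lemma polyB_reduce S th n (P f : {poly F}) : subr S -> polyB S P -> P \is monic ->
 size P = n.+1 -> P.[th] = 0 -> polyB S f ->
 exists g, [/\ polyB S g, (size g <= n)%N & g.[th] = f.[th]].
move=> hS PS mP sP Pth; elim/poly_ind: f => [|f c ih] fS.
 by exists 0; rewrite size_poly0; split=> //; exact: polyB0.
have [|g [gS sg eg]] := ih.
 by move=> i; have := fS i.+1; rewrite coefD coefMX coefC addr0.
have Sc : S c by have := fS 0%N; rewrite coefD coefMX coefC add0r.
pose h := g * 'X + c%:P - (g * 'X + c%:P)`_n *: P.
have S1 : polyB S (g * 'X + c%:P) by apply: polyBD => //; [apply: polyBM => //; exact: polyBX|exact: polyBC].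
exists h; split.
- by move=> i; rewrite coefB coefZ; apply: srB => //; apply: srM.
- apply/leq_sizeP => j; rewrite leq_eqVlt => /orP[/eqP <-|nj].
  rewrite /h coefB coefZ; have /monicP := mP; rewrite lead_coefE sP /= => ->.
  by rewrite mulr1 subrr.
 rewrite /h coefB coefZ [P`_j]nth_default ?sP // mulr0 subr0 nth_default //.
 apply: leq_trans nj; apply: leq_trans (size_polyD _ _) _; rewrite geq_max.
 rewrite (leq_trans (size_polyC_leq1 _)) // andbT.
 by apply: leq_trans (size_polyMleq _ _) _; rewrite size_polyX addn2.
- by rewrite /h hornerD hornerN hornerZ Pth mulr0 subr0 !hornerMXaddC eg.
Qed.

(* An element of [V \cap M] lies in the ideal of the parameters upstairs; as the
  powers of [th] are independent over [M], comparing coefficients brings the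
  relation down. *)
Lemma good_down r M Z th n (P : {poly F}) : sfield M -> (forall x, A x -> M x) -> good r Z ->
 (forall x, M x -> Z x) -> Z th -> V th -> polyB M P -> polyB V P -> P \is monic ->
 size P = n.+1 -> P.[th] = 0 ->
 (forall q, polyB M q -> (size q <= n)%N -> q.[th] = 0 -> q = 0) ->
 (forall z, Z z -> z != 0 -> exists2 m, M m & vu V (z / m)) ->
 (forall x, Z x -> V x -> exists f g : {poly F}, [/\ polyB M f /\ polyB V f, polyB M g /\ polyB V g,
   vu V g.[th] & x * g.[th] = f.[th]]) -> good r M.
move=> hM AM [X [u hm eZ]] MZ Zth Vth PM PV mP sP Pth ind imm quot.
have [[u0 ui] um XV hc] := hm.
have fX x : x \in X -> Z x by move=> h; apply/eZ; apply: frac_base; [exact: mring_subr|exact: mring_X].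
have hZ : sfield Z by exact: (good_sfield (ex_intro _ X (ex_intro2 _ _ u hm eZ))).
have Zu i : Z (u i) by apply/eZ; apply: frac_base; [exact: mring_subr|exact: mring_u].
have mi i : {m | M m /\ vu V (u i / m)} by apply: cid; have [m h1 h2] := imm _ (Zu i) (u0 i); exists m.
pose m i := sval (mi i); have Mm i : M (m i) by case: (svalP (mi i)).
have vmi i : vu V (u i / m i) by case: (svalP (mi i)).
have m0 i : m i != 0 by apply/eqP => m0; have := vu_n0 (vmi i); rewrite m0 invr0 mulr0 eqxx.
clearbody m.
pose eps i := m i / u i.
have epsu i : vu V (eps i) by have := vu_inv (vmi i); rewrite invf_div.
have Zeps i : Z (eps i) by apply: sf_div => //; exact: MZ.
pose X1 := X ++ [seq eps i | i : 'I_r].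
have X1ZV x : x \in X1 -> Z x /\ V x.
 rewrite mem_cat => /orP[h|/mapP[i _ ->]]; first by split; [exact: fX|exact: XV].
 by split=> //; exact: vu_V.
have fg x : {fg : {poly F} * {poly F} | x \in X1 -> [/\ polyB M fg.1 /\ polyB V fg.1, polyB M fg.2 /\ polyB V fg.2,
   vu V fg.2.[th] & x * fg.2.[th] = fg.1.[th]]}.
 apply: cid; have [/X1ZV[h1 h2]|h] := boolP (x \in X1); last by exists (0, 0).
 by have [f [g h]] := quot x h1 h2; exists (f, g).
(* The coefficients of the equation of [th] and of the fractions in [th] that represent the
   generators upstairs. They lie in [M] and in [V], and become the generators downstairs. *)
pose C : seq F := P ++ flatten [seq ((sval (fg x)).1 : seq F) ++ ((sval (fg x)).2 : seq F) | x <- X1].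
have polyseqP (B : F -> Prop) (p : {poly F}) x : polyB B p -> x \in (p : seq F) -> B x.
 by move=> hp /(nthP 0)[i _ <-]; exact: hp.
have CMV x : x \in C -> M x /\ V x.
 rewrite mem_cat => /orP[h|/flattenP[_ /mapP[y yX ->]]].
  by split; [exact: polyseqP h|exact: polyseqP h].
 have [[h1 h2] [h3 h4] _ _] := svalP (fg y) yX.
 by rewrite mem_cat => /orP[h|h]; split; by [exact: polyseqP h].
have [x|u2 [tu2 hm2 Zu2 sub2 fr2]] := model_monomialize (Z := C ++ th :: [seq eps i | i : 'I_r]) hm.
 rewrite mem_cat => /orP[/CMV[h1 h2]|]; first by split=> //; apply/eZ; exact: MZ.
 rewrite inE => /orP[/eqP ->|/mapP[i _ ->]]; first by split=> //; exact/eZ.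
 by split; [exact: vu_V|exact/eZ].
have [[u20 u2i] um2 _ hc2] := hm2.
set S2 := mring X u2 in Zu2 sub2 fr2 hc2 *.
have hS2 : subr S2 by exact: mring_subr.
have S2C x : x \in C -> S2 x by move=> h; apply: Zu2; rewrite mem_cat h.
have S2th : S2 th by apply: Zu2; rewrite mem_cat inE eqxx orbT.
have S2eps i : S2 (eps i) by apply: Zu2; rewrite mem_cat inE map_f ?orbT // mem_enum.
have S2inv x : S2 x -> vu V x -> S2 x^-1 by exact: mring_inv.
have S2z b : S2 (zev eps b) by apply: zev_inv => // i; apply: S2inv.
have hb i : {b | u2 i = zev u b} by apply: cid; case: tu2 => _ _ _; exact.
pose b i := sval (hb i); have eb i : u2 i = zev u (b i) by exact: (svalP (hb i)).
clearbody b.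
pose v i := zev m (b i).
have ev i : v i = zev eps (b i) * u2 i.
 rewrite eb /v /zev -big_split; apply: eq_bigr => l _ /=.
 by rewrite -expfzMl /eps divfK.
have zu i : vu V (zev eps (b i)) by apply: vu_prod => // l _; exact: vuZ.
have ev' i : u2 i = (zev eps (b i))^-1 * v i by rewrite ev mulKf // (vu_n0 (zu i)).
have Mv i : M (v i) by exact: zev_sf.
have S2v i : S2 (v i) by rewrite ev; apply: srM => //; exact: mring_u.
set S := mring C v.
have hS : subr S by exact: mring_subr.
have SM x : S x -> M x.
 apply: mring_min => // [|y /CMV[]|y hy _] //; first by case: hM.
 exact: sfV.
have SS2 x : S x -> S2 x.
 by apply: mring_min => // y; exact: mring_A.
have vmv i : vm V (v i) by rewrite ev; apply: vmMr => //; exact: vu_V.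
have SV x : S x -> V x by apply: mring_V => // y /CMV[].
have CS (p : {poly F}) : {subset (p : seq F) <= C} -> polyB S p.
 move=> h i; have [ip|ip] := ltnP i (size p); last by rewrite nth_default //; exact: sr0.
 by apply: mring_X => //; apply: h; exact: mem_nth.
have PS : polyB S P by apply: CS => x h; rewrite mem_cat h.
(* Fractions in [th] with coefficients in the candidate ring [S]. They form a ring that contains the
   whole modified model upstairs. *)
pose T x := exists f g : {poly F}, [/\ polyB S f, polyB S g, vu V g.[th] & x = f.[th] / g.[th]].
have hT : subr T.
 split.
 - by exists 1, 1; rewrite hornerC divr1; split=> //; [apply: polyBC => //; exact: sr1|apply: polyBC => //; exact: sr1|exact: vu1].
 - move=> _ _ [f [g [h1 h2 h3 ->]]] [f' [g' [h4 h5 h6 ->]]].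
  exists (f * g' - f' * g), (g * g'); split; [|exact: polyBM|by rewrite hornerM; exact: vuM|].
   by apply: polyBB => //; exact: polyBM.
  by rewrite hornerD hornerN !hornerM; field; rewrite (vu_n0 h3) (vu_n0 h6).
 - move=> _ _ [f [g [h1 h2 h3 ->]]] [f' [g' [h4 h5 h6 ->]]].
  exists (f * f'), (g * g'); split; [exact: polyBM|exact: polyBM|by rewrite hornerM; exact: vuM|].
  by rewrite !hornerM; field; rewrite (vu_n0 h3) (vu_n0 h6).
have Tinv x : T x -> vu V x -> T x^-1.
 move=> [f [g [h1 h2 h3 ex]]] hx; exists g, f; split=> //; last by rewrite ex invf_div.
 have -> : f.[th] = x * g.[th] by rewrite ex divfK // (vu_n0 h3).
 exact: vuM.
have TS x : S x -> T x.
 move=> Sx; exists x%:P, 1; rewrite !hornerC divr1; split=> //; [exact: polyBC| |exact: vu1].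
 by apply: polyBC => //; exact: sr1.
have TX x : x \in X1 -> T x.
 move=> xX; have [_ _ h3 h4] := svalP (fg x) xX; exists (sval (fg x)).1, (sval (fg x)).2.
 have sub p : {subset p <= (((sval (fg x)).1 : seq F) ++ ((sval (fg x)).2 : seq F))} -> {subset p <= C}.
  by move=> h y /h hy; rewrite mem_cat; apply/orP; right; apply/flattenP; eexists; first exact: map_f xX.
 split=> //; last by rewrite -h4 mulfK // (vu_n0 h3).
  by apply: CS; apply: sub => y h; rewrite mem_cat h.
 by apply: CS; apply: sub => y h; rewrite mem_cat h orbT.
have Teps i : T (eps i) by apply: TX; rewrite mem_cat map_f ?orbT // mem_enum.
have Tv i : T (v i) by apply: TS; exact: mring_u.
have S2T x : S2 x -> T x.
 apply: mring_min => // [y Ay|y h|i]; first by apply: TS; exact: mring_A.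
  by apply: TX; rewrite mem_cat h.
 rewrite ev'; apply: srM => //; apply: (Tinv _ _ (zu i)); apply: zev_inv => // l.
 exact: Tinv.
have redS f : polyB S f -> exists g, [/\ polyB S g, (size g <= n)%N & g.[th] = f.[th]].
 exact: (polyB_reduce hS PS mP sP Pth).
have polyZ (B : F -> Prop) c (p : {poly F}) : subr B -> B c -> polyB B p -> polyB B (c *: p).
 by move=> hB Bc hp i; rewrite coefZ; exact: srM.
have vi : vind V v.
 split=> [i|a]; first by rewrite ev mulf_neq0 // (vu_n0 (zu i)).
 have -> : \prod_i v i ^ a i = zev (fun i => zev eps (b i)) a * zev u2 a.
  by rewrite /zev -big_split; apply: eq_bigr => i _ /=; rewrite ev expfzMl.
 move=> h; apply: u2i; apply: (vu_cancel hV _ (y := zev (fun i => zev eps (b i)) a)).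
  by apply: vu_prod => // i _; exact: vuZ.
 by rewrite mulrC.
exists C, v.
 split=> // [x /CMV[] //|s Ss].
 have [c kc hcs] := kres (SV _ Ss); exists c => //; set ze := s - c.
 have Sze : S ze by apply: srB => //; apply: mring_A => //; exact: kA.
 have : igen S2 u2 ze.
  by apply: (clos_vm hV hk kV _ um2 hc2 (SS2 _ Sze)) => // x; exact: mring_V.
 move=> [b0 hb0 eze].
 have TB i : T (b0 i * (zev eps (b i))^-1).
  by apply: S2T; apply: srM => //; apply: S2inv.
 have hFG i : {fg : {poly F} * {poly F} | [/\ polyB S fg.1, polyB S fg.2, vu V fg.2.[th] &
   b0 i * (zev eps (b i))^-1 = fg.1.[th] / fg.2.[th]]}.
  by apply: cid; have [f [g h]] := TB i; exists (f, g).
 pose f i := (sval (hFG i)).1; pose g i := (sval (hFG i)).2.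
 have fS i : polyB S (f i) by case: (svalP (hFG i)).
 have gS i : polyB S (g i) by case: (svalP (hFG i)).
 have gu i : vu V (g i).[th] by case: (svalP (hFG i)).
 have efg i : b0 i * (zev eps (b i))^-1 = (f i).[th] / (g i).[th] by case: (svalP (hFG i)).
 have [G [GS sG eG]] := redS (\prod_i g i) (polyB_prod hS _ (fun i _ => gS i)).
 have hFi i : {p : {poly F} | [/\ polyB S p, (size p <= n)%N & p.[th] = (f i * \prod_(j | j != i) g j).[th]]}.
  by apply: cid; apply: redS; apply: polyBM => //; apply: polyB_prod.
 pose Fi i := sval (hFi i).
 have FS i : polyB S (Fi i) by case: (svalP (hFi i)).
 have q0 : ze *: G - \sum_i v i *: Fi i = 0.
  apply: ind.
  - apply: polyBB; [by case: hM|apply: polyZ; [by case: hM|exact: SM|by move=> i; apply: SM; exact: GS] |].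
   apply: polyB_sum => [|i _]; first by case: hM.
   by apply: polyZ => //; [case: hM|move=> l; apply: SM; exact: FS].
  - apply: leq_trans (size_polyD _ _) _; rewrite size_polyN geq_max; apply/andP; split.
    exact: leq_trans (size_scale_leq _ _) sG.
   apply: leq_trans (size_sum _ _ _) _; apply/bigmax_leqP => i _.
   by apply: leq_trans (size_scale_leq _ _) _; case: (svalP (hFi i)).
  rewrite hornerD hornerN hornerZ horner_sum eG eze mulr_suml -sumrB big1 // => i _.
  rewrite hornerZ; have [_ _ ->] := svalP (hFi i).
  rewrite hornerM horner_prod (bigD1 i) //= horner_prod ev'.
  have -> : b0 i * ((zev eps (b i))^-1 * v i) = (f i).[th] / (g i).[th] * v i by rewrite mulrA efg.
  by field; exact: vu_n0 (gu i).
 (* Since [G.[th]] is a unit and [th] is in [V], not all coefficients of [G] can lie in the maximal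
    ideal. Reading the identity [q0] at such an index solves for [ze]. *)
 have [j Gj] : exists j, vu V G`_j.
  apply: contrapT => hno; have : vm V G.[th].
   rewrite horner_coef; apply: vm_sum => // j _; apply: vmM => //; last exact: srX.
   by have [//|h] := vm_or_vu (SV _ (GS j)); case: hno; exists j.
  rewrite eG horner_prod => /vm_nvu; apply; apply: vu_prod => // i _; exact: gu.
 have ej : ze = (G`_j)^-1 * \sum_i (Fi i)`_j * v i.
  have := congr1 (fun p : {poly F} => p`_j) q0; rewrite coef0 coefB coefZ coef_sum.
  move=> /eqP; rewrite subr_eq0 => /eqP e; apply: (mulIf (vu_n0 Gj)); rewrite e mulrAC mulVf ?(vu_n0 Gj) // mul1r.
  by apply: eq_bigr => i _; rewrite coefZ mulrC.
 rewrite ej; apply: igenM => //; first by apply: mring_inv => //; exact: GS.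
 by exists (fun i => (Fi i)`_j) => // i; exact: FS.
move=> x; split=> [Mx|]; last exact: frac_min.
have /eZ/fr2[a [a' [/S2T[f [g [fS gS gu ea]]] /S2T[f' [g' [fS' gS' gu' ea']]] a'0 ex]]] := MZ _ Mx.
have [H [HS sH eH]] := redS _ (polyBM hS fS' gS).
have [K [KS sK eK]] := redS _ (polyBM hS fS gS').
have e : x * H.[th] = K.[th].
 have f'0 : f'.[th] != 0 by apply: contra_neq a'0 => h; rewrite ea' h mul0r.
 by rewrite eH eK !hornerM ex ea ea'; field; rewrite ?f'0 ?(vu_n0 gu) ?(vu_n0 gu').
have q0 : x *: H - K = 0.
 apply: ind; last by rewrite hornerD hornerN hornerZ e subrr.
  apply: polyBB; [by case: hM | |by move=> i; apply: SM; exact: KS].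
  by apply: polyZ => //; [case: hM|move=> i; apply: SM; exact: HS].
 apply: leq_trans (size_polyD _ _) _; rewrite size_polyN geq_max sK andbT.
 exact: leq_trans (size_scale_leq _ _) sH.
have H0 : H != 0.
 apply/eqP => H0; move: eH; rewrite H0 horner0 hornerM => /esym/eqP.
 rewrite mulf_eq0 (negbTE (vu_n0 gu)) orbF => h; move: a'0; rewrite ea' (eqP h) mul0r eqxx //.
exists K`_(size H).-1, H`_(size H).-1; split; [exact: KS|exact: HS| |].
 by rewrite -lead_coefE lead_coef_eq0.
have := congr1 (fun p : {poly F} => p`_(size H).-1) q0; rewrite coef0 coefB coefZ => /eqP.
rewrite subr_eq0 => /eqP <-; rewrite mulfK // -lead_coefE lead_coef_eq0 //.
Qed.
End Extensions.

(** * Characteristic p: monomials as a p-basis, removal of p-th powers *)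

Section Frobenius.
Variables (F : fieldType) (V k A : F -> Prop).
Hypotheses (hV : vring V) (hk : sfield k) (kV : forall c, k c -> V c).
Hypothesis kres : forall x, V x -> exists2 c, k c & vm V (x - c).
Hypotheses (hA : subr A) (kA : forall c, k c -> A c) (AV : forall x, A x -> V x) (AN : noeth A).
Variable p : nat.
Hypotheses (cp : p \in [pchar F]) (Af : ffin p A) (kp : forall c, k c -> exists2 d, k d & c = d ^+ p).
Implicit Types (B S M : F -> Prop) (x z : F) (X : seq F).
Let ks : subr k := proj1 hk.
Let Vs : subr V := proj1 hV.
Let p0 : (0 < p)%N. Proof. by apply: prime_gt0; exact: (pcharf_prime cp). Qed.

Lemma frob_sum (I : Type) (r : seq I) (P : pred I) (f : I -> F) :
 (\sum_(i <- r | P i) f i) ^+ p = \sum_(i <- r | P i) f i ^+ p.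
Proof. by rewrite -(pFrobenius_autE cp) rmorph_sum /=; apply: eq_bigr => i _; rewrite pFrobenius_autE. Qed.

Lemma frobD x y : (x + y) ^+ p = x ^+ p + y ^+ p.
Proof. by rewrite -!(pFrobenius_autE cp) rmorphD. Qed.

Lemma frobB x y : (x - y) ^+ p = x ^+ p - y ^+ p.
Proof. by rewrite -!(pFrobenius_autE cp) rmorphB. Qed.

Lemma ffin_adj1 B x : subr B -> ffin p B -> ffin p (adj1 B x).
move=> hB [e eB he]; have hQ := frobp_subr cp (adj1_subr x hB).
have Bx : adj1 B x x by exact: adj1_gen.
exists [seq a * x ^+ j | a <- e, j <- iota 0 p] => [_ /allpairsP[[a j] [/= ae _ ->]]|_ [q hq ->]].
 apply: srM; [exact: adj1_subr|apply: adj1_base => //; exact: eB|apply: srX => //; exact: adj1_subr].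
rewrite horner_coef; apply: lin_sum => // i _.
have -> : q`_i * x ^+ i = (x ^+ (i %/ p)) ^+ p * (q`_i * x ^+ (i %% p)).
 by rewrite mulrCA -exprM -exprD -divn_eq.
apply: linM => //; first by exists (x ^+ (i %/ p)) => //; apply: srX => //; exact: adj1_subr.
have : lin (frobp p B) e q`_i by exact: he.
apply: (@lin_min _ (frobp p B) (fun z => lin (frobp p (adj1 B x)) _ (z * x ^+ (i %% p)))).
 split; first by rewrite mul0r; exact: lin0.
  by move=> y z h1 h2; rewrite mulrDl; exact: linD.
 move=> a z [b hb ->] h; rewrite -mulrA; apply: linM => //; exists b => //; exact: adj1_base.
move=> a ae; apply: lin_mem => //; apply/allpairsP; exists (a, (i %% p)%N); split=> //=.
by rewrite mem_iota ltn_mod.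
Qed.

Lemma ffin_adjs B X : subr B -> ffin p B -> ffin p (adjs B X).
Proof. by move=> hB hf; elim: X => //= x X ih; apply: ffin_adj1 => //; exact: adjs_subr. Qed.

Lemma ffin_loc B : subr B -> ffin p B -> ffin p (loc V B).
move=> hB [e eB he]; have hL := loc_subr hV hB; have hQ := frobp_subr cp hL.
exists e => [x /eB|_ [a [b [ha hb ub ->]]]]; first exact: loc_base.
have b0 := vu_n0 ub.
have -> : a / b = (b^-1) ^+ p * (a * b ^+ p.-1).
 by rewrite exprVn -{1}(prednK p0) exprS; field; rewrite b0 expf_neq0.
apply: linM => //.
 by exists b^-1 => //; apply: loc_inv => //; exact: loc_base.
have : lin (frobp p B) e (a * b ^+ p.-1) by apply: he; apply: srM => //; exact: srX.
by apply: lin_mono => z [c hc ->]; exists c => //; exact: loc_base.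
Qed.

(** Generators are eliminated one at a time: the coefficient of the head generator in its own
    relation is in [J], so [1 - j] can be inverted and the result substituted in the other
    relations. *)
Lemma nakayama Q J N (E : seq F) : subr Q -> ideal Q J -> (forall j, J j -> Q j) ->
 (forall j, J j -> exists2 t, Q t & t * (1 - j) = 1) -> ideal Q N ->
 (forall e, e \in E -> exists2 n, N n & lin J E (e - n)) -> forall e, e \in E -> N e.
move=> hQ hJ JQ Ji hN; have [J0 JD JM] := hJ; have [N0 ND NM] := hN.
have JE (t : seq F) q x : Q q -> lin J t x -> lin J t (q * x).
 move=> Qq; elim: t x => [|y t ih] x /=; first by move->; rewrite mulr0.
 move=> [b hb h]; exists (q * b); first exact: JM.
 by rewrite -mulrA -mulrBr; exact: ih.
have JDl (t : seq F) x y : lin J t x -> lin J t y -> lin J t (x + y).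
 elim: t x y => [|z t ih] x y /=; first by move=> -> ->; rewrite addr0.
 move=> [b hb h] [c hc h']; exists (b + c); first exact: JD.
 by rewrite mulrDl opprD addrACA; exact: ih.
elim: E => // e E ih hE.
have [n Nn [j Jj hl]] := hE e (mem_head _ _); have [t Qt et] := Ji j Jj.
set l := e - n - j * e in hl.
have ee : e = t * n + t * l by rewrite -mulrDr /l -[LHS]mul1r -et; ring.
have EN e' : e' \in E -> N e'.
 apply: ih => {}e' he'; have [|n' Nn' [j' Jj' hl']] := hE e'; first by rewrite inE he' orbT.
 exists (n' + j' * t * n).
  by apply: ND => //; apply: NM => //; apply: srM => //; exact: JQ.
 have -> : e' - (n' + j' * t * n) = (e' - n' - j' * e) + (j' * t) * l by rewrite {1}ee; ring.
 by apply: JDl => //; apply: JE => //; apply: srM => //; exact: JQ.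
move=> e'; rewrite inE => /orP[/eqP ->|]; last exact: EN.
rewrite ee; apply: ND; apply: NM => //.
apply: (lin_min hN EN); apply: lin_mono hl; exact: JQ.
Qed.

Section Model.
Variables (X : seq F) (r : nat) (u : 'I_r -> F).
Hypothesis hm : model V k A X u.
Let S := mring V A X u.
Let M := frac S.
Let hS : subr S. Proof. exact: mring_subr. Qed.
Let hM : sfield M. Proof. exact: frac_sfield. Qed.
Let u0 : forall i, u i != 0. Proof. by case: hm => -[]. Qed.
Let Su i : S (u i). Proof. exact: mring_u. Qed.
Let SM x : S x -> M x. Proof. exact: frac_base. Qed.

Definition pmon (b : {ffun 'I_r -> 'I_p}) := \prod_i u i ^+ b i.

Lemma pmon_n0 b : pmon b != 0.
Proof. by apply/prodf_neq0 => i _; rewrite expf_neq0. Qed.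

(** The coordinates [m b] are the p-th roots of the coefficients, so that Frobenius linearity takes
    the form of [pspanM]. *)
Definition pspan B x := exists2 m : {ffun 'I_r -> 'I_p} -> F, forall b, B (m b) & x = \sum_b pmon b * m b ^+ p.

Lemma pspan0 B : subr B -> pspan B 0.
move=> hB; exists (fun=> 0) => [b|]; first exact: sr0.
by rewrite big1 // => b _; rewrite expr0n eqn0Ngt p0 mulr0.
Qed.

Lemma pspanD B x y : subr B -> pspan B x -> pspan B y -> pspan B (x + y).
move=> hB [m hm' ->] [n hn ->]; exists (fun b => m b + n b) => [b|]; first exact: srD.
by rewrite -big_split; apply: eq_bigr => b _; rewrite frobD mulrDr.
Qed.

Lemma pspanM B x c : subr B -> B c -> pspan B x -> pspan B (c ^+ p * x).
move=> hB Bc [m hm' ->]; exists (fun b => c * m b) => [b|]; first exact: srM.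
by rewrite mulr_sumr; apply: eq_bigr => b _; rewrite exprMn; ring.
Qed.

Lemma pspan_mon B b c : subr B -> B c -> pspan B (pmon b * c ^+ p).
move=> hB Bc; exists (fun b' => if b' == b then c else 0) => [b'|].
 by case: ifP => // _; exact: sr0.
rewrite (bigD1 b) //= eqxx big1 ?addr0 // => b' /negbTE ->.
by rewrite expr0n eqn0Ngt p0 mulr0.
Qed.

Definition mmod (m : 'X_{1..r}) : {ffun 'I_r -> 'I_p} := [ffun i => Ordinal (ltn_pmod (m i) p0)].

Lemma mev_frob m : mev u m = pmon (mmod m) * (mev u [multinom (m i %/ p)%N | i < r]) ^+ p.
rewrite /mev /pmon -prodrXl -big_split; apply: eq_bigr => i _ /=.
by rewrite mnmE ffunE /= -exprM -exprD addnC -divn_eq.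
Qed.

(** Truncated expansions show the claim modulo the ideal of the [u i ^+ p], because [k] is perfect.
    As [S] is finite over its p-th powers, Nakayama's lemma over that subring removes the
    remainder. *)
Lemma mring_frob s : S s -> pspan S s.
have [hu um XV hc] := hm; have SV x : S x -> V x by exact: mring_V.
have Sinv x : S x -> vu V x -> S x^-1 by exact: mring_inv.
pose Q := frobp p S; have hQ : subr Q by exact: frobp_subr.
have QS x : Q x -> S x by move=> [c hcS ->]; exact: srX.
pose up i := u i ^+ p.
have Qup i : Q (up i) by exists (u i).
pose J := igen Q up.
have hJ : ideal Q J.
 by split; [exact: igen0|move=> ? ?; exact: igenD|move=> ? ?; exact: igenM].
have JQ j : J j -> Q j by move=> [b hb ->]; apply: sr_sum => // i _; apply: srM.
have Ji j : J j -> exists2 t, Q t & t * (1 - j) = 1.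
 move=> [b hb ->]; have hb' i : {c | S c /\ b i = c ^+ p} by apply: cid; have [c h1 h2] := hb i; exists c.
 pose w := \sum_i sval (hb' i) * u i.
 have Sw : S w by apply: sr_sum => // i _; apply: srM => //; case: (svalP (hb' i)).
 have w1 : vu V (1 - w).
  apply: vm_one => //; apply: vm_sum => // i _; apply: vmMr => //; apply: SV; by case: (svalP (hb' i)).
 exists ((1 - w)^-1 ^+ p).
  by exists (1 - w)^-1 => //; apply: Sinv => //; apply: srB => //; exact: sr1.
 have -> : 1 - \sum_i b i * up i = (1 - w) ^+ p.
  rewrite frobB expr1n frob_sum; congr (_ - _); apply: eq_bigr => i _.
  by rewrite exprMn; have [_ <-] := svalP (hb' i).
 by rewrite -exprMn mulVf ?expr1n // (vu_n0 w1).
have hN : ideal Q (pspan S).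
 split; [exact: pspan0|move=> ? ?; exact: pspanD |].
 by move=> _ x [c Sc ->]; exact: pspanM.
(* The truncation order [#|'I_r| * p + 1] is the bound beyond which every monomial contains some
   p-th power [u i ^+ p]. *)
have key x : S x -> exists2 n, pspan S n & igen S up (x - n).
 move=> Sx; have [c [kc hx]] := expansionP hk hc Sx.
 exists (\sum_(m : 'X_{1..r < (#|'I_r| * p).+1}) c m * mev u m).
  apply: (ideal_sum _ hN) => m _; have [d kd ->] := kp (kc m).
  rewrite mev_frob mulrCA -exprMn; apply: pspan_mon => //.
  by apply: srM => //; [apply: mring_A => //; exact: kA|exact: mev_sr].
 apply: (@ipow_absorb _ S hS _ u Su (igen S up) p) (hx _).
  by split; [exact: igen0|move=> ? ?; exact: igenD|move=> ? ?; exact: igenM].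
 by move=> i; exact: igen_mem.
have [E ES hE] : ffin p S by apply: ffin_loc; [exact: adjs_subr|exact: ffin_adjs].
have NE : forall e, e \in E -> pspan S e.
 apply: (nakayama hQ hJ JQ Ji hN) => e /ES/key[n Nn hn]; exists n => //.
 have JDl (t : seq F) x y : lin J t x -> lin J t y -> lin J t (x + y).
  elim: t x y => [|z t ih] x y /=; first by move=> -> ->; rewrite addr0.
  move=> [b hb h] [d hd h']; exists (b + d); first by case: hJ => _ h1 _; exact: h1.
  by rewrite mulrDl opprD addrACA; exact: ih.
 have J0l (t : seq F) : lin J t 0.
  elim: t => //= z t ih; exists 0; first by case: hJ.
  by rewrite mul0r subr0.
 have JQl (t : seq F) j x : J j -> lin Q t x -> lin J t (j * x).
  move=> Jj; elim: t x => [|z t ih] x /=; first by move->; rewrite mulr0.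
  move=> [b hb h]; exists (b * j); first by case: hJ => _ _ h1; exact: h1.
  have -> : j * x - b * j * z = j * (x - b * z) by ring.
  exact: ih.
 case: hn => b hb ->; elim/big_rec: _ => [|i x _ hx]; first exact: J0l.
 apply: JDl hx; rewrite mulrC; apply: JQl; first exact: igen_mem.
 exact: hE.
by move=> /hE; exact: lin_min.
Qed.

Lemma frac_frob x : M x -> pspan M x.
move=> [a [t [Sa St t0 ->]]].
have -> : a / t = (t^-1) ^+ p * (a * t ^+ p.-1).
 by rewrite exprVn -{1}(prednK p0) exprS; field; rewrite t0 expf_neq0.
apply: pspanM; [by case: hM|by apply: sfV => //; exact: SM |].
have [m hm' ->] : pspan S (a * t ^+ p.-1) by apply: mring_frob; apply: srM => //; exact: srX.
by exists m => // b; exact: SM.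
Qed.

(** In the basis given by the values of the [u i], the value of [h ^+ p] has coordinates divisible
    by [p], while those of [b] and [b'] differ by less than [p]. *)
Lemma pmon_distinct b b' h : M h -> h != 0 -> vu V (pmon b / pmon b' * h ^+ p) -> b = b'.
move=> Mh h0; have [a ha] := model_zev hV hk kV hA kA AV AN hm Mh h0.
have [[_ ui] _ _ _] := hm.
have e c : pmon c = zev u (fun i => (c i)%:Z) by apply: eq_bigr.
move=> hb; apply/ffunP => i; apply: val_inj => /=.
have : vu V (zev u (fun i => ((b i)%:Z - (b' i)%:Z) + a i * p%:Z)).
 rewrite -zevD // zev_div // -!e -zevZ -exprnP.
 have := vu_div hV hb (vuX hV p ha); congr vu.
 by rewrite expr_div_n; field; rewrite !expf_neq0 ?zev_n0 ?pmon_n0.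
move=> /ui/(_ i) ei; have := ltn_ord (b i); have := ltn_ord (b' i).
have [a0|a0] : a i = 0 \/ (a i >= 1) \/ (a i <= -1) by lia.
 by move: ei; rewrite a0; lia.
nia.
Qed.

Lemma pspan_not_pth m b h : (forall b, M (m b)) -> m b != 0 -> m [ffun=> Ordinal p0] = 0 ->
 M h -> h != 0 -> ~ vu V ((\sum_b pmon b * m b ^+ p) / h ^+ p).
move=> hm' mb m0 Mh h0 hu.
have sumE : \sum_(b | m b != 0) pmon b * m b ^+ p = \sum_b pmon b * m b ^+ p.
 rewrite [RHS](bigID (fun b => m b != 0)) /= [X in _ + X]big1 ?addr0 // => c.
 by rewrite negbK => /eqP ->; rewrite expr0n eqn0Ngt p0 mulr0.
have [||c d /= mc md cd hcd|c0 [/= mc0 _ hs]] := v_distinct hV (P := fun b => m b != 0) (t := fun b => pmon b * m b ^+ p).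
- by exists b.
- by move=> c /= mc; rewrite mulf_neq0 ?pmon_n0 ?expf_neq0.
- move/eqP: cd; apply; apply: (@pmon_distinct c d (m c / m d)); first exact: sf_div.
  by rewrite mulf_neq0 ?invr_eq0.
 by move: hcd; congr vu; rewrite expr_div_n; field; rewrite pmon_n0 expf_neq0.
rewrite sumE in hs; have c0z : c0 = [ffun=> Ordinal p0].
 apply: (@pmon_distinct _ _ (m c0 / h)); first exact: sf_div.
  by rewrite mulf_neq0 ?invr_eq0.
 have -> : pmon [ffun=> Ordinal p0] = 1.
  by rewrite /pmon big1 // => i _; rewrite ffunE expr0.
 have := vu_div hV hu hs; congr vu; rewrite expr_div_n.
 have := vu_n0 hu; rewrite mulf_eq0 negb_or => /andP[s0 _].
 by field; rewrite s0 pmon_n0 !expf_neq0 // oner_neq0.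
by move: mc0; rewrite c0z m0 eqxx.
Qed.

(** Removing the component at the trivial monomial is subtracting a p-th power. The other components
    have values pairwise distinct modulo [p] and never divisible by [p]. *)
Lemma insep_adjust x : M x -> ~ frobp p M x ->
 exists2 m, M m & forall h, M h -> h != 0 -> ~ vu V ((x - m ^+ p) / h ^+ p).
move=> Mx nx; have [m hm' ex] := frac_frob Mx.
pose z : {ffun 'I_r -> 'I_p} := [ffun=> Ordinal p0].
have z1 : pmon z = 1 by rewrite /pmon big1 // => i _; rewrite ffunE expr0.
exists (m z) => // h Mh h0.
pose m' b := if b == z then 0 else m b.
have hm'' b : M (m' b) by rewrite /m'; case: ifP => // _; apply: sr0; case: hM.
have e : x - m z ^+ p = \sum_b pmon b * m' b ^+ p.
 rewrite ex (bigD1 z) //= [RHS](bigD1 z) //= !z1 !mul1r addrAC subrr add0r /m' eqxx expr0n eqn0Ngt p0 add0r.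
 by apply: eq_bigr => b /negbTE ->.
rewrite e; have [[b mb]|hno] := pselect (exists b, m' b != 0).
 by apply: (pspan_not_pth hm'' mb) => //; rewrite /m' eqxx.
case: nx; exists (m z) => //; apply/eqP; rewrite -subr_eq0 e big1 // => b _.
have -> : m' b = 0 by apply/eqP/negPn/negP => mb; apply: hno; exists b.
by rewrite expr0n eqn0Ngt p0 mulr0.
Qed.

(** Induction on the pole [t]. The only component of [s / mev u t] that is a p-th power is that of
    some [n], and modulo [n ^+ p - n] it may be replaced by [n] itself, whose pole [t %/ p] is
    smaller. *)
Lemma as_decompose t s : S s -> exists m s' n, [/\ forall b, M (m b), m [ffun=> Ordinal p0] = 0, S s', M n &
 s / mev u t = \sum_b pmon b * m b ^+ p + s' + (n ^+ p - n)].
have Ms : subr M := proj1 hM.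
pose z : {ffun 'I_r -> 'I_p} := [ffun=> Ordinal p0].
have z1 : pmon z = 1 by rewrite /pmon big1 // => i _; rewrite ffunE expr0.
pose G x := exists m, [/\ forall b, M (m b), m z = 0 & x = \sum_b pmon b * m b ^+ p].
have GD x y : G x -> G y -> G (x + y).
 move=> [m [h1 h2 ->]] [n [h3 h4 ->]]; exists (fun b => m b + n b); split=> [b||]; first exact: srD.
  by rewrite h2 h4 addr0.
 by rewrite -big_split; apply: eq_bigr => b _; rewrite frobD mulrDr.
have G0 : G 0.
 exists (fun=> 0); split=> // [b|]; first exact: sr0.
 by rewrite big1 // => b _; rewrite expr0n eqn0Ngt p0 mulr0.
have Gm b c : b != z -> M c -> G (pmon b * c ^+ p).
 move=> bz Mc; exists (fun b' => if b' == b then c else 0); split=> [b'||].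
 - by case: ifP => // _; exact: sr0.
 - by rewrite eq_sym (negbTE bz).
 rewrite (bigD1 b) //= eqxx big1 ?addr0 // => b' /negbTE ->.
 by rewrite expr0n eqn0Ngt p0 mulr0.
have Mmev m : M (mev u m) by apply: mev_sr => // i; exact: SM.
suff : S s -> exists g s' n, [/\ G g, S s', M n & s / mev u t = g + s' + (n ^+ p - n)].
 by move=> h /h[g [s' [n [[m [h1 h2 ->]] h3 h4 h5]]]]; exists m, s', n.
have [N] := ubnP (mdeg t); elim: N t s => // N ih t s; rewrite ltnS => tN Ss.
have [->|t0] := eqVneq t 0%MM.
 exists 0, s, 0; split=> //; first by apply: sr0.
 by rewrite mev0 divr1 add0r subr0 expr0n eqn0Ngt p0 addr0.
pose q : 'X_{1..r} := [multinom (t i %/ p)%N | i < r].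
have [m Sm es] := mring_frob Ss.
have p1 : (1 < p)%N by apply: prime_gt1; exact: (pcharf_prime cp).
have qN : (mdeg q < N)%N.
 apply: leq_trans tN; rewrite !mdegE.
 have [i ti] : exists i, t i != 0%N.
  apply: contrapT => hno; move/eqP: t0; apply; apply/mnmP => i; rewrite mnm0E.
  by apply/eqP/negPn/negP => h; apply: hno; exists i.
 rewrite (bigD1 i) //= [X in (_ < X)%N](bigD1 i) //= -addSn; apply: leq_add.
  by rewrite mnmE ltn_Pdiv // lt0n.
 by apply: leq_sum => j _; rewrite mnmE leq_div.
have step b : b != mmod t -> G (pmon b * m b ^+ p / mev u t).
 move=> bt; have [i0 hi0] : exists i, b i != mmod t i.
  by apply: contrapT => h; move/eqP: bt; apply; apply/ffunP => i; apply/eqP/negPn/negP => h'; apply: h; exists i.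
 (* Subtraction of [t] from [b] with a borrow: [ka] is the p-th power taken out and [b'] the
    nonnegative remainder, nonzero because [b] is not [t] modulo [p]. *)
 pose ka : 'X_{1..r} := [multinom (t i %/ p + (b i < t i %% p)%N)%N | i < r].
 have blt i : ((if b i < t i %% p then b i + p - t i %% p else b i - t i %% p) < p)%N.
  have := ltn_ord (b i); have := ltn_pmod (t i) p0; case: ifP => *; lia.
 pose b' : {ffun 'I_r -> 'I_p} := [ffun i => Ordinal (blt i)].
 have e : pmon b * (mev u ka) ^+ p = pmon b' * mev u t.
  rewrite /pmon /mev -prodrXl -!big_split; apply: eq_bigr => i _ /=.
  rewrite mnmE ffunE /= -exprM -!exprD; congr (_ ^+ _).
  have := ltn_ord (b i); have := ltn_pmod (t i) p0; have := divn_eq (t i) p.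
  move: (t i %/ p)%N (t i %% p)%N => Q T et h1 h2.
  by case: (ltnP (b i) T) => h /=; rewrite mulnDl ?mul1n ?mul0n; [lia|rewrite addn0 et [RHS]addnCA subnK // addnC].
 have -> : pmon b * m b ^+ p / mev u t = pmon b' * (m b / mev u ka) ^+ p.
  have et : mev u t = pmon b * (mev u ka) ^+ p / pmon b' by rewrite e mulrC mulKf // pmon_n0.
  by rewrite et expr_div_n; field; rewrite !pmon_n0 expf_neq0 // mev_n0.
 apply: Gm; last by apply: sf_div => //; exact: SM.
 apply/eqP => /ffunP/(_ i0)/(congr1 val); rewrite !ffunE /= => h.
 move/eqP: hi0; apply; apply: val_inj; rewrite ffunE /=; move: h.
 have := ltn_ord (b i0); have := ltn_pmod (t i0) p0; case: ifP => *; lia.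
have [g [s' [n [Gg Ss' Mn e]]]] := ih q (m (mmod t)) qN (Sm _).
have Gsum : G (\sum_(b | b != mmod t) pmon b * m b ^+ p / mev u t).
 by elim/big_rec: _ => // b x bt; apply: GD; exact: step.
exists (\sum_(b | b != mmod t) pmon b * m b ^+ p / mev u t + g), s', (m (mmod t) / mev u q + n).
split=> //; first exact: GD.
 by apply: srD => //; apply: sf_div => //; exact: SM.
rewrite es (bigD1 (mmod t)) //= mulrDl mulr_suml.
have -> : pmon (mmod t) * m (mmod t) ^+ p / mev u t = (m (mmod t) / mev u q) ^+ p.
 by rewrite [mev u t]mev_frob expr_div_n; field; rewrite pmon_n0 expf_neq0 // mev_n0.
by rewrite frobD e; ring.
Qed.
End Model.

Lemma insep_step r M x : good V k A r M -> M x -> ~ frobp p M x ->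
 exists2 m, M m & forall h, M h -> h != 0 -> ~ vu V ((x - m ^+ p) / h ^+ p).
move=> [X [u hm eM]] /eM Mx nx; have [|m Mm hm'] := insep_adjust hm Mx.
 by move=> [c /eM Mc e]; apply: nx; exists c.
by exists m => [|h /eM]; [exact/eM|exact: hm'].
Qed.

(** The denominator of [x] is a monomial up to a unit, which is absorbed in the model. If the polar
    part found by [as_decompose] is not integral, it dominates and its value is not divisible by
    [p]. *)
Lemma as_step r M x : good V k A r M -> M x ->
 exists2 m, M m & V (x - (m ^+ p - m)) \/
  ~ V (x - (m ^+ p - m)) /\ forall h, M h -> h != 0 -> ~ vu V ((x - (m ^+ p - m)) / h ^+ p).
move=> [X [u hm eM]] Mx; have /eM[a [t [Sa St t0 ex]]] := Mx.
have [[u0 _] _ _ _] := hm.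
have [_ [ta [vt _ _ _]]] := model_value hV hk kV hA kA AV AN hm St t0.
set ep := t / mev u ta in vt.
have MS y : mring V A X u y -> M y by move=> h; apply/eM; apply: frac_base => //; exact: mring_subr.
have hM := good_sfield hV hA (ex_intro _ X (ex_intro2 _ _ u hm eM)).
have Mmev m : M (mev u m) by apply: mev_sr; [case: hM|move=> i; apply: MS; exact: mring_u].
have [y|w [tw hw Zw sub fr]] := model_monomialize hV hk kV hA kA AV AN (Z := [:: ep]) hm.
 by rewrite inE => /eqP ->; split; [exact: vu_V|apply/eM; apply: sf_div => //; exact: MS].
have Sep : mring V A X w ep by apply: Zw; rewrite inE.
have [tau etau] := tor_mev ta tw.
have e : x = (a / ep) / mev w tau.
 have m0 : mev u ta != 0 by exact: mev_n0.
 by rewrite ex -etau /ep; field; rewrite t0 m0.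
have Sa' : mring V A X w (a / ep).
 apply: srM; [exact: mring_subr|exact: sub|exact: mring_inv].
have [m [s' [n [h1 h2 h3 h4 h5]]]] := as_decompose hw tau Sa'.
have eM' y : frac (mring V A X w) y <-> M y by split=> [/fr/eM|/eM/fr].
exists n; first exact/eM'.
have e' : x - (n ^+ p - n) = \sum_b pmon w b * m b ^+ p + s' by rewrite e h5; ring.
rewrite e'; set g := \sum_b _.
have Vs' : V s' by case: hw => _ wm XV _; exact: (mring_V hV AV XV wm).
have [Vg|nVg] := pselect (V g); first by left; exact: srD.
right; have g0 : g != 0 by apply/eqP => g0; apply: nVg; rewrite g0; exact: sr0.
have ug : vu V ((g + s') / g).
 rewrite mulrDl divff //; apply: vuDm => //; first exact: vu1.
 by apply: vmMr => //; exact: nV_vm.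
have [b mb] : exists b, m b != 0.
 apply: contrapT => hno; move/eqP: g0; apply; rewrite /g big1 // => b _.
 have -> : m b = 0 by apply/eqP/negPn/negP => mb; apply: hno; exists b.
 by rewrite expr0n eqn0Ngt p0 mulr0.
split; first by move=> h; apply: nVg; rewrite -(addrK s' g); exact: srB.
move=> h Mh h0 hu; apply: (pspan_not_pth hw h1 mb h2 (proj2 (eM' h) Mh) h0).
have := vu_div hV hu ug; congr vu; rewrite -/g.
by field; rewrite g0 expf_neq0 //= -(mulIr_eq0 _ (mulIf (_ : g^-1 != 0))) ?invr_eq0 // (vu_n0 ug).
Qed.
End Frobenius.

(** * Integral multipliers for the conjugates of an element *)

Section Multiplier.
Variables (F : fieldType) (V : F -> Prop).
Hypothesis hV : vring V.
Let Vs : subr V := proj1 hV.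

Lemma coef_argmin (p : {poly F}) : p != 0 ->
 exists2 j, p`_j != 0 & (forall i, V (p`_i / p`_j)) /\ forall i, (j < i)%N -> vm V (p`_i / p`_j).
move=> pn0.
pose Q j := (p`_j != 0) && `[< forall i, V (p`_i / p`_j) >].
have exQ : exists j, Q j.
 have [||j0 hj0 hj] := @v_argmin _ V hV _ [seq i <- iota 0 (size p) | p`_i != 0] (fun i => p`_i).
 - move=> h; have : (size p).-1 \in [seq i <- iota 0 (size p) | p`_i != 0].
   by rewrite mem_filter mem_iota /= -lead_coefE lead_coef_eq0 pn0 add0n ltn_predL size_poly_gt0.
  by rewrite h.
 - by move=> i; rewrite mem_filter => /andP[].
 exists j0; move: hj0; rewrite mem_filter /Q => /andP[-> _] /=; apply/asboolP => i.
 have [->|pi] := eqVneq p`_i 0; first by rewrite mul0r; exact: sr0.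
 apply: hj; rewrite mem_filter pi mem_iota /=; rewrite ltnNge; apply/negP => h.
 by move: pi; rewrite nth_default ?eqxx.
have bQ j : Q j -> (j <= size p)%N.
 move=> /andP[pj _]; rewrite leqNgt; apply/negP => h.
 by move: pj; rewrite nth_default ?eqxx // ltnW.
case: (ex_maxnP exQ bQ) => j /andP[pj /asboolP hj] jmax; exists j => //; split=> // i ji.
have [//|hu] := vm_or_vu (hj i); exfalso.
have pi : p`_i != 0 by have := vu_n0 hu; rewrite mulf_eq0 negb_or => /andP[].
suff /jmax : Q i by rewrite leqNgt ji.
rewrite /Q pi /=; apply/asboolP => l.
have -> : p`_l / p`_i = (p`_l / p`_j) * (p`_i / p`_j)^-1 by field; rewrite pi pj.
by apply: srM => //; case: hu.
Qed.

(* With [a_j] the last coefficient of minimal value, [w = sum_(i >= j) (a_i / a_j) X^(i - j)];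
  at a root outside [V] the remaining terms of the equation bound [w] and [w X]. *)
Lemma integral_multiplier (p : {poly F}) x : p != 0 -> V x ->
 exists w : {poly F}, [/\ forall K, sfield K -> polyB K p -> polyB K w, vm V (w.[x] - 1) &
  forall y, p.[y] = 0 -> V w.[y] /\ V (w.[y] * y)].
move=> pn0 Vx; have [j pj [hj jm]] := coef_argmin pn0.
pose w := \poly_(i < size p) (p`_(i + j) / p`_j).
have wi i : w`_i = p`_(i + j) / p`_j.
 rewrite coef_poly; case: ltnP => // h; rewrite nth_default ?mul0r //.
 exact: leq_trans (leq_addr _ _).
have szw : (size w <= size p)%N by exact: size_poly.
have w0 : w`_0 = 1 by rewrite wi add0n divff.
have wV : polyB V w by move=> i; rewrite wi.
exists w; split=> [K hK hp i||y py].
- by rewrite wi; apply: sf_div.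
- have [q qV ew] : exists2 q, polyB (vm V) q & w = 1 + 'X * q.
  exists (\poly_(i < size p) w`_i.+1) => [i|].
   by rewrite coef_poly; case: ifP => _; [rewrite wi; apply: jm; rewrite addSn ltnS leq_addl|left].
  apply/polyP => -[|i]; rewrite coefD coef1 mulrC coefMX ?addr0 //= add0r [in RHS]coef_poly.
  case: ltnP => // h; rewrite nth_default //; apply: leq_trans szw _; exact: leqW.
 rewrite ew hornerD hornerC hornerM hornerX addrC addKr; apply: vmMr => //.
 rewrite horner_coef; apply: vm_sum => // i _; apply: vmM => //; exact: srX.
have [Vy|nVy] := pselect (V y).
 have h : V w.[y] by exact: polyB_horner.
 by split=> //; exact: srM.
have y0 : y != 0 by apply/eqP => y0; apply: nVy; rewrite y0; exact: sr0.
have Vyi : V y^-1 by case: (proj2 hV y).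
have e : w.[y] * y ^+ j = - \sum_(i < j) p`_i / p`_j * y ^+ i.
 rewrite (horner_coef_wide _ szw) mulr_suml.
 apply/eqP; rewrite -subr_eq0 opprK; apply/eqP.
 transitivity (p.[y] / p`_j); last by rewrite py mul0r.
 have szp : (size p <= size p + j)%N by exact: leq_addr.
 rewrite (horner_coef_wide _ szp) addnC big_split_ord /= mulrDl addrC !mulr_suml; congr (_ + _).
  by apply: eq_bigr => i _; rewrite mulrAC.
 by apply: eq_bigr => i _; rewrite wi exprD addnC; ring.
have e' : w.[y] * y = - \sum_(i < j) p`_i / p`_j * (y^-1) ^+ (j.-1 - i).
 have yj : y ^+ j != 0 by rewrite expf_neq0.
 apply: (mulIf yj); rewrite mulrAC e mulNr [in RHS]mulNr !mulr_suml; congr (- _).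
 apply: eq_bigr => i _; rewrite -!mulrA; congr (_ * _).
 rewrite -exprSr exprVn.
 have -> : y ^+ j = y ^+ (j.-1 - i) * y ^+ i.+1.
  by rewrite -exprD; congr (_ ^+ _); have := ltn_ord i; lia.
 by rewrite mulKf // expf_neq0.
have V' : V (w.[y] * y).
 by rewrite e'; apply: srN => //; apply: sr_sum => // i _; apply: srM => //; exact: srX.
by split=> //; rewrite -[w.[y]](mulfK y0); exact: srM.
Qed.
End Multiplier.

(** * Decomposition group and decomposition field *)

Section Decomposition.
Variables (L0 : fieldType) (N : splittingFieldType L0) (V k : N -> Prop).
Hypotheses (hV : vring V) (hk : sfield k) (kV : forall c, k c -> V c).
Hypothesis kres : forall x, V x -> exists2 c, k c & vm V (x - c).
Hypothesis k1 : forall c, k c -> c \in 1%VS.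
Let Vs : subr V := proj1 hV.
Implicit Types (B K E : {subfield N}) (s t : gal_of {:N}).

Definition inF B (x : N) : Prop := x \in B.

Lemma inF_sfield B : sfield (inF B).
split; last by move=> x; rewrite /inF memvV.
split; rewrite /inF; [exact: rpred1|by move=> x y; exact: rpredB|by move=> x y; exact: rpredM].
Qed.

Lemma polyB_over B (p : {poly N}) : polyB (inF B) p <-> p \is a polyOver B.
Proof. by split=> [h|/polyOverP h i]; [apply/polyOverP => i; exact: h|exact: h]. Qed.

Lemma gal_k B s c : s \in 'Gal({:N} / B)%g -> k c -> s c = c.
move=> sB kc; apply: (fixed_gal (subvf B) sB).
by apply: (subvP (sub1v B)); exact: k1.
Qed.

Lemma gal_B B s x : s \in 'Gal({:N} / B)%g -> x \in B -> s x = x.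
Proof. exact: (fixed_gal (subvf B)). Qed.

Lemma galMf s t x : (s * t)%g x = t (s x).
Proof. by rewrite galM // memvf. Qed.

Lemma gal_horner B s (p : {poly N}) x : s \in 'Gal({:N} / B)%g -> polyB (inF B) p -> s p.[x] = p.[s x].
move=> sB pB; rewrite !horner_coef rmorph_sum; apply: eq_bigr => i _.
by rewrite rmorphM rmorphXn /= (gal_B sB) //; exact: pB.
Qed.

(** The decomposition group; one inclusion suffices because the Galois group is finite. *)
Definition stab : {set gal_of {:N}} := [set s : gal_of {:N} | `[< forall x, V x -> V ((s : gal_of {:N}) x) >]].

Lemma stabP s : reflect (forall x, V x -> V (s x)) (s \in stab).
Proof. by rewrite inE; exact: asboolP. Qed.

Lemma stab_group_set : group_set stab.
apply/group_setP; split; first by apply/stabP => x; rewrite gal_id.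
move=> s t /stabP hs /stabP ht; apply/stabP => x Vx; rewrite galMf; apply: ht; exact: hs.
Qed.
Canonical stab_group := Group stab_group_set.

Lemma stab_vm s x : s \in stab -> vm V x -> vm V (s x).
move=> hs [->|h]; first by left; rewrite rmorph0.
right => h'; apply: h; have si : (s^-1)%g \in stab by rewrite groupV.
have := stabP _ si _ h'; rewrite -fmorphV -galMf mulgV gal_id //.
Qed.

Lemma fixed_separable B x : separable_element B x ->
 (forall s, s \in 'Gal({:N} / B)%g -> s x = x) -> x \in B.
move=> sx fx; have [r _ er] := normalFieldP (normalFieldf B) x (memvf x).
have rx y : y \in r -> y = x.
 move=> yr; have [|s sB <-] := normalField_root_minPoly (subvf B) (normalFieldf B) (memvf x) (b := y).
  by rewrite er root_prod_XsubC.
 exact: fx.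
have ur : uniq r by move: sx; rewrite /separable_element er separable_prod_XsubC.
have sr : (size r <= 1)%N.
 have : {subset r <= [:: x]} by move=> y /rx ->; rewrite mem_head.
 by move/(uniq_leq_size ur).
rewrite -adjoin_deg_eq1 -eqSS -size_minPoly er size_prod_XsubC eqSS eqn_leq sr /=.
have := size_minPoly B x; rewrite er size_prod_XsubC => -[->].
by rewrite lt0n; apply/negP => /eqP h; have := adjoin0_deg B; have := size_minPoly B x; rewrite h; case: (adjoin_degree B x).
Qed.

Lemma vm_prod1 (I : Type) (r : seq I) (P : pred I) (f : I -> N) :
 (forall i, P i -> vm V (f i - 1)) -> vm V (\prod_(i <- r | P i) f i - 1).
move=> h; elim/big_rec: _ => [|i x Pi hx]; first by rewrite subrr; left.
have -> : f i * x - 1 = (f i - 1) * (x - 1 + 1) + (x - 1) by ring.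
apply: vmD => //; apply: vmM => //; [exact: h|apply: srD => //; [exact: vm_V|exact: sr1]].
Qed.

Lemma vm1_vu x : vm V (x - 1) -> vu V x.
Proof. by move=> h; rewrite -[x](subrK 1) addrC; apply: vuDm => //; exact: vu1. Qed.

(** One conjugate is congruent to 1 and all others are congruent to 0. Hence [th] is a simple root
    modulo the maximal ideal, and the group elements fixing it are exactly those of the
    decomposition group over [B]. *)
Definition dec_elt B th := [/\ separable_element B th, vm V (th - 1),
 forall s, s \in 'Gal({:N} / B)%g -> s \in stab -> s th = th &
 forall s, s \in 'Gal({:N} / B)%g -> s \notin stab -> vm V (s th)].

(** For each [t] outside the decomposition group, some [x] in [V] has [t x] outside [V]; its
    multiplier is congruent to 1, has integral conjugates, and is made small by [t]. The rest is a
    product over all such [t], followed by a norm. *)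
Lemma dec_elt_exists B : exists th, dec_elt B th.
have hb t : {b : N | t \in 'Gal({:N} / B)%g -> t \notin stab -> [/\ vm V (b - 1),
  forall s, s \in 'Gal({:N} / B)%g -> V (s b) & vm V (t b)]}.
 apply: cid; have [[tB ts]|h] := pselect (t \in 'Gal({:N} / B)%g /\ t \notin stab); last first.
  by exists 0 => h1 h2; case: h.
 have [x [Vx nVx]] : exists x, V x /\ ~ V (t x).
  apply: contrapT => hno; move/negP: ts; apply; apply/stabP => x Vx.
  by apply: contrapT => h; apply: hno; exists x.
 have mp0 : minPoly B x != 0 by rewrite monic_neq0 // monic_minPoly.
 have [w [wB w1 wr]] := integral_multiplier hV mp0 Vx.
 have mpB : polyB (inF B) (minPoly B x) by apply/polyB_over; exact: minPolyOver.
 have {}wB := wB _ (inF_sfield B) mpB.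
 have root s : s \in 'Gal({:N} / B)%g -> (minPoly B x).[s x] = 0.
  by move=> sB; rewrite -(gal_horner x sB mpB); have /rootP -> := root_minPoly B x; rewrite rmorph0.
 exists w.[x] => _ _; split=> // [s sB|].
  by rewrite (gal_horner _ sB wB); case: (wr _ (root s sB)).
 rewrite (gal_horner _ tB wB); have [_ h] := wr _ (root t tB).
 have tx0 : t x != 0 by apply/eqP => tx0; apply: nVx; rewrite tx0; exact: sr0.
 by rewrite -[w.[_]](mulfK tx0); apply: vmMr => //; exact: nV_vm.
pose b t := sval (hb t).
pose c := \prod_(t in 'Gal({:N} / B)%g | t \notin stab) b t.
have c1 : vm V (c - 1).
 by apply: vm_prod1 => t /andP[tB ts]; case: (svalP (hb t) tB ts).
have cV s : s \in 'Gal({:N} / B)%g -> V (s c).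
 move=> sB; rewrite rmorph_prod; apply: sr_prod => // t /andP[tB ts].
 by case: (svalP (hb t) tB ts) => _ + _; exact.
have cm s : s \in 'Gal({:N} / B)%g -> s \notin stab -> vm V (s c).
 move=> sB ss; rewrite rmorph_prod (bigD1 s) ?sB ?ss //=; apply: vmM => //.
  by case: (svalP (hb s) sB ss).
 apply: sr_prod => // t /andP[/andP[tB ts] _].
 by case: (svalP (hb t) tB ts) => _ + _; exact.
pose DB : {group gal_of {:N}} := ('Gal({:N} / B) :&: stab_group)%G.
have DBP d : d \in DB -> d \in 'Gal({:N} / B)%g /\ d \in stab by rewrite inE => /andP[].
(* A norm over the decomposition group makes [c] invariant. The factor at [d = 1] keeps the image
   under an outside element in the maximal ideal. *)
pose th := \prod_(d in DB) (d : gal_of {:N}) c.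
have th1 : vm V (th - 1).
 apply: vm_prod1 => d /DBP[dB ds].
 have -> : (d : gal_of {:N}) c - 1 = (d : gal_of {:N}) (c - 1) by rewrite rmorphB rmorph1.
 exact: stab_vm.
have sth s : s th = \prod_(d in DB) (d * s)%g c.
 by rewrite rmorph_prod; apply: eq_bigr => d _; rewrite galMf.
have thf s : s \in 'Gal({:N} / B)%g -> s \in stab -> s th = th.
 move=> sB ss; rewrite sth; have sD : s \in DB by rewrite inE sB.
 rewrite [RHS](reindex_inj (mulIg s)) /=; apply: eq_bigl => d.
 by rewrite groupMr.
have thm s : s \in 'Gal({:N} / B)%g -> s \notin stab -> vm V (s th).
 move=> sB ss; rewrite sth (bigD1 1%g) ?group1 //= mul1g; apply: vmM => //; first exact: cm.
 apply: sr_prod => // d /andP[/DBP[dB ds] _]; apply: cV; exact: groupM.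
(* Separability is reached by raising to a power of the characteristic exponent, which preserves the
   congruences. *)
have [n /andP[n0 hn]] := separable_exponent_pchar B th.
exists (th ^+ n); split=> //.
- by rewrite -(card_ord n) -prodr_const; apply: vm_prod1.
- by move=> s sB ss; rewrite rmorphXn /= thf.
- move=> s sB ss; rewrite rmorphXn /=; have /andP[n1 _] := n0.
 by rewrite -(prednK n1); apply: vmX => //; exact: thm.
Qed.

Lemma dec_elt_pow B th n : dec_elt B th -> (0 < n)%N -> dec_elt B (th ^+ n).
move=> [h0 h1 h2 h3] n0; split.
- have hs : separable B <<B & [:: th]>> by apply: separable_Fadjoin_seq; rewrite /= h0.
 by apply: (separableP hs); apply: rpredX; apply: seqv_sub_adjoin; exact: mem_head.
- by rewrite -(card_ord n) -prodr_const; apply: vm_prod1.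
- by move=> s sB ss; rewrite rmorphXn /= h2.
- by move=> s sB ss; rewrite rmorphXn /=; case: n n0 => // m _; apply: vmX => //; exact: h3.
Qed.

Section DecElt.
Variables (B : {subfield N}) (th : N).
Hypothesis hth : dec_elt B th.
Local Notation G := ('Gal({:N} / B)%g).

Definition conjs : seq N := undup [seq (t : gal_of {:N}) th | t <- enum G].

Lemma conjsP y : reflect (exists2 t, t \in G & y = t th) (y \in conjs).
rewrite mem_undup; apply: (iffP mapP) => -[t tG ->]; exists t => //; last by rewrite mem_enum.
by rewrite mem_enum in tG.
Qed.

Lemma conjs_th : th \in conjs.
Proof. by apply/conjsP; exists 1%g; rewrite ?group1 ?gal_id. Qed.

Lemma conjs_gal s y : s \in G -> y \in conjs -> s y \in conjs.
by move=> sG /conjsP[t tG ->]; apply/conjsP; exists (t * s)%g; rewrite ?groupM // galMf.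
Qed.

Lemma conjs_perm s : s \in G -> perm_eq [seq s y | y <- conjs] conjs.
move=> sG; have us : uniq [seq s y | y <- conjs].
 by rewrite map_inj_uniq ?undup_uniq //; exact: fmorph_inj.
apply: uniq_perm => //; first exact: undup_uniq.
apply: (uniq_min_size us _ _).2; last by rewrite size_map.
by move=> _ /mapP[y yc ->]; exact: conjs_gal.
Qed.

Lemma conjs_vm y : y \in conjs -> y != th -> vm V y.
move=> /conjsP[t tG ->] yth; have [_ _ h2 h3] := hth; apply: h3 => //.
by apply: contra yth => ts; rewrite h2.
Qed.

Lemma th_vu : vu V th. Proof. by case: hth => _ h _ _; exact: vm1_vu. Qed.

Lemma conjs_V y : y \in conjs -> V y.
have [-> _|yth yc] := eqVneq y th; first by case: th_vu.
by apply: vm_V => //; exact: conjs_vm.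
Qed.

Lemma conjs_n0 y : y \in conjs -> y != 0.
Proof. by move=> /conjsP[t _ ->]; rewrite fmorph_eq0; exact: vu_n0 th_vu. Qed.

Lemma conjs_sep : separable B <<B & conjs>>.
apply: separable_Fadjoin_seq; apply/allP => _ /conjsP[t tG ->].
have [/separable_elementP[f [fB rf sf]] _ _ _] := hth.
apply/separable_elementP; exists f; split=> //.
by rewrite /root -(gal_horner th tG) ?(rootP rf) ?rmorph0 //; exact/polyB_over.
Qed.

Lemma conjs_mem y : y \in conjs -> y \in <<B & conjs>>%VS.
Proof. by move=> yc; exact: seqv_sub_adjoin. Qed.

Lemma conjs_fixed x : x \in <<B & conjs>>%VS -> (forall s, s \in G -> s x = x) -> x \in B.
Proof. by move=> xO fx; apply: fixed_separable => //; exact: (separableP conjs_sep). Qed.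

Lemma conjs_poly (P : {poly N}) : polyB (inF <<B & conjs>>%AS) P ->
 (forall s, s \in G -> map_poly s P = P) -> polyB (inF B) P.
move=> hP fP i; apply: conjs_fixed; first exact: hP.
by move=> s sG; rewrite -[in RHS](fP s sG) coef_map.
Qed.

Let hO := inF_sfield <<B & conjs>>%AS.
Let Os : subr (inF <<B & conjs>>%AS) := proj1 hO.

Lemma inF_O (p : {poly N}) : polyB (inF B) p -> polyB (inF <<B & conjs>>%AS) p.
Proof. by move=> pB i; apply: (subvP (subv_adjoin_seq B conjs)); exact: pB. Qed.

Lemma conjs_horner (p : {poly N}) y : polyB (inF B) p -> y \in conjs -> inF <<B & conjs>>%AS p.[y].
Proof. by move=> pB yc; apply: polyB_horner => //; [exact: inF_O|exact: conjs_mem]. Qed.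

Lemma map_XsubC s (c : N) : map_poly s ('X - c%:P) = 'X - (s c)%:P.
Proof. by rewrite rmorphB /= map_polyX map_polyC. Qed.

Lemma conjs_prod (p : {poly N}) : polyB (inF B) p ->
 polyB (inF B) (\prod_(y <- conjs) ('X - (p.[y])%:P)).
move=> pB; apply: conjs_poly => [|s sG].
 rewrite big_seq; apply: polyB_prod => // y yc; apply: polyBB => //; first exact: polyBX.
 by apply: polyBC => //; exact: conjs_horner.
rewrite rmorph_prod -[RHS](perm_big _ (conjs_perm sG)) big_map; apply: eq_bigr => y _ /=.
by rewrite map_XsubC (gal_horner _ sG pB).
Qed.

(** Lagrange interpolation through the conjugates, without denominators. The Galois group permutes
    the summands, so the coefficients descend to [B]. *)
Lemma conjs_sum (p : {poly N}) : polyB (inF B) p ->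
 polyB (inF B) (\sum_(y <- conjs) p.[y] *: \prod_(z <- rem y conjs) ('X - z%:P)).
move=> pB; apply: conjs_poly => [|s sG].
 rewrite big_seq; apply: polyB_sum => // y yc i; rewrite coefZ; apply: srM => //; first exact: conjs_horner.
 move: i; rewrite big_seq; apply: polyB_prod => // z /mem_rem zc; apply: polyBB => //; first exact: polyBX.
 by apply: polyBC => //; exact: conjs_mem.
rewrite rmorph_sum -[RHS](perm_big _ (conjs_perm sG)) big_map !big_seq; apply: eq_bigr => y yc /=.
rewrite map_polyZ /= (gal_horner _ sG pB) rmorph_prod; congr (_ *: _).
have pr : perm_eq [seq s z | z <- rem y conjs] (rem (s y) conjs).
 rewrite -(perm_cons (s y)); apply: (perm_trans _ (perm_to_rem (conjs_gal sG yc))).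
 apply: (perm_trans _ (conjs_perm sG)); rewrite -map_cons; apply: perm_map.
 by rewrite perm_sym; exact: perm_to_rem.
by rewrite -(perm_big _ pr) big_map; apply: eq_bigr => z _ /=; rewrite map_XsubC.
Qed.

Definition dpoly : {poly N} := \prod_(y <- conjs) ('X - y%:P).

Lemma dpoly_B : polyB (inF B) dpoly.
have := conjs_prod (polyBX (proj1 (inF_sfield B))); rewrite /dpoly.
by congr polyB; apply: eq_bigr => y _; rewrite hornerX.
Qed.

Lemma dpoly_V : polyB V dpoly.
rewrite /dpoly big_seq; apply: polyB_prod => // y yc; apply: polyBB => //; first exact: polyBX.
by apply: polyBC => //; exact: conjs_V.
Qed.

Lemma dpoly_root : dpoly.[th] = 0.
Proof. by apply/rootP; rewrite root_prod_XsubC conjs_th. Qed.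

Lemma dpoly_deriv : dpoly^`().[th] = \prod_(z <- rem th conjs) (th - z).
rewrite /dpoly (perm_big _ (perm_to_rem conjs_th)) big_cons derivM derivXsubC mul1r hornerD hornerM.
rewrite hornerXsubC subrr mul0r addr0 horner_prod; apply: eq_bigr => y _.
by rewrite hornerXsubC.
Qed.

Lemma dpoly_deriv_vu : vu V dpoly^`().[th].
rewrite dpoly_deriv big_seq; apply: vu_prod => // z; rewrite mem_rem_uniq ?undup_uniq // inE => /andP[zth zc].
by apply: vuDm => //; [exact: th_vu|apply: vmN => //; exact: conjs_vm].
Qed.

Lemma mem_adj x : x \in <<B; th>>%VS <-> exists2 q, polyB (inF B) q & x = q.[th].
split=> [/Fadjoin_polyP[q /polyB_over qB e]|[q qB e]]; first by exists q.
by apply/Fadjoin_polyP; exists q => //; exact/polyB_over.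
Qed.

Lemma dec_indep (q : {poly N}) : polyB (inF B) q -> (size q <= size conjs)%N -> q.[th] = 0 -> q = 0.
move=> qB sq q0; apply/eqP/negPn/negP => qn0.
have : all (root q) conjs.
 apply/allP => _ /conjsP[t tG ->]; rewrite /root -(gal_horner th tG qB) q0 rmorph0 //.
by move/(max_poly_roots qn0)/(_ (undup_uniq _)); rewrite ltnNge sq.
Qed.

Lemma conj_nonzero (q : {poly N}) y : polyB (inF B) q -> q.[th] != 0 -> y \in conjs -> q.[y] != 0.
by move=> qB q0 /conjsP[t tG ->]; rewrite -(gal_horner th tG qB) fmorph_eq0.
Qed.

Lemma dec_quot x : x \in <<B; th>>%VS -> V x -> exists f g : {poly N},
 [/\ polyB (inF B) f /\ polyB V f, polyB (inF B) g /\ polyB V g, vu V g.[th] & x * g.[th] = f.[th]].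
move=> /mem_adj[q qB ex] Vx.
have mp0 : minPoly B x != 0 by rewrite monic_neq0 // monic_minPoly.
have [w [wB w1 wr]] := integral_multiplier hV mp0 Vx.
have mpB : polyB (inF B) (minPoly B x) by apply/polyB_over; exact: minPolyOver.
have {}wB := wB _ (inF_sfield B) mpB.
have Bs := proj1 (inF_sfield B).
pose a := w \Po q; pose b := a * q.
have aB : polyB (inF B) a.
 apply/polyB_over; apply: polyOver_comp; exact/polyB_over.
have bB : polyB (inF B) b by exact: polyBM.
have ab y : y \in conjs -> V a.[y] /\ V b.[y].
 move=> /conjsP[t tG ->]; rewrite /b hornerM /a horner_comp.
 apply: wr; rewrite -(gal_horner th tG qB) -ex -(gal_horner x tG mpB).
 by have /rootP -> := root_minPoly B x; rewrite rmorph0.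
pose S (p : {poly N}) := \sum_(y <- conjs) p.[y] *: \prod_(z <- rem y conjs) ('X - z%:P).
have SV p : (forall y, y \in conjs -> V p.[y]) -> polyB V (S p).
 move=> h; rewrite /S big_seq; apply: polyB_sum => // y yc i; rewrite coefZ; apply: srM => //; first exact: h.
 move: i; rewrite big_seq; apply: polyB_prod => // z /mem_rem zc; apply: polyBB => //; first exact: polyBX.
 by apply: polyBC => //; exact: conjs_V.
have Sth p : (S p).[th] = p.[th] * dpoly^`().[th].
 rewrite dpoly_deriv /S horner_sum (bigD1_seq th) ?conjs_th ?undup_uniq //= [X in _ + X](_ : _ = 0) ?addr0.
  by rewrite hornerZ horner_prod; congr (_ * _); apply: eq_bigr => z _; rewrite hornerXsubC.
 rewrite big_seq_cond big1 // => y /andP[yc yth]; rewrite hornerZ horner_prod (big_rem th) /=; first by rewrite hornerXsubC subrr mul0r mulr0.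
 by rewrite mem_rem_uniq ?undup_uniq // inE eq_sym yth conjs_th.
exists (S b), (S a); split.
- by split; [exact: conjs_sum|apply: SV => y /ab[]].
- by split; [exact: conjs_sum|apply: SV => y /ab[]].
- rewrite Sth; apply: vuM => //; last exact: dpoly_deriv_vu.
 by rewrite /a horner_comp -ex; exact: vm1_vu.
- by rewrite !Sth /b hornerM -ex; ring.
Qed.

Lemma polyV_congr_prod (r : seq N) (f g : N -> {poly N}) :
 (forall y, y \in r -> [/\ polyB V (f y), polyB V (g y) & polyB (vm V) (f y - g y)]) ->
 polyB (vm V) (\prod_(y <- r) f y - \prod_(y <- r) g y).
elim: r => [|y r ih] h; first by rewrite !big_nil subrr => i; rewrite coef0; left.
have [f1 g1 h1] := h y (mem_head _ _).
have hr z : z \in r -> [/\ polyB V (f z), polyB V (g z) & polyB (vm V) (f z - g z)].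
 by move=> zr; apply: h; rewrite inE zr orbT.
have fr : polyB V (\prod_(y <- r) f y) by rewrite big_seq; apply: polyB_prod => // z /hr[].
rewrite !big_cons; have -> : f y * \prod_(j <- r) f j - g y * \prod_(j <- r) g j =
  (f y - g y) * \prod_(j <- r) f j + g y * (\prod_(j <- r) f j - \prod_(j <- r) g j) by ring.
move=> i; rewrite coefD !coefM; apply: vmD => //; apply: vm_sum => // j _.
 by apply: vmM => //; exact: fr.
by apply: vmMr => //; exact: ih.
Qed.

Lemma ratio_eq (a b c g ge q0 q1 t : N) : c != 0 -> ge != 0 -> t != 0 -> a != 0 -> b != 0 -> q0 != 0 ->
 a * ge = c * q0 -> b * (g * ge) = c * q1 -> g / t / (a / b) = q1 / q0 / t.
move=> c0 ge0 t0 a0 b0 q00 h1 h2.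
have e : g * b * q0 = q1 * a.
 apply: (mulIf (mulf_neq0 c0 ge0)); transitivity ((b * (g * ge)) * (c * q0)); first by ring.
 by rewrite h2 -h1; ring.
have -> : g / t / (a / b) = g * b * q0 / (a * q0 * t) by field; rewrite t0 a0 b0 q00.
by rewrite e; field; rewrite t0 a0 q00.
Qed.

(* Multiplying [z] by a power of [th] separates its value from those of its
  conjugates; it is then a slope of the Newton polygon, and a quotient of two
  consecutive coefficients has the same value. *)
Lemma dec_immediate z : z \in <<B; th>>%VS -> z != 0 -> exists2 m, m \in B & vu V (z / m).
move=> /mem_adj[q qB ez] z0; have q0 : q.[th] != 0 by rewrite -ez.
have Bs := proj1 (inF_sfield B).
(* Every other conjugate lies in the maximal ideal, so for each of them at most one exponent gives a
   unit; any larger exponent is safe. *)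
have [n hn] : exists n, forall y, y \in conjs -> y != th -> ~ vu V (y ^+ n * q.[y] / q.[th]).
 suff [n hn] : exists n, forall m, (n <= m)%N -> forall y, y \in conjs -> y != th -> ~ vu V (y ^+ m * q.[y] / q.[th]).
  by exists n; exact: hn.
 elim: {-2}conjs (fun y (h : y \in conjs) => h) => [|y r ih] rc; first by exists 0%N.
 have [|n hn] := ih; first by move=> w wr; apply: rc; rewrite inE wr orbT.
 have yc := rc y (mem_head _ _).
 have [yth|yth] := eqVneq y th.
  exists n => m nm w; rewrite inE => /orP[/eqP ->|wr]; first by rewrite yth eqxx.
  exact: hn.
 have [[n0 hn0]|hno] := pselect (exists n0, vu V (y ^+ n0 * q.[y] / q.[th])); last first.
  exists n => m nm w; rewrite inE => /orP[/eqP -> _ h|wr]; last exact: hn.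
  by apply: hno; exists m.
 exists (maxn n n0.+1) => m; rewrite geq_max => /andP[nm nm0] w; rewrite inE => /orP[/eqP -> _ h|wr]; last exact: hn.
 have := vu_div hV h hn0; apply: (vm_nvu (V := V)).
 have -> : y ^+ m * q.[y] / q.[th] / (y ^+ n0 * q.[y] / q.[th]) = y ^+ (m - n0.+1).+1.
  have -> : y ^+ m = y ^+ (m - n0.+1).+1 * y ^+ n0 by rewrite -exprD; congr (_ ^+ _); lia.
  by field; rewrite q0 (conj_nonzero qB q0 yc) expf_neq0 // conjs_n0.
 by apply: vmX => //; exact: conjs_vm.
pose gp := 'X^n * q.
have gB : polyB (inF B) gp by apply: polyBM => //; apply: polyBXn => //; exact: polyBX.
pose ga := gp.[th].
have gaE : ga = th ^+ n * z by rewrite /ga /gp hornerM hornerXn -ez.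
have ga0 : ga != 0 by rewrite gaE mulf_neq0 // expf_neq0 // (vu_n0 th_vu).
have gne y : y \in conjs -> y != th -> ~ vu V (gp.[y] / ga).
 move=> yc yth h; apply: (hn y yc yth); have := vuM hV h (vuX hV n th_vu); congr vu.
 by rewrite gaE -ez /gp hornerM hornerXn; field; rewrite z0 expf_neq0 // (vu_n0 th_vu).
have gy0 y : y \in conjs -> gp.[y] != 0 by exact: conj_nonzero.
pose up y := `[< V (gp.[y] / ga) >].
(* After rescaling the variable by [ga], each linear factor is a constant [kk y] times [qq y], which
   reduces to [rr y]. The reduced product is ['X - 1] times a power of ['X], so two consecutive
   coefficients are units: this is the slope of the Newton polygon. *)
pose qq y : {poly N} := if y == th then 'X - 1 else if up y then 'X - (gp.[y] / ga)%:P else 1 - (ga / gp.[y]) *: 'X.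
pose rr y : {poly N} := if y == th then 'X - 1 else if up y then 'X else 1.
pose kk y := if y == th then ga else if up y then ga else - gp.[y].
have small y : y \in conjs -> y != th -> up y -> vm V (gp.[y] / ga).
 by move=> yc yth /asboolP h; have [//|h'] := vm_or_vu h; case: (gne y yc yth).
have big y : y \in conjs -> ~~ up y -> vm V (ga / gp.[y]).
 by move=> yc /asboolPn h; rewrite -invf_div; exact: nV_vm.
have qr y : y \in conjs -> [/\ polyB V (qq y), polyB V (rr y) & polyB (vm V) (qq y - rr y)].
 move=> yc; rewrite /qq /rr; have PX := polyBX Vs; have P1 : polyB V 1 by apply: polyBC => //; exact: sr1.
 case: eqP => [_|/eqP yth].
  by split; [exact: polyBB|exact: polyBB|move=> i; rewrite subrr coef0; left].
 case: ifPn => h.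
  have hm := small y yc yth h; split=> //; first by apply: polyBB => //; apply: polyBC => //; exact: vm_V.
  move=> i; rewrite addrC addKr coefN coefC; case: ifP => _; first exact: vmN.
  by rewrite oppr0; left.
 have hm := big y yc h; split=> //.
  apply: polyBB => // i; rewrite coefZ; apply: (srM Vs); [exact: vm_V|exact: PX].
 move=> i; rewrite addrC addKr coefN coefZ; apply: vmN => //; apply: vmM => //; exact: PX.
pose P := \prod_(y <- conjs) ('X - (gp.[y])%:P).
have PB : polyB (inF B) P by exact: conjs_prod.
have eP : P \Po (ga *: 'X) = (\prod_(y <- conjs) kk y) *: \prod_(y <- conjs) qq y.
 rewrite /P rmorph_prod /= -[RHS]mul_polyC rmorph_prod -big_split !big_seq; apply: eq_bigr => y yc /=.
 rewrite rmorphB /= comp_polyX comp_polyC mul_polyC /kk /qq.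
 case: eqP => [->|/eqP yth].
  by rewrite scalerBr -/ga; congr (_ - _); rewrite -mul_polyC mulr1.
 case: ifPn => h; first by rewrite scalerBr -[_ *: (_)%:P]mul_polyC -rmorphM /= mulrCA divff // mulr1.
 rewrite scalerBr scalerA (_ : - gp.[y] * (ga / gp.[y]) = - ga); last by field; exact: gy0.
 by rewrite !scaleNr opprK addrC -[gp.[y] *: 1]mul_polyC mulr1.
pose e := size [seq y <- rem th conjs | up y].
have eR : \prod_(y <- conjs) rr y = ('X - 1) * 'X^e.
 rewrite (perm_big _ (perm_to_rem conjs_th)) big_cons {1}/rr eqxx; congr (_ * _).
 rewrite /e size_filter; have : {subset rem th conjs <= [pred y | y != th]}.
  by move=> y; rewrite mem_rem_uniq ?undup_uniq // inE => /andP[].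
 elim: (rem th conjs) => [|y r ih] hr; first by rewrite big_nil expr0.
 rewrite big_cons ih; last by move=> w wr; apply: hr; rewrite inE wr orbT.
 have := hr y (mem_head _ _); rewrite inE /rr /= => /negbTE ->.
 by case: ifP => _; rewrite ?mul1r ?add0n // add1n exprS.
pose Q := \prod_(y <- conjs) qq y.
have QR i : vm V (Q`_i - (('X - 1) * 'X^e)`_i).
 by have := polyV_congr_prod qr i; rewrite eR coefB.
have Q1 : vu V Q`_e.+1.
 apply: vm1_vu; have := QR e.+1; rewrite coefMXn ltnNge leqnSn /= subSn // subnn.
 by rewrite coefB coefX coef1 subr0.
have Q0 : vu V Q`_e.
 have := QR e; rewrite coefMXn ltnn subnn coefB coefX coef1 sub0r opprK => h.
 by rewrite -[Q`_e]opprK; apply: vuN => //; apply: vm1_vu; rewrite -opprD; apply: vmN.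
have ePi i : P`_i * ga ^+ i = (\prod_(y <- conjs) kk y) * Q`_i.
 have := congr1 (fun p : {poly N} => p`_i) eP; rewrite coefZ => <-.
 rewrite coef_comp_poly; have [iP|iP] := ltnP i (size P); last first.
  rewrite nth_default // mul0r big1 // => j _; rewrite exprZn coefZ coefXn gtn_eqF ?mulr0 //.
  exact: leq_trans iP.
 rewrite (bigD1 (Ordinal iP)) //= exprZn coefZ coefXn eqxx mulr1 big1 ?addr0 // => j ji.
 rewrite exprZn coefZ coefXn (_ : (i == j) = false) ?mulr0 //.
 by apply/negbTE; apply: contra ji => /eqP h; apply/eqP/val_inj.
have k0 : \prod_(y <- conjs) kk y != 0.
 rewrite prodf_seq_neq0; apply/allP => y yc; rewrite /kk; case: ifP => _ //=; case: ifP => _ //.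
 by rewrite oppr_eq0 gy0.
have Pe1 : P`_e.+1 != 0.
 by apply: contraTneq (mulf_neq0 k0 (vu_n0 Q1)) => h; rewrite -ePi h mul0r eqxx.
have Pe0 : P`_e != 0.
 by apply: contraTneq (mulf_neq0 k0 (vu_n0 Q0)) => h; rewrite -ePi h mul0r eqxx.
exists (P`_e / P`_e.+1); first by apply: (sf_div (inF_sfield B)); exact: PB.
have h1 := ePi e; have h2 := ePi e.+1.
have -> : z / (P`_e / P`_e.+1) = Q`_e.+1 / Q`_e / th ^+ n.
 have thn : th ^+ n != 0 by rewrite expf_neq0 // (vu_n0 th_vu).
 have -> : z = ga / th ^+ n by rewrite gaE mulrC mulKf.
 have := ratio_eq k0 (expf_neq0 e ga0) thn Pe0 Pe1 (vu_n0 Q0) h1 (q1 := Q`_e.+1); apply.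
 by rewrite -exprS.
by apply: vu_div => //; [exact: vu_div|apply: vuX => //; exact: th_vu].
Qed.

End DecElt.
End Decomposition.

(** * Bases with values in distinct classes *)

Section ValuationBasis.
Variables (F : fieldType) (V : F -> Prop).
Hypothesis hV : vring V.
Implicit Types (E K Z : F -> Prop).
Let Vs : subr V := proj1 hV.

(** The number of classes equals the number of generators, so such a basis encodes total
    ramification without defect. *)
Definition vbasis E K (I : finType) (z : I -> F) :=
 [/\ forall i, K (z i) /\ z i != 0,
   forall x, K x -> exists2 m : I -> F, forall i, E (m i) & x = \sum_i m i * z i &
   forall i j m, i != j -> E m -> ~ vu V (z i / (m * z j))].

Definition VB E K := exists (I : finType) (z : I -> F) (i0 : I), vbasis E K z /\ z i0 = 1.

Lemma VB_refl E : sfield E -> VB E E.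
move=> hE; exists unit, (fun=> 1), tt; split=> //; split.
- by move=> _; rewrite oner_neq0; split=> //; apply: sr1; case: hE.
- by move=> x Ex; exists (fun=> x) => //; rewrite (big_pred1 tt) ?mulr1 // => -[].
- by move=> [] [].
Qed.

Lemma VB_step E K K' x n : sfield E -> sfield K -> (forall y, E y -> K y) -> VB E K ->
 sfield K' -> (forall y, K y -> K' y) -> K' x -> x != 0 -> (0 < n)%N ->
 (forall y, K' y -> exists2 m : 'I_n -> F, forall j, K (m j) & y = \sum_j m j * x ^+ j) ->
 (forall (i j : 'I_n) m, i != j -> K m -> ~ vu V (x ^+ i / (m * x ^+ j))) -> VB E K'.
move=> hE hK EK [I [z [i0 [[z1 zs zd] z0]]]] hK' KK' K'x x0 n0 xs xd.
have Ks' := proj1 hK'.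
exists (I * 'I_n)%type, (fun ij : I * 'I_n => z ij.1 * x ^+ ij.2), (i0, Ordinal n0); split; last first.
 by rewrite /= z0 expr0 mulr1.
split.
- move=> [i j] /=; have [Kz zn] := z1 i; split; last by rewrite mulf_neq0 // expf_neq0.
 by apply: srM => //; [exact: KK'|exact: srX].
- move=> y /xs[m Km ->].
 have hm j : {c : I -> F | (forall i, E (c i)) /\ m j = \sum_i c i * z i}.
  by apply: cid; have [c h1 h2] := zs _ (Km j); exists c.
 exists (fun ij : I * 'I_n => sval (hm ij.2) ij.1) => [ij|]; first by case: (svalP (hm ij.2)) => h _; exact: h.
 rewrite -(pair_bigA _ (fun i (j : 'I_n) => sval (hm j) i * (z i * x ^+ j))) /= exchange_big; apply: eq_bigr => j _.
 have [_ e] := svalP (hm j); rewrite [in LHS]e mulr_suml; apply: eq_bigr => i _; exact: esym (mulrA _ _ _).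
- move=> [i j] [i' j'] m /= ne Em h; have [Kz zn] := z1 i; have [Kz' zn'] := z1 i'.
 have [ej|nj] := eqVneq j j'.
  subst j'; have ni : i != i' by apply: contraNneq ne => ->.
  have m0 : m != 0 by apply/eqP => m0; have := vu_n0 h; rewrite m0 mul0r invr0 mulr0 eqxx.
  apply: (zd i i' m ni Em); move: h; congr vu.
  by field; rewrite m0 zn' expf_neq0.
 have m0 : m != 0 by apply/eqP => m0; have := vu_n0 h; rewrite m0 mul0r invr0 mulr0 eqxx.
 apply: (xd j j' (m * z i' / z i) nj).
  by apply: sf_div => //; apply: srM; [case: hK|exact: EK | ].
 by move: h; congr vu; field; rewrite m0 zn zn' expf_neq0.
Qed.

(** The class of [x] modulo the values of [K] has order dividing the prime [l] and is not trivial,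
    so its powers below [l] are distinct. *)
Lemma ramified_classes K x l h : sfield K -> x != 0 -> prime l -> K h -> vu V (x ^+ l / h) ->
 (forall m, K m -> m != 0 -> ~ vu V (x ^+ l / m ^+ l)) ->
 forall (i j : 'I_l) m, i != j -> K m -> ~ vu V (x ^+ i / (m * x ^+ j)).
move=> hK x0 pl Kh vh hx i j m ij Km hu; have Ks := proj1 hK.
have m0 : m != 0 by apply/eqP => m0; have := vu_n0 hu; rewrite m0 mul0r invr0 mulr0 eqxx.
have h0 : h != 0 by apply/eqP => h0; have := vu_n0 vh; rewrite h0 invr0 mulr0 eqxx.
wlog ltij : i j m ij Km hu m0 / (j < i)%N.
 move=> hw; case: (ltngtP j i) => [|lt|/esym/val_inj e]; [exact: (hw i j m)| |by rewrite e eqxx in ij].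
 apply: (hw j i m^-1); rewrite ?invr_eq0 //; [by rewrite eq_sym|exact: sfV |].
 have := vu_inv hu; congr vu; by field; rewrite m0 !expf_neq0.
pose d := (i - j)%N.
have hd : vu V (x ^+ d / m).
 move: hu; congr vu; have -> : x ^+ i = x ^+ d * x ^+ j by rewrite -exprD; congr (_ ^+ _); rewrite /d; lia.
 by field; rewrite m0 expf_neq0.
have d0 : (0 < d)%N by rewrite subn_gt0.
have cop : coprime d l.
 rewrite coprime_sym prime_coprime //; apply/negP => /(dvdn_leq d0).
 by rewrite leqNgt (leq_ltn_trans (leq_subr _ _)).
(* Bezout: from the values of [x ^+ d] and [x ^+ l] in [K] follows that of [x] itself, equal to the
   value of [m ^+ a / h ^+ b]. *)
have [a b eab _] := egcdnP l d0.
rewrite (eqP cop) in eab.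
apply: (hx (m ^+ a / h ^+ b)); first by apply: sf_div => //; exact: srX.
 by rewrite mulf_neq0 ?invr_eq0 ?expf_neq0.
rewrite -expr_div_n; apply: vuX => //.
have := vu_div hV (vuX hV a hd) (vuX hV b vh); congr vu.
rewrite !expr_div_n -!exprM [(d * a)%N]mulnC eab [(l * b)%N]mulnC addn1 exprS.
by field; rewrite !expf_neq0.
Qed.

(* A subspace of a space with a valuation basis has one: exchange, for each
  class occurring in the subspace, the basis element of that class. *)
Lemma VB_sub E K K' : sfield E -> sfield K' -> sfield K -> (forall x, E x -> K' x) ->
 (forall x, K' x -> K x) -> VB E K -> VB E K'.
move=> hE hK' hK EK' K'K [I [z [i0 [[z1 zs zd] z0]]]]; have Es := proj1 hE; have Ks' := proj1 hK'.
pose J i := `[< exists2 x, K' x & vu V (x / z i) >].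
have hJ i : {x | [/\ K x, J i -> K' x, vu V (x / z i) & i = i0 -> x = 1]}.
 apply: cid; have [->|ni] := eqVneq i i0.
  exists 1; rewrite z0 divr1; split=> //; [exact: sr1 (proj1 hK)|by move=> _; exact: sr1|exact: vu1].
 have [/asboolP[x K'x hx]|hno] := boolP (J i); first by exists x; split=> //; [exact: K'K|move=> e; rewrite e eqxx in ni].
 have [Kz zn] := z1 i; exists (z i); split=> //; first by rewrite divff //; exact: vu1.
 by move=> e; rewrite e eqxx in ni.
pose e i := sval (hJ i).
have Ke i : K (e i) by case: (svalP (hJ i)).
have eK' i : J i -> K' (e i) by case: (svalP (hJ i)).
have ez i : vu V (e i / z i) by case: (svalP (hJ i)).
have e1 : e i0 = 1 by case: (svalP (hJ i0)) => _ _ _; exact.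
have zn i : z i != 0 by case: (z1 i).
have en i : e i != 0 by have := vu_n0 (ez i); rewrite mulf_eq0 negb_or => /andP[].
have ed i j m : i != j -> E m -> ~ vu V (e i / (m * e j)).
 move=> ij Em h; apply: (zd i j m ij Em).
 have m0 : m != 0 by apply/eqP => m0; have := vu_n0 h; rewrite m0 mul0r invr0 mulr0 eqxx.
 have := vuM hV h (vu_div hV (ez j) (ez i)); congr vu.
 by field; rewrite m0 !en !zn.
have dom (P : pred I) (m : I -> F) : (forall i, E (m i)) -> (exists2 i, P i & m i != 0) ->
  exists i, [/\ P i, m i != 0 & vu V ((\sum_(i | P i) m i * e i) / (m i * e i))].
 move=> Em [i Pi mi].
 have sumE : \sum_(i | P i && (m i != 0)) m i * e i = \sum_(i | P i) m i * e i.
  rewrite [RHS](bigID (fun i => m i != 0)) /= [X in _ + X]big1 ?addr0 //.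
  by move=> l /andP[_]; rewrite negbK => /eqP ->; rewrite mul0r.
 have [||l j|l [/andP[Pl ml] _ hl]] := v_distinct hV (P := fun i => P i && (m i != 0)) (t := fun i => m i * e i).
 - by exists i; rewrite Pi mi.
 - by move=> l /andP[_ ml]; rewrite mulf_neq0.
 - move=> /andP[_ ml] /andP[_ mj] lj h; apply: (ed l j (m j / m l) lj); first exact: sf_div.
  by move: h; congr vu; field; rewrite ml mj en.
 by exists l; split=> //; rewrite -sumE.
(* Dimension count: [x] and the [e i] are one more than the members of the spanning family [z], and
   a relation among the [e i] alone is impossible because their classes differ. *)
have span x : K x -> exists2 m : I -> F, forall i, E (m i) & x = \sum_i m i * e i.
 move=> Kx.
 have co (y : F) : {c : I -> F | K y -> (forall i, E (c i)) /\ y = \sum_i c i * z i}.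
  apply: cid; have [h|h] := pselect (K y); last by exists (fun=> 0).
  by have [c h1 h2] := zs _ h; exists c.
 pose w (i : 'I_#|I|.+1) := fcons x (fun i : 'I_#|I| => e (enum_val i)) i.
 have Kw i : K (w i) by rewrite /w; apply: (fcons_case (P := K)) => // l; exact: Ke.
 have [|v [Ev [l vl] hv]] := sfield_dep (C := fun i (j : 'I_#|I|) => sval (co (w i)) (enum_val j)) hE (ltnSn _).
  by move=> i j; case: (svalP (co (w i)) (Kw i)) => h _; exact: h.
 have v0 : \sum_i v i * w i = 0.
  rewrite (eq_bigr (fun i => \sum_j v i * sval (co (w i)) j * z j)) => [|i _]; last first.
   have [_ ew] := svalP (co (w i)) (Kw i); rewrite [in LHS]ew mulr_sumr.
   by apply: eq_bigr => j _; rewrite mulrA.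
  rewrite exchange_big big1 // => j _; rewrite -mulr_suml.
  have := hv (enum_rank j); rewrite (eq_bigr (fun i => v i * sval (co (w i)) j)) => [->|i _].
   by rewrite mul0r.
  by rewrite enum_rankK.
 have sumE (m : 'I_#|I| -> F) : \sum_i m i * e (enum_val i) = \sum_i m (enum_rank i) * e i.
  rewrite [RHS](reindex (@enum_val I predT)) /=; last first.
   by exists enum_rank => i _; [exact: enum_valK|exact: enum_rankK].
  by apply: eq_bigr => i _; rewrite enum_valK.
 rewrite big_ord_recl /w fcons0 in v0.
 rewrite (eq_bigr (fun i => v (lift ord0 i) * e (enum_val i))) in v0; last by move=> i _; rewrite fconsS.
 rewrite (sumE (fun i => v (lift ord0 i))) in v0.
 have [v00|v00] := eqVneq (v ord0) 0.
  exfalso; rewrite v00 mul0r add0r in v0.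
  have [||i [_ _]] := dom xpredT (fun i => v (lift ord0 (enum_rank i))); first by [].
   case: (unliftP ord0 l) vl => [j ->|-> ]; last by rewrite v00 eqxx.
   by move=> vj; exists (enum_val j) => //; rewrite enum_valK.
  by rewrite v0 mul0r => /vu_n0; rewrite eqxx.
 exists (fun i => - (v (lift ord0 (enum_rank i)) / v ord0)) => [i|].
  by apply: srN => //; exact: sf_div.
 apply: (mulfI v00); move/eqP: v0; rewrite addr_eq0 => /eqP ->; rewrite mulr_sumr -sumrN.
 by apply: eq_bigr => i _; field.
have Ji0 : J i0 by apply/asboolP; exists 1; [exact: sr1|rewrite z0 divr1; exact: vu1].
exists {i | J i}, (fun i => e (val i)), (exist _ i0 Ji0); split=> //; split.
- by move=> [i Ji] /=; split=> //; exact: eK'.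
- move=> x K'x; have [m Em ex] := span x (K'K _ K'x).
 (* This partial sum lies in [K']. Were it nonzero, its dominating index would have a class
    represented in [K'], against the choice of the indices. *)
 have z' : \sum_(i | ~~ J i) m i * e i = 0.
  apply/eqP/negPn/negP => ne.
  have [||i [Ji mi hi]] := dom (fun i => ~~ J i) m; first by [].
   apply: contrapT => hno; move/eqP: ne; apply; rewrite big1 // => i Ji.
   have -> : m i = 0 by apply/eqP/negPn/negP => mi; apply: hno; exists i.
   by rewrite mul0r.
  move/negP: Ji; apply; apply/asboolP; exists ((\sum_(i | ~~ J i) m i * e i) / m i).
   apply: sf_div => //; last exact: EK'.
   have -> : \sum_(i | ~~ J i) m i * e i = x - \sum_(i | J i) m i * e i.
    by rewrite ex [in RHS](bigID J) /= addrAC subrr add0r.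
   by apply: srB => //; apply: sr_sum => // j Jj; apply: srM => //; [exact: EK'|exact: eK'].
  by have := vuM hV hi (ez i); congr vu; field; rewrite mi en zn.
 exists (fun i => m (val i)) => //; rewrite ex (bigID J) /= z' addr0.
 rewrite (reindex_omap (fun i : {i | J i} => val i) insub) /= => [|i Ji]; last by rewrite insubT.
 by apply: eq_big => [i|//]; rewrite (valP i) valK eqxx.
- move=> i j m ij; exact: ed.
Qed.
End ValuationBasis.

Section GoodBasis.
Variables (F : fieldType) (V k A : F -> Prop).
Hypotheses (hV : vring V) (hk : sfield k) (kV : forall c, k c -> V c).
Hypothesis kres : forall x, V x -> exists2 c, k c & vm V (x - c).
Hypotheses (hA : subr A) (kA : forall c, k c -> A c) (AV : forall x, A x -> V x) (AN : noeth A).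

Lemma good_VB r E K : good V k A r E -> sfield K -> (forall x, E x -> K x) -> VB V E K ->
 good V k A r K.
move=> hE hK EK [I [z [i0 [[z1 zs zd] z0]]]].
apply: (good_ramified hV hk kV hA kA AV AN (z := fun q : 'I_#|I| => z (enum_val q)) (q00 := enum_rank i0) hE) => //.
- by rewrite enum_rankK.
- by move=> q; case: (z1 (enum_val q)).
- by move=> q; case: (z1 (enum_val q)).
- move=> x /zs[m Em ->]; exists (fun q => m (enum_val q)) => //.
 rewrite (reindex (@enum_val I predT)) //=.
 by exists enum_rank => i _; [exact: enum_valK|exact: enum_rankK].
- by move=> q q' m qq'; apply: zd; apply: contra qq' => /eqP/enum_val_inj ->.
Qed.
End GoodBasis.

(** * Residue characters and solvability of the decomposition group *)

Section Ramification.
Variables (L0 : fieldType) (N : splittingFieldType L0) (V k A : N -> Prop).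
Hypotheses (hV : vring V) (hk : sfield k) (kV : forall c, k c -> V c) (kc : kclosed k).
Hypothesis kres : forall x, V x -> exists2 c, k c & vm V (x - c).
Hypothesis k1 : forall c, k c -> c \in 1%VS.
Hypotheses (hA : subr A) (kA : forall c, k c -> A c) (AV : forall x, A x -> V x) (AN : noeth A).
Hypothesis Af : forall p, p \in [pchar N] -> ffin p A.
Let Vs : subr V := proj1 hV.
Let ks : subr k := proj1 hk.
Implicit Types (B K E Z : {subfield N}) (s t : gal_of {:N}).
Local Notation stab := (stab V).
Local Notation G := ('Gal({:N} / 1)%g).

Lemma gal_G B s : s \in 'Gal({:N} / B)%g -> s \in G.
Proof. by apply/fintype.subsetP; apply: galS; exact: sub1v. Qed.

Lemma k_zero c : k c -> vm V c -> c = 0.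
Proof. exact: (k_vm hk kV). Qed.

Lemma stab_orbit s x n : s \in stab -> vm V (s x / x) -> x != 0 -> vm V ((s ^+ n.+1)%g x / x).
move=> hs h x0; elim: n => [|n ih]; first by rewrite expg1.
rewrite expgSr galMf.
have sx0 : s x != 0 by rewrite fmorph_eq0.
have -> : s ((s ^+ n.+1)%g x) / x = s ((s ^+ n.+1)%g x / x) * (s x / x).
 by rewrite rmorphM fmorphV /=; field; rewrite x0 sx0.
by apply: vmM => //; [exact: stab_vm|exact: vm_V].
Qed.

(** If [s] changed the value of [x], its iterates would change it further in the same direction, but
    [s] has finite order. *)
Lemma stab_ratio s x : s \in stab -> x != 0 -> vu V (s x / x).
have no t : t \in stab -> x != 0 -> ~ vm V (t x / x).
 move=> ht x0 h; have := stab_orbit (#[t]%g).-1 ht h x0; rewrite prednK // expg_order gal_id divff //.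
 by move/vm_nvu; apply; exact: vu1.
move=> hs x0; have sx0 : s x != 0 by rewrite fmorph_eq0.
case: (v_tri V (_ : s x / x != 0)) => //; first by rewrite mulf_neq0 ?invr_eq0.
 by move/(no s hs x0).
move=> h; exfalso; have si : (s^-1)%g \in stab by rewrite groupV.
apply: (no _ si x0); have := stab_vm si h; congr vm.
by rewrite invf_div rmorphM fmorphV /= -galMf mulgV gal_id.
Qed.

(* On a nonzero [x], the stabilizer acts by a residue class: a character. *)
Definition rch s x c := k c /\ vm V (s x / x - c).

Lemma rch_ex s x : s \in stab -> x != 0 -> exists c, rch s x c.
Proof. by move=> hs x0; have [c kc' h] := kres (vu_V (stab_ratio hs x0)); exists c. Qed.

Lemma rch_uniq s x c d : rch s x c -> rch s x d -> c = d.
move=> [kc' h1] [kd h2]; apply/eqP; rewrite -subr_eq0; apply/eqP; apply: k_zero; first exact: srB.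
have -> : c - d = (s x / x - d) - (s x / x - c) by ring.
exact: vmB.
Qed.

Lemma rchM B s t x c d : s \in 'Gal({:N} / B)%g -> t \in 'Gal({:N} / B)%g -> t \in stab -> x != 0 ->
 rch s x c -> rch t x d -> rch (s * t)%g x (c * d).
move=> sB tB ts x0 [kc' h1] [kd h2]; split; first exact: srM.
have tx0 : t x != 0 by rewrite fmorph_eq0.
have -> : (s * t)%g x / x - c * d = t (s x / x - c) * (t x / x) + c * (t x / x - d).
 by rewrite galMf rmorphB rmorphM fmorphV /= (gal_k k1 tB kc'); field; rewrite x0 tx0.
apply: vmD => //; last by apply: vmMr => //; exact: kV.
by apply: vmM => //; [exact: stab_vm|apply: vu_V; exact: stab_ratio].
Qed.

Lemma rch1 x : x != 0 -> rch 1%g x 1.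
Proof. by move=> x0; split; [exact: sr1|rewrite gal_id divff // subrr; left]. Qed.

Lemma rchV B s x c : s \in 'Gal({:N} / B)%g -> s \in stab -> x != 0 -> rch s x c -> c != 0 /\ rch s^-1%g x c^-1.
move=> sB ss x0 hc; have si : (s^-1)%g \in stab by rewrite groupV.
have siB : (s^-1)%g \in 'Gal({:N} / B)%g by rewrite groupV.
have [d hd] := rch_ex si x0; have := rchM sB siB si x0 hc hd; rewrite mulgV => h.
have e := rch_uniq h (rch1 x0); have c0 : c != 0 by apply: contra_eq_neq e => ->; rewrite mul0r eq_sym oner_neq0.
by split=> //; have -> : c^-1 = d by rewrite -[d](mulKf c0) e mulr1.
Qed.

(** The residue of [w] lies in [k], on which [s] acts trivially, so it equals [z] times itself. *)
Lemma fixed_root_unit s z w : s \in stab -> s \in G -> k z -> z != 1 -> vu V w -> s w = z * w -> False.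
move=> ss sG kz z1 hw e; have [c kc' h] := kres (vu_V hw).
have c0 : c != 0 by apply/eqP => c0; rewrite c0 subr0 in h; exact: vm_nvu h hw.
have h2 := stab_vm ss h; rewrite rmorphB /= (gal_k k1 sG kc') e in h2.
have : c * (1 - z) = 0.
 apply: k_zero; first by apply: srM => //; apply: srB => //; exact: sr1.
 have -> : c * (1 - z) = z * (w - c) - (z * w - c) by ring.
 by apply: vmB => //; apply: vmMr => //; exact: kV.
by move/eqP; rewrite mulf_eq0 (negbTE c0) subr_eq0 eq_sym (negbTE z1).
Qed.

(* The eigenvectors of [s] of order [q] on the orbit of [y] span [q y]. *)
Lemma eigenvector s q y : s \in G -> prime q -> q%:R != 0 :> N -> (s ^+ q)%g y = y -> s y <> y ->
 forall P : N -> Prop, P 0 -> (forall a b, P a -> P b -> P (a + b)) ->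
 (forall c a, k c -> P a -> P (c * a)) -> (forall i, P ((s ^+ i)%g y)) ->
 exists z x, [/\ k z, z != 1, z ^+ q = 1, x != 0 & P x /\ s x = z * x].
move=> sG pq q0 sy sny P P0 PD PZ Py.
have [||z kz ez] := @kroot _ k hk kc (\poly_(i < q) 1).
- by move=> i; rewrite coef_poly; case: ifP => _; [exact: sr1|exact: sr0].
- by rewrite size_poly_eq ?oner_neq0 ?prime_gt1.
have sumz : \sum_(i < q) z ^+ i = 0.
 by rewrite -[RHS]ez horner_poly; apply: eq_bigr => i _; rewrite mul1r.
have zq : z ^+ q = 1.
 have := subrX1 z q; rewrite sumz mulr0 => /eqP; by rewrite subr_eq0 => /eqP.
have z1 : z != 1.
 apply: contraNneq q0 => z1; move: sumz; rewrite z1 (eq_bigr (fun=> 1)) => [|i _]; last by rewrite expr1n.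
 by rewrite sumr_const card_ord => ->.
have z0 : z != 0.
 by apply: contraTneq isT => z0; move: zq; rewrite z0 expr0n (gtn_eqF (prime_gt0 pq)) => /eqP; rewrite eq_sym oner_eq0.
have zj j : (0 < j < q)%N -> z ^+ j != 1.
 move=> /andP[j0 jq]; apply: contra z1 => /eqP e.
 have cop : coprime j q by rewrite coprime_sym prime_coprime // gtnNdvd.
 have [a b eab _] := egcdnP q j0; rewrite (eqP cop) in eab.
 have : z ^+ (a * j) = 1 by rewrite mulnC exprM e expr1n.
 by rewrite eab addn1 exprS mulnC exprM zq expr1n mulr1 => ->.
pose yj j := \sum_(i < q) z ^+ (i * j) * (s ^+ i)%g y.
have syj j : s (yj j) = (z ^+ j)^-1 * yj j.
 have zj0 : z ^+ j != 0 by rewrite expf_neq0.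
 apply: (mulfI zj0); rewrite mulrA divff // mul1r.
 pose f i := z ^+ (i * j) * (s ^+ i)%g y.
 have -> : z ^+ j * s (yj j) = \sum_(i < q) f i.+1.
  rewrite rmorph_sum mulr_sumr; apply: eq_bigr => i _.
  by rewrite rmorphM /= (gal_k k1 sG) ?mulrA -?exprD -?mulSn /f ?expgSr ?galMf //; exact: srX.
 have -> : yj j = \sum_(i < q) f i by [].
 have fq : f q = f 0%N by rewrite /f mulnC exprM exprAC zq expr1n sy mul0n expr0 expg0 gal_id.
 by case: (q) fq => [_|q' fq']; rewrite ?big_ord0 // big_ord_recr big_ord_recl /= fq' addrC.
have Pyj j : P (yj j).
 by rewrite /yj; elim/big_rec: _ => // i x _ hx; apply: PD => //; apply: PZ => //; exact: srX.
have sumj : \sum_(j < q) yj j = q%:R * y.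
 rewrite exchange_big /= -(prednK (prime_gt0 pq)) big_ord_recl [X in _ + X]big1 ?addr0 => [|i _].
  rewrite expg0 gal_id (eq_bigr (fun=> y)) => [|j _]; last by rewrite mul0n expr0 mul1r.
  by rewrite sumr_const card_ord mulr_natl.
 rewrite -mulr_suml (_ : \sum_(_ < _) _ = 0) ?mul0r //.
 have ij : (0 < lift ord0 i < q)%N by rewrite /= /bump leq0n add1n -[X in (_ < X)%N](prednK (prime_gt0 pq)) ltnS ltn_ord.
 have ne : z ^+ (lift ord0 i) - 1 != 0 by rewrite subr_eq0; exact: zj.
 apply: (mulfI ne); rewrite mulr0 (eq_bigr (fun j : 'I_q.-1.+1 => (z ^+ (lift ord0 i)) ^+ j)) => [|j _]; last by rewrite exprM.
 have pw (a : N) : a ^+ q.-1.+1 = a ^+ q by rewrite prednK ?prime_gt0.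
 by rewrite -subrX1 pw exprAC zq expr1n subrr.
have [j [j0 yj0]] : exists j, (0 < j < q)%N /\ yj j != 0.
 apply: contrapT => hno; apply: sny; apply: (mulfI q0).
 have e0 : q%:R * y = yj 0%N.
  rewrite -sumj -(prednK (prime_gt0 pq)) big_ord_recl big1 ?addr0 // => i _.
  apply/eqP/negPn/negP => h; apply: hno; exists (lift ord0 i); split=> //.
  by rewrite /= /bump leq0n add1n -[X in (_ < X)%N](prednK (prime_gt0 pq)) ltnS ltn_ord.
 have := syj 0%N; rewrite expr0 invr1 mul1r -e0 rmorphM /= rmorph_nat; exact.
exists (z ^+ j)^-1, (yj j); split=> //.
- by apply: sfV => //; exact: srX.
- by rewrite invr_eq1; exact: zj.
- by rewrite exprVn exprAC zq expr1n invr1.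
Qed.

(** The ramification group: all residue characters are trivial on it. *)
Definition wild : {set gal_of {:N}} :=
 [set s : gal_of {:N} | (s \in G) && ((s \in stab) && `[< forall x, x != 0 -> rch s x 1 >])].

Lemma wildP s : reflect [/\ s \in G, s \in stab & forall x, x != 0 -> rch s x 1] (s \in wild).
rewrite [X in reflect _ X]finset.in_set.
by apply: (iffP and3P) => -[h1 h2 h3]; split=> //; exact/asboolP.
Qed.

Lemma wild_group_set : group_set wild.
apply/group_setP; split.
 by apply/wildP; split; rewrite ?group1 // => x; exact: rch1.
move=> s t /wildP[sG ss hs] /wildP[tG ts ht]; apply/wildP; split; rewrite ?groupM // => x x0.
by have := rchM sG tG ts x0 (hs x x0) (ht x x0); rewrite mulr1.
Qed.
Canonical wild_group := Group wild_group_set.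

(** It is a group of prime power order. An element of prime order invertible in the field would have
    an eigenvector with eigenvalue other than 1, which is a nontrivial character value. *)
Lemma wild_solvable : solvable wild_group.
have key q : prime q -> (q %| #|wild_group|)%N -> q \in [pchar N].
 move=> pq /(Cauchy pq)[s sW os]; have /wildP[sG ss hs] := sW.
 rewrite inE pq /=; apply/negPn/negP => q0.
 have [y sy] : exists y, s y <> y.
  apply: contrapT => hno; have : s == 1%g.
   by apply/gal_eqP => y _; rewrite gal_id; apply: contrapT => h; apply: hno; exists y.
  by move=> /eqP s1; move: os; rewrite s1 order1 => e; move: pq; rewrite -e.
 have sqy : (s ^+ q)%g y = y by rewrite -os expg_order gal_id.
 have [//|//|//|//|z [x [kz z1 _ x0 [_ e]]]] := eigenvector sG pq q0 sqy sy (P := fun=> True).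
 have [_ h] := hs x x0; move: h; rewrite e mulfK // => /(k_zero (srB ks kz (sr1 ks))) /eqP.
 by rewrite subr_eq0 (negbTE z1).
have [w1|w1] := eqVneq #|wild_group| 1%N.
 by apply: (pgroup_sol (p := 2)); rewrite /pgroup w1.
have ww : (1 < #|wild_group|)%N by rewrite ltn_neqAle eq_sym w1 cardG_gt0.
have hp := key _ (pdiv_prime ww) (pdiv_dvd _).
apply: (pgroup_sol (p := pdiv #|wild_group|)); rewrite /pgroup.
apply/pnatP => //.
move=> q pq /(key _ pq) hq; rewrite inE /=; have := pcharf_eq hp q; by rewrite hq !inE => /esym.
Qed.

(** Characters have commuting values, so commutators lie in the ramification group, which is
    solvable. *)
Lemma stab_solvable (H : {group gal_of {:N}}) : H \subset G -> H \subset stab -> solvable H.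
move=> HG Hs; have hH s : s \in H -> s \in G /\ s \in stab.
 by move=> sH; split; [exact: (fintype.subsetP HG)|exact: (fintype.subsetP Hs)].
rewrite (series_sol (der_normal 1 H)); apply/andP; split; last first.
 by apply: abelian_sol; have := der_abelian 0 H; rewrite derg0.
apply: (solvableS _ wild_solvable); rewrite gen_subG; apply/fintype.subsetP => _ /imset2P[s t sH tH ->].
have [sG ss] := hH s sH; have [tG ts] := hH t tH.
have inv u : u \in H -> (u^-1)%g \in G /\ (u^-1)%g \in stab.
 by move=> uH; apply: hH; rewrite groupV.
have [siG sis] := inv s sH; have [tiG tis] := inv t tH.
apply/wildP; split.
- by rewrite groupR.
- by rewrite groupR.
move=> x x0; have [c hc] := rch_ex ss x0; have [d hd] := rch_ex ts x0.
have [c0 hci] := rchV sG ss x0 hc; have [d0 hdi] := rchV tG ts x0 hd.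
have h1 := rchM tG sG ss x0 hd hc.
have h2 := rchM tiG (groupM tG sG) (groupM ts ss) x0 hdi h1.
have h3 := rchM siG (groupM tiG (groupM tG sG)) (groupM tis (groupM ts ss)) x0 hci h2.
have h4 := rchM sG tG ts x0 hc hd.
have h5 := rchM tiG (groupM sG tG) (groupM ss ts) x0 hdi h4.
have h6 := rchM siG (groupM tiG (groupM sG tG)) (groupM tis (groupM ss ts)) x0 hci h5.
by move: h6; rewrite /commg /conjg; congr rch; field; rewrite c0 d0.
Qed.
End Ramification.

(** * Prime degree steps above the decomposition field *)

Section Chain.
Variables (L0 : fieldType) (N : splittingFieldType L0) (V k A : N -> Prop).
Hypotheses (hV : vring V) (hk : sfield k) (kV : forall c, k c -> V c) (kc : kclosed k).
Hypothesis kres : forall x, V x -> exists2 c, k c & vm V (x - c).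
Hypothesis k1 : forall c, k c -> c \in 1%VS.
Hypotheses (hA : subr A) (kA : forall c, k c -> A c) (AV : forall x, A x -> V x) (AN : noeth A).
Hypothesis A1 : forall x, A x -> x \in 1%VS.
Hypothesis Af : forall p, p \in [pchar N] -> ffin p A.
Let Vs : subr V := proj1 hV.
Let ks : subr k := proj1 hk.
Implicit Types (B K E Z : {subfield N}) (s t : gal_of {:N}).
Local Notation stab := (stab V).
Local Notation good := (good V k A).

Lemma kclosed_pth p c : p \in [pchar N] -> k c -> exists2 d, k d & c = d ^+ p.
move=> cp kc'; have p0 : (0 < p)%N by apply: prime_gt0; exact: (pcharf_prime cp).
have [||c' h1 h2] := @kc p (fun i => if i == 0%N then c else 0) => //.
 by move=> i; case: ifP => // _; exact: sr0.
exists c' => //; rewrite h2; case: (p) p0 => // p' _.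
by rewrite big_ord_recl expr0 mulr1 big1 ?addr0 // => i _; rewrite mul0r.
Qed.

Lemma span_powers E x (P : {poly N}) n : polyB (inF E) P -> P \is monic -> size P = n.+1 -> P.[x] = 0 ->
 forall y, inF <<E; x>>%AS y -> exists2 m : 'I_n -> N, forall j, inF E (m j) & y = \sum_j m j * x ^+ j.
move=> PE mP sP Px y /Fadjoin_polyP[q /polyB_over qE ->].
have [g [gE sg <-]] := polyB_reduce (proj1 (inF_sfield E)) PE mP sP Px qE.
exists (fun j => g`_j) => [j|]; first exact: gE.
by rewrite (horner_coef_wide _ sg).
Qed.

Lemma binomial_poly E a n : a \in E -> (0 < n)%N ->
 [/\ polyB (inF E) ('X^n - a%:P), ('X^n - a%:P) \is monic & size ('X^n - a%:P) = n.+1].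
move=> aE n0; have Es := proj1 (inF_sfield E); split.
- by apply: polyBB => //; [apply: polyBXn => //; exact: polyBX|exact: polyBC].
- exact: monicXnsubC.
- exact: size_XnsubC.
Qed.

Lemma as_poly E a p : a \in E -> (1 < p)%N ->
 [/\ polyB (inF E) ('X^p - 'X - a%:P), ('X^p - 'X - a%:P) \is monic & size ('X^p - 'X - a%:P) = p.+1].
move=> aE p1; have Es := proj1 (inF_sfield E).
have sX : (size ('X + a%:P)%R < size ('X^p : {poly N})%R)%N.
 by rewrite size_polyXn size_XaddC.
have -> : 'X^p - 'X - a%:P = 'X^p - ('X + a%:P) :> {poly N} by rewrite opprD addrA.
split.
- apply: polyBB => //; first by apply: polyBXn => //; exact: polyBX.
 by apply: polyBD => //; [exact: polyBX|exact: polyBC].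
- by apply/monicP; rewrite lead_coefDl ?size_polyN // lead_coefXn.
- by rewrite size_polyDl ?size_polyN // size_polyXn.
Qed.

Lemma chain_step r Z E x (P : {poly N}) l h : good r (inF Z) -> (Z <= E)%VS -> VB V (inF Z) (inF E) ->
 prime l -> x \notin E -> polyB (inF E) P -> P \is monic -> size P = l.+1 -> P.[x] = 0 ->
 h \in E -> vu V (x ^+ l / h) -> (forall m, m \in E -> m != 0 -> ~ vu V (x ^+ l / m ^+ l)) ->
 exists E', [/\ (E <= E')%VS, (\dim E < \dim E')%N & VB V (inF Z) (inF E')].
move=> gZ ZE vb pl xE PE mP sP Px hE vh hx; exists <<E; x>>%AS.
have EE' := subv_adjoin E x.
have x0 : x != 0 by apply: contraNneq xE => ->; exact: rpred0.
split=> //.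
 rewrite ltn_neqAle dimvS // andbT; apply: contra xE => /eqP e.
 have : E == <<E; x>>%AS :> {vspace N} by rewrite eqEdim EE' e leqnn.
 by move=> /eqP ->; exact: memv_adjoin.
apply: (VB_step (inF_sfield Z) (inF_sfield E) _ vb (inF_sfield _) _ _ x0 (prime_gt0 pl)).
- by move=> y; exact: (subvP ZE).
- by move=> y; exact: (subvP EE').
- exact: memv_adjoin.
- exact: (span_powers PE mP sP Px).
- exact: (ramified_classes hV (inF_sfield E) x0 pl hE vh hx).
Qed.

Lemma fix_orbit (H H' : {group gal_of {:N}}) s y : (H' <| H)%g -> s \in H ->
 (forall t, t \in H' -> t y = y) -> forall t, t \in H' -> t (s y) = s y.
move=> nH sH fy t tH'; rewrite -galMf.
have -> : (s * t)%g = ((t ^ s^-1) * s)%g by rewrite conjgE invgK; rewrite -!mulgA mulVg mulg1.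
rewrite galMf fy // memJ_norm //; apply: (fintype.subsetP (normal_norm nH)); by rewrite groupV.
Qed.

(** The stabilizer of [x] in [H] contains [H'] and [s]; as [H'] has prime index it is maximal, so
    the stabilizer is all of [H]. *)
Lemma fixed_by_maximal (H H' : {group gal_of {:N}}) s x : (H' <| H)%g -> prime #|H : H'|%g -> s \in H -> s \notin H' ->
 s x = x -> (forall t, t \in H' -> t x = x) -> forall t, t \in H -> t x = x.
move=> nH pH sH sH' sx fx.
pose Kx := [set t : gal_of {:N} | (t \in H) && (t x == x)].
have KxP t : reflect (t \in H /\ t x = x) (t \in Kx).
 rewrite [X in reflect _ X]finset.in_set; apply: (iffP andP) => -[h1 h2]; split=> //; exact/eqP.
have gK : group_set Kx.
 apply/group_setP; split; first by apply/KxP; rewrite group1 gal_id.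
 move=> t u /KxP[tH tx] /KxP[uH ux]; apply/KxP; split; first exact: groupM.
 by rewrite galMf tx ux.
have mH := p_index_maximal (normal_sub nH) pH.
have [_ hm] := maxgroupP mH.
have HK : H' \subset Group gK.
 by apply/fintype.subsetP => t tH'; apply/KxP; split; [exact: (fintype.subsetP (normal_sub nH))|exact: fx].
have KH : Group gK \subset H by apply/fintype.subsetP => t /KxP[].
move=> t tH; have [pr|npr] := boolP (Group gK \proper H).
 have e := hm _ pr HK; case/negP: sH'; rewrite -e; exact/KxP.
have : H \subset Group gK by move: npr; rewrite properE KH negbK.
by move/fintype.subsetP/(_ t tH)/KxP => -[].
Qed.

Definition delta s y : N := s y - y.

(* [(s - 1)^p = s^p - 1] in characteristic [p]. *)
Lemma delta_pth p s y : p \in [pchar N] -> (s ^+ p)%g y = y -> iter p (delta s) y = 0.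
move=> cp sp.
pose Phi n (q : {poly N}) := \sum_(i < n) q`_i * (s ^+ i)%g y.
have step n : exists2 q : {poly N}, q = ('X - 1) ^+ n & iter n (delta s) y = Phi n.+1 q.
 exists (('X - 1) ^+ n) => //; elim: n => [|n ih].
  by rewrite /Phi big_ord1 expr0 coef1 mul1r expg0 gal_id.
 rewrite iterS ih /delta /Phi exprS; set q := ('X - 1) ^+ n.
 have sq : (size q <= n.+1)%N.
  by rewrite /q -polyC1 size_exp_XsubC.
 have fq i : s q`_i = q`_i.
  by rewrite -(coef_map s) /q rmorphXn rmorphB /= map_polyX rmorph1.
 rewrite mulrBl mul1r rmorph_sum.
 rewrite [RHS](eq_bigr (fun i : 'I_n.+2 => ('X * q)`_i * (s ^+ i)%g y - q`_i * (s ^+ i)%g y)); last first.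
  by move=> i _; rewrite coefB mulrBl.
 rewrite sumrB; congr (_ - _).
  rewrite [RHS]big_ord_recl coefXM /= mul0r add0r; apply: eq_bigr => i _.
  by rewrite rmorphM /= fq coefXM /= /bump leq0n add1n /= expgSr galMf.
 by rewrite [RHS]big_ord_recr /= [q`_n.+1]nth_default // mul0r addr0.
have [q eq ->] := step p.
have p0 : (0 < p)%N by apply: prime_gt0; exact: (pcharf_prime cp).
have cpp : p \in [pchar {poly N}] by rewrite pchar_poly.
have {}eq : q = 'X^p - 1.
 by rewrite eq -(pFrobenius_autE cpp) rmorphB rmorph1 /= pFrobenius_autE.
rewrite /Phi big_ord_recr (bigD1 (Ordinal p0)) //= eq !coefB !coefXn !coef1 eqxx (gtn_eqF p0) (ltn_eqF p0) /= big1 => [|i i0].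
 by rewrite addr0 subr0 sub0r mul1r mulN1r expg0 gal_id sp addNr.
have {}i0 : (i : nat) == 0%N = false by apply/negbTE; apply: contra i0 => /eqP h; apply/eqP/val_inj.
by rewrite coefB coefXn coef1 i0 (ltn_eqF (ltn_ord i)) subrr mul0r.
Qed.

(** Inseparable steps are taken as long as there are any; afterwards [N] is Galois over [E] with
    solvable group, and a normal subgroup of prime index gives an Artin-Schreier or Kummer
    generator. In each case a correction from [E] yields a value whose class has order exactly the
    degree. *)
Lemma chain_extend r Z E : good r (inF Z) -> (Z <= E)%VS -> VB V (inF Z) (inF E) ->
 'Gal({:N} / Z)%g \subset stab -> E != {:N}%AS :> {vspace N} ->
 exists E', [/\ (E <= E')%VS, (\dim E < \dim E')%N & VB V (inF Z) (inF E')].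
move=> gZ ZE vb Zs nE; have gE : good r (inF E).
 by apply: (good_VB hV hk kV hA kA AV AN gZ (inF_sfield E) _ vb) => x; exact: (subvP ZE).
have hE := inF_sfield E; have Es := proj1 hE.
have [[x [p [xE cp xp]]]|nins] := pselect (exists x p, [/\ x \notin E, p \in [pchar N] & x ^+ p \in E]).
 have pp := pcharf_prime cp.
 have [|m Em hm] := insep_step hV hk kV hA kA AV AN cp (Af cp) (fun c => kclosed_pth cp) gE xp.
  move=> [b bE e]; case/negP: xE; have -> : x = b; last exact: bE.
  have := frobB cp x b; rewrite e subrr => /eqP; rewrite expf_eq0 => /andP[_].
  by rewrite subr_eq0 => /eqP.
 have e : (x - m) ^+ p = x ^+ p - m ^+ p by exact: (frobB cp).
 have hpE : (x - m) ^+ p \in E by rewrite e; apply: rpredB => //; apply: rpredX.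
 have xmE : x - m \notin E by apply: contra xE => h; rewrite -(subrK m x) rpredD.
 have xm0 : (x - m) ^+ p != 0.
  by rewrite expf_neq0 //; apply: contraNneq xmE => ->; exact: rpred0.
 have [P1 P2 P3] := binomial_poly hpE (prime_gt0 pp).
 apply: (chain_step gZ ZE vb pp xmE P1 P2 P3 _ hpE) => //.
 - by rewrite hornerD hornerN hornerC hornerXn subrr.
 - by rewrite divff //; exact: vu1.
 - by move=> h hh h0; rewrite e; exact: hm.
pose H : {group gal_of {:N}} := 'Gal({:N} / E)%G.
(* Some power of [x] by a product of characteristic primes is in [E]; these primes are removed one
   by one, since no inseparable step is left. *)
have fixE x : (forall s, s \in H -> s x = x) -> x \in E.
 move=> fx; have [n /andP[n0 sn]] := separable_exponent_pchar E x.
 have : x ^+ n \in E.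
  by apply: fixed_separable => // s sH; rewrite rmorphXn /= fx.
 elim/ltn_ind: n n0 {sn} => n ih n0 xn.
 have [n1|n1] := leqP n 1.
  by move: xn; have /andP[n0' _] := n0; have -> : n = 1%N by apply/eqP; rewrite eqn_leq n1.
 have pn := pdiv_dvd n; have pp := pdiv_prime n1.
 have cp : pdiv n \in [pchar N] by have /pnatP := n0; apply => //; exact: ltnW.
 have en : n = (n %/ pdiv n * pdiv n)%N by rewrite divnK.
 apply: (ih (n %/ pdiv n)%N).
 - by rewrite ltn_Pdiv ?prime_gt1 // ltnW.
 - by apply: pnat_dvd n0; exact: dvdn_div.
 apply: contrapT => /negP h; apply: nins; exists (x ^+ (n %/ pdiv n)), (pdiv n); split=> //.
 by rewrite -exprM -en.
have HG : H \subset 'Gal({:N} / 1)%g by apply: galS; exact: sub1v.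
have Hs : H \subset stab by apply: fintype.subset_trans Zs; exact: galS.
have H1 : H != 1%g :> {set _}.
 apply: contra nE => /eqP h; rewrite eqEsubv subvf /=; apply/subvP => x _; apply: fixE => s.
 by rewrite /= h => /set1gP ->; rewrite gal_id.
have [H' nH pH] := sol_prime_factor_exists (stab_solvable hV hk kV kc kres k1 HG Hs) H1.
set l := #|H : H'|%g in pH.
have [y [fy [s sH sy]]] : exists y, (forall t, t \in H' -> t y = y) /\ exists2 s, s \in H & s y <> y.
 apply: contrapT => hno.
 have : (fixedField H' <= fixedField H)%VS.
  apply/subvP => y /mem_fixedFieldP[_ fy]; apply/fixedFieldP; first exact: memvf.
  by move=> s sH; apply: contrapT => h; apply: hno; exists y; split=> //; exists s.
 move/(galS {:N}%AS); rewrite !gal_fixedField => HH'.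
 by move: pH; rewrite /l; move: HH'; rewrite -indexg_eq1 => /eqP ->.
have sH' : s \notin H' by apply/negP => /fy.
have sG : s \in 'Gal({:N} / 1)%g by exact: (fintype.subsetP HG).
have ss : s \in stab by exact: (fintype.subsetP Hs).
have sl : (s ^+ l)%g \in H'.
 have nsH : s \in 'N(H')%g by exact: (fintype.subsetP (normal_norm nH)).
 apply: coset_idr; first exact: groupX.
 rewrite morphX // -(expg_cardG (mem_quotient H' sH)) card_quotient // normal_norm //.
have fixE' x : s x = x -> (forall t, t \in H' -> t x = x) -> x \in E.
 by move=> sx fx; apply: fixE => t tH; exact: (fixed_by_maximal nH pH sH sH' sx fx tH).
have fyi i : forall t, t \in H' -> t ((s ^+ i)%g y) = (s ^+ i)%g y.
 by apply: (fix_orbit nH) => //; exact: groupX.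
have kE c t : t \in H -> k c -> t c = c by move=> tH; apply: (gal_k k1 tH).
have [cl|cl] := boolP (l%:R == 0 :> N).
 have cp : l \in [pchar N] by rewrite inE pH.
 have fd i : forall t, t \in H' -> t (iter i (delta s) y) = iter i (delta s) y.
  elim: i => [//|i ih] t tH'; rewrite iterS; set d := iter i _ y in ih *.
  by rewrite /delta rmorphB /= (ih t tH') (fix_orbit nH sH ih tH').
 have dl : iter l (delta s) y = 0 by apply: delta_pth => //; exact: fy.
 have exd : exists n, iter n (delta s) y == 0 by exists l; rewrite dl.
 case: (ex_minnP exd) => n /eqP dn nmin.
 have [n2] : exists n2, n = n2.+2.
  case: n dn nmin => [|[|n]] dn nmin; last by exists n.
   by exfalso; apply: sy; move: dn => /= ->; rewrite rmorph0.
  by exfalso; apply: sy; move: dn => /= /eqP; rewrite subr_eq0 => /eqP.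
 (* The last nonzero iterate [z] is fixed by [s], and the one before, [w], is moved to [w + z]; so
    [w / z] is moved to itself plus 1. *)
 move=> en; pose z := iter n2.+1 (delta s) y; pose w := iter n2 (delta s) y.
 have z0 : z != 0 by apply/negP => h; have := nmin _ h; rewrite en ltnn.
 have sz : s z = z by apply/eqP; rewrite -subr_eq0; apply/eqP; have := dn; rewrite en.
 have sw : s w = w + z by rewrite /z iterS -/w /delta addrC subrK.
 pose x := w / z.
 have sx : s x = x + 1 by rewrite /x rmorphM fmorphV /= sw sz; field.
 have fx t : t \in H' -> t x = x by move=> tH'; rewrite /x rmorphM fmorphV /= !fd.
 clearbody x; pose a := x ^+ l - x.
 have aE : a \in E.
  apply: fixE' => [|t tH']; last by rewrite /a rmorphB rmorphXn /= fx.
  by rewrite /a rmorphB rmorphXn /= sx (frobD cp) expr1n opprD addrACA subrr addr0.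
 have [m Em hm] := as_step hV hk kV hA kA AV AN cp (Af cp) (fun c => kclosed_pth cp) gE aE.
 pose x1 := x - m; set a' := a - (m ^+ l - m) in hm.
 have e1 : x1 ^+ l - x1 = a' by rewrite /x1 (frobB cp) /a' /a; move: (x ^+ l) (m ^+ l) => u v; ring.
 have sx1 : s x1 = x1 + 1.
  by rewrite /x1 rmorphB /= sx (gal_B sH Em) addrAC.
 have x1E : x1 \notin E.
  by apply/negP => h; move/eqP: (gal_B sH h); rewrite sx1 -subr_eq0 addrAC subrr add0r oner_eq0.
 have x10 : x1 != 0 by apply: contraNneq x1E => ->; exact: rpred0.
 have l1 : (1 < l)%N by exact: prime_gt1.
 have el : x1 ^+ l = x1 ^+ l.-2.+1 * x1 by case: (l) l1 => [|[|q]] //= _; rewrite -exprSr.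
 have aE' : a' \in E by rewrite /a' rpredB // rpredB // rpredX.
 clearbody a'.
 have nV : ~ V x1 -> vu V (x1 ^+ l / a').
  move=> nVx; have hm1 : vm V x1^-1 by exact: nV_vm.
  have h1 : vu V (1 - (x1^-1) ^+ l.-2.+1) by apply: vm_one => //; exact: vmX.
  have := vu_inv h1; congr vu; rewrite -e1 el exprVn.
  have : x1 ^+ l.-2.+1 - 1 != 0.
   have := vu_n0 h1; apply: contra => /eqP h; move/eqP: h; rewrite subr_eq0 => /eqP h.
   by rewrite exprVn h invr1 subrr.
  move=> hd; have xn : x1 ^+ l.-2.+1 != 0 by rewrite expf_neq0.
  move: (x1 ^+ _) hd xn => w' hd xn; field; rewrite ?xn ?x10 ?hd //=.
  by rewrite (_ : _ - _ = x1 * (w' - 1)) ?mulf_neq0 //; ring.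
 have [P1 P2 P3] := as_poly aE' l1.
 (* An integral right-hand side is impossible: [x1] would be integral with a residue in [k], which
    [s] fixes although it adds 1 to [x1]. In the other case [x1 ^+ l] dominates [x1], and has the
    value of [a']. *)
 case: hm => [Va|[nVa hx]].
  exfalso; have Vx : V x1.
   apply: contrapT => nVx; have h := nV nVx.
   have hm1 : vm V (x1^-1 ^+ l.-1.+1) by apply: vmX => //; exact: nV_vm.
   rewrite prednK ?prime_gt0 // exprVn in hm1.
   have := vmM hV hm1 (srM Vs Va (vu_V h)).
   have a0 : a' != 0 by have := vu_n0 h; rewrite mulf_eq0 negb_or invr_eq0 => /andP[].
   rewrite (_ : _ * _ = 1); first by move/vm_nvu; apply; exact: vu1.
   have := expf_neq0 l x10; by move: (x1 ^+ l) => w' w0; field; rewrite a0 w0.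
  have [c kc' hc] := kres Vx.
  have := stab_vm ss hc; rewrite rmorphB /= sx1 (kE c s sH kc') => h.
  have := vmB hV h hc; rewrite (_ : _ - _ = 1); last by ring.
  by move/vm_nvu; apply; exact: vu1.
 have nVx : ~ V x1.
  by move=> h; apply: nVa; rewrite -e1; apply: srB => //; exact: srX.
 apply: (chain_step gZ ZE vb pH x1E P1 P2 P3 _ aE' (nV nVx)).
  by rewrite !hornerE e1 subrr.
 move=> h hE' h0 hu; apply: (hx h hE' h0).
 have := vu_div hV hu (nV nVx); congr vu.
 have a0 : a' != 0 by have := vu_n0 (nV nVx); rewrite mulf_eq0 negb_or invr_eq0 => /andP[].
 have := expf_neq0 l x10; have := expf_neq0 l h0; move: (x1 ^+ l) (h ^+ l) => w1 w2 w10 w20.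
 by field; rewrite a0 w10 w20.
have [||||z [x [kz z1 zl x0 [fx sx]]]] := eigenvector hk kc k1 sG pH cl (fy _ sl) sy
  (P := fun x => forall t, t \in H' -> t x = x).
- by move=> t _; rewrite rmorph0.
- by move=> a b ha hb t tH'; rewrite rmorphD /= ha ?hb.
- move=> c a kc' ha t tH'; rewrite rmorphM /= ha // kE //; exact: (fintype.subsetP (normal_sub nH)).
- exact: fyi.
have xE : x \notin E.
 apply/negP => xE; have := gal_B sH xE; rewrite sx => /eqP; rewrite -subr_eq0 -{2}[x]mul1r -mulrBl.
 by rewrite mulf_eq0 (negbTE x0) orbF subr_eq0 (negbTE z1).
have aE : x ^+ l \in E.
 apply: fixE' => [|t tH']; last by rewrite rmorphXn /= fx.
 by rewrite rmorphXn /= sx exprMn zl mul1r.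
have [P1 P2 P3] := binomial_poly aE (prime_gt0 pH).
apply: (chain_step gZ ZE vb pH xE P1 P2 P3 _ aE).
- by rewrite hornerD hornerN hornerC hornerXn subrr.
- by rewrite divff ?expf_neq0 //; exact: vu1.
(* If [x ^+ l] had the value of an l-th power from [E], then [x / m] would be a unit eigenvector
   with eigenvalue [z] other than 1. *)
move=> m mE m0; rewrite -expr_div_n => hu.
have w0 : x / m != 0 by rewrite mulf_neq0 ?invr_eq0.
have wu : vu V (x / m) by move: hu; rewrite -(prednK (prime_gt0 pH)); exact: vuX_inv.
apply: (fixed_root_unit hV hk kV kres k1 ss sG kz z1 wu).
by rewrite rmorphM fmorphV /= sx (gal_B sH mE) mulrA.
Qed.

Lemma chain_full r Z : good r (inF Z) -> 'Gal({:N} / Z)%g \subset stab -> VB V (inF Z) (inF {:N}%AS).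
move=> gZ Zs.
suff h n E : (\dim {:N} - \dim E <= n)%N -> (Z <= E)%VS -> VB V (inF Z) (inF E) -> VB V (inF Z) (inF {:N}%AS).
 by apply: (h _ Z (leqnn _) (subvv _)); apply: VB_refl => //; exact: inF_sfield.
elim: n E => [|n ih] E dE ZE vb; (have [e|nE] := eqVneq (E : {vspace N}) {:N}%VS;
 first by move: vb; rewrite /inF /= e); have [E' [EE' dEE' vb']] := chain_extend gZ ZE vb Zs nE.
 have := dimvS (subvf E'); rewrite leqNgt => /negP[]; apply: leq_ltn_trans dEE'.
 by rewrite -subn_eq0 -leqn0.
apply: (ih E') => //; last exact: subv_trans ZE EE'.
by have := dimvS (subvf E'); lia.
Qed.

(** Two decomposition fields are used: [Z] over the base, reached by an etale step, and [ZK] over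
    [K], from which goodness is brought down to [K]. Since [ZK] need not be normal over [Z], it
    receives its valuation basis as a subspace of [N]. *)
Theorem lift_normal r K : good r (inF 1%AS) -> good r (inF K).
move=> g1; have [tK hK] := dec_elt_exists hV K; have [t1 h1] := dec_elt_exists hV 1%AS.
pose ZK : {subfield N} := <<K; tK>>%AS.
have t1fix s : s \in 'Gal({:N} / ZK)%g -> s t1 = t1.
 move=> sZ; have [_ _ h2 _] := h1; apply: h2; first exact: gal_G sZ.
 apply: contrapT => /negP ns; have [_ _ _ h3] := hK.
 have sK : s \in 'Gal({:N} / K)%g.
  by apply: (fintype.subsetP (galS _ _)) sZ; exact: subv_adjoin.
 have := h3 s sK ns; rewrite (gal_B sZ (memv_adjoin K tK)) => h; apply: (vm_nvu h); exact: (th_vu hV hK).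
(* Invariance of [t1] under the group of [ZK] gives membership in [ZK] only up to inseparability,
   hence the passage to a power. *)
have [n /andP[n0 sn]] := separable_exponent_pchar ZK t1.
have n1 : (0 < n)%N by case/andP: n0.
have t1Z : t1 ^+ n \in ZK.
 by apply: fixed_separable => // s sZ; rewrite rmorphXn /= t1fix.
have {}h1 := dec_elt_pow hV h1 n1.
pose Z : {subfield N} := <<1; t1 ^+ n>>%AS.
have gZ : good r (inF Z).
 apply: (good_etale hV hk kV kres hA kA AV AN g1 (inF_sfield Z) _ _ _ _ (dpoly_B h1) (dpoly_V hV h1)
  (dpoly_root _ _) (dpoly_deriv_vu hV h1)).
 - by move=> x; apply: (subvP (sub1v _)).
 - exact: memv_adjoin.
 - by case: (th_vu hV h1).
 - by move=> x /mem_adj.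
have Zs : 'Gal({:N} / Z)%g \subset stab.
 apply/fintype.subsetP => s sZ; apply: contrapT => /negP ns; have [_ _ _ h3] := h1.
 have := h3 s (gal_G sZ) ns; rewrite (gal_B sZ (memv_adjoin 1%VS _)) => h.
 by apply: (vm_nvu h); exact: (th_vu hV h1).
have ZZK : (Z <= ZK)%VS by apply/FadjoinP; rewrite sub1v.
have vb := chain_full gZ Zs.
have vbK : VB V (inF Z) (inF ZK).
 apply: (VB_sub hV (inF_sfield Z) (inF_sfield ZK) (inF_sfield {:N}%AS) _ _ vb).
  by move=> x; exact: (subvP ZZK).
 by move=> x _; exact: memvf.
have gZK : good r (inF ZK).
 apply: (good_VB hV hk kV hA kA AV AN gZ (inF_sfield ZK) _ vbK) => x; exact: (subvP ZZK).
have sdp : size (dpoly K tK) = (size (conjs K tK)).+1 by rewrite size_prod_XsubC.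
apply: (good_down hV hk kV kres hA kA AV AN (inF_sfield K) _ gZK _ _ _ (dpoly_B hK) (dpoly_V hV hK) _ sdp
 (dpoly_root _ _)).
- by move=> x /A1; apply: (subvP (sub1v _)).
- by move=> x; apply: (subvP (subv_adjoin _ _)).
- exact: memv_adjoin.
- by case: (th_vu hV hK).
- by apply: monic_prod_XsubC.
- by move=> q; exact: dec_indep.
- by move=> z; exact: dec_immediate.
- by move=> x; exact: dec_quot.
Qed.
End Chain.

(** * Splitting fields, and transport of models along partial isomorphisms *)

Lemma splits_exists (L0 : fieldType) (p : {poly L0}) : p != 0 ->
 exists (L : fieldExtType L0) (rs : seq L), map_poly (in_alg L) p %= \prod_(z <- rs) ('X - z%:P).
move: {2}(size p) (leqnn (size p)) => n; elim: n L0 p => [|n ih] L0 p sp p0.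
 by move: sp; rewrite leqn0 size_poly_eq0 (negbTE p0).
have [s1|s1] := leqP (size p) 1.
 exists L0^o, [::]; rewrite big_nil -size_poly_eq1 size_map_poly.
 by rewrite eqn_leq s1 lt0n size_poly_eq0.
have [q [qp qi]] : exists q, q %| p /\ irreducible_poly q.
 have ex : exists m, `[< exists q, [/\ q %| p, (1 < size q)%N & size q = m] >].
  by exists (size p); apply/asboolP; exists p; split.
 case: (ex_minnP ex) => m /asboolP[q [qp sq eq]] mmin; exists q; split=> //; split=> // d sd dq.
 have q0 : q != 0 by apply: contraTneq sq => ->; rewrite size_poly0.
 have d0 : d != 0 by apply: contraTneq dq => ->; rewrite dvd0p.
 have hd : (1 < size d)%N by rewrite ltn_neqAle eq_sym sd lt0n size_poly_eq0.
 rewrite -dvdp_size_eqp // eqn_leq dvdp_leq //= eq; apply: mmin; apply/asboolP; exists d; split=> //.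
 exact: dvdp_trans qp.
have [L1 _ [z qz _]] := irredp_FAdjoin qi.
have /factor_theorem[p1 ep] : root (map_poly (in_alg L1) p) z.
 by apply: root_dvdp qz; rewrite dvdp_map.
have p10 : p1 != 0.
 by apply: contraNneq p0 => e; move/eqP: ep; rewrite e mul0r map_poly_eq0.
have [|L2 [rs hrs]] := ih L1 p1 _ p10.
 have := congr1 (fun q : {poly L1} => size q) ep; rewrite size_map_poly size_Mmonic ?monicXsubC //.
 by rewrite size_XsubC addn2 /= => e; rewrite -ltnS -e.
exists (baseFieldType L2), (rcons rs (in_alg L2 z)).
have -> : map_poly (in_alg (baseFieldType L2)) p = map_poly (in_alg L2) (map_poly (in_alg L1) p).
 by rewrite -map_poly_comp; apply: eq_map_poly => a /=; rewrite baseField_scaleE.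
rewrite ep rmorphM /= -cats1 big_cat big_seq1 rmorphB /= map_polyX map_polyC.
by first [exact: eqp_mulr|exact: eqp_mull].
Qed.

Lemma splitting_field_exists (L0 : fieldType) (p : {poly L0}) : p != 0 ->
 exists (N : splittingFieldType L0) (rs : seq N), map_poly (in_alg N) p %= \prod_(z <- rs) ('X - z%:P).
move=> p0; have [L [rs hrs]] := splits_exists p0.
pose E : {subfield L} := <<1 & rs>>%AS; pose rs' : seq (subvs_of E) := map (vsproj E) rs.
have ers : map vsval rs' = rs.
 rewrite -map_comp -[RHS]map_id; apply/eq_in_map => x xs /=; apply: vsprojK.
 exact: seqv_sub_adjoin.
have hp : map_poly (in_alg (subvs_of E)) p %= \prod_(z <- rs') ('X - z%:P).
 rewrite -(eqp_map (vsval : subvs_of E -> L)) -map_poly_comp rmorph_prod /=.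
 have -> : map_poly (vsval \o in_alg (subvs_of E)) p = map_poly (in_alg L) p by apply: eq_map_poly => a /=; rewrite algid1.
 apply: eqp_trans hrs _; rewrite -{1}ers big_map; apply/eqpP; exists (1, 1); rewrite ?oner_eq0 // !scale1r.
 by apply: eq_bigr => x _; rewrite rmorphB /= map_polyX map_polyC.
have full : <<1 & rs'>>%VS = fullv.
 apply/eqP; rewrite eqEsubv subvf /=; apply/subvP => w _.
 pose f := linfun_ahom (vsval : subvs_of E -> L).
 have : vsval w \in (f @: <<1 & rs'>>)%VS.
  rewrite aimg_adjoin_seq aimg1.
  have -> : map f rs' = rs by rewrite -[RHS]ers; apply: eq_map => x; rewrite lfunE.
  exact: subvsP.
 by move=> /memv_imgP[w' hw']; rewrite lfunE => /subvs_inj ->.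
have ax : splitting_field_axiom (subvs_of E).
 exists (map_poly (in_alg (subvs_of E)) p); last by exists rs'; [exact: hp|exact: full].
 by apply/polyOverP => i; rewrite coef_map /= memvZ ?mem1v.
pose N' := FieldExt_isSplittingField.Build L0 (subvs_of E) ax.
pose N : splittingFieldType L0 := HB.pack (subvs_of E) N'.
by exists N, rs'.
Qed.

Definition img (F E : fieldType) (f : F -> E) (S : F -> Prop) (y : E) := exists2 x, S x & y = f x.

Section Map.
Variables (F E : fieldType) (K : F -> Prop) (f : F -> E) (V k A : F -> Prop) (V' : E -> Prop).
Hypotheses (hK : sfield K) (f1 : f 1 = 1).
Hypothesis fB : forall x y, K x -> K y -> f (x - y) = f x - f y.
Hypothesis fM : forall x y, K x -> K y -> f (x * y) = f x * f y.
Let Ks : subr K := proj1 hK.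
Local Notation img := (img f).

Lemma pm0 : f 0 = 0.
Proof. by rewrite -(subrr 1) fB ?subrr //; exact: sr1. Qed.

Lemma pmN x : K x -> f (- x) = - f x.
Proof. by move=> Kx; rewrite -sub0r fB ?pm0 ?sub0r //; exact: sr0. Qed.

Lemma pmD x y : K x -> K y -> f (x + y) = f x + f y.
Proof. by move=> Kx Ky; rewrite -[y]opprK fB ?pmN ?opprK //; apply: srN => //; exact: srN. Qed.

Lemma pmV x : K x -> f x^-1 = (f x)^-1.
move=> Kx; have [->|x0] := eqVneq x 0; first by rewrite invr0 pm0 invr0.
have e : f x * f x^-1 = 1 by rewrite -fM ?divff //; exact: sfV.
have fx0 : f x != 0 by apply: contraTneq isT => h; move/eqP: e; rewrite h mul0r eq_sym oner_eq0.
by apply: (mulfI fx0); rewrite e divff.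
Qed.

Lemma pm_eq0 x : K x -> (f x == 0) = (x == 0).
move=> Kx; apply/eqP/eqP => [fx|->]; last exact: pm0.
apply: contrapT => /eqP x0; have : f (x * x^-1) = 0 by rewrite fM ?fx ?mul0r //; exact: sfV.
by rewrite divff // f1 => /eqP; rewrite oner_eq0.
Qed.

Lemma pmX x n : K x -> f (x ^+ n) = f x ^+ n.
by move=> Kx; elim: n => [|n ih]; rewrite ?expr0 // !exprS fM ?ih //; exact: srX.
Qed.

Lemma pmZ x (n : int) : K x -> f (x ^ n) = f x ^ n.
move=> Kx; case: n => n; rewrite ?NegzE -?exprnN -?exprnP ?pmX //.
by rewrite pmV ?pmX //; exact: srX.
Qed.

Lemma pm_prod (I : Type) (s : seq I) (P : pred I) (g : I -> F) : (forall i, P i -> K (g i)) ->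
 f (\prod_(i <- s | P i) g i) = \prod_(i <- s | P i) f (g i).
move=> h; suff [] : K (\prod_(i <- s | P i) g i) /\
 f (\prod_(i <- s | P i) g i) = \prod_(i <- s | P i) f (g i) by [].
elim/big_rec2: _ => [|i a b Pi [Ka <-]]; first by split=> //; exact: sr1.
by split; [apply: srM => //; exact: h|rewrite fM //; exact: h].
Qed.

Lemma pm_sum (I : Type) (s : seq I) (P : pred I) (g : I -> F) : (forall i, P i -> K (g i)) ->
 f (\sum_(i <- s | P i) g i) = \sum_(i <- s | P i) f (g i).
move=> h; suff [] : K (\sum_(i <- s | P i) g i) /\
 f (\sum_(i <- s | P i) g i) = \sum_(i <- s | P i) f (g i) by [].
elim/big_rec2: _ => [|i a b Pi [Ka <-]]; first by split; [exact: sr0|exact: pm0].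
by split; [apply: srD => //; exact: h|rewrite pmD //; exact: h].
Qed.

Lemma img_subr S : subr S -> (forall x, S x -> K x) -> subr (img S).
move=> hS SK; split.
- by exists 1; [exact: sr1|rewrite f1].
- by move=> _ _ [x Sx ->] [y Sy ->]; exists (x - y); [exact: srB|rewrite fB //; exact: SK].
- by move=> _ _ [x Sx ->] [y Sy ->]; exists (x * y); [exact: srM|rewrite fM //; exact: SK].
Qed.

Lemma img_sfield S : sfield S -> (forall x, S x -> K x) -> sfield (img S).
move=> hS SK; split; first by apply: img_subr => //; case: hS.
by move=> _ [x Sx ->]; exists x^-1; [exact: sfV|rewrite pmV //; exact: SK].
Qed.

Lemma img_kclosed S : kclosed S -> sfield S -> (forall x, S x -> K x) -> kclosed (img S).
move=> kc hS SK n P n0 hP.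
have g i : {c | S c /\ P i = f c} by apply: cid; have [c h1 h2] := hP i; exists c.
pose Q i := sval (g i).
have hQ i : S (Q i) by case: (svalP (g i)).
have eQ i : P i = f (Q i) by case: (svalP (g i)).
have [c Sc ec] := @kc n Q n0 hQ.
exists (f c); first by exists c.
rewrite -pmX ?ec; last exact: SK.
rewrite pm_sum => [|i _]; last by apply: srM => //; [exact: SK|apply: srX => //; exact: SK].
apply: eq_bigr => i _; rewrite fM ?pmX ?eQ //; first [exact: SK|apply: srX => //; exact: SK].
Qed.

Lemma img_lin S s x : (forall x, S x -> K x) -> (forall x, x \in s -> K x) -> K x ->
 lin S s x -> lin (img S) (map f s) (f x).
move=> SK; elim: s x => [|y s ih] x sK Kx /=; first by move=> ->; exact: pm0.
move=> [b Sb hb]; exists (f b); first by exists b.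
have Ky : K y by apply: sK; exact: mem_head.
have Kby : K (b * y) by apply: srM => //; exact: SK.
rewrite -fM // -?fB //; last exact: SK.
by apply: ih => //; [move=> z zs; apply: sK; rewrite inE zs orbT|exact: srB].
Qed.

Lemma img_noeth S : subr S -> noeth S -> (forall x, S x -> K x) -> noeth (img S).
move=> hS SN SK J [j0 jD jM] JS; pose J' x := S x /\ J (f x).
have [||s [sJ hs]] := SN J'.
- split.
 + by split; [exact: sr0|rewrite pm0].
 + by move=> x y [Sx Jx] [Sy Jy]; split; [exact: srD|rewrite pmD; [exact: jD|exact: SK|exact: SK]].
 + move=> a x Sa [Sx Jx]; split; [exact: srM|rewrite fM; [|exact: SK|exact: SK]].
  by apply: jM => //; exists a.
- by move=> x [].
exists (map f s); split; first by move=> _ /mapP[x /sJ[_ h] ->].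
move=> y Jy; have [x Sx e] := JS _ Jy; rewrite e.
apply: img_lin => //; last by apply: hs; split=> //; rewrite -e.
- by move=> z /sJ[/SK].
- exact: SK.
Qed.

Lemma img_ffin p S : ffin p S -> (forall x, S x -> K x) -> ffin p (img S).
move=> [e eS he] SK; exists (map f e); first by move=> _ /mapP[x /eS h ->]; exists x.
move=> _ [a Sa ->]; have hf x : frobp p S x -> K x by move=> [b Sb ->]; apply: srX => //; exact: SK.
have := img_lin hf (fun x xe => SK _ (eS _ xe)) (SK _ Sa) (he _ Sa).
apply: lin_mono => _ [x [b Sb ->] ->]; exists (f b); first by exists b.
by rewrite pmX //; exact: SK.
Qed.

Hypotheses (hV : vring V) (hV' : vring V') (hA : subr A) (AK : forall x, A x -> K x).
Hypothesis VV : forall x, K x -> V x <-> V' (f x).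

Lemma pm_vm x : K x -> vm V x <-> vm V' (f x).
move=> Kx; have KV : K x^-1 by exact: sfV.
split=> [] [h|h].
- by rewrite h pm0; left.
- by right; rewrite -pmV // -VV.
- by left; apply/eqP; rewrite -pm_eq0 // h.
- by right; rewrite VV // pmV.
Qed.

Lemma pm_vu x : K x -> vu V x <-> vu V' (f x).
move=> Kx; have KV : K x^-1 by exact: sfV.
by split=> [] [h1 h2 h3]; split; move: h1 h2 h3; rewrite -?pmV // ?pm_eq0 // -?VV.
Qed.

Lemma img_mring X r (u : 'I_r -> F) : (forall x, x \in X -> K x) -> (forall i, K (u i)) ->
 forall y, mring V' (img A) (map f X) (f \o u) y <-> img (mring V A X u) y.
move=> XK uK; have hA' := img_subr hA AK.
have hS := mring_subr hV hA X u; have hS' := mring_subr hV' hA' (map f X) (f \o u).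
have SK x : mring V A X u x -> K x by apply: mring_min => // z Kz _; exact: sfV.
move=> y; split.
 apply: mring_min.
 - exact: img_subr.
 - by move=> _ [x Ax ->]; exists x => //; exact: mring_A.
 - by move=> _ /mapP[x xX ->]; exists x => //; exact: mring_X.
 - by move=> i; exists (u i) => //; exact: mring_u.
 - move=> _ [x Sx ->] hx; have Kx := SK _ Sx; exists x^-1; last by rewrite pmV.
  by apply: mring_inv => //; apply/pm_vu.
move=> [x Sx ->].
suff : K x /\ mring V' (img A) (map f X) (f \o u) (f x) by case.
apply: (@mring_min _ V A X r u (fun x => K x /\ mring V' (img A) (map f X) (f \o u) (f x)) _ _ _ _ _ x Sx).
- split.
 + by split; [exact: sr1|rewrite f1; exact: sr1].
 + by move=> a b [Ka ha] [Kb hb]; split; [exact: srB|rewrite fB //; exact: srB].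
 + by move=> a b [Ka ha] [Kb hb]; split; [exact: srM|rewrite fM //; exact: srM].
- by move=> a Aa; split; [exact: AK|apply: mring_A => //; exists a].
- by move=> a Xa; split; [exact: XK|apply: mring_X => //; exact: map_f].
- by move=> i; split=> //; exact: (mring_u hV' hA').
- move=> a [Ka ha] hu; split; first exact: sfV.
 by rewrite pmV //; apply: mring_inv => //; apply/pm_vu.
Qed.

(** The map [f] is a total function that is a morphism on [K] only. This is harmless because a model
    of a subfield of [K] has all its elements in [K]. *)
Lemma good_map r M : (forall x, M x -> K x) -> good V k A r M ->
 good V' (img k) (img A) r (img M).
move=> MK [X [u [[u0 ui] um XV uc] hM]].
have hS := mring_subr hV hA X u.
have SK x : mring V A X u x -> K x by move=> h; apply: MK; apply/hM; exact: frac_base.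
have XK x : x \in X -> K x by move=> xX; apply: SK; exact: mring_X.
have uK i : K (u i) by apply: SK; exact: mring_u.
have hm := img_mring XK uK.
exists (map f X), (f \o u); last first.
 move=> y; split=> [[x /hM[a [b [Sa Sb b0 ->]]] ->]|[a [b [/hm[a' Sa ->] /hm[b' Sb ->] b0 ->]]]].
  have Kb := SK _ Sb; exists (f a), (f b); split; last by rewrite fM ?pmV //; [exact: SK|exact: sfV].
  - by apply/hm; exists a.
  - by apply/hm; exists b.
  - by rewrite pm_eq0.
 have Kb := SK _ Sb; exists (a' / b'); last by rewrite fM ?pmV //; [exact: SK|exact: sfV].
 by apply/hM; exists a', b'; split=> //; rewrite -pm_eq0.
split.
- split=> [i|a ha]; first by rewrite /= pm_eq0.
 have Kz : K (\prod_i u i ^ a i).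
  apply: (sr_prod Ks) => i _; case: (a i) => n; rewrite ?NegzE -?exprnN; first exact: srX.
  by apply: sfV => //; exact: srX.
 apply: ui; apply/(pm_vu Kz); move: ha; rewrite pm_prod => [|i _]; last first.
  case: (a i) => n; rewrite ?NegzE -?exprnN; first exact: srX.
  by apply: sfV => //; exact: srX.
 by congr vu; apply: eq_bigr => i _; rewrite pmZ.
- by move=> i; apply/pm_vm.
- by move=> _ /mapP[x xX ->]; apply/VV; [exact: XK|exact: XV].
move=> y /hm[x Sx ->]; have [c kc [b Sb e]] := uc x Sx.
exists (f c); first by exists c.
exists (fun i => f (b i)); first by move=> i; apply/hm; exists (b i).
have Kb i : K (b i * u i) by apply: srM => //; exact: SK.
have Kx := SK _ Sx.
have ec : c = x - \sum_i b i * u i by rewrite -e; ring.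
have Kc : K c by rewrite ec; apply: srB => //; apply: sr_sum.
rewrite -fB // e pm_sum //; apply: eq_bigr => i _; rewrite fM //; exact: SK.
Qed.
End Map.

Lemma good_ext (F : fieldType) (V k A : F -> Prop) r (M M' : F -> Prop) :
 (forall x, M x <-> M' x) -> good V k A r M -> good V k A r M'.
move=> MM [X [u hm hM]]; exists X, u => // x.
by split=> [/MM/hM|/hM/MM].
Qed.

(** Over [k] the polynomial splits into linear factors, and the maximal ideal is prime, so one of
    the factors is in it. *)
Lemma residue_root (F : fieldType) (V k : F -> Prop) y (p : {poly F}) : vring V -> sfield k ->
 (forall c, k c -> V c) -> kclosed k -> polyB k p -> p != 0 -> V y -> vm V p.[y] ->
 exists2 c, k c & vm V (y - c).
move=> hV hk kV kc; move: {2}(size p) (leqnn (size p)) => n.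
elim: n p => [|n ih] p sp pk p0 Vy hy; first by move: sp; rewrite leqn0 size_poly_eq0 (negbTE p0).
have [s1|s1] := leqP (size p) 1.
 have e := size1_polyC s1; rewrite e hornerC in hy.
 by case/eqP: p0; rewrite e (k_vm hk kV (pk 0%N) hy).
have [c kc' hc] := kroot hk kc pk s1.
have [q qk e] := polyB_factor (proj1 hk) pk kc'; rewrite hc add0r in e.
have q0 : q != 0 by apply: contraNneq p0 => h; rewrite e h mulr0.
have Vc : V (y - c) by apply: srB (proj1 hV) _ _ Vy (kV _ kc').
have Vq : V q.[y] by apply: polyB_horner (proj1 hV) _ _ _ Vy => i; exact: kV.
move: hy; rewrite e hornerM hornerXsubC => /(vm_prime hV Vc Vq)[h|h]; first by exists c.
apply: ih h => //; move: sp; rewrite e mulrC size_Mmonic ?monicXsubC //.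
by rewrite size_XsubC addn2.
Qed.

Lemma sfieldT_poly (F : fieldType) (L : F -> Prop) (hL : sfield L) (P : {poly F}) : polyB L P ->
 exists p : {poly sfieldT hL}, map_poly val p = P.
move=> hP; exists (\poly_(i < size P) sval (sfieldT_sub hL (hP i))).
apply/polyP => i; rewrite coef_map coef_poly; case: ltnP => h; last by rewrite [RHS]nth_default.
exact: svalP (sfieldT_sub hL (hP i)).
Qed.

(** * Lifting goodness along arbitrary finite extensions *)

Section LiftOne.
Variables (F : fieldType) (V k A L : F -> Prop) (x : F) (r : nat).
Hypotheses (hV : vring V) (hk : sfield k) (kV : forall c, k c -> V c) (kc : kclosed k).
Hypothesis kres : forall x, V x -> exists2 c, k c & vm V (x - c).
Hypotheses (hA : subr A) (kA : forall c, k c -> A c) (AV : forall x, A x -> V x) (AN : noeth A).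
Hypothesis Af : forall p, p \in [pchar F] -> ffin p A.
Hypotheses (hL : sfield L) (AL : forall x, A x -> L x).
Hypothesis xL : exists2 p, polyB L p & p != 0 /\ p.[x] = 0.
Local Notation LT := (sfieldT hL).
Local Notation ev q := (map_poly (val : LT -> F) q).[x].

Lemma minimal_annihilator : exists p : {poly LT}, irreducible_poly p /\ forall q : {poly LT}, ev q = 0 <-> p %| q.
have [P PL [P0 Px]] := xL; have [p0 e0] := sfieldT_poly hL PL.
have ex : exists n, `[< exists p : {poly LT}, [/\ p != 0, ev p = 0 & size p = n] >].
 exists (size p0); apply/asboolP; exists p0; split=> //; last by rewrite e0.
 by apply: contraNneq P0 => e; rewrite -e0 e rmorph0.
case: (ex_minnP ex) => n /asboolP[p [pn0 px sp]] nmin.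
have hd q : ev q = 0 <-> p %| q.
 split=> [qx|/dvdpP[s ->]]; last by rewrite rmorphM hornerM px mulr0.
 have : ev (q %% p) = 0.
  have e : q %% p = q - q %/ p * p by rewrite {2}(divp_eq q p) addrAC subrr add0r.
  by rewrite e rmorphB rmorphM /= hornerD hornerN hornerM px qx mulr0 subr0.
 move=> h; rewrite /dvdp; apply: contrapT => /negP m0.
 have : (n <= size (q %% p)%R)%N by apply: nmin; apply/asboolP; exists (q %% p).
 by rewrite leqNgt -sp ltn_modp pn0.
exists p; split=> //; split.
 rewrite ltnNge; apply/negP => s1; have e := size1_polyC s1.
 have : val p`_0 = 0 by move: px; rewrite [p in map_poly _ p]e map_polyC hornerC.
 by move/eqP; rewrite fmorph_eq0 => /eqP h; case/eqP: pn0; rewrite e h.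
move=> d sd /dvdpP[s es]; have := px; rewrite es rmorphM hornerM => /eqP; rewrite mulf_eq0.
have sd0 : (s != 0) && (d != 0) by move: pn0; rewrite es mulf_eq0 negb_or.
have /andP[s0 d0] := sd0.
case/orP=> /eqP /hd h; last by apply/andP; split; [rewrite dvdp_mull|rewrite -es].
have := dvdp_leq s0 h; rewrite es size_mul // => hs.
case/negP: sd; rewrite eqn_leq lt0n size_poly_eq0 d0 andbT.
have hs0 : (0 < size s)%N by rewrite lt0n size_poly_eq0.
move: hs; rewrite -subn1 leq_subLR addnC leq_add2r.
by [].
Qed.

(** The ambient field need not contain a normal closure, so one is built abstractly as a splitting
    field; the valuation is extended to it, and [f] and [g] carry the base there and the extension
    back. *)
Theorem lift_one : good V k A r L -> sfield (adj1 L x) /\ good V k A r (adj1 L x).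
move=> gL; have [p [pi hp]] := minimal_annihilator; have [p1 _] := pi.
have pn0 : p != 0 by apply: contraTneq p1 => ->; rewrite size_poly0.
have [N [rs hrs]] := splitting_field_exists pn0.
have [x' px'] : exists x' : N, root (map_poly (in_alg N) p) x'.
 case: rs hrs => [|z rs] hrs; last first.
  by exists z; rewrite (eqp_root hrs) big_cons rootM root_XsubC eqxx.
 by move: hrs => /eqp_size; rewrite big_nil size_poly1 size_map_poly => e; rewrite e in p1.
pose ev' (q : {poly LT}) := (map_poly (in_alg N) q).[x'].
have hp' (q : {poly LT}) : ev' q = 0 -> ev q = 0.
 move=> qx; apply/hp; pose g := gcdp p q.
 have gx : root (map_poly (in_alg N) g) x' by rewrite gcdp_map root_gcd px'; apply/eqP.
 have g1 : size g != 1%N.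
  apply/negP => /eqP g1; have e := size1_polyC (eq_leq g1); move: gx.
  rewrite e map_polyC rootC fmorph_eq0 => /eqP h.
  by move: g1; rewrite e h size_poly0.
 have := pi.2 g g1 (dvdp_gcdl _ _) => /andP[_ h]; exact: dvdp_trans h (dvdp_gcdr _ _).
pose K' : {subfield N} := <<1; x'>>%AS.
have K'P y : inF K' y <-> exists q, y = ev' q.
 split=> [/Fadjoin_polyP[_ /polyOver1P[q ->] ->]|[q ->]]; first by exists q.
 by apply/Fadjoin_polyP; exists (map_poly (in_alg N) q) => //; apply/polyOver1P; exists q.
pose g y := if pselect (exists q, y = ev' q) is left h then ev (sval (cid h)) else 0.
have hg q : g (ev' q) = ev q.
 rewrite /g; case: pselect => [h|[]]; last by exists q.
 case: (cid h) => q' /= e.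
 have : ev (q' - q) = 0 by apply: hp'; rewrite /ev' rmorphB hornerD hornerN -/(ev' q') -/(ev' q) -e subrr.
 by rewrite rmorphB hornerD hornerN => /eqP; rewrite subr_eq0 => /eqP.
have evC c : ev' c%:P = c%:A by rewrite /ev' map_polyC hornerC.
have g1 : g 1 = 1 by have := hg 1; rewrite /ev' !rmorph1 !hornerC.
have gB y z : inF K' y -> inF K' z -> g (y - z) = g y - g z.
 move=> /K'P[q ->] /K'P[s ->].
 have -> : ev' q - ev' s = ev' (q - s) by rewrite /ev' rmorphB hornerD hornerN.
 by rewrite !hg rmorphB hornerD hornerN.
have gM y z : inF K' y -> inF K' z -> g (y * z) = g y * g z.
 move=> /K'P[q ->] /K'P[s ->].
 have -> : ev' q * ev' s = ev' (q * s) by rewrite /ev' rmorphM hornerM.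
 by rewrite !hg rmorphM hornerM.
have hK' := inF_sfield K'.
pose f a : N := if pselect (L a) is left h then in_alg N (sval (sfieldT_sub hL h)) else 0.
have hf (c : LT) : f (val c) = c%:A.
 rewrite /f; case: pselect => [h|[]]; last exact: sfieldT_val.
 by congr (_ *: _); apply: val_inj; exact: (svalP (sfieldT_sub hL h)).
have fP a : L a -> exists2 c : LT, a = val c & f a = c%:A.
 by move=> La; have [c <-] := sfieldT_sub hL La; exists c.
have f1 : f 1 = 1 by have := hf 1; rewrite scale1r.
have fB a b : L a -> L b -> f (a - b) = f a - f b.
 move=> /fP[c -> ->] /fP[d -> ->].
 by rewrite -rmorphB hf scalerBl.
have fM a b : L a -> L b -> f (a * b) = f a * f b.
 move=> /fP[c -> ->] /fP[d -> ->].
 by rewrite -rmorphM hf -in_algE rmorphM.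
have gf a : L a -> g (f a) = a.
 by move=> /fP[c -> ->]; rewrite -evC hg map_polyC hornerC.
have fK a : L a -> inF K' (f a).
 by move=> /fP[c _ ->]; apply/K'P; exists c%:P; rewrite evC.
(* The pair to which Chevalley's theorem is applied is already a valuation ring of [K'], so the
   extension restricts to exactly the given valuation. *)
pose T y := inF K' y /\ V (g y); pose J y := inF K' y /\ vm V (g y).
have [||||V' [hV' TV' JV']] := @chevalley N T J.
- split.
 + by split; [exact: sr1 (proj1 hK')|rewrite g1; exact: sr1 (proj1 hV)].
 + by move=> y z [Ky Vy] [Kz Vz]; split; [exact: (srB (proj1 hK'))|rewrite gB //; exact: (srB (proj1 hV))].
 + by move=> y z [Ky Vy] [Kz Vz]; split; [exact: (srM (proj1 hK'))|rewrite gM //; exact: (srM (proj1 hV))].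
- split.
 + by split; [exact: sr0 (proj1 hK')|rewrite (pm0 hK' gB); left].
 + by move=> y z [Ky Vy] [Kz Vz]; split; [exact: (srD (proj1 hK'))|rewrite (pmD hK' gB) //; exact: vmD].
 + by move=> y z [Ky Vy] [Kz Vz]; split; [exact: (srM (proj1 hK'))|rewrite gM //; exact: vmMr].
- by move=> [_]; rewrite g1 => /vm_nvu; apply; exact: vu1.
- by move=> y [Ky /vm_V h]; split=> //; exact: h.
have VV y : inF K' y -> V' y <-> V (g y).
 move=> Ky; split=> [V'y|]; last by move=> h; apply: TV'.
 apply: contrapT => nV; have y0 : y != 0.
  by apply: contra_notN nV => /eqP ->; rewrite (pm0 hK' gB); exact: sr0 (proj1 hV).
 have : vm V' y^-1.
  by apply: JV'; split; [exact: sfV|rewrite (pmV hK' g1 gB gM) //; exact: nV_vm].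
 by move/vm_nV; rewrite invr_eq0 invrK => /(_ y0).
have VVf a : L a -> V a <-> V' (f a).
 by move=> La; have := VV _ (fK _ La); rewrite gf // => h; split; apply h.
have kL c : k c -> L c by move=> /kA/AL.
have imgL y : img f L y <-> y \in (1%AS : {subfield N}).
 split=> [[a /fP[c _ ->] ->]|/vlineP[c ->]]; first by rewrite memvZ ?mem1v.
 by exists (val c); [exact: sfieldT_val|rewrite hf].
have hk' : sfield (img f k) by apply: (img_sfield hL).
have kV' c : img f k c -> V' c by move=> [a ka ->]; apply/VVf; [exact: kL|exact: kV].
have kc' : kclosed (img f k) by apply: (img_kclosed hL).
(* The residue field does not grow: the minimal equation of [y], divided by a coefficient of least
   value, reduces to a nonzero polynomial over the algebraically closed residue field of the
   base. *)
have kres' y : V' y -> exists2 c, img f k c & vm V' (y - c).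
 move=> V'y; have /polyOver1P[q eq] := minPolyOver 1 y.
 have q0 : map_poly (in_alg N) q != 0 by rewrite -eq; exact: monic_neq0 (monic_minPoly 1 y).
 have [j j0 [hj _]] := coef_argmin hV' q0.
 have hq i : (map_poly (in_alg N) q)`_i = f (val q`_i) by rewrite coef_map hf.
 have hw i : exists c, k c /\ vm V' ((map_poly (in_alg N) q)`_i / (map_poly (in_alg N) q)`_j - f c).
  have La : L (val q`_i / val q`_j) by apply: sf_div => //; exact: sfieldT_val.
  have e : (map_poly (in_alg N) q)`_i / (map_poly (in_alg N) q)`_j = f (val q`_i / val q`_j).
   by rewrite !hq fM ?(pmV hL f1 fB fM) //; first [exact: sfieldT_val|apply: sfV => //; exact: sfieldT_val].
  have := hj i; rewrite e => /VVf-/(_ La)/kres[c kc1 hc]; exists c; split=> //.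
  rewrite -fB //; last exact: kL.
  by apply/(pm_vm hL f1 fB fM VVf) => //; apply: srB (proj1 hL) _ _ La (kL _ kc1).
 have h i := cid (hw i); pose c i := sval (h i).
 have kc1 i : k (c i) by rewrite /c; case: (svalP (h i)).
 have hc i : vm V' ((map_poly (in_alg N) q)`_i / (map_poly (in_alg N) q)`_j - f (c i)).
  by rewrite /c; case: (svalP (h i)).
 clearbody c; clear h; move: (map_poly (in_alg N) q) eq q0 j0 hc {hj hq hw} => w ew w0 j0 hc.
 have jw : (j < size w)%N by rewrite ltnNge; apply: contra j0 => /leq_sizeP/(_ j (leqnn j)) ->.
 apply: (residue_root (p := \poly_(i < size w) f (c i)) hV' hk' kV' kc') => //.
 - move=> i; rewrite coef_poly; case: ifP => _; last exact: sr0 (proj1 hk').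
  by exists (c i).
 - apply/eqP => /(congr1 (fun q : {poly N} => q`_j)); rewrite coef_poly jw coef0 => e.
  by have := hc j; rewrite e subr0 divff // => /vm_nvu; apply; exact: vu1.
 have -> : (\poly_(i < size w) f (c i)).[y] = - \sum_(i < size w) (w`_i / w`_j - f (c i)) * y ^+ i.
  rewrite horner_poly [in RHS](eq_bigr (fun i : 'I_(size w) => w`_i * y ^+ i / w`_j - f (c i) * y ^+ i)) => [|i _].
   rewrite sumrB -mulr_suml -horner_coef -ew.
   by have /eqP -> := root_minPoly 1 y; rewrite mul0r sub0r opprK.
  by rewrite mulrBl mulrAC.
 apply: vmN => //; apply: vm_sum => // i _; apply: vmM => //.
 by apply: srX => //; exact: (proj1 hV').
have gg : good V' (img f k) (img f A) r (inF 1%AS).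
 apply: (good_ext imgL); apply: (good_map hL f1 fB fM hV hV' hA AL VVf) => //.
have AV' a : img f A a -> V' a by move=> [b Ab ->]; apply/VVf; [exact: AL|exact: AV].
have gK : good V' (img f k) (img f A) r (inF K').
 apply: (lift_normal hV' hk' kV' kc' kres' _ _ _ AV' _ _ _ K' gg).
 - by move=> c [a /kL La ->]; apply/imgL; exists a.
 - exact: (img_subr f1 fB fM hA AL).
 - by move=> c [a ka ->]; exists a => //; exact: kA.
 - exact: (img_noeth hL fB fM hA AN AL).
 - by move=> c [a /AL La ->]; apply/imgL; exists a.
 move=> q; rewrite (fmorph_pchar (in_alg N)) -(fmorph_pchar (val : LT -> F)) => hq.
 exact: (img_ffin hL f1 fB fM (Af hq) AL).
have gimg S : (forall a, S a -> L a) -> img g (img f S) = S.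
 move=> SL; apply: functional_extensionality_dep => a; apply: propositional_extensionality; split.
  by move=> [_ [b Sb ->] ->]; rewrite gf //; exact: SL.
 by move=> Sa; exists (f a); [exists a|rewrite gf //; exact: SL].
have iK a : img g (inF K') a <-> adj1 L x a.
 split=> [[_ /K'P[q ->] ->]|[P PL ->]].
  rewrite hg; exists (map_poly val q) => // i; rewrite coef_map; exact: sfieldT_val.
 have [q <-] := sfieldT_poly hL PL; exists (ev' q); last by rewrite hg.
 by apply/K'P; exists q.
split.
 have := img_sfield hK' g1 gB gM hK' (fun y h => h).
 by have -> : img g (inF K') = adj1 L x
  by apply: functional_extensionality_dep => a; apply: propositional_extensionality.
apply: (good_ext iK); rewrite -{1}(gimg k) // -(gimg A) //.
apply: (good_map hK' g1 gB gM hV' hV _ _ VV) => //.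
- exact: (img_subr f1 fB fM hA AL).
- by move=> _ [a /AL La ->]; exact: fK.
Qed.
End LiftOne.

Theorem lift_finite (F : fieldType) (V k A L : F -> Prop) r (e : seq F) :
 vring V -> sfield k -> (forall c, k c -> V c) -> kclosed k ->
 (forall x, V x -> exists2 c, k c & vm V (x - c)) ->
 subr A -> (forall c, k c -> A c) -> (forall x, A x -> V x) -> noeth A ->
 (forall p, p \in [pchar F] -> ffin p A) -> sfield L -> (forall x, A x -> L x) ->
 (forall x, x \in e -> exists2 p, polyB L p & p != 0 /\ p.[x] = 0) ->
 good V k A r L -> sfield (adjs L e) /\ good V k A r (adjs L e).
move=> hV hk kV kc kres hA kA AV AN Af hL AL he gL.
suff [h1 _ h2] : [/\ sfield (adjs L e), forall x, L x -> adjs L e x & good V k A r (adjs L e)] by [].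
elim: e he => [|x e ih] he //=.
have [|hM LM gM] := ih; first by move=> y ye; apply: he; rewrite inE ye orbT.
have [||hx gx] := lift_one (x := x) hV hk kV kc kres hA kA AV AN Af hM _ _ gM.
- by move=> a /AL/LM.
- have [p pL hp] := he x (mem_head _ _); exists p => // i; exact: LM.
by split=> // y /LM h; apply: adj1_base => //; case: hM.
Qed.

(** * Goodness of the fraction field of a power series ring *)

Section BaseGood.
Variable F : fieldType.
Variables (V k : F -> Prop).
Hypotheses (hV : vring V) (hk : sfield k) (kV : forall c, k c -> V c) (kc : kclosed k).
Hypothesis kres : forall x, V x -> exists2 c, k c & vm V (x - c).
Let ks : subr k := proj1 hk.

Lemma vind_exists (M : F -> Prop) r : (forall m, r = m.+1 -> ~ rkle V M m) ->
 exists2 u : 'I_r -> F, forall i, M (u i) & vind V u.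
case: r => [|r] h; first by exists (fun=> 1) => [[]|] //; split=> [[]|a _ []].
by apply: contrapT => hno; apply: (h r) => // u hu hu1; apply: hno; exists u.
Qed.

Lemma pser_fcons Fl r g (y : 'I_r -> F) x : pser k Fl y x -> pser k Fl (fcons g y) x.
move=> [h [hh hx]]; exists h; split=> // n; have {hh} := hh n; move: (h n).
elim: n => //= n ih z [b hb ->]; exists (fcons 0 b) => [i|].
 apply: fcons_case => [|j]; last exact: ih.
 by case: (ipow_ideal ks (fcons g y) n).
rewrite big_ord_recl !fcons0 mul0r add0r; apply: eq_bigr => i _; by rewrite !fconsS.
Qed.

Lemma base_good0 A (y : 'I_0 -> F) : base k A y -> (forall x, A x -> V x) -> good V k A 0 (frac A).
move=> [hA [_ kA] Ay hc _] AV; exists [::], y.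
 split=> //; [by split=> [[]|a _ []]|by case|].
 apply: clos_gen => //; first by case.
 move=> a /hc[c kc' [b Ab e]]; exists c => //; exists b => // i; exact: mring_A.
move=> x; split=> [[a [b [Aa Ab b0 ->]]]|].
 by exists a, b; split=> //; exact: mring_A.
apply: frac_min; first exact: frac_sfield.
move=> z; apply: mring_min; first exact: (proj1 (frac_sfield hA)).
- by move=> a; exact: frac_base.
- by [].
- by case.
- by move=> a h _; exact: sfV (frac_sfield hA) h.
Qed.

(** The new parameter is [g] itself: it is independent of the old ones because it is outside the
    hull, and it generates the new part of the maximal ideal because every element of [A1] differs
    from one of [A0] by a multiple of [g]. *)
Lemma good_base_extend A0 A1 r (g : F) X0 (u0 : 'I_r -> F) : subr A0 -> subr A1 ->
 (forall c, k c -> A0 c) -> (forall x, A0 x -> A1 x) -> (forall x, A1 x -> V x) ->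
 A1 g -> g != 0 -> vm V g -> ~ hull V (frac A0) g ->
 (forall x, A1 x -> exists a b, [/\ A0 a, A1 b & x = a + g * b]) ->
 model V k A0 X0 u0 -> (forall x, frac A0 x <-> frac (mring V A0 X0 u0) x) ->
 good V k A1 r.+1 (frac A1).
move=> h0 h1 k0 A01 A1V A1g g0 gm gh sp [[u00 ui] um XV uc] hM.
have k1 c : k c -> A1 c by move=> /k0/A01.
have hK0 := frac_sfield h0; have K0s := proj1 hK0.
have hK1 := frac_sfield h1.
pose u := fcons g u0.
have uK0 i : frac A0 (u0 i) by apply/hM; apply: frac_base (mring_subr hV h0 _ _) _ (mring_u hV h0 _ _ _).
have F01 x : frac A0 x -> frac A1 x.
 by move=> [a [b [Aa Ab b0 ->]]]; exists a, b; split=> //; exact: A01.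
have um' i : vm V (u i) by apply: fcons_case.
have S01 x : mring V A0 X0 u0 x -> mring V A1 X0 u x.
 apply: mring_min; first exact: mring_subr.
 - by move=> a /A01; exact: mring_A.
 - by move=> a; exact: mring_X.
 - by move=> i; rewrite -(fconsS g u0 i); exact: mring_u.
 - by move=> a; exact: mring_inv.
have hS := mring_subr hV h1 X0 u.
have ig0 x : igen (mring V A0 X0 u0) u0 x -> igen (mring V A1 X0 u) u x.
 apply: igen_min; [exact: igen0|exact: igenD|by move=> a z /S01; exact: igenM |].
 by move=> i; rewrite -(fconsS g u0 i); exact: igen_mem.
exists X0, u.
 split=> //; last first.
  apply: clos_gen => //.
   move=> a /sp[a0 [b [Aa0 Ab ->]]].
   have [|c kc' hc] := uc a0; first exact: mring_A.
   exists c => //; rewrite addrAC; apply: igenD => //; first exact: ig0.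
   rewrite mulrC -(fcons0 g u0); apply: igenM; [exact: hS|exact: mring_A|exact: igen_mem].
  move=> x xX; have [|c kc' hc] := uc x; first exact: mring_X.
  by exists c => //; exact: ig0.
 split=> [i|a]; first by apply: (@fcons_case _ _ g u0 (fun z => z != 0)).
 rewrite /u big_ord_recl fcons0 (eq_bigr (fun i => u0 i ^ a (lift ord0 i))) => [|i _]; last by rewrite fconsS.
 set w := \prod_i _ => hu.
 have K0w : frac A0 w.
  apply: (sr_prod K0s) => i _; case: (a _) => n; rewrite ?NegzE -?exprnN; first exact: srX.
  by apply: sfV => //; exact: srX.
 have a0 : a ord0 = 0.
  have w0 : w != 0 by have := vu_n0 hu; rewrite mulf_eq0 negb_or => /andP[].
  case e : (a ord0) hu => [[|n]|n] // hu; exfalso; apply: gh; exists n.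
   by exists w^-1; [exact: sfV|rewrite invrK].
  exists w => //; rewrite NegzE -exprnN in hu; have := vu_inv hu.
  by rewrite invfM invrK.
 move: hu; rewrite a0 expr0z mul1r => /ui hz i.
 by case: (unliftP ord0 i) => [j ->|->].
move=> x; split=> [[a [b [Aa Ab b0 ->]]]|].
 by exists a, b; split=> //; exact: mring_A.
apply: frac_min => // z; apply: mring_min; first exact: (proj1 hK1).
- by move=> a; exact: frac_base.
- by move=> a aX; apply: F01; apply/hM; apply: frac_base (mring_subr hV h0 _ _) _ (mring_X hV h0 _ aX).
- by move=> i; apply: fcons_case => [|j]; [exact: frac_base|exact: F01].
- by move=> a h _; exact: sfV.
Qed.

(** Once a modification has absorbed [y], the model over [A1] contains all of [A], so it is also a
    model over [A]. *)
Lemma good_base_change A A1 r y d : subr A -> subr A1 -> noeth A1 -> (forall c, k c -> A1 c) ->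
 (forall x, A1 x -> A x) -> (forall x, A x -> V x) -> A y ->
 (forall x, A x -> exists2 c : 'I_d -> F, forall j, A1 (c j) & x = \sum_j c j * y ^+ j) ->
 good V k A1 r (frac A) -> good V k A r (frac A).
move=> hA h1 N1 k1 A1A AV Ay hd [X [u hm hM]].
have A1V x : A1 x -> V x by move=> /A1A/AV.
have [|w [_ [wi wm XV wc] yw _ hF]] := model_monomialize hV hk kV h1 k1 A1V N1 (Z := [:: y]) hm.
 by move=> z; rewrite inE => /eqP ->; split; [exact: AV|apply/hM; exact: frac_base].
have hS := mring_subr hV h1 X w.
have AS x : A x -> mring V A1 X w x.
 move=> /hd[c hc ->]; apply: sr_sum => // i _; apply: srM => //; first by apply: mring_A.
 by apply: srX => //; apply: yw; exact: mem_head.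
have e1 x : mring V A X w x <-> mring V A1 X w x.
 split; apply: mring_min => //.
 - by move=> z; exact: mring_X.
 - by move=> i; exact: mring_u.
 - by move=> z; exact: mring_inv.
 - exact: mring_subr.
 - by move=> a /A1A; exact: mring_A.
 - by move=> z; exact: mring_X.
 - by move=> i; exact: mring_u.
 - by move=> z; exact: mring_inv.
exists X, w.
 split=> // s /e1/wc[c kc' [b hb eb]]; exists c => //; exists b => // i; exact/e1.
move=> x; rewrite hM -hF; split=> -[a [b [Sa Sb b0 ->]]]; exists a, b; split=> //; exact/e1.
Qed.

Theorem base_good r A (y g : 'I_r -> F) : base k A y -> (forall x, A x -> V x) -> (forall i, vm V (y i)) ->
 (forall i, frac A (g i)) -> vind V g -> good V k A r (frac A).
elim: r A y g => [|r ih] A y f hb AV ym fA fi; first exact: base_good0 hb AV.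
have [hA [_ kA] Ay _ _] := hb; have hF := base_filt hb.
have hab i : {p : F * F | [/\ A p.1, A p.2, p.2 != 0 & f i = p.1 / p.2]}.
 by apply: cid; have [a [b [h1 h2 h3 h4]]] := fA i; exists (a, b).
pose a i := (sval (hab i)).1; pose b i := (sval (hab i)).2.
have fab i : f i = a i / b i by case: (svalP (hab i)).
have Aab i : [/\ A (a i), A (b i), a i != 0 & b i != 0].
 have := fab i; rewrite /a /b; case: (svalP (hab i)) => h1 h2 h3 _ e; split=> //.
 by have [/(_ i) f0 _] := fi; apply: contraNneq f0 => h; rewrite e h mul0r.
clearbody a b; clear hab.
pose s := [seq a i | i : 'I_r.+1] ++ [seq b i | i : 'I_r.+1].
have [|y' [y'' [g1 g2 hs]]] := coord_list (s := s) hk kc hb.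
 by move=> z; rewrite mem_cat => /orP[] /mapP[i _ ->]; case: (Aab i).
have y'1 := coord_y'1 hb g1.
have hb0 := base0_base hk hb g1; set A0 := pser _ _ y' in hb0.
have A0s : subr A0 := base0_subr hk hb g1.
have A0A x : A0 x -> A x by exact: (pserB_sub hF).
have A0V x : A0 x -> V x by move=> /A0A/AV.
have y'm i : vm V (y' i) by apply: igen_vm (y'1 i).
have [g [i hgi] gh] := coord_not_hull hV hk hb y'1 (abhyankar hV hk kc hb0 A0V y'm) fi fab.
have [Aa Ab a0 b0] := Aab i.
have Ag : A g by case: hgi => ->.
have g0 : g != 0 by case: hgi => ->.
have [|d [v [Av hd]]] := hs g.
 by rewrite mem_cat; case: hgi => ->; rewrite map_f ?mem_enum // orbT.
have gig := coord_nonunit hk hb AV g1 Ag g0 gh.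
have gm : vm V g by apply: igen_vm gig.
have hb1 := base1_base hk hb AV g1 Ag g0 gh; set A1 := pser _ _ _ in hb1.
have [A1s [_ kA1] A1y _ _] := hb1.
have A1A x : A1 x -> A x.
 by apply: (pserB_sub hF).
have A1g : A1 g by have := A1y ord0; rewrite fcons0.
have A01 x : A0 x -> A1 x by exact: pser_fcons.
have sp x : A1 x -> exists a b, [/\ A0 a, A1 b & x = a + g * b].
 by apply: (pser_split hF hk kA gig y'1).
(* A smaller rank for [A0] would bound that of [A1], hence that of its finite extension [A], by [r],
   against the [r + 1] given values. *)
have [u0 u0K u0i] : exists2 u0 : 'I_r -> F, forall i, frac A0 (u0 i) & vind V u0.
 apply: vind_exists => m er hr.
 have hr1 : rkle V (frac A1) r.
  by rewrite er; apply: (rkle_gen hV (g := g) _ g0 hr); [exact: frac_sfield|exact: (coord_param hV hk kc hb AV ym g1)].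
 apply: (rkle_hull hV hr1 _ fA fi) => x.
 by apply: (coord_hull1 hV hk hb AV g1 g2 Ag g0 Av hd gh).
have [X0 [u1 hm1 hM1]] := ih A0 y' u0 hb0 A0V y'm u0K u0i.
have kA0 c : k c -> A0 c by case: hb0 => _ [_ h] _ _ _; exact: h.
have A1V x : A1 x -> V x by move=> /A1A/AV.
have gA1 := good_base_extend A0s A1s kA0 A01 A1V A1g g0 gm gh sp hm1 hM1.
have fin := coord_fin hk hb AV g1 g2 Ag g0 Av hd gh.
have Ay'' : A y''.
 have := g1 ord0; rewrite fcons0 => -[c hc ->].
 by apply: sr_sum => // j _; apply: srM => //; exact: kA.
have hL := frac_sfield A1s.
have A1N : noeth A1 by move=> J; exact: (base_noeth hk kc hb1).
have [|||h1 h2] := lift_one (x := y'') hV hk kV kc kres A1s kA1 A1V A1N _ hL _ _ gA1.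
- by move=> p cp; exact: (base_ffin cp hk kc hb1).
- by move=> x; exact: frac_base.
- apply: (finite_algebraic (e := fun j : 'I_d => y'' ^+ j) hL hA _ Ay'') => x /fin[c hc ->].
 by exists c => // j; exact: (frac_base A1s (hc j)).
apply: (good_base_change hA A1s A1N kA1 A1A AV Ay'' fin).
apply: good_ext h2 => x; split; last first.
 apply: frac_min => // z /fin[c hc ->]; apply: (sr_sum (proj1 h1)) => j _.
 apply: (srM (proj1 h1)); last by apply: (srX (proj1 h1)); exact: adj1_gen (proj1 hL).
 by apply: adj1_base (proj1 hL) _; exact: (frac_base A1s (hc j)).
apply: adj1_min; first exact: (proj1 (frac_sfield hA)).
- by move=> z [p [q [Ap Aq q0 ->]]]; exists p, q; split=> //; exact: A1A.
- exact: frac_base.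
Qed.
End BaseGood.

(** * Coefficient fields (Cohen) *)

Section Cohen.
Variables (F : fieldType) (B : F -> Prop) (I : finType) (g : I -> F).
Hypotheses (hB : subr B) (Bg : forall i, B (g i)).
Local Notation m := (igen B g).
Local Notation Fl := (ipow B g).
Hypotheses (Bl : forall x, B x -> ~ m x -> B x^-1) (m1 : ~ m 1).
Hypothesis sep : forall x, (forall n, Fl n x) -> x = 0.
Hypothesis compl : forall t : nat -> F, (forall n, Fl n (t n)) -> exists s, forall n, Fl n (s - \sum_(i < n) t i).
Hypothesis res_closed : forall n (P : nat -> F), (0 < n)%N -> (forall i, B (P i)) ->
 exists2 x, B x & m (x ^+ n - \sum_(i < n) P i * x ^+ i).
Hypothesis equichar : forall p, prime p -> m p%:R -> p%:R = 0 :> F.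
Let Flid n := ipow_ideal hB g n.
Let FlB n x y : Fl n x -> Fl n y -> Fl n (x - y) := idealB hB (Flid n).

Lemma m_B x : m x -> B x. Proof. exact: (@ipow_base _ _ hB _ _ Bg 1). Qed.

Lemma m_n x : B x -> m x -> B x^-1 -> x = 0.
move=> Bx mx BV; apply: contrapT => /eqP x0; apply: m1; rewrite -(mulVf x0); exact: igenM.
Qed.

Lemma m_prime x y : B x -> B y -> m (x * y) -> m x \/ m y.
move=> Bx By h; have [mx|nx] := pselect (m x); [by left|right].
have x0 : x != 0 by apply: contra_notN nx => /eqP ->; exact: igen0.
by rewrite -(mulKf x0 y); apply: igenM => //; exact: Bl.
Qed.

Lemma m_root x n : B x -> m (x ^+ n) -> m x.
move=> Bx; elim: n => [/m1 //|n ih]; rewrite exprS => /(m_prime Bx (srX hB n Bx))[//|]; exact: ih.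
Qed.

Lemma sfield_m k x : sfield k -> (forall c, k c -> B c) -> k x -> m x -> x = 0.
Proof. by move=> hk kB kx mx; apply: m_n => //; [exact: kB|apply: kB; exact: sfV]. Qed.

Lemma limit (c : nat -> F) : (forall n, Fl n (c n.+1 - c n)) ->
 exists l, forall n, Fl n (l - c n).
move=> hc; have [s hs] := compl hc; exists (s + c 0%N) => n.
have := hs n; rewrite -(big_mkord xpredT (fun i => c i.+1 - c i)) telescope_sumr //.
by rewrite (_ : s - (c n - c 0%N) = s + c 0%N - c n) //; ring.
Qed.

Lemma cohen_kclosed k : sfield k -> (forall c, k c -> B c) ->
 (forall a, B a -> exists2 c, k c & m (a - c)) -> kclosed k.
move=> hk kB hres n P n0 hP; have ks := proj1 hk.
have [x Bx hx] := res_closed n0 (fun i => kB _ (hP i)).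
have [c kc hc] := hres x Bx; exists c => //.
have Bc := kB _ kc.
have pX i : m (x ^+ i - c ^+ i).
 elim: i => [|i ih]; first by rewrite subrr; exact: igen0.
 have -> : x ^+ i.+1 - c ^+ i.+1 = x * (x ^+ i - c ^+ i) + c ^+ i * (x - c) by rewrite !exprS; ring.
 by apply: igenD => //; apply: igenM => //; exact: srX.
apply/eqP; rewrite -subr_eq0; apply/eqP; apply: (sfield_m hk kB).
 by apply: (srB ks); [exact: srX|apply: sr_sum => // i _; apply: srM => //; exact: srX].
have -> : c ^+ n - \sum_(i < n) P i * c ^+ i =
 (x ^+ n - \sum_(i < n) P i * x ^+ i) - (x ^+ n - c ^+ n) + \sum_(i < n) P i * (x ^+ i - c ^+ i).
 under [X in _ = _ + X]eq_bigr do rewrite mulrBr.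
 by rewrite sumrB; move: (\sum_(i < n) P i * c ^+ i) (\sum_(i < n) P i * x ^+ i) (x ^+ n) (c ^+ n) => u v w z; ring.
apply: igenD => //; first exact: igenB.
by apply: igen_sum => // i _; apply: igenM => //; exact: kB.
Qed.

(** The residue field is perfect, so the elements having roots of every order [p ^ n] in [B] form a
    coefficient field. A residue is lifted by taking approximate roots and raising them back, which
    converges. *)
Lemma cohen_pchar p : p \in [pchar F] ->
 exists k, [/\ sfield k, forall c, k c -> B c & forall a, B a -> exists2 c, k c & m (a - c)].
move=> cp; have pp := pcharf_prime cp.
pose k x := forall n, exists2 b, B b & x = b ^+ (p ^ n).
have fB n (x y : F) : (x - y) ^+ (p ^ n) = x ^+ (p ^ n) - y ^+ (p ^ n).
 elim: n => [|n ih]; first by rewrite !expr1.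
 by rewrite expnSr !exprM ih (frobB cp).
have kB c : k c -> B c by move=> /(_ 0%N)[b Bb ->].
have pX n x : m x -> Fl n (x ^+ (p ^ n)).
 move=> mx; apply: (ipow_le hB Bg (ltnW (ltn_expl n (prime_gt1 pp)))); exact: ipow_expr.
have km x : k x -> m x -> x = 0.
 move=> kx mx; apply: sep => n; have [b Bb e] := kx n; rewrite e; apply: pX.
 by apply: (m_root (n := p ^ n) Bb); rewrite -e.
exists k; split=> //.
 split; last first.
  move=> x kx n; have [->|x0] := eqVneq x 0.
   exists 0; first exact: sr0.
   by rewrite invr0 expr0n expn_eq0 eqn0Ngt prime_gt0.
  have [b Bb e] := kx n; exists b^-1; last by rewrite e exprVn.
  apply: Bl => // mb; case/eqP: x0; apply: km => //.
  have pn : (0 < p ^ n)%N by rewrite expn_gt0 prime_gt0.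
  rewrite e -(prednK pn).
  by rewrite exprSr; apply: igenM => //; exact: srX.
 split.
 - by move=> n; exists 1; [exact: sr1|rewrite expr1n].
 - by move=> x y kx ky n; have [b Bb ->] := kx n; have [c Bc ->] := ky n; exists (b - c); [exact: srB|rewrite fB].
 - by move=> x y kx ky n; have [b Bb ->] := kx n; have [c Bc ->] := ky n; exists (b * c); [exact: srM|rewrite exprMn].
move=> a Ba.
have step (x : {x | B x}) : {z : {x | B x} | m (sval z ^+ p - sval x)}.
 apply: cid; case: x => x Bx /=.
 have [z Bz hz] := res_closed (P := fun i => if i == 0%N then x else 0) (prime_gt0 pp)
  (fun i => match i with 0%N => Bx | _ => sr0 hB end).
 exists (exist _ z Bz) => /=; move: hz; case: (p) (prime_gt0 pp) => // p' _.
 by rewrite big_ord_recl expr0 mulr1 big1 ?addr0 // => i _; rewrite mul0r.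
pose s := fix s n : {x | B x} := if n is n'.+1 then sval (step (s n')) else exist _ a Ba.
pose b n := sval (s n).
have Bb n : B (b n) by rewrite /b; case: (s n).
have hb n : m (b n.+1 ^+ p - b n) by rewrite /b /=; case: (step (s n)).
have b0 : b 0%N = a by [].
clearbody b.
have lim j : exists d, forall n, Fl n (d - b (n + j)%N ^+ (p ^ n)).
 apply: (limit (c := fun n => b (n + j)%N ^+ (p ^ n))) => n.
 by rewrite expnS exprM -fB addSn; apply: pX.
have [c hc] := lim 0%N.
have Bc : B c by have := hc 0%N; rewrite expn0 expr1 => /= h; rewrite -(subrK (b (0 + 0)%N) c); apply: srD.
exists c; last first.
 have := hc 1%N; rewrite expn1 addn0 => h.
 have -> : a - c = - (b 1%N ^+ p - b 0%N) - (c - b 1%N ^+ p).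
  by rewrite b0; move: (b 1%N ^+ p) => w; ring.
 have := igenN hB (hb 0%N).
 by move=> h'; apply: igenB.
move=> j; have [d hd] := lim j; exists d.
 by have := hd 0%N; rewrite expn0 expr1 => /= h; rewrite -(subrK (b (0 + j)%N) d); apply: srD.
apply/eqP; rewrite -subr_eq0; apply/eqP; apply: sep => n.
have -> : c - d ^+ (p ^ j) = (c - b (n + j)%N ^+ (p ^ (n + j))) - (d ^+ (p ^ j) - b (n + j)%N ^+ (p ^ (n + j))).
 by ring.
apply: FlB; first by have := hc (n + j)%N; rewrite addn0; apply: ipow_le => //; exact: leq_addr.
rewrite expnD exprM -fB; have := hd n; set z := d - _ => hz.
have Bz : B z by exact: ipow_base hz.
have [_ _ hM] := Flid n; have pj : (0 < p ^ j)%N by rewrite expn_gt0 prime_gt0.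
rewrite -(prednK pj).
by rewrite exprSr; apply: hM => //; exact: srX.
Qed.

(** Newton iteration. Gaining one order per step is enough for convergence, so the quadratic rate is
    not recorded. *)
Lemma hensel (P : {poly F}) a : polyB B P -> B a -> m P.[a] -> ~ m P^`().[a] ->
 exists b, [/\ B b, m (a - b) & P.[b] = 0].
move=> PB Ba Pa P'a.
have taylor (Q : {poly F}) x h : polyB B Q -> B x -> B h ->
  exists2 q, B q & Q.[x + h] = Q.[x] + Q^`().[x] * h + h ^+ 2 * q.
 move=> QB Bx Bh; elim/poly_ind: Q QB => [|Q c ih] QB.
  by exists 0; [exact: sr0|rewrite deriv0 !horner0; ring].
 have QB' : polyB B Q by move=> i; have := QB i.+1; rewrite coefD coefMX coefC addr0.
 have [q Bq e] := ih QB'; have BQ' : B Q^`().[x].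
  by apply: polyB_horner => // i; rewrite coef_deriv; apply: sr_muln.
 exists (q * (x + h) + Q^`().[x]); first by apply: srD => //; apply: srM => //; exact: srD.
 by rewrite derivD derivM derivX derivC !hornerE e; ring.
have dB x : B x -> B P^`().[x].
 by move=> Bx; apply: polyB_horner => // i; rewrite coef_deriv; apply: sr_muln.
have cong (Q : {poly F}) x y n : polyB B Q -> B x -> B y -> Fl n (x - y) -> Fl n (Q.[x] - Q.[y]).
 move=> QB Bx By h; have [q qB e] := polyB_factor hB QB By.
 have -> : Q.[x] - Q.[y] = q.[x] * (x - y).
  by rewrite e !hornerE /=; ring.
 by have [_ _ hM] := Flid n; apply: hM => //; exact: polyB_horner.
pose N x := x - P.[x] / P^`().[x].
pose b := fix b n := if n is n'.+1 then N (b n') else a.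
have hb n : [/\ B (b n), m (b n - a), B (P^`().[b n])^-1, P^`().[b n] != 0 & Fl n.+1 P.[b n]].
 have un x : B x -> m (x - a) -> B (P^`().[x])^-1 /\ P^`().[x] != 0.
  move=> Bx hx; have nm : ~ m P^`().[x].
   move=> h; apply: P'a; rewrite -(subKr P^`().[x] P^`().[a]); apply: igenB => //.
   apply: (cong _ _ _ 1%N) => //; by move=> i; rewrite coef_deriv; apply: sr_muln.
  split; first by apply: Bl => //; exact: dB.
  by apply: contra_notN nm => /eqP ->; exact: igen0.
 elim: n => [|n [B1 h1 B2 d0 h2]].
  have h : m (b 0%N - a) by rewrite subrr; exact: igen0.
  by have [] := un _ Ba h; split.
 have BP : B P.[b n] by exact: polyB_horner.
 have hm : m (- (P.[b n] / P^`().[b n])).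
  rewrite -mulNr mulrC; apply: igenM => //; apply: igenN => //.
  exact: (ipow_le hB Bg (n := 1%N) _ h2).
 have Bh := m_B hm.
 have Bn : B (b n.+1) by exact: srD.
 have hn : m (b n.+1 - a).
  have -> : b n.+1 - a = (b n - a) + - (P.[b n] / P^`().[b n]) by rewrite /= /N addrAC.
  exact: igenD.
 have [u1 u2] := un _ Bn hn; split=> //.
 have [q Bq ->] := taylor _ _ _ PB B1 Bh.
 have -> : P.[b n] + P^`().[b n] * - (P.[b n] / P^`().[b n]) = 0 by field.
 rewrite add0r sqrrN mulrC; have [_ _ hM] := Flid n.+2; apply: (hM) => //.
 rewrite exprMn mulrC; apply: (hM); first exact: srX.
 by rewrite expr2 -[n.+2]/(1 + n.+1)%N; apply: ipow_mul => //; exact: (ipow_le hB Bg (n := 1%N) _ h2).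
have [|l hl] := limit (c := b).
 move=> n; have [B1 h1 B2 d0 h2] := hb n.
 rewrite /= /N addrAC subrr add0r -mulNr mulrC; have [_ _ hM] := Flid n; apply: hM => //.
 have [_ _ hM'] := Flid n; rewrite -mulN1r; apply: hM'; first by apply: srN => //; exact: sr1.
 exact: (ipowS hB Bg).
have Bbn n : B (b n) by case: (hb n).
have Bl' : B l by rewrite -(subrK (b 0%N) l); apply: srD => //; exact: (hl 0%N).
exists l; split=> //.
 have -> : a - l = - (b 1%N - a) - (l - b 1%N) by ring.
 by apply: igenB; [|apply: igenN => //; case: (hb 1%N)| exact: (hl 1%N)].
apply: sep => n; have -> : P.[l] = (P.[l] - P.[b n]) + P.[b n] by ring.
have [_ hD _] := Flid n; apply: hD; first exact: cong.
by apply: (ipowS hB Bg); case: (hb n).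
Qed.

(** A maximal subfield [k] of [B] represents all residues. For a residue transcendental over [k],
    any lift generates a larger subfield inside [B]; an algebraic one is separable, and Hensel's
    lemma lifts it to a root of the same equation. *)
Lemma cohen_pchar0 : (forall p, prime p -> ~ m p%:R) ->
 exists k, [/\ sfield k, forall c, k c -> B c & forall a, B a -> exists2 c, k c & m (a - c)].
move=> hp.
have nu n : ~ m n.+1%:R.
 elim/ltn_ind: n => n ih h; case: n ih h => [|n] ih h; first exact: m1.
 have pn : prime (pdiv n.+2) by exact: pdiv_prime.
 have en : n.+2 = (n.+2 %/ pdiv n.+2 * pdiv n.+2)%N by rewrite divnK // pdiv_dvd.
 have q0 : (0 < n.+2 %/ pdiv n.+2)%N by rewrite divn_gt0 ?prime_gt0 // dvdn_leq // pdiv_dvd.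
 have ql : (n.+2 %/ pdiv n.+2 < n.+2)%N by rewrite ltn_Pdiv // prime_gt1.
 move: h; rewrite en natrM; move: (n.+2 %/ pdiv n.+2)%N q0 ql => q q0 ql.
 case/(m_prime (sr_nat hB _) (sr_nat hB _)); last exact: hp.
 by rewrite -(prednK q0); apply: ih; rewrite -ltnS prednK.
have n0 n : n.+1%:R != 0 :> F by apply/eqP => e; apply: (nu n); rewrite e; exact: igen0.
pose Z x := exists a b : nat, x = a%:R - b%:R :> F.
have hZ : subr Z.
 split.
 - by exists 1%N, 0%N; rewrite subr0.
 - by move=> _ _ [a [b ->]] [c [d ->]]; exists (a + d)%N, (b + c)%N; rewrite !natrD; ring.
 - by move=> _ _ [a [b ->]] [c [d ->]]; exists (a * c + b * d)%N, (a * d + b * c)%N; rewrite !natrD !natrM; ring.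
(* Stated under an element of [X], the condition holds for the empty set, as Zorn's lemma requires
   for the empty chain. The rational numbers then show that a maximal [k] is not empty. *)
pose P (X : set F) := forall x, X x -> sfield X /\ forall z, X z -> B z.
have [|k [Pk kmax]] := @Zorn_bigcup F P.
 move=> C CP Ctot x0 [W CW Wx0].
 have top X Y x y : C X -> C Y -> X x -> Y y ->
   exists Z, [/\ C Z, sfield Z, Z x & Z y].
  move=> CX CY Xx Yy; have [hX _] := CP _ CX x Xx; have [hY _] := CP _ CY y Yy.
  by case: (Ctot X Y CX CY) => h; [exists Y | exists X]; split=> //; exact: h.
 have [hW _] := CP _ CW x0 Wx0.
 split; last by move=> z [X CX Xz]; have [_] := CP _ CX z Xz; exact.
 split; last by move=> x [X CX Xx]; exists X => //; have [hX _] := CP _ CX x Xx; exact: sfV.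
 split; first by exists W => //; exact: sr1 (proj1 hW).
 - move=> x y [X CX Xx] [Y CY Yy]; have [Z' [CZ hZ' Zx Zy]] := top X Y x y CX CY Xx Yy.
  by exists Z' => //; exact: (srB (proj1 hZ')).
 - move=> x y [X CX Xx] [Y CY Yy]; have [Z' [CZ hZ' Zx Zy]] := top X Y x y CX CY Xx Yy.
  by exists Z' => //; exact: (srM (proj1 hZ')).
have maxi (K : F -> Prop) : sfield K -> (forall z, K z -> B z) -> (forall z, k z -> K z) -> forall z, K z -> k z.
 move=> hK KB kK z Kz; apply: contrapT => nkz; apply: (kmax K); last by split.
 by split=> // h; apply: nkz; exact: h.
have ZB z : Z z -> B z by move=> [a [b ->]]; apply: srB => //; exact: sr_nat.
have ZV z : Z z -> z != 0 -> B z^-1.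
 have pos n : B (n%:R)^-1.
  case: n => [|n]; first by rewrite invr0; exact: sr0.
  by apply: Bl => //; exact: sr_nat.
 move=> [a [b ->]] _; have [ab|/ltnW ab] := leqP a b.
  by rewrite -opprB invrN -natrB //; apply: srN.
 by rewrite -natrB.
have k1 : k 1.
 have [[x kx]|hno] := pselect (exists x, k x).
  by have [h _] := Pk x kx; exact: sr1 (proj1 h).
 apply: (maxi (frac Z)); first exact: frac_sfield.
 - by move=> _ [a [b [Za Zb b0 ->]]]; apply: srM => //; [exact: ZB|exact: ZV].
 - by move=> z kz; case: hno; exists z.
 - exact: sr1 (proj1 (frac_sfield hZ)).
have [hk kB] := Pk 1 k1; have ks := proj1 hk.
have adj b : B b -> (forall q, polyB k q -> m q.[b] -> q.[b] = 0) -> k b.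
 move=> Bb hb; have bs := adj1_subr b ks.
 apply: (maxi (frac (adj1 k b))); first exact: frac_sfield.
 - have aB z : adj1 k b z -> B z by apply: adj1_min.
  move=> _ [x [y [/aB Bx [q qk ey] y0 ->]]]; apply: srM => //; apply: Bl.
   by rewrite ey; apply: polyB_horner => // i; exact: kB.
  by rewrite ey => /(hb _ qk) h; move: y0; rewrite ey h eqxx.
 - by move=> z kz; apply: frac_base => //; exact: adj1_base.
 - by apply: frac_base => //; exact: adj1_gen.
exists k; split=> // a Ba.
have [[q [qk q0 mq]]|tr] := pselect (exists q, [/\ polyB k q, q != 0 & m q.[a]]); last first.
 exists a; last by rewrite subrr; exact: igen0.
 apply: adj => // q qk mq; have [->|q0] := eqVneq q 0; first by rewrite horner0.
 by case: tr; exists q.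
have ex : exists n, `[< exists q, [/\ polyB k q, q != 0, m q.[a] & size q = n] >].
 by exists (size q); apply/asboolP; exists q.
case: (ex_minnP ex) => n /asboolP[p [pk p0 mp sp]] nmin {q qk q0 mq ex}.
have min q : polyB k q -> m q.[a] -> (size q < n)%N -> q = 0.
 move=> qk mq; apply: contraTeq => q0; rewrite -leqNgt; apply: nmin; apply/asboolP.
 by exists q.
have pB q : polyB k q -> polyB B q by move=> qk i; exact: kB.
have s1 : (1 < size p)%N.
 rewrite ltnNge; apply/negP => s1; have e := size1_polyC s1.
 have mp0 : m p`_0 by move: mp; rewrite e hornerC coefC.
 by case/eqP: p0; rewrite e (sfield_m hk kB (pk 0%N) mp0) polyC0.
have dk : polyB k p^`() by move=> i; rewrite coef_deriv; apply: sr_muln.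
have np' : ~ m p^`().[a].
 move=> h; have sd : (size p^`() < n)%N by rewrite -sp; exact: lt_size_deriv.
 have := congr1 (fun q : {poly F} => q`_(size p).-2) (min _ dk h sd).
 rewrite coef_deriv coef0 => /eqP; rewrite -mulr_natr mulf_eq0 (negbTE (n0 _)) orbF (_ : (size p).-2.+1 = (size p).-1).
  by rewrite -/(lead_coef p) lead_coef_eq0 (negbTE p0).
 by case: (size p) s1 => [|[]].
have [b [Bb ab pb]] := hensel (pB _ pk) Ba mp np'.
exists b => //; apply: adj => // q qk mq.
pose c := lead_coef p.
have c0 : c != 0 by rewrite lead_coef_eq0.
have ck : k c^-1 by apply: sfV => //; exact: pk.
have [|||||r' [rk' sr' er']] := @polyB_reduce F k b (size p).-1 (c^-1 *: p) q ks.
- by move=> i; rewrite coefZ; exact: srM.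
- by rewrite monicE lead_coefZ mulVf.
- by rewrite size_scale ?invr_eq0 // prednK // ltnW.
- by rewrite hornerZ pb mulr0.
- exact: qk.
rewrite -er'; suff -> : r' = 0 by rewrite horner0.
apply: min => //; last by rewrite -sp; apply: leq_ltn_trans sr' _; rewrite prednK // ltnW.
have [s sB es] := polyB_factor hB (pB _ rk') Bb.
rewrite es !hornerE /= er'; apply: igenD => //.
by rewrite mulrC; apply: igenM => //; apply: polyB_horner.
Qed.

Theorem cohen : exists k, [/\ sfield k, forall c, k c -> B c, forall a, B a -> exists2 c, k c & m (a - c) & kclosed k].
suff [k [h1 h2 h3]] : exists k, [/\ sfield k, forall c, k c -> B c & forall a, B a -> exists2 c, k c & m (a - c)].
 by exists k; split=> //; exact: cohen_kclosed.
have [[p [pp mp]]|h] := pselect (exists p, prime p /\ m p%:R); last first.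
 by apply: cohen_pchar0 => p pp mp; apply: h; exists p.
by apply: (@cohen_pchar p); rewrite inE pp (equichar pp mp) eqxx.
Qed.
End Cohen.

Lemma In_cat (T : Type) (s t : seq T) x : List.In x (s ++ t) <-> List.In x s \/ List.In x t.
elim: s => [|y s ih] /=; first by split=> [|[]] //; right.
by rewrite ih or_assoc.
Qed.

(** * Chains of primes and systems of parameters *)

Section PrimeHeights.
Variables (F : fieldType) (B k : F -> Prop) (n0 : nat) (g : 'I_n0 -> F).
Hypotheses (hB : subr B) (hk : sfield k) (kB : forall c, k c -> B c) (Bg : forall i, B (g i)).
Hypotheses (kc : kclosed k) (BN : noeth B).
Local Notation m := (igen B g).
Hypotheses (Bl : forall x, B x -> ~ m x -> B x^-1) (m1 : ~ m 1).
Implicit Types (P Q J : F -> Prop).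

Definition sprime P := [/\ ideal B P, forall x, P x -> B x, ~ P 1 &
 forall x y, B x -> B y -> P (x * y) -> P x \/ P y].

(** A lower bound only: some chain of [n] strict inclusions of primes ends at [P]. *)
Fixpoint height n P : Prop := sprime P /\
 if n is n'.+1 then exists Q, [/\ height n' Q, forall x, Q x -> P x & exists2 x, P x & ~ Q x] else True.

Lemma height_prime n P : height n P -> sprime P. Proof. by case: n => [|n] []. Qed.

(** Noetherian induction: a maximal counterexample is not prime, so it contains a product [a * b]
    without its factors, and the lists for the two larger ideals can be concatenated. *)
Lemma primes_over J : ideal B J -> (forall x, J x -> B x) ->
 exists Qs : seq (F -> Prop), [/\ forall Q, List.In Q Qs -> sprime Q /\ forall x, J x -> Q x,
  forall P, sprime P -> (forall x, J x -> P x) -> exists2 Q, List.In Q Qs & forall x, Q x -> P x &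
  forall x, B x -> (forall Q, List.In Q Qs -> Q x) -> exists n, J (x ^+ n)].
move=> hJ JB; apply: contrapT => hno.
pose good J := exists Qs : seq (F -> Prop), [/\ forall Q, List.In Q Qs -> sprime Q /\ forall x, J x -> Q x,
  forall P, sprime P -> (forall x, J x -> P x) -> exists2 Q, List.In Q Qs & forall x, Q x -> P x &
  forall x, B x -> (forall Q, List.In Q Qs -> Q x) -> exists n, J (x ^+ n)].
have [||I [hI IB nI] Imax] := @noeth_max _ _ BN (fun J => [/\ ideal B J, forall x, J x -> B x & ~ good J]).
- by exists J.
- by move=> J' [].
apply: nI; have [I0 ID IM] := hI.
have [I1|I1] := pselect (I 1).
 exists [::]; split=> //; first by move=> P [_ _ P1 _] IP; case: P1; exact: IP.
 by move=> x Bx _; exists 0%N.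
have [[a [b [Ba Bb Iab na nb]]]|pr] := pselect (exists a b, [/\ B a, B b, I (a * b), ~ I a & ~ I b]); last first.
 have Ip : sprime I.
  split=> // x y Bx By h; apply: contrapT => hn; apply: pr; exists x, y; split=> //.
   by move=> h'; apply: hn; left.
  by move=> h'; apply: hn; right.
 exists [:: I]; split=> [Q [<-|//]|P _ IP|x _ h] //; first by exists I => //; left.
 by exists 1%N; apply: h; left.
pose ext a x := exists z c, [/\ I z, B c & x = z + c * a].
have eid a' : B a' -> ideal B (ext a') /\ forall x, ext a' x -> B x.
 move=> Ba'; split; last by move=> _ [z [c [/IB Bz Bc ->]]]; apply: srD => //; exact: srM.
 split.
 - by exists 0, 0; split; [|exact: sr0|rewrite mul0r addr0].
 - move=> _ _ [z [c [Iz Bc ->]]] [z' [c' [Iz' Bc' ->]]]; exists (z + z'), (c + c').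
  by split; [exact: ID|exact: srD | ring].
 - move=> r _ Br [z [c [Iz Bc ->]]]; exists (r * z), (r * c).
  by split; [exact: IM|exact: srM | ring].
have Ie a' x : I x -> ext a' x by move=> Ix; exists x, 0; split=> //; [exact: sr0|rewrite mul0r addr0].
have ge a' : B a' -> ~ I a' -> good (ext a').
 move=> Ba' nIa; apply: contrapT => ng; have [h1 h2] := eid a' Ba'.
 apply: nIa; apply: (Imax (ext a')); [by split|exact: Ie |].
 by exists 0, 1; split=> //; [exact: sr1|rewrite mul1r add0r].
have [Q1 [p1 c1 r1]] := ge a Ba na; have [Q2 [p2 c2 r2]] := ge b Bb nb.
exists (Q1 ++ Q2); split.
- move=> Q /In_cat[/p1|/p2] [h h']; split=> // x Ix; apply: h'; exact: Ie.
- move=> P Pp IP; have [[P0 PD PM] PB _ Ppr] := Pp; have := Ppr a b Ba Bb (IP _ Iab).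
 case=> h.
  have [|Q hQ QP] := c1 P Pp; last by exists Q => //; apply/In_cat; left.
  by move=> _ [z [c [Iz Bc ->]]]; apply: PD; [exact: IP|exact: PM].
 have [|Q hQ QP] := c2 P Pp; last by exists Q => //; apply/In_cat; right.
 by move=> _ [z [c [Iz Bc ->]]]; apply: PD; [exact: IP|exact: PM].
move=> x Bx hx.
have [|i [z [c [Iz Bc e1]]]] := r1 x Bx; first by move=> Q hQ; apply: hx; apply/In_cat; left.
have [|j [w [d [Iw Bd e2]]]] := r2 x Bx; first by move=> Q hQ; apply: hx; apply/In_cat; right.
exists (i + j)%N; rewrite exprD e1 e2.
have -> : (z + c * a) * (w + d * b) = (w + d * b) * z + (c * a) * w + (c * d) * (a * b) by ring.
apply: (ID); first apply: (ID).
- by apply: IM => //; rewrite -e2; exact: srX.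
- by apply: IM => //; exact: srM.
- by apply: IM => //; exact: srM.
Qed.

(** Each prime excludes at most one constant: two bad constants would put both [y] and [z] in it.
    Hence one constant more than there are primes suffices. *)
Lemma generic_combination (Qs : seq (F -> Prop)) (cs : seq F) y z : uniq cs -> (forall c, c \in cs -> k c) ->
 (size Qs < size cs)%N -> (forall Q, List.In Q Qs -> sprime Q) -> (forall Q, List.In Q Qs -> ~ (Q y /\ Q z)) ->
 B z -> exists2 c, c \in cs & forall Q, List.In Q Qs -> ~ Q (y + c * z).
move=> + + + + + Bz; elim: Qs cs => [|Q Qs ih] cs ucs kcs sz hp hyz.
 by case: cs ucs kcs sz => // c cs _ _ _; exists c; rewrite ?mem_head.
have hp' P : List.In P Qs -> sprime P by move=> h; apply: hp; right.
have hyz' P : List.In P Qs -> ~ (P y /\ P z) by move=> h; apply: hyz; right.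
have [[c0 c0cs Qc0]|nb] := pselect (exists2 c, c \in cs & Q (y + c * z)); last first.
 have [|c ccs hc] := ih cs ucs kcs _ hp' hyz'; first exact: ltnW sz.
 by exists c => // P [<- h|/hc //]; apply: nb; exists c.
have [|||c crem hc] := ih (rem c0 cs) _ _ _ hp' hyz'.
- exact: rem_uniq.
- by move=> c /mem_rem; exact: kcs.
- by rewrite size_rem //; move: sz => /=; case: (size cs).
move: crem; rewrite mem_rem_uniq // inE => /andP[cn ccs]; exists c => // P [<-|/hc //] h.
have [[Q0 QD QM] QB Q1 Qp] := hp Q (or_introl erefl).
have kd : k ((c - c0)^-1) by apply: sfV => //; apply: (srB (proj1 hk)); exact: kcs.
have Qz : Q z.
 have -> : z = (c - c0)^-1 * ((y + c * z) - (y + c0 * z)) by field; rewrite subr_eq0.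
 by apply: (QM); [exact: kB|apply: (idealB hB (And3 Q0 QD QM))].
apply: (hyz Q (or_introl erefl)); split=> //.
have -> : y = (y + c0 * z) - c0 * z by ring.
apply: (idealB hB (And3 Q0 QD QM)) => //; apply: QM => //; apply: kB; exact: kcs.
Qed.

Lemma prime_avoidance (Qs : seq (F -> Prop)) : (forall Q, List.In Q Qs -> sprime Q /\ exists2 z, m z & ~ Q z) ->
 exists2 y, m y & forall Q, List.In Q Qs -> ~ Q y.
elim: Qs => [|Q Qs ih] h; first by exists 0; [exact: igen0 | ].
have [|y my hy] := ih; first by move=> P hP; apply: h; right.
have [_ [z mz nz]] := h Q (or_introl erefl).
have Bz : B z by exact: (ipow_base hB Bg (n := 1%N)).
have [cs [ucs scs kcs]] := kinfinite hk kc (size Qs).+2.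
have [|||c ccs hc] := @generic_combination (Q :: Qs) cs y z ucs kcs _ _ _ Bz.
- by rewrite scs.
- by move=> P /h[].
- by move=> P [<-|/hy hP] [h1 h2]; [exact: nz|exact: hP].
exists (y + c * z) => //; apply: igenD => //; apply: igenM => //; apply: kB; exact: kcs.
Qed.

Lemma m_sprime : sprime m.
have mB x : m x -> B x by exact: (ipow_base hB Bg (n := 1%N)).
split=> //; first exact: (ipow_ideal hB g 1).
move=> x y Bx By h; exact: (m_prime hB Bl Bx By h).
Qed.

Lemma sprime_m P x : sprime P -> P x -> m x.
move=> [[_ _ PM] PB P1 _] Px; apply: contrapT => nm; apply: P1.
have x0 : x != 0 by apply: contra_notN nm => /eqP ->; exact: igen0.
by rewrite -(mulVf x0); apply: PM => //; apply: Bl => //; exact: PB.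
Qed.

(** Unless every prime over [(y)] contains the maximal ideal, prime avoidance finds a new element
    outside those that do not; each prime over the enlarged ideal then lies strictly above one of
    them or contains the maximal ideal. *)
Lemma parameters_step d (y : 'I_d -> F) : (forall i, m (y i)) ->
 (forall P, sprime P -> (forall x, igen B y x -> P x) -> height d P) ->
 (exists N, forall x, ipow B g N x -> igen B y x) \/
 height d.+1 m /\ exists y' : 'I_d.+1 -> F, (forall i, m (y' i)) /\
  forall P, sprime P -> (forall x, igen B y' x -> P x) -> height d.+1 P.
move=> ym hy; have mB x : m x -> B x by exact: (ipow_base hB Bg (n := 1%N)).
have yB x : igen B y x -> B x by apply: (ipow_base hB (fun i => mB _ (ym i)) (n := 1%N)).
have [Qs [Qp Qc Qr]] := primes_over (ipow_ideal hB y 1) yB.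
have [hm|nm] := pselect (forall Q, List.In Q Qs -> forall z, m z -> Q z).
 left; have hn (i : 'I_n0) : {n | igen B y (g i ^+ n)}.
  by apply: cid; apply: Qr => // Q hQ; apply: hm => //; exact: igen_mem.
 pose N := \max_i sval (hn i).
 exists (#|'I_n0| * N).+1; apply: (ipow_absorb hB Bg (ipow_ideal hB y 1)) => i.
 rewrite -(subnK (leq_bigmax i : sval (hn i) <= N)%N) exprD; apply: igenM => //; first exact: srX.
 exact: (svalP (hn i)).
have [Q1 [hQ1 [z1 mz1 nz1]]] : exists Q, List.In Q Qs /\ exists2 z, m z & ~ Q z.
 apply: contrapT => h; apply: nm => Q hQ z mz; apply: contrapT => nz; apply: h.
 by exists Q; split=> //; exists z.
have h1 : height d Q1 by have [h h'] := Qp _ hQ1; exact: hy.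
have below P : (forall x, m x -> P x) -> sprime P -> height d.+1 P.
 move=> mP Pp; split=> //; exists Q1; split=> //; last by exists z1 => //; exact: mP.
 by move=> x /(sprime_m (Qp _ hQ1).1); exact: mP.
right; split; first by apply: below => //; exact: m_sprime.
pose Qs' := List.filter (fun Q => `[< exists2 z, m z & ~ Q z >]) Qs.
have [|y0 my0 hy0] := @prime_avoidance Qs'.
 by move=> Q /List.filter_In[/Qp[h _] /asboolP].
exists (fcons y0 y); split; first exact: fcons_case.
move=> P Pp hP.
have yP x : igen B y x -> P x.
 by move=> hx; apply: hP; apply/igen_fcons; exists 0, x; split=> //; [exact: sr0|rewrite mul0r add0r].
have [Q hQ QP] := Qc P Pp yP.
have [hz|nz] := pselect (exists2 z, m z & ~ Q z); last first.
 apply: below => // x mx; apply: QP; apply: contrapT => h; apply: nz; by exists x.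
split=> //; exists Q; split=> //; first by have [h h'] := Qp _ hQ; exact: hy.
exists y0; last by apply: hy0; apply/List.filter_In; split=> //; exact/asboolP.
by apply: hP; rewrite -{2}(fcons0 y0 y); exact: igen_mem.
Qed.

(** Each step adds a parameter and a link to the chain of primes; the chain cannot exceed length
    [d]. If the process stops early, the list is padded with zeros. *)
Theorem system_of_parameters d : ~ height d.+1 m ->
 exists y : 'I_d -> F, (forall i, m (y i)) /\ exists N, forall x, ipow B g N x -> igen B y x.
move=> hd.
have key i : exists y : 'I_i -> F, (forall j, m (y j)) /\
  ((exists N, forall x, ipow B g N x -> igen B y x) \/
   (forall P, sprime P -> (forall x, igen B y x -> P x) -> height i P)).
 elim: i => [|i [y [ym [[N hN]|hy]]]].
 - by exists (fun=> 0); split; [case|right=> P Pp _; split].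
 - exists (fcons 0 y); split; first by apply: (@fcons_case _ _ 0 y m) => //; exact: igen0.
  left; exists N => x /hN hx; apply/igen_fcons; exists 0, x.
  by split=> //; [exact: sr0|rewrite mul0r add0r].
 have [[N hN]|[_ [y' [y'm hy']]]] := parameters_step ym hy; last by exists y'; split=> //; right.
 exists (fcons 0 y); split; first by apply: (@fcons_case _ _ 0 y m) => //; exact: igen0.
 left; exists N => x /hN hx; apply/igen_fcons; exists 0, x.
 by split=> //; [exact: sr0|rewrite mul0r add0r].
have [y [ym [hN|hy]]] := key d; first by exists y.
by have [hN|[/hd //]] := parameters_step ym hy; exists y.
Qed.

(** Modulo the parameters, every element is a combination of the monomials of degree below [N]; the
    complete Nakayama lemma makes these module generators. *)
Theorem finite_over_parameters d (y : 'I_d -> F) N : base k B g -> (forall i, m (y i)) ->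
 (forall x, ipow B g N x -> igen B y x) ->
 let A := pser k (ipow B g) y in
 [/\ base k A y, forall x, A x -> B x & exists (J : finType) (e : J -> F), (forall j, B (e j)) /\
  forall b, B b -> exists2 a : J -> F, forall j, A (a j) & b = \sum_j a j * e j].
move=> hb ym hN A; have hF := base_filt hb; split.
- by apply: (pser_base hF).
- by move=> x; apply: (pserB_sub hF).
exists ('X_{1..n0 < N} : finType), (fun j : 'X_{1..n0 < N} => mev g j); split; first by move=> j; exact: mev_sr.
apply: (complete_nakayama hF kB ym); first by move=> j; exact: mev_sr.
have hc : clos k B g by case: hb => _ _ _ h _.
move=> b Bb; have [c [kcc hcc]] := expansionP hk hc Bb.
by exists (fun j : 'X_{1..n0 < N} => c j) => [j|]; [exact: kcc|exact: hN].
Qed.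
End PrimeHeights.

(** * Dimension bounds from composite valuations *)

(** A composite valuation. Chevalley's theorem is applied to the localization of [S] at [P] plus the
    maximal ideal of [W1]; putting that ideal into [J] forces the result to lie inside [W1]. *)
Lemma extend_valuation (F : fieldType) (S W1 P : F -> Prop) : subr S -> vring W1 -> (forall x, S x -> W1 x) ->
 sprime S P -> (forall x, S x -> vm W1 x -> P x) ->
 exists W, [/\ vring W, forall x, S x -> W x, forall x, W x -> W1 x & forall x, S x -> (vm W x <-> P x)].
move=> hS hW1 SW1 [[P0 PD PM] PS P1 Pp] hP.
have u1 t : S t -> ~ P t -> W1 t^-1 /\ t != 0.
 move=> St nt; have [h|[t0 _ h]] := vm_or_vu (SW1 _ St); last by split.
 by case: nt; exact: hP.
have dM s t : S s -> S t -> ~ P s -> ~ P t -> ~ P (s * t).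
 by move=> Ss St ns nt /(Pp _ _ Ss St)[].
pose T z := exists s t w, [/\ S s, S t, ~ P t, vm W1 w & z = s / t + w].
pose J z := exists s t w, [/\ P s, S t, ~ P t, vm W1 w & z = s / t + w].
have W1s := proj1 hW1.
have st s t : S s -> S t -> ~ P t -> W1 (s / t).
 by move=> Ss St nt; apply: (srM W1s); [exact: SW1 | case: (u1 t St nt)].
have hT : subr T.
 split.
 - by exists 1, 1, 0; split; [exact: sr1|exact: sr1|exact: P1|left|rewrite divr1 addr0].
 - move=> _ _ [s [t [w [Ss St nt hw ->]]]] [s' [t' [w' [Ss' St' nt' hw' ->]]]].
  have [_ t0] := u1 t St nt; have [_ t0'] := u1 t' St' nt'.
  exists (s * t' - s' * t), (t * t'), (w - w'); split; [|exact: srM|exact: dM|exact: vmB|by field; rewrite t0 t0'].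
  by apply: srB => //; exact: srM.
 - move=> _ _ [s [t [w [Ss St nt hw ->]]]] [s' [t' [w' [Ss' St' nt' hw' ->]]]].
  have [_ t0] := u1 t St nt; have [_ t0'] := u1 t' St' nt'.
  exists (s * s'), (t * t'), (w' * (s / t) + w * (s' / t' + w')).
  split; [exact: srM|exact: srM|exact: dM| |by field; rewrite t0 t0'].
  apply: vmD => //; apply: vmM => //; first exact: st.
  by apply: (srD W1s); [exact: st|exact: vm_V].
have [|||W [hW TW JW]] := @chevalley F T J hT.
- split.
 + by exists 0, 1, 0; split=> //; [exact: sr1|left|rewrite mul0r addr0].
 + move=> _ _ [s [t [w [Ps St nt hw ->]]]] [s' [t' [w' [Ps' St' nt' hw' ->]]]].
  have [_ t0] := u1 t St nt; have [_ t0'] := u1 t' St' nt'.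
  exists (t' * s + t * s'), (t * t'), (w + w'); split; [|exact: srM|exact: dM|exact: vmD|by field; rewrite t0 t0'].
  by apply: PD; exact: PM.
 + move=> _ _ [s [t [w [Ss St nt hw ->]]]] [s' [t' [w' [Ps' St' nt' hw' ->]]]].
  have [_ t0] := u1 t St nt; have [_ t0'] := u1 t' St' nt'.
  exists (s * s'), (t * t'), (w' * (s / t) + w * (s' / t' + w')).
  split; [exact: PM|exact: srM|exact: dM| |by field; rewrite t0 t0'].
  apply: vmD => //; apply: vmM => //; first exact: st.
  by apply: (srD W1s); [apply: st => //; exact: PS|exact: vm_V].
- move=> [s [t [w [Ps St nt hw e]]]]; apply: (nt); have [_ t0] := u1 t St nt.
 rewrite (_ : t = s + (t - s)); last by ring.
 apply: (PD) => //; apply: hP; first by apply: srB => //; exact: PS.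
 have -> : t - s = w * t by rewrite -[t in LHS]mul1r e; field.
 by apply: vmM => //; exact: SW1.
- by move=> _ [s [t [w [Ps St nt hw ->]]]]; exists s, t, w; split=> //; exact: PS.
have SW x : S x -> W x.
 by move=> Sx; apply: TW; exists x, 1, 0; split=> //; [exact: sr1|left|rewrite divr1 addr0].
exists W; split=> // [x Wx|x Sx].
 apply: contrapT => nx; have hx := nV_vm nx.
 have x0 : x != 0 by apply: contra_notN nx => /eqP ->; exact: sr0 W1s.
 have : vm W x^-1 by apply: JW; exists 0, 1, x^-1; split=> //; [exact: sr1|rewrite mul0r add0r].
 by move=> /vm_nV; rewrite invr_eq0 invrK => /(_ x0).
split=> [hx|Px]; last by apply: JW; exists x, 1, 0; split=> //; [exact: sr1|left|rewrite divr1 addr0].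
apply: contrapT => nx; have [_ x0] := u1 x Sx nx; apply: (vm_nV x0 hx).
by apply: TW; exists 1, x, 0; split=> //; [exact: sr1|left|rewrite mul1r addr0].
Qed.

Lemma vind_coarse (F : fieldType) (W W1 : F -> Prop) n (f : 'I_n -> F) :
 (forall x, W x -> W1 x) -> vind W1 f -> vind W f.
Proof. by move=> WW [f0 fi]; split=> // a [h1 h2 h3]; apply: fi; split=> //; exact: WW. Qed.

(** Each strict inclusion contributes an element that is a unit for the coarser ring but not for the
    finer one, hence a value independent of those already found. *)
Lemma height_vind (F : fieldType) (S : F -> Prop) n P : subr S -> height S n P ->
 exists W, exists2 f : 'I_n -> F, vind W f &
  [/\ vring W, forall x, S x -> W x & forall x, S x -> (vm W x <-> P x)].
move=> hS; elim: n P => [|n ih] P [Pp hP].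
 have hT : vring (fun _ : F => True) by split; [split|left].
 have [||W [h1 h2 h3 h4]] := extend_valuation hS hT _ Pp => //.
  by move=> x Sx [->|[]//]; case: Pp => [[]].
 by exists W, (fun=> 1) => //; split=> [[]|a _ []].
case: hP => Q [hQ QP [t Pt nt]]; have [W1 [f fi [hW1 SW1 c1]]] := ih Q hQ.
have [|W [hW SW WW c]] := extend_valuation hS hW1 SW1 Pp; first by move=> x Sx /(c1 _ Sx)/QP.
have St : S t by case: Pp => _ h _ _; exact: h.
have tm : vm W t by apply/(c _ St).
have [t0 tV tV'] : vu W1 t by case: (vm_or_vu (SW1 _ St)) => // /(c1 _ St).
have [f0 fa] := fi.
exists W, (fcons t f) => //; split; first exact: (@fcons_case _ _ t f (fun z => z != 0)).
move=> a; rewrite big_ord_recl fcons0 (eq_bigr (fun i => f i ^ a (lift ord0 i))) => [|i _]; last by rewrite fconsS.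
move=> [h1 h2 h3].
have ha : forall i, a (lift ord0 i) = 0.
 apply: (fa (fun i => a (lift ord0 i))); rewrite mulrC in h1 h2 h3.
 apply: (vu_cancel hW1 (y := t ^ a ord0)); first by apply: vuZ.
 by split=> //; exact: WW.
have a0 : a ord0 = 0.
 have hu : vu W (t ^ a ord0).
  by move: (And3 h1 h2 h3); rewrite big1 ?mulr1 // => i _; rewrite ha expr0z.
 case: (a ord0) hu => [[|q]|q] //; rewrite ?NegzE -?exprnN => hu; exfalso.
  by apply: (vm_nvu (vmX hW q tm)); exact: hu.
 by apply: (vm_nvu (vmX hW q tm)); have := vu_inv hu; rewrite invrK.
by move=> i; case: (unliftP ord0 i) => [j ->|->].
Qed.

(** A longer chain of primes would give a valuation with [r + 1] independent values on an algebraic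
    extension of the fraction field of [A], against Abhyankar's inequality. *)
Lemma height_le_params (F : fieldType) (k A S mS P : F -> Prop) r (y : 'I_r -> F) :
 sfield k -> kclosed k -> base k A y -> (forall x, A x -> S x) -> subr S ->
 (forall x : F, exists2 p, polyB (frac A) p & p != 0 /\ p.[x] = 0) ->
 sprime S mS -> (forall i, mS (y i)) -> (forall x, P x -> mS x) -> ~ height S r.+1 P.
move=> hk kc hb AS hS alg mp my Pm /(height_vind hS)[W1 [f fi [hW1 SW1 c1]]].
have [|W [hW SW WW c]] := extend_valuation hS hW1 SW1 mp; first by move=> x Sx /(c1 _ Sx)/Pm.
have [hA _ Ay _ _] := hb.
have rk : rkle W (frac A) r.
 apply: (abhyankar hW hk kc hb) => [z /AS /SW //|i]; apply/c; [exact: AS|exact: my].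
apply: (rkle_hull hW rk (M := fun=> True) _ (u := f)) => // [x _ x0|]; last exact: vind_coarse fi.
have [p pA [p0 px]] := alg x; exact: (alg_hull hW (frac_sfield hA) pA p0 px x0).
Qed.

(** * Uniqueness of expansions and the primes generated by parameters *)

Section Expansions.
Variables (F : fieldType) (V k S : F -> Prop) (r : nat) (u : 'I_r -> F).
Hypotheses (hV : vring V) (hk : sfield k) (kV : forall c, k c -> V c).
Hypotheses (hS : subr S) (SN : noeth S) (SV : forall x, S x -> V x) (kS : forall c, k c -> S c).
Hypotheses (Sinv : forall x, S x -> vu V x -> S x^-1).
Hypotheses (Su : forall i, S (u i)) (um : forall i, vm V (u i)) (Sc : clos k S u) (hu : vind V u).
Let ks : subr k := proj1 hk.
Local Notation expn := (expansion k S u).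
Let pid n := ipow_ideal hS u n.

Lemma expansionD x y c d : expn x c -> expn y d -> expn (x + y) (fun m => c m + d m).
move=> [kc hx] [kd hy]; split=> [m|n]; first exact: srD.
have -> : x + y - \sum_(m : 'X_{1..r < n}) (c m + d m) * mev u m =
 (x - \sum_(m : 'X_{1..r < n}) c m * mev u m) + (y - \sum_(m : 'X_{1..r < n}) d m * mev u m).
 by under eq_bigr do rewrite mulrDl; rewrite big_split /=; ring.
by case: (pid n) => _ hD _; exact: hD.
Qed.

Lemma expansion_mev m0 : expn (mev u m0) (fun m => (m == m0)%:R).
split=> [m|n]; first exact: sr_nat.
have [m0n|m0n] := ltnP (mdeg m0) n.
 rewrite (bigD1 (BMultinom m0n)) //= eqxx mul1r big1 ?addr0 ?subrr; first by case: (pid n).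
 by move=> m mm0; rewrite (_ : (_ == _) = false) ?mul0r //; apply/negbTE.
rewrite big1 ?subr0 => [|m _]; first exact: ipow_mev.
rewrite (_ : (_ == _) = false) ?mul0r //; apply/eqP => e.
by have := bmdeg m; rewrite e ltnNge m0n.
Qed.

(** If zero had an expansion with a nonzero coefficient at [m1], adding it to the monomial
    [M = m1 + U_(i)] would give an expansion with a term of smaller value than the monomial itself.
    With no variables there is no such [i], whence the separate case. *)
Lemma expansion_uniq c : expn 0 c -> forall m, c m = 0.
move=> hc m1; apply: contrapT => /eqP cm.
have [r0|[i _]] : (r = 0%N) \/ exists i : 'I_r, True.
 by case: (r) => [|r']; [left|right; exists ord0].
 have : ipow S u (mdeg m1).+1 0 by case: (pid (mdeg m1).+1).
 case: hc => kc /(_ (mdeg m1).+1) h _; case/eqP: cm.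
 have em (m : 'X_{1..r}) : m = m1 by apply/mnmP => i; have := ltn_ord i; rewrite {2}r0.
 move: h; rewrite (bigD1 (BMultinom (ltnSn (mdeg m1)))) //= big1 => [|m]; last first.
  by move=> /eqP h; case: h; apply/val_inj; exact: em.
 move=> [b _]; rewrite big1 => [|i _]; last by have := ltn_ord i; rewrite {2}r0.
 rewrite addr0 sub0r => /eqP; rewrite oppr_eq0 mulf_eq0 => /orP[/eqP //|/eqP h].
 by have := mev_n0 m1 hu.1; rewrite h eqxx.
pose M := (m1 + U_(i))%MM; have hM := expansionD (expansion_mev M) hc; rewrite addr0 in hM.
have M0 : mev u M != 0 by apply: mev_n0; case: hu.
have m1M : (m1 == M) = false.
 apply/eqP => /(congr1 mdeg); rewrite mdegD mdeg1; lia.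
have [s [m0 [_ hm0 hmin] _]] := expansion_min hV hk kV hS SN SV kS Sinv Su um hu (mev_sr _ hS Su) M0 hM.
have e0 := vind_neq hu hm0; have := hmin m1; rewrite m1M add0r -e0 => /(_ cm).
have -> : mev u m1 / mev u M = (u i)^-1.
 rewrite /M mevD mevU invfM mulrA divff ?mul1r //; apply: mev_n0; by case: hu.
by apply/vm_nV => //; case: hu.
Qed.

Let T (c : 'X_{1..r} -> F) n : {mpoly F[r]} := \sum_(m : 'X_{1..r < n}) c m *: 'X_[m].

Lemma mcoeff_T c n m : (T c n)@_m = if (mdeg m < n)%N then c m else 0.
rewrite /T raddf_sum /=; case: ltnP => mn.
 rewrite (bigD1 (BMultinom mn)) //= mcoeffZ mcoeffX eqxx mulr1 big1 ?addr0 // => m' hm.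
 rewrite mcoeffZ mcoeffX (_ : (_ == _) = false) ?mulr0 //; exact/negbTE.
rewrite big1 // => m' _; rewrite mcoeffZ mcoeffX (_ : (_ == _) = false) ?mulr0 //.
by apply/eqP => e; have := bmdeg m'; rewrite e ltnNge mn.
Qed.

Lemma meval_T c n : (T c n).@[u] = \sum_(m : 'X_{1..r < n}) c m * mev u m.
Proof. by rewrite /T raddf_sum /=; apply: eq_bigr => m _; rewrite mevalZ mevalX. Qed.

Lemma meval_high n (p : {mpoly F[r]}) : (forall m, k p@_m) -> (forall m, (mdeg m < n)%N -> p@_m = 0) ->
 ipow S u n p.@[u].
move=> kp hp; rewrite mevalE; apply: (ideal_sum _ (pid n)) => m _.
have [mn|mn] := ltnP (mdeg m) n; first by rewrite hp // mul0r; case: (pid n).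
by case: (pid n) => _ _ hM; apply: hM; [exact: kS|exact: (ipow_mev hS Su mn)].
Qed.

(** The Cauchy product, indexed as in [mcoeffM] so that it agrees with products of truncations. *)
Definition conv (c d : 'X_{1..r} -> F) m :=
 \sum_(k : 'X_{1..r < (mdeg m).+1, (mdeg m).+1} | m == (k.1 + k.2)%MM) c k.1 * d k.2.

Lemma expansionM x y c d : S x -> S y -> expn x c -> expn y d -> expn (x * y) (conv c d).
move=> Sx Sy [kc hx] [kd hy]; have kcd m : k (conv c d m) by apply: sr_sum => // i _; exact: srM.
split=> // n; rewrite -meval_T.
have hx' := hx n; have hy' := hy n; rewrite -meval_T in hx'; rewrite -meval_T in hy'.
have kT e m : (forall m, k (e m)) -> k (T e n)@_m by move=> ke; rewrite mcoeff_T; case: ifP => // _; exact: sr0.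
have SX : S (T c n).@[u].
 by rewrite -(subKr x (T c n).@[u]); apply: srB => //; exact: (ipow_base hS Su hx').
have -> : x * y - (T (conv c d) n).@[u] = y * (x - (T c n).@[u]) + (T c n).@[u] * (y - (T d n).@[u])
  + (T c n * T d n - T (conv c d) n).@[u].
 by rewrite mevalB mevalM; ring.
have [_ hD hM] := pid n; apply: (hD); first by apply: (hD); exact: hM.
apply: meval_high => m.
 rewrite mcoeffB; apply: (srB ks); last exact: kT.
 by rewrite mcoeffM; apply: (sr_sum ks) => i _; apply: (srM ks); exact: kT.
move=> mn; rewrite mcoeffB mcoeff_T mn mcoeffM; apply/eqP; rewrite subr_eq0; apply/eqP.
apply: eq_bigr => i _; rewrite !mcoeff_T.
by rewrite !(leq_ltn_trans _ mn) // -ltnS bmdeg.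
Qed.

Definition low i (m : 'X_{1..r}) := forall j : 'I_r, (j < i)%N -> m j = 0%N.

(* The ideal generated by the [u j] with [j < i]. *)
Definition coord_prime i x := S x /\ exists2 c, expn x c & forall m, low i m -> c m = 0.

Lemma coord_primeP i x c : expn x c -> coord_prime i x -> forall m, low i m -> c m = 0.
move=> hx [_ [d hd d0]] m lm.
have hN : expn (- x) (fun m => - d m).
 case: hd => kd hd; split=> [m'|n]; first exact: srN.
 under eq_bigr do rewrite mulNr; rewrite sumrN -opprD -mulN1r.
 by case: (pid n) => _ _ hM; apply: hM => //; apply: srN => //; exact: sr1.
have := expansionD hx hN; rewrite subrr => /expansion_uniq/(_ m).
by rewrite d0 // oppr0 addr0.
Qed.

Lemma min_mnm (Pm : 'X_{1..r} -> Prop) : (exists m, Pm m) -> exists m, Pm m /\ forall m', (m' < m)%O -> ~ Pm m'.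
move=> [m]; elim/(well_founded_ind (@ltom_wf r)): m => m ih Pmm.
have [[m' [h1 h2]]|h] := pselect (exists m', (m' < m)%O /\ Pm m'); first exact: ih h1 h2.
by exists m; split=> // m' h1 h2; apply: h; exists m'.
Qed.

(** For two elements outside, consider the least monomials free of the first [i] parameters in a
    well-founded additive order; at their sum the coefficient of the product is the product of the
    two coefficients. *)
Lemma coord_prime_sprime i : sprime S (coord_prime i).
have E x : S x -> exists c, expn x c := @expansionP _ _ hk _ _ _ Sc x.
split=> [|x []//||x y Sx Sy hxy].
- split.
 + split; first exact: sr0.
  exists (fun=> 0) => //; split=> [m|n]; first exact: sr0.
  by rewrite big1 ?subr0 => [|m _]; [case: (pid n)|rewrite mul0r].
 + move=> x y [Sx [c hc c0]] [Sy [d hd d0]]; split; first exact: srD.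
  by exists (fun m => c m + d m) => [|m lm]; [exact: expansionD|rewrite c0 ?d0 ?addr0].
 + move=> a x Sa [Sx [c hc c0]]; have [d hd] := E a Sa; split; first exact: srM.
  exists (conv d c) => [|m lm]; first exact: expansionM.
  apply: big1 => j /eqP e; rewrite c0 ?mulr0 // => l li.
  have := congr1 (fun m' : 'X_{1..r} => m' l) e; rewrite mnmDE (lm l li) => /esym/eqP.
  by rewrite addn_eq0 => /andP[_ /eqP].
- have := expansion_mev 0%MM; rewrite mev0 => h1 /(coord_primeP h1)/(_ 0%MM).
 by rewrite eqxx => h; have /eqP := h (fun j _ => mnm0E j); rewrite oner_eq0.
apply: contrapT => hno.
have [c hc] := E x Sx; have [d hd] := E y Sy.
have nz z e : S z -> expn z e -> ~ coord_prime i z -> exists m, low i m /\ e m != 0.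
 move=> Sz he nzp; apply: contrapT => h; apply: nzp; split=> //; exists e => // m lm.
 by apply: contrapT => /eqP em; apply: h; exists m.
have [|a [[la ca] amin]] := min_mnm (Pm := fun m => low i m /\ c m != 0).
 by apply: (nz x) => // h; apply: hno; left.
have [|b [[lb db] bmin]] := min_mnm (Pm := fun m => low i m /\ d m != 0).
 by apply: (nz y) => // h; apply: hno; right.
have lab : low i (a + b)%MM by move=> j ji; rewrite mnmDE la ?lb.
have := coord_primeP (expansionM Sx Sy hc hd) hxy lab.
have da : (mdeg a < (mdeg (a + b)%MM).+1)%N by rewrite mdegD ltnS leq_addr.
have db' : (mdeg b < (mdeg (a + b)%MM).+1)%N by rewrite mdegD ltnS leq_addl.
rewrite /conv (bigD1 (BMultinom da, BMultinom db')) //= big1 ?addr0 => [|[p q] /= /andP[/eqP e ne]].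
 by move=> /eqP; rewrite mulf_eq0 (negbTE ca) (negbTE db).
have lpq (j : 'I_r) : (j < i)%N -> (p : 'X_{1..r}) j = 0%N /\ (q : 'X_{1..r}) j = 0%N.
 move=> ji; have := congr1 (fun m' : 'X_{1..r} => m' j) e; rewrite (lab j ji) mnmDE => /esym/eqP.
 by rewrite addn_eq0 => /andP[/eqP -> /eqP ->].
have [cp|cp] := eqVneq (c p) 0; first by rewrite cp mul0r.
have [dq|dq] := eqVneq (d q) 0; first by rewrite dq mulr0.
have ap : (a <= p)%O.
 rewrite leNgt; apply/negP => /amin; apply; split=> // j /lpq[] //.
have bq : (b <= q)%O.
 rewrite leNgt; apply/negP => /bmin; apply; split=> // j /lpq[] //.
case/negP: ne; rewrite -pair_eqE /= -!val_eqE /=.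
move: ap; rewrite le_eqVlt => /orP[/eqP ap|ap]; last first.
 by have := ltmc_le_add ap bq; rewrite -e ltxx.
have bq' : b = q :> 'X_{1..r} by apply/eqP; rewrite -(eqm_add2l a) {2}ap -e.
by rewrite -ap -bq' !eqxx.
Qed.

Lemma coord_prime_height i : (i <= r)%N -> height S i (coord_prime i).
elim: i => [|i ih] ir; split=> //; try exact: coord_prime_sprime.
exists (coord_prime i); split; first by apply: ih; exact: ltnW.
 by move=> x [Sx [c hc c0]]; split=> //; exists c => // m lm; apply: c0 => j ji; apply: lm; exact: ltnW.
have hU := expansion_mev U_(Ordinal ir); exists (mev u U_(Ordinal ir)).
 split; first exact: mev_sr.
 exists (fun m => (m == U_(Ordinal ir)%MM)%:R) => // m lm.
 by case: eqP => // e; have := lm (Ordinal ir) (ltnSn i); rewrite e mnm1E eqxx.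
move=> /(coord_primeP hU)/(_ U_(Ordinal ir)%MM); rewrite eqxx => h.
suff /h/eqP : low i U_(Ordinal ir) by rewrite oner_eq0.
move=> j ji; rewrite mnm1E.
by case: eqP => // e; move: ji; rewrite -e /= ltnn.
Qed.
End Expansions.

(** * Translation between rings and predicates on a field *)

Definition rg (A : comNzRingType) (F : fieldType) (f : A -> F) (x : F) := exists a, x = f a.

Lemma rg_subr (A : comNzRingType) (F : fieldType) (f : {rmorphism A -> F}) : subr (rg f).
split; first by exists 1; rewrite rmorph1.
 by move=> _ _ [a ->] [b ->]; exists (a - b); rewrite rmorphB.
by move=> _ _ [a ->] [b ->]; exists (a * b); rewrite rmorphM.
Qed.

Lemma ideal_gen_igen (A : comNzRingType) (F : fieldType) (f : {rmorphism A -> F}) n (s : 'I_n -> A) a :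
 injective f -> ideal_gen (range s) a <-> igen (rg f) (fun i => f (s i)) (f a).
move=> fi; split=> [h|[b hb e]].
 have hB := rg_subr f; apply: (h (fun a => igen (rg f) (fun i => f (s i)) (f a))).
  split; first by rewrite rmorph0; exact: igen0.
   by move=> x y hx hy; rewrite rmorphD; exact: igenD.
  by move=> c x hx; rewrite rmorphM; apply: igenM => //; exists c.
 by move=> _ [i _ <-]; exact: (igen_mem hB (fun i => f (s i)) i).
have hc i : {c | b i = f c} by apply: cid; exact: hb.
have -> : a = \sum_i sval (hc i) * s i.
 apply: fi; rewrite e rmorph_sum; apply: eq_bigr => i _.
 by rewrite rmorphM -(svalP (hc i)).
move=> J [J0 JD JM] sJ; elim/big_rec: _ => // i y _ hy; apply: JD => //; apply: JM; apply: sJ; by exists i.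
Qed.

Lemma noeth_rg (A : comNzRingType) (F : fieldType) (f : {rmorphism A -> F}) :
 injective f -> noetherian A -> noeth (rg f).
move=> fi hN J [J0 JD JM] JB.
have [|n [s es]] := hN (fun a => J (f a)).
 split; first by rewrite rmorph0.
  by move=> x y hx hy; rewrite rmorphD; exact: JD.
 by move=> c x hx; rewrite rmorphM; apply: JM => //; exists c.
have sJ i : J (f (s i)).
 have : ideal_gen (range s) (s i) by move=> I hI; apply; exists i.
 by rewrite -es.
exists [seq f (s i) | i : 'I_n]; split; first by move=> _ /mapP[i _ ->].
move=> x Jx; have [a ea] := JB x Jx; rewrite ea in Jx *.
have : ideal_gen (range s) a by rewrite -es.
move=> /(ideal_gen_igen _ _ fi)[b hb ->]; have hB := rg_subr f.
apply: lin_sum => // i _; apply: linM => //; apply: lin_mem => //.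
by apply/mapP; exists i => //; rewrite mem_enum.
Qed.

Lemma noetherian_rg (A : comNzRingType) (F : fieldType) (f : {rmorphism A -> F}) :
 injective f -> noeth (rg f) -> noetherian A.
move=> fi hN J [J0 JD JM]; have hB := rg_subr f.
have [||t [tJ ht]] := hN (fun x => exists2 a, J a & x = f a).
- split; first by exists 0; rewrite ?rmorph0.
  by move=> _ _ [a Ja ->] [b Jb ->]; exists (a + b); [exact: JD|rewrite rmorphD].
 by move=> _ _ [c ->] [a Ja ->]; exists (c * a); [exact: JM|rewrite rmorphM].
- by move=> _ [a _ ->]; exists a.
have ht' (i : 'I_(size t)) : {a | J a & f a = t`_i}.
 have [|a Ja ->] := cid2 (tJ t`_i _); last by exists a.
 by rewrite mem_nth.
pose s i := s2val (ht' i).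
exists (size t), s; rewrite predeqE => a; split=> [Ja|h].
 apply/(ideal_gen_igen _ _ fi).
 have : lin (rg f) t (f a) by apply: ht; exists a.
 apply: lin_min; first exact: (ipow_ideal hB (fun i => f (s i)) 1).
 move=> y /(nthP 0)[i si <-]; rewrite -[i]/(nat_of_ord (Ordinal si)) -(s2valP' (ht' (Ordinal si))).
 exact: (igen_mem hB (fun i => f (s i)) (Ordinal si)).
apply: h; first by split.
move=> _ [i _ <-]; exact: (s2valP (ht' i)).
Qed.

Lemma height_chain (A : comNzRingType) (F : fieldType) (f : {rmorphism A -> F}) n P :
 height (rg f) n P -> has_prime_chain A n.
have pr Q : sprime (rg f) Q -> prime_ideal (fun a => Q (f a)).
 move=> [[Q0 QD QM] QB Q1 Qp]; split.
 - split; first by rewrite rmorph0.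
   by move=> x y hx hy; rewrite rmorphD; exact: QD.
  by move=> c x hx; rewrite rmorphM; apply: QM => //; exists c.
 - by rewrite rmorph1.
 - by move=> x y; rewrite rmorphM; apply: Qp; [exists x | exists y].
move=> hP; suff [Qs [h1 h2 _]] : exists Qs : nat -> A -> Prop, [/\ forall i, (i <= n)%N -> prime_ideal (Qs i),
  forall i, (i < n)%N -> (Qs i `<` Qs i.+1)%classic & Qs n = (fun a => P (f a))] by exists Qs.
elim: n P hP => [|n ih] P [Pp hP].
 by exists (fun _ a => P (f a)); split=> // i _; exact: pr.
have [Q [hQ QP [x Px nx]]] := hP; have [Qs [h1 h2 h3]] := ih Q hQ.
exists (fun i => if (i <= n)%N then Qs i else (fun a => P (f a))); split.
- by move=> i _; case: ifP => [/h1 //|_]; exact: pr.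
- move=> i; rewrite ltnS => le_in; rewrite le_in; case: ltnP => [/h2 //|ni].
 have -> : i = n by apply/eqP; rewrite eqn_leq le_in.
 rewrite h3; split=> [a /QP //|h]; have [_ PB _ _] := Pp; have [a ea] := PB x Px.
 by apply: nx; rewrite ea; apply: h; rewrite -ea.
- by rewrite ltnn.
Qed.

Lemma chain_height (A : comNzRingType) (F : fieldType) (f : {rmorphism A -> F}) n :
 injective f -> has_prime_chain A n -> exists P, height (rg f) n P.
move=> fi [Ps [h1 h2]]; pose P i x := exists2 a, Ps i a & x = f a.
have pr i : (i <= n)%N -> sprime (rg f) (P i).
 move=> /h1[[P0 PD PM] P1 Pp]; split.
 - split; first by exists 0; rewrite ?rmorph0.
   by move=> _ _ [a Pa ->] [b Pb ->]; exists (a + b); [exact: PD|rewrite rmorphD].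
  by move=> _ _ [c ->] [a Pa ->]; exists (c * a); [exact: PM|rewrite rmorphM].
 - by move=> _ [a _ ->]; exists a.
 - by move=> [a Pa e]; apply: P1; rewrite (_ : 1 = a) //; apply: fi; rewrite rmorph1.
 - move=> _ _ [a ->] [b ->] [c Pc]; rewrite -rmorphM => /fi e; rewrite -e in Pc.
  by case: (Pp _ _ Pc) => h; [left; exists a|right; exists b].
suff h i : (i <= n)%N -> height (rg f) i (P i) by exists (P n); exact: h.
elim: i => [|i ih] hi; first by split=> //; exact: pr.
split; first exact: pr.
have [s1 s2] := h2 i hi; exists (P i); split; first by apply: ih; exact: ltnW.
 by move=> _ [a Pa ->]; exists a => //; exact: s1.
have [a [Pa na]] : exists a, Ps i.+1 a /\ ~ Ps i a.
 by apply: contrapT => h; apply: s2 => a Pa; apply: contrapT => na; apply: h; exists a.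
by exists (f a); [exists a|move=> [b Pb /fi e]; apply: na; rewrite e].
Qed.

Lemma ideal_pow_mul (A : comNzRingType) (I : A -> Prop) n a b :
 ideal_pow I n a -> I b -> ideal_pow I n.+1 (a * b).
move=> ha Ib; have hI := ideal_pow_ideal I n.+1; case: (hI) => h0 hD hM.
apply: (ha (fun a => ideal_pow I n.+1 (a * b))).
 split; first by rewrite mul0r.
  by move=> x y hx hy; rewrite mulrDl; exact: hD.
 by move=> c x hx; rewrite -mulrA; exact: hM.
move=> _ [s sI ->] J hJ; apply; exists (fun i => if unlift ord_max i is Some j then s j else b).
 by move=> i; case: unlift.
rewrite big_ord_recr /= unlift_none; congr (_ * b); apply: eq_bigr => i _.
have -> : widen_ord (leqnSn n) i = lift ord_max i.
 by apply: val_inj; rewrite /= /bump leqNgt ltn_ord.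
by rewrite liftK.
Qed.

Lemma ideal_pow_ipow (A : comNzRingType) (F : fieldType) (f : {rmorphism A -> F}) n0 (s : 'I_n0 -> A)
  (I : A -> Prop) n a : injective f -> (forall a, I a <-> igen (rg f) (fun i => f (s i)) (f a)) ->
 ideal_pow I n a <-> ipow (rg f) (fun i => f (s i)) n (f a).
move=> fi hI; have hB := rg_subr f; split.
 move=> h; apply: (h (fun a => ipow (rg f) (fun i => f (s i)) n (f a))).
  have [h0 hD hM] := ipow_ideal hB (fun i => f (s i)) n.
  split; first by rewrite rmorph0.
   by move=> x y hx hy; rewrite rmorphD; exact: hD.
  by move=> c x hx; rewrite rmorphM; apply: hM => //; exists c.
 move=> _ [t tI ->]; rewrite rmorph_prod; elim: n t tI {h} => [|n ih] t tI.
  by rewrite big_ord0; exact: sr1.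
 by rewrite big_ord_recl -[n.+1]/(1 + n)%N; apply: ipow_mul => //; [apply/hI|apply: ih].
elim: n a => [|n ih] a.
 move=> _ J [J0 JD JM] hJ; rewrite -[a]mulr1; apply: JM; apply: hJ.
 by exists (fun _ => 0); [case|rewrite big_ord0].
move=> [b hb e].
have hc i : {c | b i = f c}.
 by apply: cid; have := hb i; apply: (ipow_base hB) => j; exists (s j).
have -> : a = \sum_i sval (hc i) * s i.
 apply: fi; rewrite e rmorph_sum; apply: eq_bigr => i _.
 by rewrite rmorphM -(svalP (hc i)).
have [h0 hD hM] := ideal_pow_ideal I n.+1; elim/big_rec: _ => // i y _ hy; apply: hD => //.
apply: ideal_pow_mul; first by apply: ih; rewrite -(svalP (hc i)); exact: hb.
by apply/hI; exact: (igen_mem hB (fun i => f (s i)) i).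
Qed.

(** Partial sums of a series whose terms lie in growing powers form a Cauchy sequence; comparing
    with a later index shows that the limit approximates each partial sum to the exact order. *)
Lemma complete_rg (A : comNzRingType) (F : fieldType) (f : {rmorphism A -> F}) n0 (s : 'I_n0 -> A)
  (I : A -> Prop) : injective f -> (forall a, I a <-> igen (rg f) (fun i => f (s i)) (f a)) ->
 adic_complete I ->
 (forall x, (forall n, ipow (rg f) (fun i => f (s i)) n x) -> x = 0) /\
 (forall t : nat -> F, (forall n, ipow (rg f) (fun i => f (s i)) n (t n)) ->
   exists l, forall n, ipow (rg f) (fun i => f (s i)) n (l - \sum_(i < n) t i)).
move=> fi hI [sep com]; have hp n a := @ideal_pow_ipow A F f n0 s I n a fi hI.
split=> [x hx|t ht].
 have [a ea] := hx 0%N; rewrite ea in hx *.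
 by rewrite (sep a) ?rmorph0 // => n; apply/hp.
have hB := rg_subr f; have sB j : rg f (f (s j)) by exists (s j).
have hc i : {c | t i = f c} by apply: cid; exact: (ipow_base hB sB (ht i)).
pose c i := sval (hc i); have ec i : t i = f (c i) by exact: (svalP (hc i)).
have cI i : ideal_pow I i (c i) by apply/hp; rewrite -ec.
have mono i j a : (i <= j)%N -> ideal_pow I j a -> ideal_pow I i a.
 by move=> ij /hp h; apply/hp; exact: (ipow_le hB sB ij).
have tail n N : (n <= N)%N -> ideal_pow I n (\sum_(i < N) c i - \sum_(i < n) c i).
 move=> nN; have [h0 hD _] := ideal_pow_ideal I n.
 rewrite -(subnK nN) addnC big_split_ord /= addrAC subrr add0r.
 by elim/big_rec: _ => // i y _ hy; apply: hD => //; apply: mono (cI _); exact: leq_addr.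
have [k|l hl] := com (fun n => \sum_(i < n) c i).
 exists k => i j ki kj.
 have -> : \sum_(x < i) c x - \sum_(x < j) c x = (\sum_(x < i) c x - \sum_(x < k) c x) - (\sum_(x < j) c x - \sum_(x < k) c x) by ring.
 by apply: (ideal_subr (ideal_pow_ideal I k)); exact: tail.
exists (f l) => n.
have -> : f l - \sum_(i < n) t i = f (l - \sum_(i < n) c i).
 by rewrite rmorphB rmorph_sum; congr (_ - _); apply: eq_bigr => i _.
apply/hp; have [N hN] := hl n.
have -> : l - \sum_(i < n) c i = (\sum_(i < maxn n N) c i - \sum_(i < n) c i) - (\sum_(i < maxn n N) c i - l) by ring.
apply: (ideal_subr (ideal_pow_ideal I n)); first by apply: tail; exact: leq_maxl.
by apply: hN; exact: leq_maxr.
Qed.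

(** * Residue field and completion of a local ring *)

Lemma residue_eq (A : comNzRingType) (hA : local_ring A) (a b : A) :
 residue hA a = residue hA b <-> max_ideal A (a - b).
have := Quotient.idealrBE (max_ideal_pred hA) a b; rewrite /residue => h.
split=> [e|hm]; first by move: h; rewrite e eqxx => /asboolP.
by apply/eqP; rewrite -h; exact/asboolP.
Qed.

Lemma residue_morph (A : comNzRingType) (hA : local_ring A) :
 exists f : {rmorphism A -> residue_field hA}, forall a, f a = residue hA a.
by exists (\pi_{ideal_quot (max_ideal_pred hA)}%qT : {rmorphism A -> residue_field hA}).
Qed.

Lemma residue_surj (A : comNzRingType) (hA : local_ring A) (x : residue_field hA) :
 exists a, residue hA a = x.
by exists (generic_quotient.repr (x : {ideal_quot (max_ideal_pred hA)})); rewrite /residue reprK.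
Qed.

Lemma residue_closed (A : comNzRingType) (hA : local_ring A) :
 GRing.closed_field_axiom (residue_field hA) -> forall n (P : nat -> A), (0 < n)%N ->
 exists x, max_ideal A (x ^+ n - \sum_(i < n) P i * x ^+ i).
move=> kcl n P n0; have [f hf] := residue_morph hA.
have [x hx] := kcl n (fun i => f (P i)) n0; have [a ea] := residue_surj x.
exists a; apply/(residue_eq hA); rewrite -!hf rmorphXn rmorph_sum /= hf ea hx.
by apply: eq_bigr => i _; rewrite rmorphM rmorphXn /= (hf a) ea.
Qed.

Lemma residue_char (A : comNzRingType) (hA : local_ring A) : [pchar A] =i [pchar (residue_field hA)] ->
 forall p, prime p -> max_ideal A p%:R -> p%:R = 0 :> A.
move=> hp p pp mp; have [f hf] := residue_morph hA.
have : p \in [pchar (residue_field hA)].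
 rewrite inE pp /= -(rmorph_nat f) hf -(rmorph0 f) hf; apply/eqP/residue_eq.
 by rewrite subr0.
by rewrite -hp => /pcharf0.
Qed.

Definition cpi (A : comNzRingType) (hA : local_ring A) (s : cauchy_seq hA) : completion hA :=
 \pi_{ideal_quot (@null_seq_pred A hA)}%qT s.

Lemma cpi_morph (A : comNzRingType) (hA : local_ring A) :
 exists f : {rmorphism cauchy_seq hA -> completion hA}, forall s, f s = cpi s.
by exists (\pi_{ideal_quot (@null_seq_pred A hA)}%qT : {rmorphism cauchy_seq hA -> completion hA}).
Qed.

Lemma cpi_surj (A : comNzRingType) (hA : local_ring A) (z : completion hA) : exists s, cpi s = z.
by exists (generic_quotient.repr (z : {ideal_quot (@null_seq_pred A hA)})); rewrite /cpi reprK.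
Qed.

Lemma cpi_eq (A : comNzRingType) (hA : local_ring A) (s t : cauchy_seq hA) :
 cpi s = cpi t <-> adic_cvg (max_ideal A) (val (s - t)) 0.
have := Quotient.idealrBE (@null_seq_pred A hA) s t; rewrite /cpi => h.
split=> [e|hm]; first by move: h; rewrite e eqxx => /asboolP.
by apply/eqP; rewrite -h; exact/asboolP.
Qed.

(** A Cauchy sequence is either eventually in the maximal ideal or eventually made of units; in the
    latter case the termwise inverses are again Cauchy. *)
Lemma max_completion (A : comNzRingType) (hA : local_ring A) (s : cauchy_seq hA) :
 max_ideal (completion hA) (cpi s) <-> exists N, forall n, (N <= n)%N -> max_ideal A (val s n).
have [f hf] := cpi_morph hA; have /asboolP cs := valP s.
split=> [h|[N hN] [w]]; last first.
 have [t <-] := cpi_surj w; rewrite -!hf -rmorphM -(rmorph1 f) !hf => /cpi_eq/(_ 1%N)[M hM].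
 have := hM _ (leq_maxr N M); rewrite subr0 => /(ideal_pow1_sub hA) h1.
 have h2 := hN _ (leq_maxl N M).
 apply: (@max_ideal1 A); set n := maxn N M in h1 h2.
 have -> : 1 = val t n * val s n - val (s * t - 1) n.
  have -> : val (s * t - 1) n = val s n * val t n - 1 by [].
  by rewrite mulrC; ring.
 by apply: (ideal_subr hA) => //; have [_ _ hA3] := hA; exact: hA3.
have [N hN] := cs 1%N; apply: contrapT => hno.
have nm n : (N <= n)%N -> ~ max_ideal A (val s n).
 move=> Nn mn; apply: hno; exists N => i Ni.
 have -> : val s i = val s n + (val s i - val s n) by ring.
 by have [_ hD _] := hA; apply: hD => //; apply: (ideal_pow1_sub hA); exact: hN.
have inv n : {y | (N <= n)%N -> val s n * y = 1}.
 apply: cid; have [Nn|_] := leqP N n; last by exists 0.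
 by have /contrapT[y e] := nm n Nn; exists y.
pose t n := sval (inv n); have ht n : (N <= n)%N -> val s n * t n = 1 by exact: (svalP (inv n)).
have ct : t \in cauchy_seq_pred hA.
 apply/asboolP => k; have [M hM] := cs k; exists (maxn N M) => i j.
 rewrite !geq_max => /andP[Ni Mi] /andP[Nj Mj].
 have -> : t i - t j = (t i * t j) * (val s j - val s i).
  have -> : (t i * t j) * (val s j - val s i) = t i * (val s j * t j) - (val s i * t i) * t j by ring.
  by rewrite !ht // mulr1 mul1r.
 by case: (ideal_pow_ideal (max_ideal A) k) => _ _; apply; exact: hM.
apply: h; exists (cpi (Sub t ct : cauchy_seq hA)).
rewrite -!hf -rmorphM -(rmorph1 f) !hf; apply/cpi_eq => k; exists N => n Nn.
have -> : val (s * (Sub t ct : cauchy_seq hA) - 1) n = val s n * t n - 1 by [].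
by rewrite ht // subrr subr0; case: (ideal_pow_ideal (max_ideal A) k).
Qed.

Lemma to_completion_morph (A : comNzRingType) (hA : local_ring A) :
 exists f : {rmorphism A -> completion hA}, forall a, f a = to_completion hA a.
have [g hg] := cpi_morph hA.
pose c a : cauchy_seq hA := Sub (fun=> a) (const_cauchy hA a).
have cB : zmod_morphism c by move=> a b; apply: val_inj.
have cM : monoid_morphism c by split=> [|a b]; apply: val_inj.
pose mB := GRing.isZmodMorphism.Build _ _ c cB; pose mM := GRing.isMonoidMorphism.Build _ _ c cM.
pose cR : {rmorphism A -> cauchy_seq hA} := HB.pack c mB mM.
by exists (g \o cR : {rmorphism A -> completion hA}) => a; rewrite /= hg.
Qed.

Lemma max_to_completion (A : comNzRingType) (hA : local_ring A) a :
 max_ideal (completion hA) (to_completion hA a) <-> max_ideal A a.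
have h := max_completion (Sub (fun=> a) (const_cauchy hA a) : cauchy_seq hA).
split=> [/h[N /(_ N (leqnn N))] //|ma]; apply/h; by exists 0%N.
Qed.

(** A coefficient field of the local ring also serves its completion: modulo the maximal ideal a
    Cauchy sequence is eventually constant. *)
Lemma representatives_of_subfield (A : comNzRingType) (hA : local_ring A) (k : A -> Prop) :
 k 1 -> (forall c d, k c -> k d -> k (c - d) /\ k (c * d)) ->
 (forall c, k c -> c != 0 -> exists2 c', k c' & c * c' = 1) ->
 (forall a, exists2 c, k c & max_ideal A (a - c)) ->
 field_of_representatives (fun z => exists2 c, k c & z = to_completion hA c).
move=> k1 kBM kV kr; have [f hf] := to_completion_morph hA; have [g hg] := cpi_morph hA.
split.
- by exists 1 => //; rewrite -hf rmorph1.
- move=> _ _ [c kc ->] [d kd ->]; have [h1 h2] := kBM c d kc kd.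
 by split; [exists (c - d) | exists (c * d)] => //; rewrite -!hf ?rmorphB ?rmorphM.
- move=> _ [c kc ->] c0; have [|c' kc' e] := kV c kc.
  by apply: contraNneq c0 => ->; rewrite -hf rmorph0.
 by exists (to_completion hA c'); [exists c'|rewrite -!hf -rmorphM e rmorph1].
move=> z; have [s <-] := cpi_surj z; have /asboolP cs := valP s; have [N hN] := cs 1%N.
have [c kc hc] := kr (val s N).
have key a : max_ideal (completion hA) (cpi s - to_completion hA a) <->
  exists N, forall n, (N <= n)%N -> max_ideal A (val s n - a).
 rewrite /to_completion -/(cpi _) -!hg -rmorphB hg; exact: max_completion.
exists (to_completion hA c); split.
 split; first by exists c.
 apply/key; exists N => n Nn; have -> : val s n - c = (val s n - val s N) + (val s N - c) by ring.
 by have [_ hD _] := hA; apply: hD => //; apply: (ideal_pow1_sub hA); exact: hN.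
move=> _ [[d kd ->] /key[M hM]]; congr to_completion; apply/eqP; rewrite -subr_eq0.
apply: contrapT => /negP cd; have [h1 _] := kBM c d kc kd; have [y _ e] := kV _ h1 cd.
have md := hM _ (leq_maxr N M).
have mc : max_ideal A (val s (maxn N M) - c).
 have -> : val s (maxn N M) - c = (val s (maxn N M) - val s N) + (val s N - c) by ring.
 by have [_ hD _] := hA; apply: hD => //; apply: (ideal_pow1_sub hA); apply: hN => //; exact: leq_maxl.
have := ideal_subr hA md mc; rewrite (_ : _ - d - _ = c - d); last by ring.
by apply; exists y.
Qed.

Lemma ideal_pow_completion (A : comNzRingType) (hA : local_ring A) n a :
 ideal_pow (max_ideal A) n a -> ideal_pow (max_ideal (completion hA)) n (to_completion hA a).
move=> h; have [f hf] := to_completion_morph hA; rewrite -hf.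
have [h0 hD hM] := ideal_pow_ideal (max_ideal (completion hA)) n.
apply: (h (fun a => ideal_pow (max_ideal (completion hA)) n (f a))).
 split; first by rewrite rmorph0.
  by move=> x y hx hy; rewrite rmorphD; exact: hD.
 by move=> c x hx; rewrite rmorphM; exact: hM.
move=> _ [s sm ->] J hJ; apply; exists (fun i => f (s i)); last by rewrite rmorph_prod.
by move=> i; rewrite hf; apply/max_to_completion.
Qed.

(** * From the given valuation to the regular local ring *)

Lemma tr_deg_setT (L : fieldType) t : tr_deg (setT : set L) t -> t = 0%N.
case: t => // t [[y hy] _]; pose P : {mpoly L[t.+1]} := 'X_ord0 - (y ord0)%:MP.
have : P = 0 by apply: hy => //; rewrite /P mevalB mevalXU mevalC subrr.
move=> /(congr1 (fun p : {mpoly L[t.+1]} => p@_U_(ord0))).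
rewrite /P mcoeffB mcoeffX eqxx mcoeffC mcoeff0 (_ : (U_(ord0)%MM == 0%MM) = false) ?mulr0 ?subr0.
 by move/eqP; rewrite oner_eq0.
by apply/eqP => /(congr1 mdeg); rewrite mdeg1 mdeg0.
Qed.

Lemma adjoin_facts (R : idomainType) n (x : 'I_n -> {fraction R}) :
 [/\ subr (adjoin x), forall a, adjoin x (tofrac a) & forall i, adjoin x (x i)].
split; last 2 first.
- by move=> a; exists a%:MP; rewrite mmapC.
- by move=> i; exists 'X_i; rewrite mmapX mmap1U.
split; first by exists 1; rewrite rmorph1.
 by move=> _ _ [p ->] [q ->]; exists (p - q); rewrite rmorphB.
by move=> _ _ [p ->] [q ->]; exists (p * q); rewrite rmorphM.
Qed.

Definition vset (K : fieldType) (Phi : orderedZmodType) (v : valuation K Phi) (x : K) : Prop :=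
 x \in valuation_ring_pred v.

Lemma valuationV (K : fieldType) (Phi : orderedZmodType) (v : valuation K Phi) x : x != 0 -> v x^-1 = - v x.
by move=> x0; apply: (addrI (v x)); rewrite subrr -valuationM ?invr_eq0 // divff // valuation1.
Qed.

Lemma vset_ge0 (K : fieldType) (Phi : orderedZmodType) (v : valuation K Phi) x : x != 0 ->
 vset v x <-> 0 <= v x.
by move=> x0; rewrite /vset inE (negbTE x0).
Qed.

Lemma ordered_oppr_ge0 (Phi : orderedZmodType) (a : Phi) : (0 <= - a) = (a <= 0).
apply/idP/idP => h; first by have := ordered_lerD2l a _ _ h; rewrite addr0 subrr.
by have := ordered_lerD2l (- a) _ _ h; rewrite addNr addr0.
Qed.

Lemma vset_vring (K : fieldType) (Phi : orderedZmodType) (v : valuation K Phi) : vring (vset v).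
have [h1 hB hM] := valuation_ring_subring v; split; first by split.
move=> x; have [->|x0] := eqVneq x 0; first by left; rewrite /vset inE eqxx.
have [h|h] := orP (ordered_le_total 0 (v x)); first by left; apply/vset_ge0.
by right; apply/vset_ge0; rewrite ?invr_eq0 // valuationV // ordered_oppr_ge0.
Qed.

Lemma vset_vu (K : fieldType) (Phi : orderedZmodType) (v : valuation K Phi) x :
 vu (vset v) x -> x != 0 /\ v x = 0.
move=> [x0 /(vset_ge0 v x0) h1 h2]; split=> //; apply/eqP; rewrite eq_le h1 andbT -ordered_oppr_ge0.
by rewrite -valuationV //; apply/vset_ge0; rewrite ?invr_eq0.
Qed.

Lemma vset_max (K : fieldType) (Phi : orderedZmodType) (v : valuation K Phi) (b : valuation_ring v) :
 max_ideal (valuation_ring v) b <-> vm (vset v) (val b).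
split=> [h|[b0|h] [y /(congr1 val)]].
- have [b0|b0] := eqVneq (val b) 0; [by left|right => hV; apply: h].
 by exists (Sub (val b)^-1 hV : valuation_ring v); apply: val_inj; rewrite subring_valM /= divff.
- by rewrite subring_valM b0 mul0r subring_val1 => /eqP; rewrite eq_sym oner_eq0.
rewrite subring_valM subring_val1 => e; apply: h.
have b0 : val b != 0 by apply: contra_eq_neq e => ->; rewrite mul0r eq_sym oner_eq0.
have -> : (val b)^-1 = val y by rewrite -[LHS]mulr1 -e mulKf.
exact: (valP y).
Qed.

Lemma valuation_exprz (K : fieldType) (Phi : orderedZmodType) (v : valuation K Phi) x (a : int) :
 x != 0 -> v (x ^ a) = v x *~ a.
move=> x0; have X n : v (x ^+ n) = v x *+ n.
 elim: n => [|n ih]; first by rewrite expr0 valuation1 mulr0n.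
 by rewrite exprS mulrS valuationM ?expf_neq0 // ih.
case: a => n; first by rewrite -exprnP X pmulrn.
by rewrite NegzE -exprnN valuationV ?expf_neq0 // X mulrNz pmulrn.
Qed.

Lemma vind_valuation (K : fieldType) (Phi : orderedZmodType) (v : valuation K Phi) r (f : 'I_r -> K) :
 (forall i, f i != 0) -> (forall c : 'I_r -> int, \sum_i v (f i) *~ c i = 0 -> forall i, c i = 0) ->
 vind (vset v) f.
move=> f0 fi; split=> // a /vset_vu[_ e].
suff [_ h] : \prod_i f i ^ a i != 0 /\ v (\prod_i f i ^ a i) = \sum_i v (f i) *~ a i.
 by apply: fi; rewrite -h e.
elim/big_rec2: _ => [|i s y _ [y0 e']]; first by rewrite oner_eq0 valuation1.
have fi0 : f i ^ a i != 0 by apply: expfz_neq0.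
by rewrite mulf_neq0 // valuationM // e' valuation_exprz.
Qed.

Definition subr_pred (F : fieldType) (B : F -> Prop) (hB : subr B) : {pred F} := [pred x | `[< B x >]].

Lemma subr_pred_closed (F : fieldType) (B : F -> Prop) (hB : subr B) : GRing.subring_closed (subr_pred hB).
split=> [|x y /asboolP hx /asboolP hy|x y /asboolP hx /asboolP hy]; apply/asboolP.
- exact: sr1.
- exact: srB.
- exact: srM.
Qed.

HB.instance Definition _ (F : fieldType) (B : F -> Prop) (hB : subr B) :=
 GRing.isSubringClosed.Build F (subr_pred hB) (subr_pred_closed hB).

Lemma rg_subring (F : fieldType) (B : F -> Prop) (hB : subr B) :
 rg (val : subring_of (subr_pred hB) -> F) = B.
apply: functional_extensionality_dep => x; apply: propositional_extensionality; split.
 by move=> [a ->]; apply/asboolP; exact: (valP a).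
by move=> /asboolP h; exists (Sub x h : subring_of (subr_pred hB)).
Qed.

Lemma max_subring (F : fieldType) (V S : F -> Prop) (hS : subr S) (a : subring_of (subr_pred hS)) :
 vring V -> (forall x, S x -> V x) -> (forall x, S x -> vu V x -> S x^-1) ->
 max_ideal (subring_of (subr_pred hS)) a <-> vm V (val a).
move=> hV SV Sinv; have /asboolP Sa := valP a.
split=> [h|[b0|h] [y /(congr1 val)]].
- have [//|hu] := vm_or_vu (SV _ Sa); case: h.
 have h : (val a)^-1 \in subr_pred hS by apply/asboolP; exact: Sinv.
 exists (Sub (val a)^-1 h : subring_of (subr_pred hS)); apply: val_inj.
 by rewrite subring_valM /= divff //; exact: (vu_n0 hu).
- by rewrite subring_valM b0 mul0r subring_val1 => /eqP; rewrite eq_sym oner_eq0.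
rewrite subring_valM subring_val1 => e; apply: h.
have b0 : val a != 0 by apply: contra_eq_neq e => ->; rewrite mul0r eq_sym oner_eq0.
have -> : (val a)^-1 = val y by rewrite -[LHS]mulr1 -e mulKf.
by apply: SV; apply/asboolP; exact: (valP y).
Qed.

(** An equation of [b] with nonzero constant term expresses the inverse of [b] as a polynomial in
    [b]. After clearing denominators, [a / b] is a constant of [L] times an element of [B], and [B]
    is algebraic over [L]. *)
Lemma alg_quotient (F : fieldType) (L B : F -> Prop) a b (q : {poly F}) : sfield L -> subr B ->
 (forall n (h : nat -> F), (forall i, L (h i)) -> exists c, [/\ L c, c != 0 & forall i, (i < n)%N -> B (c * h i)]) ->
 (forall x, B x -> exists2 p, polyB L p & p != 0 /\ p.[x] = 0) ->
 B a -> B b -> b != 0 -> polyB L q -> q != 0 -> q.[b] = 0 ->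
 exists2 p, polyB L p & p != 0 /\ p.[a / b] = 0.
move=> hL hB clear algB Ba Bb b0; move: {2}(size q) (leqnn (size q)) => n.
elim: n q => [|n ih] q sq qL q0 qb; first by move: sq; rewrite leqn0 size_poly_eq0 (negbTE q0).
have [q' q'L eq] := polyB_factor (proj1 hL) qL (sr0 (proj1 hL)).
rewrite subr0 in eq.
have [h0|h0] := eqVneq q.[0] 0.
 rewrite h0 add0r in eq; have q'0 : q' != 0 by apply: contraNneq q0 => h; rewrite eq h mulr0.
 apply: (ih q') => //.
  by move: sq; rewrite eq mulrC size_mulX.
 by move: qb; rewrite eq hornerM hornerX => /eqP; rewrite mulf_eq0 (negbTE b0) => /eqP.
have Lq0 : L q.[0] by apply: polyB_horner (proj1 hL) _ _ qL (sr0 (proj1 hL)).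
have eb : b^-1 = - (q.[0])^-1 * q'.[b].
 have q0e : q.[0] = - (b * q'.[b]).
  apply/eqP; rewrite -addr_eq0; apply/eqP; rewrite -[RHS]qb [in RHS]eq.
  by rewrite hornerD hornerM hornerX hornerC.
 have q'b : q'.[b] != 0 by apply: contraNneq h0 => z; rewrite q0e z mulr0 oppr0.
 by rewrite q0e invrN opprK invfM -mulrA mulVf // mulr1.
have [c [Lc c0 hc]] := clear (size q') (fun i => q'`_i) q'L.
have By : B (a * (c * q'.[b])).
 apply: srM => //; rewrite horner_coef mulr_sumr; apply: sr_sum => // i _.
 by rewrite mulrA; apply: srM => //; [exact: hc|exact: srX].
have [p pL [p0 px]] := algB _ By.
pose d := - (q.[0])^-1 / c.
have d0 : d != 0 by rewrite mulf_neq0 ?oppr_eq0 ?invr_eq0.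
have Ld : L d^-1 by apply: sfV => //; apply: (srM (proj1 hL)); [apply: (srN (proj1 hL))|]; exact: sfV.
have ex : a / b = d * (a * (c * q'.[b])) by rewrite eb /d; field; rewrite c0 h0.
exists (p \Po (d^-1 *: 'X)).
 move=> i; rewrite comp_polyE coef_sum; apply: (sr_sum (proj1 hL)) => j _.
 rewrite exprZn !coefZ coefXn; apply: (srM (proj1 hL)); first exact: pL.
 by apply: (srM (proj1 hL)); [exact: (srX (proj1 hL))|exact: (sr_nat (proj1 hL))].
split; last by rewrite horner_comp hornerZ hornerX ex mulKf.
have s2 : size (d^-1 *: 'X : {poly F}) = 2 by rewrite size_scale ?invr_eq0 // size_polyX.
apply: contraNneq p0 => h; have := size_comp_poly2 p s2.
by rewrite h size_poly0 => /esym/eqP; rewrite size_poly_eq0.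
Qed.

(** The closing monomialization absorbs the module generators [es], so that the model contains the
    whole ring [B] and not merely [A]. *)
Lemma good_complete (F : fieldType) (V B k : F -> Prop) n0 (g : 'I_n0 -> F) r (f : 'I_r -> F) :
 vring V -> kclosed k -> (forall x, V x -> exists2 c, k c & vm V (x - c)) ->
 base k B g -> noeth B -> (forall x, B x -> V x) -> (forall i, vm V (g i)) ->
 (forall x, B x -> ~ igen B g x -> B x^-1) -> ~ igen B g 1 -> (forall x, frac B x) ->
 vind V f -> ~ height B r.+1 (igen B g) ->
 exists A (y : 'I_r -> F) X (w : 'I_r -> F),
  [/\ base k A y, forall x, A x -> B x & forall i, igen B g (y i)] /\
  [/\ model V k A X w, forall x, B x -> mring V A X w x, forall x, frac (mring V A X w) x &
  forall x, exists2 p, polyB (frac A) p & p != 0 /\ p.[x] = 0].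
move=> hV kc kres hb BN BV gm Bl m1 fB fi hh.
have [hB [hk kB] Bg _ _] := hb.
have kV c : k c -> V c by move=> /kB/BV.
have [y [ym [N hN]]] := system_of_parameters hB hk kB Bg kc BN Bl m1 hh.
have [hbA AB [J [e [eB he]]]] := finite_over_parameters hB hk kB Bg hb ym hN.
set A := pser _ _ _ in hbA AB he; have [hA [_ kA] Ay _ _] := hbA.
have AV x : A x -> V x by move=> /AB/BV.
have yV i : vm V (y i) by apply: igen_vm (ym i).
have hL := frac_sfield hA.
have algB x : B x -> exists2 p, polyB (frac A) p & p != 0 /\ p.[x] = 0.
 apply: (finite_algebraic (e := fun i : 'I_#|J| => e (enum_val i)) hL hB) => b /he[a Aa ->].
 exists (fun i => a (enum_val i)) => [i|]; first by apply: frac_base.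
 by rewrite (reindex (@enum_val J xpredT)) //=; apply: onW_bij; exact: enum_val_bij.
pose es := [seq e j | j : J].
have AN : noeth A by move=> I; exact: (base_noeth hk kc hbA).
have AF p : p \in [pchar F] -> ffin p A by move=> cp; exact: (base_ffin cp hk kc hbA).
have AL x : A x -> frac A x by exact: frac_base.
have ealg x : x \in es -> exists2 p, polyB (frac A) p & p != 0 /\ p.[x] = 0.
 by move=> /mapP[j _ ->]; exact: algB.
have BC C : subr C -> (forall x, A x -> C x) -> (forall x, x \in es -> C x) -> forall x, B x -> C x.
 move=> hC hAC eC x /he[a Aa ->]; apply: sr_sum => // j _; apply: srM => //; first exact: hAC.
 by apply: eC; apply/mapP; exists j => //; rewrite mem_enum.
have alg x : exists2 p, polyB (frac A) p & p != 0 /\ p.[x] = 0.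
 have [a [b [Ba Bb b0 ->]]] := fB x; have [q qA [q0 qb]] := algB b Bb.
 apply: (alg_quotient hL hB _ algB Ba Bb b0 qA q0 qb) => n h hL'.
 elim: n => [|n [c [Lc c0 hc]]]; first by exists 1; rewrite oner_eq0; split=> //; exact: sr1 (proj1 hL).
 have [p [s [Ap As s0 es']]] := hL' n; have [c1 [c2 [Ac1 Ac2 c20 ec]]] := Lc.
 have c10 : c1 != 0 by apply: contraNneq c0 => z; rewrite ec z mul0r.
 exists (c1 * s); split; [apply: (srM (proj1 hL)); exact: AL|exact: mulf_neq0|].
 move=> i; rewrite ltnS leq_eqVlt => /orP[/eqP ->|/hc h'].
  by rewrite es' -mulrA [s * _]mulrC divfK //; apply: srM => //; exact: AB.
 rewrite (_ : c1 * s * h i = c2 * s * (c * h i)); last by rewrite ec; field.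
 by apply: srM => //; apply: srM => //; exact: AB.
have [u uA ui] : exists2 u : 'I_r -> F, forall i, frac A (u i) & vind V u.
 apply: vind_exists => m er hr; subst r.
 apply: (rkle_hull hV hr (M := fun=> True) _ (u := f)) => // x _ x0.
 by have [p pA [p0 px]] := alg x; exact: (alg_hull hV hL pA p0 px x0).
have gA := base_good hV hk kV kc kres hbA AV yV uA ui.
have [hK [X [w0 hm hM]]] := lift_finite hV hk kV kc kres hA kA AV AN AF hL AL ealg gA.
have [|w [_ hm' eS _ hF]] := model_monomialize hV hk kV hA kA AV AN (Z := es) hm.
 move=> _ /mapP[j _ ->]; split; first exact: BV.
 by apply/hM; apply: adjs_gen => //; [exact: (proj1 hL)|apply: map_f; rewrite mem_enum].
exists A, y, X, w; split; first by split.
have hS := mring_subr hV hA X w.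
split=> //; first by apply: BC => //; exact: mring_A.
move=> x; apply/hF/hM; have [a [b [Ba Bb b0 ->]]] := fB x.
have BK z : B z -> adjs (frac A) es z.
 apply: BC; first exact: (proj1 hK).
  by move=> z' /AL; apply: adjs_base; exact: (proj1 hL).
 by move=> z'; apply: adjs_gen; exact: (proj1 hL).
by apply: sf_div => //; exact: BK.
Qed.

Lemma fraction_quotient (R : idomainType) (z : {fraction R}) :
 exists a b : R, b != 0 /\ z = tofrac a / tofrac b.
pose x : {ratio R} := generic_quotient.repr (z : FracField.type R).
have d0 : \d_x != 0 by exact: denom_ratioP.
exists \n_x, \d_x; split=> //.
have e : z * tofrac \d_x = tofrac \n_x.
 apply/eqP; change (FracField.mul z (FracField.tofrac \d_x) == FracField.tofrac \n_x).
 rewrite (_ : z = (\pi_(FracField.type R) x)%qT); last by rewrite /x reprK.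
 rewrite !piE FracField.equivfE /FracField.mulf !numer_Ratio ?denom_Ratio ?mulf_neq0 ?oner_neq0 //.
 by rewrite !mulr1 mulrC.
by rewrite -e mulfK // tofrac_eq0.
Qed.

Lemma tofrac_injective (R : idomainType) : injective (@tofrac R).
by move=> a b /eqP; rewrite tofrac_eq => /eqP.
Qed.

Lemma cohen_data (R : idomainType) (R_local : local_ring R) : noetherian R -> adic_complete (max_ideal R) ->
 [pchar R] =i [pchar (residue_field R_local)] -> GRing.closed_field_axiom (residue_field R_local) ->
 exists n0 (s : 'I_n0 -> R) (k : {fraction R} -> Prop),
  [/\ base k (rg (@tofrac R)) (fun i => tofrac (s i)), kclosed k, noeth (rg (@tofrac R)),
  forall a, max_ideal R a <-> igen (rg (@tofrac R)) (fun i => tofrac (s i)) (tofrac a) &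
  forall x, rg (@tofrac R) x -> ~ igen (rg (@tofrac R)) (fun i => tofrac (s i)) x -> rg (@tofrac R) x^-1].
move=> hN hC hch hcl; have fi := @tofrac_injective R.
pose f : {rmorphism R -> {fraction R}} := @tofrac R.
have hB : subr (rg (@tofrac R)) := rg_subr f.
have [n0 [s es]] := hN _ R_local.
have hI a : max_ideal R a <-> igen (rg f) (fun i => f (s i)) (f a).
 by rewrite {1}es; exact: ideal_gen_igen.
have [sep com] := complete_rg (f := f) fi hI hC.
have Bg i : rg (@tofrac R) (tofrac (s i)) by exists (s i).
have Bl x : rg (@tofrac R) x -> ~ igen (rg (@tofrac R)) (fun i => tofrac (s i)) x -> rg (@tofrac R) x^-1.
 move=> [a ->] na; have /contrapT[b e] : ~ max_ideal R a by move=> /hI.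
 exists b; have e' : f a * f b = 1 by rewrite -rmorphM e rmorph1.
 have a0 : f a != 0 by apply: contra_eq_neq e' => ->; rewrite mul0r eq_sym oner_eq0.
 by rewrite -[LHS]mulr1 -e' mulKf.
have m1 : ~ igen (rg (@tofrac R)) (fun i => tofrac (s i)) 1.
 by have := (hI 1).2; rewrite rmorph1 => h /h; exact: max_ideal1.
have [||k [hk kB kr kc]] := cohen hB Bg Bl m1 sep com.
- move=> n P n0' hP; have hc i : {c | P i = f c} by apply: cid; exact: hP.
 have [x hx] := residue_closed hcl (fun i => sval (hc i)) n0'.
 exists (f x); first by exists x.
 move/hI: hx; rewrite rmorphB rmorphXn rmorph_sum /=.
 rewrite (eq_bigr (fun i : 'I_n => P i * f x ^+ i)) // => i _.
 by rewrite rmorphM rmorphXn /= -(svalP (hc i)).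
- move=> p pp hp; rewrite -(rmorph_nat f) (residue_char hch pp) ?rmorph0 //.
 by apply/(hI p%:R); rewrite rmorph_nat.
exists n0, s, k; split.
- split; [exact: hB | split; [exact: hk|exact: kB]|exact: Bg|exact: kr | split; [exact: sep|exact: com]].
- exact: kc.
- exact: (noeth_rg (f := f) fi hN).
- exact: hI.
- exact: Bl.
Qed.

Lemma vm_sprime (F : fieldType) (V S : F -> Prop) : vring V -> subr S -> (forall x, S x -> V x) ->
 sprime S (fun x => S x /\ vm V x).
move=> hV hS SV; split=> [|x []//|[_]|x y Sx Sy [_ h]].
- split.
 + by split; [exact: sr0|left].
 + by move=> x y [Sx mx] [Sy my]; split; [exact: srD|exact: vmD].
 + by move=> a x Sa [Sx mx]; split; [exact: srM|apply: vmMr => //; exact: SV].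
- by move/vm_nvu; apply; exact: vu1.
- by case: (vm_prime hV (SV _ Sx) (SV _ Sy) h) => h'; [left|right].
Qed.

(** The primes generated by initial segments of the parameters give dimension at least [r]; the
    valuation-theoretic bound gives at most [r], which is also the number of generators of the
    maximal ideal. *)
Lemma mring_regular (F : fieldType) (V k A : F -> Prop) r (y w : 'I_r -> F) X
  (hS : subr (mring V A X w)) (u : 'I_r -> subring_of (subr_pred hS)) :
 vring V -> (forall c, k c -> V c) -> kclosed k -> base k A y -> (forall x, A x -> V x) -> (forall i, vm V (y i)) ->
 model V k A X w -> (forall x, exists2 p, polyB (frac A) p & p != 0 /\ p.[x] = 0) ->
 (forall i, val (u i) = w i) ->
 [/\ local_ring (subring_of (subr_pred hS)), noetherian (subring_of (subr_pred hS)) & regular_system_of_parameters u].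
move=> hV kV kc hb AV ym hm alg hu; have [wi wm XV wc] := hm.
have [hA [hk kA] Ay _ _] := hb; have AN : noeth A by move=> I; exact: (base_noeth hk kc hb).
set S := mring V A X w in hS u hu wc *.
pose T := subring_of (subr_pred hS); pose f : {rmorphism T -> F} := val.
have fi : injective f by exact: val_inj.
have rS : rg f = S := rg_subring hS.
have SV x : S x -> V x by exact: mring_V.
have Sinv x : S x -> vu V x -> S x^-1 by exact: mring_inv.
have SN : noeth S by exact: mring_noeth.
have Sw i : S (w i) by exact: mring_u.
have AS x : A x -> S x by exact: mring_A.
have kS c : k c -> S c by move=> /kA/AS.
have mx a : max_ideal T a <-> vm V (f a) by exact: max_subring.
have lT : local_ring T.
 split; first by apply/mx; left.
  by move=> a b /mx ha /mx hb'; apply/mx; rewrite rmorphD; exact: vmD.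
 move=> a b /mx hb'; apply/mx; rewrite rmorphM; apply: vmMr => //; apply: SV; apply/asboolP; exact: (valP a).
have nT : noetherian T by apply: (noetherian_rg (f := f) fi); rewrite rS.
split=> //; split.
 split.
  apply: (height_chain (f := f) (P := coord_prime k S w r)); rewrite rS.
  exact: (coord_prime_height hV hk kV hS SN SV kS Sinv Sw wm wc wi).
 move=> /(chain_height (f := f) fi)[P hP]; rewrite rS in hP.
 apply: (height_le_params hk kc hb AS hS alg (vm_sprime hV hS SV) _ _ hP).
  by move=> i; split; [apply: AS; exact: Ay|exact: ym].
 move=> x Px; have pP := height_prime hP; have [_ PS _ _] := pP.
 have igm z : igen S w z -> vm V z by exact: igen_vm.
 split; first exact: PS.
 apply: igm; apply: (sprime_m hS _ pP Px) => z Sz nz; apply: Sinv => //.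
 by case: (vm_or_vu (SV _ Sz)) => // hz; case: nz; exact: (clos_vm hV hk kV SV wm wc Sz hz).
rewrite predeqE => a; split=> [/mx h|h]; last first.
 apply: h => // _ [i _ <-]; apply/mx; have -> : f (u i) = w i := hu i; exact: wm.
apply/(ideal_gen_igen (f := f) _ _ fi); rewrite rS.
have -> : (fun i => f (u i)) = w by apply: functional_extensionality_dep => i; exact: hu.
apply: (clos_vm hV hk kV SV wm wc) => //; apply/asboolP; exact: (valP a).
Qed.

Lemma mring_monomial (R : idomainType) (Phi : orderedZmodType) (nu : valuation {fraction R} Phi)
  (k A : {fraction R} -> Prop) r (w : 'I_r -> {fraction R}) X
  (hS : subr (mring (vset nu) A X w)) (hT : local_ring (subring_of (subr_pred hS)))
  (u : 'I_r -> subring_of (subr_pred hS)) :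
 sfield k -> (forall c, k c -> vset nu c) -> subr A -> (forall c, k c -> A c) -> (forall x, A x -> vset nu x) -> noeth A ->
 model (vset nu) k A X w -> (forall i, val (u i) = w i) -> monomial_wrt nu hT u.
move=> hk kV hA kA AV AN hm hu; have [wi wm XV wc] := hm; have hV := vset_vring nu.
set S := mring _ A X w in hS hT u hu wc *; set V := vset nu in hm wi wm XV hV *.
pose T := subring_of (subr_pred hS); pose f : {rmorphism T -> {fraction R}} := val.
have fi : injective f by exact: val_inj.
have rS : rg f = S := rg_subring hS.
have SV x : S x -> V x by exact: mring_V.
have Sinv x : S x -> vu V x -> S x^-1 by exact: mring_inv.
have SN : noeth S by exact: mring_noeth.
have Sw i : S (w i) by exact: mring_u.
have kS c : k c -> S c by move=> /kA; exact: mring_A.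
have mx a : max_ideal T a <-> vm V (f a) by exact: max_subring.
have fu : (fun i => f (u i)) = w by apply: functional_extensionality_dep => i; exact: hu.
have Sf a : S (f a) by apply/asboolP; exact: (valP a).
have lift x : S x -> {a : T | f a = x}.
 by move=> Sx; exists (Sub x (asboolT Sx) : T).
have hI a : max_ideal T a <-> igen (rg f) (fun i => f (u i)) (f a).
 rewrite rS fu; split=> [/mx h|h]; first exact: (clos_vm hV hk kV SV wm wc).
 by apply/mx; exact: igen_vm h.
have [g hg] := to_completion_morph hT.
have mevf (m : 'X_{1..r}) : f (\prod_(i < r) u i ^+ m i) = mev w m.
 by rewrite rmorph_prod /mev; apply: eq_bigr => i _; rewrite rmorphXn; congr (_ ^+ _); exact: hu.
exists (fun z => exists2 c : T, k (f c) & z = to_completion hT c).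
 apply: (@representatives_of_subfield _ hT (fun c : T => k (f c))).
 - by rewrite rmorph1; exact: sr1 (proj1 hk).
 - by move=> c d kc kd; rewrite rmorphB rmorphM; split; [exact: (srB (proj1 hk))|exact: (srM (proj1 hk))].
 - move=> c kc c0; have kV' : k (f c)^-1 by exact: sfV.
  have c0' : f c != 0 by rewrite -(rmorph0 f) (inj_eq fi).
  have [c' e] := lift _ (kS _ kV'); exists c'; first by rewrite e.
  by apply: fi; rewrite rmorphM e divff // rmorph1.
 - move=> a; have [c kc hc] := wc _ (Sf a); have [c' e] := lift _ (kS _ kc).
  by exists c'; [rewrite e|apply/hI; rewrite rS fu rmorphB e].
move=> x x0; have x0' : f x != 0 by rewrite -(rmorph0 f) (inj_eq fi).
have [c hc] := expansionP hk wc (Sf x); have [kc hx] := hc.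
have [s [m0 [cm0 hm0 hmin] _]] := expansion_min hV hk kV hS SN SV kS Sinv Sw wm wi (Sf x) x0' hc.
have cl m : {a : T | f a = c m} by apply: lift; exact: kS.
pose cT m : T := sval (cl m); have ecT m : f (cT m) = c m by exact: (svalP (cl m)).
clearbody cT; clear cl.
have w0 m : mev w m != 0 by apply: mev_n0; case: wi.
have vx : nu (f x) = nu (mev w m0).
 have [_] := vset_vu hm0; rewrite valuationM ?invr_eq0 // valuationV // => /eqP.
 by rewrite subr_eq0 => /eqP.
have c0E m : (to_completion hT (cT m) != 0) = (c m != 0).
 apply/idP/idP => [|cn].
  apply: contraNneq => h; rewrite (_ : cT m = 0) -?hg ?rmorph0 //.
  by apply: fi; rewrite ecT h rmorph0.
 have [d ed] := lift _ (kS _ (sfV hk (kc m))).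
 have e : cT m * d = 1 by apply: fi; rewrite rmorphM ecT ed divff // rmorph1.
 apply: contra_eq_neq (congr1 g e) => h.
 by rewrite rmorphM hg h mul0r rmorph1 eq_sym oner_neq0.
have valE (m : 'X_{1..r}) : \prod_(i < r) val (u i) ^+ m i = mev w m.
 by apply: eq_bigr => i _; rewrite hu.
exists (fun m => to_completion hT (cT m)); split.
- by move=> m; exists (cT m) => //; rewrite ecT.
- move=> n; exists n => n' nn'.
 have -> : \sum_(a : 'X_{1..r < n'}) to_completion hT (cT a) * \prod_(i < r) to_completion hT (u i) ^+ (a : 'X_{1..r}) i
   - to_completion hT x = to_completion hT (\sum_(a : 'X_{1..r < n'}) cT a * \prod_(i < r) u i ^+ (a : 'X_{1..r}) i - x).
  rewrite -!hg rmorphB rmorph_sum; congr (_ - _); apply: eq_bigr => a _.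
  rewrite rmorphM rmorph_prod -!hg; congr (_ * _); apply: eq_bigr => i _.
  by rewrite rmorphXn /= hg.
 apply: ideal_pow_completion; apply/(ideal_pow_ipow n _ fi hI); rewrite rS fu.
 have [h0 hD hM] := ipow_ideal hS w n.
 have -> : f (\sum_(a : 'X_{1..r < n'}) cT a * \prod_(i < r) u i ^+ (a : 'X_{1..r}) i - x) =
   -1 * (f x - \sum_(a : 'X_{1..r < n'}) c a * mev w a).
  rewrite rmorphB rmorph_sum mulN1r opprB; congr (_ - _); apply: eq_bigr => a _.
  by rewrite rmorphM mevf ecT.
 apply: hM; first by apply: srN => //; exact: sr1.
 exact: (ipow_le hS Sw nn' (hx n')).
- by exists m0; [rewrite c0E|rewrite /= valE; exact: vx].
move=> m; rewrite c0E => cm; rewrite /= valE; have -> : nu (val x) = nu (mev w m0) := vx.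
have := hmin m cm; move/(vset_ge0 nu (_ : mev w m / mev w m0 != 0)).
rewrite valuationM ?invr_eq0 // valuationV // => h.
have h' : 0 <= nu (mev w m) - nu (mev w m0) by apply: h; rewrite mulf_neq0 ?invr_eq0.
by have := ordered_lerD2l (nu (mev w m0)) _ _ h'; rewrite addr0 addrC subrK.
Qed.

(** The model is a localization over [A], but finite type is wanted over [R]. Both algebras give the
    same localization, since the image of [R] lies between [A] and the model. *)
Lemma mring_essentially_finite (R : idomainType) (V A : {fraction R} -> Prop) r (w : 'I_r -> {fraction R}) X
  (hS : subr (mring V A X w)) : vring V -> subr A -> (forall x, A x -> rg (@tofrac R) x) ->
 (forall x, rg (@tofrac R) x -> mring V A X w x) ->
 essentially_finite_type (subr_pred hS).
move=> hV hA AB BS; pose Y := X ++ [seq w i | i : 'I_r].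
pose x (i : 'I_(size Y)) := Y`_i; have [hJ cJ gJ] := adjoin_facts x.
have YJ z : z \in Y -> adjoin x z.
 by move=> /(nthP 0)[i si <-]; exact: (gJ (Ordinal si)).
have AJ z : adjs A Y z -> adjoin x z.
 by apply: adjs_min => // a /AB[b ->]; exact: cJ.
have JS z : adjoin x z -> mring V A X w z.
 have YS i : mring V A X w (x i).
  have : x i \in Y by rewrite mem_nth.
  rewrite mem_cat => /orP[h|/mapP[j _ ->]]; [exact: mring_X|exact: mring_u].
 move=> [p ->]; rewrite /mmap; apply: sr_sum => // m _; apply: srM => //; first by apply: BS; exists p@_m.
 by apply: sr_prod => // i _; apply: srX.
exists (size Y), x, (fun t => adjoin x t /\ vu V t); split.
- by split; [exact: sr1|exact: vu1].
- by move=> s t [Js us] [Jt ut]; split; [exact: srM|exact: vuM].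
- by move=> t [Jt /vu_n0].
move=> z; split=> [/asboolP[a [b [Aa Ab ub ->]]]|[a [t [Ja [Jt ut] ->]]]].
 by exists a, b; split; [exact: AJ | split=> //; exact: AJ |].
by apply/asboolP; apply: srM => //; [exact: JS|apply: mring_inv => //; exact: JS].
Qed.
Theorem proposition7p24 (R : idomainType) (R_local : local_ring R)
  (R_noetherian : noetherian R)
  (R_complete : adic_complete (max_ideal R))
  (R_equichar : [pchar R] =i [pchar (residue_field R_local)])
  (k_closed : GRing.closed_field_axiom (residue_field R_local))
  (Phi : orderedZmodType) (nu : valuation {fraction R} Phi)
  (nu_dom : valuation_of_local_domain nu)
  (nu_rational : rational_valuation nu)
  (nu_abhyankar : abhyankar_valuation nu) :
  quasi_monomial nu.
Proof.
have [n0 [s [k [hb kc BN mI Bl]]]] := cohen_data R_noetherian R_complete R_equichar k_closed.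
have fi := @tofrac_injective R; pose f : {rmorphism R -> {fraction R}} := @tofrac R.
set B := rg (@tofrac R) in hb BN mI Bl; set g := fun i => tofrac (s i) in hb mI Bl.
have hV := vset_vring nu; set V := vset nu in hV.
have [hB [hk kB] Bg hc _] := hb.
have [dom1 dom2] := nu_dom.
have mV a : max_ideal R a <-> vm V (tofrac a).
 have [b eb] := dom1 a; rewrite (dom2 a b (esym eb)) vset_max eb; by [].
have BV x : B x -> V x.
 by move=> [a ->]; have [b <-] := dom1 a; exact: (valP b).
have kV c : k c -> V c by move=> /kB/BV.
have gm i : vm V (g i) by apply/mV/mI; exact: (igen_mem hB g i).
have m1 : ~ igen B g 1.
 by have := (mI 1).2; rewrite rmorph1 => h /h; exact: max_ideal1.
have igm x : igen B g x -> vm V x by exact: igen_vm.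
(* Rationality yields an element of [R] with the same residue as [x], and the coefficient field
   yields a constant with the same residue as that element. *)
have kres x : V x -> exists2 c, k c & vm V (x - c).
 move=> Vx; pose b : valuation_ring nu := Sub x Vx.
 have eR : @base_residue_field _ _ nu = setT := nu_rational.
 have : base_residue_field (residue (valuation_ring_local nu) b) by rewrite eR.
 move=> [a [b' [eab /residue_eq /vset_max h]]].
 have [c kc' hac] := hc (tofrac a) (ex_intro _ a erefl); exists c => //.
 have -> : x - c = - (tofrac a - x) + (tofrac a - c) by ring.
 apply: vmD => //; last exact: igm.
 by apply: vmN => //; move: h; rewrite eab.
have [r [t [[[x xfree] _] htr hdim]]] := nu_abhyankar.
have eR : @base_residue_field _ _ nu = setT := nu_rational.
(* By rationality the residue extension is trivial, so the Abhyankar equality makes the rational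
   rank equal to the dimension of [R]. *)
have t0 : t = 0%N by rewrite eR in htr; exact: (tr_deg_setT htr).
rewrite t0 addn0 in hdim; have [_ hdim2] := hdim.
have hfx i : {z | z != 0 /\ nu z = x i} by apply: cid; have [z h1 h2] := valuation_surj nu (x i); exists z.
pose fx i := sval (hfx i).
have fxi : vind V fx.
 apply: vind_valuation => [i|c hcc]; first by case: (svalP (hfx i)).
 by apply: xfree; rewrite -[RHS]hcc; apply: eq_bigr => i _; case: (svalP (hfx i)) => _ <-.
(* The dimension enters only as this upper bound on chains of primes; the matching [r] independent
   values are the [fx i]. *)
have hh : ~ height B r.+1 (igen B g) by move=> /(height_chain (f := f)).
have fB z : frac B z.
 have [a [b [b0 ->]]] := fraction_quotient z.
 by exists (tofrac a), (tofrac b); split; [exists a | exists b|rewrite tofrac_eq0 |].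
have [A [y [X [w [[hbA AB yB] [hm BS hM alg]]]]]] :=
 good_complete hV kc kres hb BN BV gm Bl m1 fB fxi hh.
have [hA [_ kA] Ay _ _] := hbA; have AV a : A a -> V a by move=> /AB/BV.
have AN : noeth A by move=> I; exact: (base_noeth hk kc hbA).
have hS : subr (mring V A X w) by exact: mring_subr.
have Sw i : mring V A X w (w i) by exact: mring_u.
pose u i : subring_of (subr_pred hS) := Sub (w i) (asboolT (Sw i)).
have hu i : val (u i) = w i by [].
have ym i : vm V (y i) by apply: igm; exact: yB.
have [hT nT hreg] := mring_regular (u := u) hV kV kc hbA AV ym hm alg hu.
have [wi wm XV wc] := hm.
have SV z : mring V A X w z -> V z by exact: mring_V.
first [exists (subr_pred hS : subringClosed {fraction R}) | refine (ex_intro _ (subr_pred hS) _) | exists (GRing.SubringClosed.clone {fraction R} (subr_pred hS) _)]; split.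
 split=> //.
 - by move=> a; apply/asboolP; apply: BS; exists a.
 - exact: mring_essentially_finite.
 - move=> z; have [a [b [Sa Sb b0 ->]]] := hM z.
  by exists a, b; split=> //; exact/asboolP.
 split=> [a|a b e].
  have /asboolP Sa := valP a; by exists (Sub (val a) (SV _ Sa) : valuation_ring nu).
 rewrite vset_max -e; apply: max_subring => // z; exact: mring_inv.
exists hT; split; first by split=> //; exists r, u.
exists r, u; split=> //.
exact: (mring_monomial (k := k)).
Qed.
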